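(* Let a comparison set-up $(G^0,M^0,\rho_{M^0},\mathcal K^0;\,G,M,\rho_M,\mathcal K;\,N^\heartsuit)$ as in the context be given, and assume: (1) $\mathcal K^0$ is a family of quasi-$G^0$-covers with respect to $N^\heartsuit$ and has the double coset property; (2) $\mathcal K$ is a family of quasi-$G$-covers with respect to $N^\heartsuit$; (3) $\mathcal K^0$ has the reflection property with a normal subgroup $W_{\mathrm{aff}}$ of $W^\heartsuit$; (4) $\mathcal K^0$ has the rank-one property with the groups $K'_{x,s}=K^0_{x,sx}$ for each simple reflection $s\in S$ and $x\in\mathcal A_{\mathrm{gen}}$ with $\mathfrak H_{x,sx}=\{H_s\}$; (5) Levi compatibility, cover compatibility and neighbor compatibility hold, the groups $K^0_{x,sx}$ in (4) being those of neighbor compatibility. Fix a subset $\mathcal C_{>1}\subset\mathcal C^\times\smallsetminus\{1\}$ with $|\{q,q^{-1}\}\cap\mathcal C_{>1}|=1$ for all $q\in\mathcal C^\times\smallsetminus\{1\}$, an adapted family $\mathcal T^0$ for $G^0$, let $\mathcal T$ be the associated adapted family for $G$, and let $\mathcal I\colon\mathcal H(G^0(F),\rho^0_{x_0})\to\mathcal H(G(F),\rho_{x_0})$ be the isomorphism with $\mathcal I(\varphi^0_w)=\varphi_w$ for $w\in W^\heartsuit$. Then there exists a unique quadratic character $\epsilon\colon N^\heartsuit\to\{\pm1\}$ that factors through $N^\heartsuit\twoheadrightarrow W^\heartsuit$ and is trivial on $\Omega$ such that $\mathcal I$ is given as follows: if $\varphi\in\mathcal H(G^0(F),\rho^0_{x_0})$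 is supported on $K^0_{x_0}nK^0_{x_0}$ for some $n\in N^\heartsuit$, then $\mathcal I(\varphi)$ is supported on $K_{x_0}nK_{x_0}$ and $$\mathcal I(\varphi)(n)=d_n\cdot\varphi(n)\otimes\bigl(\epsilon(n)\cdot\widetilde\kappa_M(n)\bigr)\quad\text{with}\quad d_n=\left(\frac{|K^0_{x_0}/(K^0_{nx_0}\cap K^0_{x_0})|}{|K_{x_0}/(K_{nx_0}\cap K_{x_0})|}\right)^{1/2}\in\mathcal C^\times.$$
   Context: **Conventions.** $F$ is a non-archimedean local field of residue characteristic $p$; $\mathcal C$ is an algebraically closed field of characteristic $\ell\neq p$ with a fixed square root $p^{1/2}$ of $p$; $(p^n)^{1/2}:=(p^{1/2})^n$ for $n\in\mathbb Z$. Representations are on $\mathcal C$-vector spaces. For a representation $\rho$ of a subgroup $K$ of a group $H$ and $h\in H$: ${}^hK=hKh^{-1}$, ${}^h\rho(x)=\rho(h^{-1}xh)$; $N_H(\rho)=\{h: {}^hK=K,\ {}^h\rho\simeq\rho\}$; $I_H(\rho)=\{h:\mathrm{Hom}_{K\cap{}^hK}({}^h\rho,\rho)\neq0\}$. $\mathrm{ind}_K^{H}(\rho)$ is the space of functions $f\colon H\to V_\rho$, compactly supported modulo $K$, with $f(kh)=\rho(k)f(h)$, with $H$ acting by right translation. **I. Generic notions for one group.** $G$ is a connected reductive group over $F$, $M$ a Levi subgroup, $A_M$ the maximal split torus of the center of $M$, $\mathcal U(M)$ the set of unipotent radicals of parabolic subgroups with Levi factor $M$ ($\overline U$ opposite to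 $U$). With an admissible embedding $\mathcal B(M,F)\subset\mathcal B(G,F)$ of enlarged Bruhat--Tits buildings (for a connected reductive subgroup $J\subseteq G$, an injective map $\mathcal B(J,F)\to\mathcal B(G,F)$ is called *admissible* if it is $J(F)$-equivariant and, for every maximal split torus $A$ of $J$, maps the apartment of $A$ into the apartment of some maximal split torus $A'\supseteq A$ of $G$ by an affine map whose linear part is the natural inclusion $X_*(A)\otimes\mathbb R\subseteq X_*(A')\otimes\mathbb R$) and $x_0\in\mathcal B(M,F)$, put $\mathcal A_{x_0}=x_0+(X_*(A_M)\otimes\mathbb R)$, Euclidean via a fixed $N_G(M)(F)$-invariant inner product. $N_G(M)(F)_{[x_0]_M}=\{n\in N_G(M)(F):nx_0\in\mathcal A_{x_0}\}$ acts on $\mathcal A_{x_0}$. $\mathfrak H$ is a locally finite (possibly empty) set of affine hyperplanes of $\mathcal A_{x_0}$ not containing $x_0$; $\mathcal A_{\mathrm{gen}}=\mathcal A_{x_0}\smallsetminus\bigcup_{H\in\mathfrak H}H$; $\mathfrak H_{x,y}$ is the set of $H\in\mathfrak H$ with $x,y\in\mathcal A_{\mathrm{gen}}$ on opposite sides; $d(x,y)=\#\mathfrak H_{x,y}$. $K_M\subseteq M(F)_{x_0}$ (the stabilizer of $x_0$) is compact open, $\rho_M$ an irreducible smooth representation of $K_M$, $N^\heartsuit$ a subgroup of $N(\rho_M)_{[x_0]_M}:=N_{G(F)}(\rho_M)\cap N_G(M)(F)_{[x_0]_M}$ containing $A_M(F)$, $W^\heartsuit=N^\heartsuit/(N^\heartsuit\cap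 K_M)$. $\mathcal K=\{(K_x,K_{x,+},\rho_x)\}_{x\in\mathcal A_{\mathrm{gen}}}$: compact open subgroups $K_x\subset G(F)$, normal open subgroups $K_{x,+}\subset K_x$, irreducible smooth representations $\rho_x$ of $K_x$. $(K,\rho)$ is a *quasi-$G$-cover* of $(K_M,\rho_M)$ if for every $U\in\mathcal U(M)$: $K=(K\cap U(F))(K\cap M(F))(K\cap\overline U(F))$, $K\cap M(F)=K_M$, $\rho|_{K_M}=\rho_M$ (same space), and $\rho$ is trivial on $K\cap U(F)$, $K\cap\overline U(F)$. $\mathcal K$ is a *family of quasi-$G$-covers with respect to $N^\heartsuit$* if: (a) $\rho_x|_{K_{x,+}}$ is $\theta_x$-isotypic for a character $\theta_x$; (b) $N^\heartsuit$ preserves $\mathfrak H$; (c) $K_{nx}=nK_xn^{-1}$, $K_{nx,+}=nK_{x,+}n^{-1}$ for $n\in N^\heartsuit$; (d) for all $x$ and all $U\in\mathcal U(M)$, $(K_x,\rho_x)$ is a quasi-$G$-cover of $(K_M,\rho_M)$, $K_x=K_MK_{x,+}$, $K_{x,+}=(K_{x,+}\cap U(F))(K_{x,+}\cap M(F))(K_{x,+}\cap\overline U(F))$, and $K_{x,+}\cap M(F)$ is independent of $x$; (e) if $d(x,y)+d(y,z)=d(x,z)$ there is $U\in\mathcal U(M)$ with $K_x\cap U(F)\subseteq K_y\cap U(F)\subseteq K_z\cap U(F)$ and $K_z\cap\overline U(F)\subseteq K_y\cap\overline U(F)\subseteq K_x\cap\overline U(F)$. *Double coset property*: $K_xN^\heartsuit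 K_x=I_{G(F)}(\rho_x)$ for all $x\in\mathcal A_{\mathrm{gen}}$. $\mathcal H(G(F),\rho_x)$ is the algebra of compactly supported $\varphi\colon G(F)\to\mathrm{End}_{\mathcal C}(V_{\rho_x})$ with $\varphi(k_1gk_2)=\rho_x(k_1)\varphi(g)\rho_x(k_2)$, product $(\varphi_1*\varphi_2)(g)=\sum_{h\in G(F)/K_x}\varphi_1(h)\varphi_2(h^{-1}g)$; it is identified with $\mathrm{End}_{G(F)}(\mathrm{ind}_{K_x}^{G(F)}\rho_x)$ via $\varphi(g)(v)=(\Phi(f_v))(g)$, $f_v$ supported on $K_x$, $f_v(k)=\rho_x(k)v$. $(\Theta_{y\mid x}f)(g)=|K_{y,+}/(K_{x,+}\cap K_{y,+})|^{-1}\sum_{k\in K_{y,+}/(K_{x,+}\cap K_{y,+})}\theta_y(k)f(k^{-1}g)$ defines a $G(F)$-map $\mathrm{ind}_{K_x}^{G(F)}\rho_x\to\mathrm{ind}_{K_y}^{G(F)}\rho_y$ (all $V_{\rho_x}=V_{\rho_M}$; indices are powers of $p$); $\Theta^{\mathrm{norm}}_{y\mid x}=|K_y/(K_x\cap K_y)|^{1/2}\Theta_{y\mid x}$. $H\in\mathfrak H$ is *relevant* if $\Theta_{x\mid y}\Theta_{y\mid x}$ is non-scalar for some $x,y$ with $\mathfrak H_{x,y}=\{H\}$; $\mathfrak H_{\mathrm{rel}}$ is the set of these. A *basic family* $\mathcal T$: non-zero $T_n\in\mathrm{Hom}_{K_M}({}^n\rho_M,\rho_M)$ ($n\in N^\heartsuit$),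 $T_1=\mathrm{id}$, $T_{nk}=T_n\rho_M(k)$ for $k\in K_M\cap N^\heartsuit$. For $w\in W^\heartsuit$ with lift $n$: $(c_{x,w}f)(g)=T_n(f(n^{-1}g))$, $\Phi_{x,w}=c_{w^{-1}x,w}\circ\Theta^{\mathrm{norm}}_{w^{-1}x\mid x}$, $\Phi_w=\Phi_{x_0,w}$, and $\varphi_w\in\mathcal H(G(F),\rho_{x_0})$ corresponds to $\Phi_w$; $\varphi_w$ is non-zero with support $K_{x_0}wK_{x_0}$. Under the double coset property the $\varphi_w$ form a basis. $W_{\mathrm{rel}}=\langle s_H:H\in\mathfrak H_{\mathrm{rel}}\rangle$ ($s_H$ the orthogonal reflection). *Reflection property*: a normal subgroup $W_{\mathrm{aff}}\subset W^\heartsuit$ maps isomorphically onto $W_{\mathrm{rel}}$ via the action on $\mathcal A_{x_0}$. $V^{\mathrm{rel}}$ is the common kernel of the gradients of all $H\in\mathfrak H_{\mathrm{rel}}$; $C_{\mathrm{rel}}$ is the component of the complement of $\mathfrak H_{\mathrm{rel}}$ in $\mathcal A_{x_0}/V^{\mathrm{rel}}$ containing the image of $x_0$; $\Omega=\{w\in W^\heartsuit:wC_{\mathrm{rel}}=C_{\mathrm{rel}}\}$; $S\subset W_{\mathrm{aff}}$ is the set of reflections in the walls $H_s$ of $C_{\mathrm{rel}}$ (so $W^\heartsuit=\Omega\ltimes W_{\mathrm{aff}}$ with $(W_{\mathrm{aff}},S)$ Coxeter). *Rank-one property* with groups $K'_{x,s}$: for $s\in S$ and $x$ with $\mathfrak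 H_{x,sx}=\{H_s\}$, $K'_{x,s}\supseteq K_x$ is a compact open subgroup with $(N^\heartsuit\cap K'_{x,s})/(N^\heartsuit\cap K_M)=\{1,s\}$. A basic family is *adapted* if for each $s\in S$ there is $q_s\in\mathcal C_{>1}$ with $\Phi_s^2=(q_s-1)\Phi_s+q_s\Phi_1$; $\Phi_w=\Phi_{s_1}\cdots\Phi_{s_r}$ for reduced expressions $w=s_1\cdots s_r$ in $W_{\mathrm{aff}}$; and $\Phi_t\Phi_w=\Phi_{tw}$ for $t\in\Omega,w\in W_{\mathrm{aff}}$. **II. Comparison set-up.** $G^0$ is a connected reductive subgroup of $G$ of the same rank, $M^0$ a Levi subgroup of $G^0$, $M=Z_G(A_{M^0})$ (a Levi subgroup of $G$), with $A_{M^0}=A_M$. Fix a commutative square of admissible embeddings $\mathcal B(M^0,F)\subset\mathcal B(G^0,F)\subset\mathcal B(G,F)$, $\mathcal B(M^0,F)\subset\mathcal B(M,F)\subset\mathcal B(G,F)$ and $x_0\in\mathcal B(M^0,F)$; then $\mathcal A_{x_0}$ is the same for both groups, and one fixed $\mathfrak H$ is used for both. $(K_{M^0},\rho_{M^0})$, $(K_M,\rho_M)$ are pairs as in I for $M^0$, $M$; $N^\heartsuit$ is a subgroup of $N(\rho_{M^0})_{[x_0]_{M^0}}$ containing $A_{M^0}(F)$. $\mathcal K^0=\{(K^0_x,K^0_{x,+},\rho^0_x)\}$ and $\mathcal K=\{(K_x,K_{x,+},\rho_x)\}$ are families as in I for $G^0$ and $G$, both using the same $N^\heartsuit$ (Levi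 compatibility implies $N^\heartsuit\subset N(\rho_M)_{[x_0]_M}$). Objects for $G^0$ carry a superscript $0$. *Levi compatibility*: (1) there is a compact open subgroup $K_{M,0+}$ of $M(F)$, normalized by $N^\heartsuit K_{M^0}$, with $M^0(F)\cap K_{M,0+}\subseteq\ker\rho_{M^0}$ and $K_M=K_{M^0}K_{M,0+}$; (2) there is an irreducible smooth representation $\kappa_M$ of $K_M$ that extends to a smooth representation $\widetilde\kappa_M$ of $\widetilde K_M=N^\heartsuit K_M$, with $\rho_M\simeq\inf(\rho_{M^0})\otimes\kappa_M$, where $\inf$ is inflation via $K_M\to K_M/K_{M,0+}\simeq K_{M^0}/(K_{M^0}\cap K_{M,0+})$. Such $\widetilde\kappa_M$ and an identification $V_{\rho_M}=V_{\rho_{M^0}}\otimes V_{\kappa_M}$ are fixed (and $V_{\rho_{x_0}}=V_{\rho_M}$, $V_{\rho^0_{x_0}}=V_{\rho_{M^0}}$). *Cover compatibility*: for each $x\in\mathcal A_{\mathrm{gen}}$: (1) there is a compact open subgroup $K_{x,0+}$ of $K_x$, normalized by $K^0_x$, with $G^0(F)\cap K_{x,0+}\subseteq\ker\rho^0_x$ and $K_x=K^0_xK_{x,0+}$; (2) there is an irreducible smooth representation $\kappa_x$ of $K_x$ with $\rho_x=\inf(\rho^0_x)\otimes\kappa_x$, inflation via $K_x\to K_x/K_{x,0+}\simeq K^0_x/(K^0_x\cap K_{x,0+})$; (3) $I_{G(F)}(\rho_x)=K_x\,I_{G^0(F)}(\rho^0_x)\,K_x$. *Neighbor compatibility*: for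 $x,y\in\mathcal A_{\mathrm{gen}}$ with $d(x,y)=1$ there are a compact open subgroup $K^0_{x,y}\subset G^0(F)$, a compact open subgroup $K_{x,y;0+}\subset G(F)$ and an irreducible smooth representation $\kappa_{x,y}$ of $K_{x,y}=K^0_{x,y}K_{x,y;0+}$ (symmetric in $x,y$) such that: (1) $K^0_x,K^0_y\subseteq K^0_{x,y}$; (2) $K^0_{x,y}$ normalizes $K_{x,y;0+}$, $K_{x,0+}\subset(G^0(F)\cap K_{x,0+})K_{x,y;0+}$ and $K_{y,0+}\subset(G^0(F)\cap K_{y,0+})K_{x,y;0+}$; (3) $G^0(F)\cap K_{x,y;0+}\subseteq\ker\rho^0_x\cap\ker\rho^0_y$; (4) $\kappa_{x,y}|_{K_{x,y;0+}}$ is irreducible; (5) $\kappa_{x,y}|_{K^0_xK_{x,y;0+}}\simeq\mathrm{ind}_{K_x}^{K^0_xK_{x,y;0+}}(\kappa_x)$ and $\kappa_{x,y}|_{K^0_yK_{x,y;0+}}\simeq\mathrm{ind}_{K_y}^{K^0_yK_{x,y;0+}}(\kappa_y)$. Under the hypotheses of the claim the relevant hyperplanes for $\mathcal K^0$ and $\mathcal K$ coincide and $N^\heartsuit\cap K_M=N^\heartsuit\cap K_{M^0}$, so $W^\heartsuit,W_{\mathrm{aff}},\Omega,S$ are the same for both. Given an adapted family $\mathcal T^0$ for $G^0$, the *associated adapted family* $\mathcal T$ for $G$ is the unique adapted family with $T_n=T^0_n\otimes\widetilde\kappa_M(n)$ for all $n\in N^\heartsuit$ with image in $\Omega$. The elements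 $\varphi^0_w$, $\varphi_w$ ($w\in W^\heartsuit$) formed from $\mathcal T^0,\mathcal T$ are bases of $\mathcal H(G^0(F),\rho^0_{x_0})$ and $\mathcal H(G(F),\rho_{x_0})$, and the linear map $\varphi^0_w\mapsto\varphi_w$ is an algebra isomorphism. *)

(* Defs.v *)
From HB Require Import structures.
From mathcomp Require Import all_boot all_order all_algebra all_field.
From mathcomp Require Import finmap.
From mathcomp Require Import all_classical all_reals all_analysis.
Set Implicit Arguments.
Unset Strict Implicit.
Unset Printing Implicit Defensive.
Import Order.TTheory GRing.Theory Num.Theory.
Import numFieldNormedType.Exports.
Local Open Scope classical_set_scope.
Local Open Scope ring_scope.

(* [nval] is the normalized valuation on nonzero elements; its value at 0 is
   irrelevant, which is why [x = 0] appears as a separate case. *)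
HB.mixin Record Field_Topological_isNonarchLocal F
    of GRing.Field F & Topological F := {
  nval : F -> int ;
  nvalM : forall x y : F, x != 0 -> y != 0 -> nval (x * y) = nval x + nval y ;
  nvalD : forall x y : F, x != 0 -> y != 0 -> x + y != 0 ->
    Num.min (nval x) (nval y) <= nval (x + y) ;
  nval_onto : exists2 x : F, x != 0 & nval x = 1 ;
  nval_nbhs : forall (x : F) (A : set F),
    nbhs x A <-> exists N : int, forall y, y = x \/ N <= nval (y - x) -> A y ;
  nval_complete : forall u : nat -> F,
    (forall N : int, exists n0, forall i j, (n0 <= i)%N -> (n0 <= j)%N ->
       u i = u j \/ N <= nval (u i - u j)) ->
    exists l : F, u i @[i --> \oo] --> l ;
  nval_finite : exists s : seq F, forall x : F, x = 0 \/ 0 <= nval x ->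
    exists2 a, a \in s & x = a \/ 0 < nval (x - a) }.

#[short(type="nonarchLocalFieldType")]
HB.structure Definition NonarchLocalField :=
  {F of GRing.Field F & Topological F & Field_Topological_isNonarchLocal F}.

(* Residue characteristic: [p] lies in the maximal ideal. *)
Definition residue_char (F : nonarchLocalFieldType) (p : nat) :=
  prime p /\ (p%:R = 0 :> F \/ 0 < nval (p%:R : F)).

Section SetsInUnitRings.
Context (T : unitRingType).
Implicit Types (A B H U : set T) (g : T).

Definition subgroup H := [/\ H `<=` [set x | x \is a GRing.unit], H 1,
  forall x y, H x -> H y -> H (x * y) & forall x, H x -> H x^-1].
Definition conj g x : T := g * x * g^-1.
Definition setconj g A : set T := conj g @` A.
Definition setprod A B : set T := [set a * b | a in A & b in B].
Definition normalizes B A := forall g, B g -> setconj g A = A.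
Definition normal_in U H := U `<=` H /\ normalizes H U.
Definition centralizer H A : set T :=
  [set g | H g /\ forall a, A a -> g * a = a * g].
Definition normalizer H A : set T := [set g | H g /\ setconj g A = A].
Definition center H := centralizer H H.

Definition solvable H := exists n (D : nat -> set T),
  [/\ D 0%N = H, D n = [set 1] & forall i, (i < n)%N ->
    [/\ subgroup (D i), D i.+1 `<=` D i & forall x y, D i x -> D i y ->
        D i.+1 (x * y * x^-1 * y^-1)]].

Definition lcosets A B : set (set T) := [set (setprod [set a] B) | a in A].
Definition coset_rep (c : set T) : T := xget 1 c.
Definition coset_index A B : nat := #|` fset_set (lcosets A (A `&` B))|.

End SetsInUnitRings.

(* Smooth affine [F]-groups are encoded by their geometric points: Zariski
   closed subgroups of GL_{d+1}(Fb), [Fb] an algebraic closure of [F], whose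
   ideal is generated by polynomials with coefficients in [F]. *)
Section AlgebraicGroups.
Context (F : fieldType) (Fb : closedFieldType) (iota : {rmorphism F -> Fb}).
Context (d : nat).
Local Notation MF := 'M[F]_d.+1.
Local Notation MB := 'M[Fb]_d.+1.
Implicit Types (H J P M U Z A T : set MB).

Inductive polyfun (S : set Fb) : (MB -> Fb) -> Prop :=
| polyfun_const c : S c -> polyfun S (fun=> c)
| polyfun_coord i j : polyfun S (fun g => g i j)
| polyfun_add f1 f2 : polyfun S f1 -> polyfun S f2 ->
    polyfun S (fun g => f1 g + f2 g)
| polyfun_mul f1 f2 : polyfun S f1 -> polyfun S f2 ->
    polyfun S (fun g => f1 g * f2 g).

Definition vanishing_on Z (f : MB -> Fb) := forall g, Z g -> f g = 0.

Definition zclosed Z := exists I : set (MB -> Fb), I `<=` polyfun setT /\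
  Z = [set g | g \is a GRing.unit /\ forall f, I f -> f g = 0].

Definition defined_over Z := forall f, polyfun setT f -> vanishing_on Z f ->
  exists (n : nat) (c : 'I_n -> Fb) (h : 'I_n -> MB -> Fb),
    (forall i, polyfun (range iota) (h i) /\ vanishing_on Z (h i)) /\
    forall g, f g = \sum_i c i * h i g.

Definition zconnected H := forall Z1 Z2, zclosed Z1 -> zclosed Z2 ->
  H `<=` Z1 `|` Z2 -> H `&` Z1 `&` Z2 = set0 -> H `<=` Z1 \/ H `<=` Z2.

Definition alg_group H := zclosed H /\ subgroup H.
Definition F_group H := alg_group H /\ defined_over H.
Definition Fpts H : set MF := [set g | H (map_mx iota g)].

Definition unipotent H := forall g, H g -> (g - 1) ^+ d.+1 = 0.

Definition reductive H := forall U, alg_group U -> zconnected U ->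
  unipotent U -> normal_in U H -> U = [set 1].

Definition connected_reductive H := [/\ F_group H, zconnected H & reductive H].

Definition torus T := [/\ alg_group T, zconnected T &
  exists2 h : MB, h \is a GRing.unit & forall t, T t -> is_diag_mx (conj h t)].

Definition split_torus T := [/\ F_group T, zconnected T &
  exists2 h : MF, h \is a GRing.unit &
    forall t, T t -> is_diag_mx (conj (map_mx iota h) t)].

Definition maximal_among (X : set (set MB)) A :=
  X A /\ forall B, X B -> A `<=` B -> B = A.

Definition max_torus H T := maximal_among [set T | torus T /\ T `<=` H] T.
Definition max_split H A := maximal_among [set T | split_torus T /\ T `<=` H] A.

Definition borel H B := maximal_among
  [set B | [/\ alg_group B, zconnected B, solvable B & B `<=` H]] B.

Definition parabolic H P :=
  [/\ F_group P, P `<=` H & exists2 B, borel H B & B `<=` P].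

Definition unip_radical P U :=
  let X := [set U | [/\ alg_group U, zconnected U, unipotent U & normal_in U P]] in
  X U /\ forall V, X V -> V `<=` U.

(* [P] is a parabolic subgroup of [H] with Levi factor [M] and unipotent
   radical [U]. *)
Definition parabolic_levi H P M U := [/\ parabolic H P, unip_radical P U,
  F_group M /\ M `<=` P, M `&` U = [set 1] & P = setprod M U].

Definition levi H M := exists P U, parabolic_levi H P M U.

(* [U] ranges over the unipotent radicals of parabolic subgroups of [H] with
   Levi factor [M], and [Ub] is the opposite of [U]. *)
Definition radical_pair H M U Ub := exists P Pb, [/\ parabolic_levi H P M U,
  parabolic_levi H Pb M Ub & P `&` Pb = M].

(* A cocharacter is a function on all of [Fb], normalized to be 1 at 0, so
   that cocharacters are equal iff they are equal as functions. *)
Definition cocharacter A (l : Fb -> MB) :=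
  [/\ l 0 = 1, forall t, t != 0 -> A (l t),
      forall s t, s != 0 -> t != 0 -> l (s * t) = l s * l t &
      exists (n : nat) (P : 'M[{poly Fb}]_d.+1), forall t, t != 0 ->
        l t = (t ^- n) *: map_mx (horner_eval t) P].

(* Only the restriction of [chi] to [H] is relevant. *)
Definition character_over (S : set Fb) H (chi : MB -> Fb) :=
  [/\ forall h, H h -> chi h != 0,
      forall g h, H g -> H h -> chi (g * h) = chi g * chi h &
      exists (n : nat) (f : MB -> Fb), polyfun S f /\
        forall h, H h -> chi h = f h / (\det h) ^+ n].
Definition character := character_over setT.
Definition F_character := character_over (range iota).

Definition pairing (chi : MB -> Fb) (l : Fb -> MB) (m : int) :=
  forall t, t != 0 -> chi (l t) = t ^ m.

Definition cochar_basis A (k : nat) (e : 'I_k -> Fb -> MB) :=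
  (forall i, cocharacter A (e i)) /\
  forall l, cocharacter A l -> exists! z : 'rV[int]_k,
    forall t, t != 0 -> l t = \prod_(i < k) e i t ^ z 0 i.

Definition abs_rank H r :=
  exists T (e : 'I_r -> Fb -> MB), max_torus H T /\ cochar_basis T e.

Definition identity_component H : set MB := [set g | exists T,
  [/\ alg_group T, zconnected T, T `<=` H & T g]].

(* [lim_{t -> 0} l(t) g l(t)^-1 = 1] *)
Definition contracted (l : Fb -> MB) (g : MB) :=
  exists P : 'M[{poly Fb}]_d.+1, map_mx (horner_eval 0) P = 1 /\
    forall t, t != 0 -> conj (l t) g = map_mx (horner_eval t) P.

(* The root group attached to the ray of a nontrivial character [a] of a
   maximal split torus [A] of [J], described dynamically: it is the root group
   of the non-divisible root on that ray, and it is trivial if there is none. *)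
Definition root_group J A (a : MB -> Fb) : set MB := [set g |
  centralizer J (identity_component (A `&` [set t | a t = 1])) g /\
  exists l m, [/\ cocharacter A l, pairing a l m, 0 < m & contracted l g]].

Section Buildings.
Context (R : realType) (omega : F -> int).

(* [bapt A] is the apartment of the maximal split torus [A]; [btr l r x] is the
   translate of [x] by the vector [l (x) r] of X_*(A) (x) R, so that X_*(A) (x) R
   acts on [bapt A] through commuting maps that are additive in [l] and in [r]. *)
Record building := Building {
  bpt : Type ;
  bact : MF -> bpt -> bpt ;
  bapt : set MB -> set bpt ;
  btr : (Fb -> MB) -> R -> bpt -> bpt }.

Definition translate (B : building) k (e : 'I_k -> Fb -> MB) (v : 'rV[R]_k)
    (x : bpt B) : bpt B :=
  foldr (fun i y => btr (e i) (v 0 i) y) x (enum 'I_k).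

(* The characterization of the enlarged Bruhat-Tits building of [J] by Tits:
   the last two fields say that the centralizer of [A] acts on the apartment
   through the valuation, and that a root group element [u <> 1] fixes the
   half-apartment bounded by the mirror of the reflection
   [m(u) \in U_{-a} u U_{-a} \cap N]. *)
Record is_building J (B : building) : Prop := IsBuilding {
  bact1 : forall x : bpt B, bact 1 x = x ;
  bactM : forall g h (x : bpt B), Fpts J g -> Fpts J h ->
    bact (g * h) x = bact g (bact h x) ;
  bapt_cover : forall x : bpt B, exists2 A, max_split J A & bapt A x ;
  bapt_neq0 : forall A, max_split J A -> @bapt B A !=set0 ;
  bapt_conj : forall g A, Fpts J g -> max_split J A ->
    @bact B g @` bapt A = bapt (setconj (map_mx iota g) A) ;
  btr_apt : forall A l r (x : bpt B), max_split J A -> cocharacter A l ->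
    bapt A x -> bapt A (btr l r x) ;
  btr0 : forall A l (x : bpt B), max_split J A -> cocharacter A l ->
    bapt A x -> btr l 0 x = x ;
  btrD : forall A l r s (x : bpt B), max_split J A -> cocharacter A l ->
    bapt A x -> btr l (r + s) x = btr l r (btr l s x) ;
  btrC : forall A l l' r s (x : bpt B), max_split J A -> cocharacter A l ->
    cocharacter A l' -> bapt A x ->
    btr l r (btr l' s x) = btr l' s (btr l r x) ;
  btrM : forall A l l' r (x : bpt B), max_split J A -> cocharacter A l ->
    cocharacter A l' -> bapt A x ->
    btr (fun t => l t * l' t) r x = btr l r (btr l' r x) ;
  btr_simply_transitive : forall A k (e : 'I_k -> Fb -> MB) (x y : bpt B),
    max_split J A -> cochar_basis A e -> bapt A x -> bapt A y ->
    exists! v : 'rV[R]_k, y = translate e v x ;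
  btr_conj : forall g A l r (x : bpt B), Fpts J g -> max_split J A ->
    cocharacter A l -> bapt A x ->
    bact g (btr l r x) = btr (fun t => conj (map_mx iota g) (l t)) r (bact g x) ;
  bact_centralizer : forall A k (e : 'I_k -> Fb -> MB) z (x : bpt B)
      (v : 'rV[R]_k) chi c (m : 'I_k -> int),
    max_split J A -> cochar_basis A e -> Fpts (centralizer J A) z -> bapt A x ->
    bact z x = translate e v x ->
    F_character (centralizer J A) chi -> chi (map_mx iota z) = iota c ->
    (forall i, pairing chi (e i) (m i)) ->
    \sum_i v 0 i * (m i)%:~R = - (omega c)%:~R ;
  bact_root_group : forall A k (e : 'I_k -> Fb -> MB) a (m : 'I_k -> int)
      u v1 v2 n (x : bpt B) (v : 'rV[R]_k),
    max_split J A -> cochar_basis A e -> character A a ->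
    (forall i, pairing a (e i) (m i)) -> (exists i, m i != 0) ->
    Fpts (root_group J A a) u -> u != 1 ->
    Fpts (root_group J A (fun g => (a g)^-1)) v1 ->
    Fpts (root_group J A (fun g => (a g)^-1)) v2 ->
    n = v1 * u * v2 -> Fpts (normalizer J A) n ->
    bapt A x -> bact n x = x -> 0 <= \sum_i v 0 i * (m i)%:~R ->
    bact u (translate e v x) = translate e v x }.

Definition admissible J H (B B' : building) (f : bpt B -> bpt B') :=
  [/\ injective f, forall g x, Fpts J g -> f (bact g x) = bact g (f x) &
      forall A, max_split J A -> exists A', [/\ max_split H A', A `<=` A',
        f @` bapt A `<=` bapt A' &
        forall l r x, cocharacter A l -> bapt A x ->
          f (btr l r x) = btr l r (f x)]].

End Buildings.
End AlgebraicGroups.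

(* Irreducible smooth representations of compact open groups, and hence all
   the representations below, are finite-dimensional. *)
Section Representations.
Context (F : nonarchLocalFieldType) (d : nat) (C : closedFieldType).
Local Notation MF := 'M[F]_d.+1.

(* [GF] is the group of rational points in which openness is understood. *)
Definition open_in (GF K : set MF) := exists2 O : set MF, open O & K = O `&` GF.
Definition open_subgroup GF K := subgroup K /\ open_in GF K.
Definition compact_open GF (K : set MF) := open_subgroup GF K /\ compact K.

Definition smooth_rep GF (V : vectType C) (K : set MF) (rho : MF -> 'End(V)) :=
  [/\ rho 1 = \1%VF,
      forall x y, K x -> K y -> rho (x * y) = (rho x \o rho y)%VF &
      forall v, exists L, [/\ open_subgroup GF L, L `<=` K &
        forall x, L x -> rho x v = v]].

Definition irreducible (V : vectType C) (K : set MF) (rho : MF -> 'End(V)) :=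
  ({:V} != 0)%VS /\ forall U : {vspace V},
    (forall x, K x -> (rho x @: U <= U)%VS) -> U = 0%VS \/ U = {:V}%VS.

Definition irr_smooth GF (V : vectType C) (K : set MF) (rho : MF -> 'End(V)) :=
  smooth_rep GF K rho /\ irreducible K rho.

Definition hom_rep (V W : vectType C) (K : set MF) (rho : MF -> 'End(V))
    (sigma : MF -> 'End(W)) : set 'Hom(V, W) :=
  [set T | forall x, K x -> (T \o rho x)%VF = (sigma x \o T)%VF].

Definition rep_conj (V : vectType C) (h : MF) (rho : MF -> 'End(V)) :=
  fun x => rho (conj h^-1 x).

Definition rep_normalizer (GF : set MF) (V : vectType C) K
    (rho : MF -> 'End(V)) : set MF :=
  [set h | [/\ GF h, setconj h K = K &
     exists2 T, hom_rep K (rep_conj h rho) rho T & bijective T]].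

Definition rep_intertwiners (GF : set MF) (V : vectType C) K
    (rho : MF -> 'End(V)) : set MF :=
  [set h | GF h /\
     exists2 T, hom_rep (K `&` setconj h K) (rep_conj h rho) rho T & T != 0].

Definition rep_kernel (V : vectType C) (K : set MF) (rho : MF -> 'End(V)) :
  set MF := [set k | K k /\ rho k = \1%VF].

Definition in_ind (V : vectType C) (GF K : set MF) (rho : MF -> 'End(V))
    (f : MF -> V) :=
  (forall k g, K k -> GF g -> f (k * g) = rho k (f g)) /\
  exists D, [/\ compact D, D `<=` GF &
    forall g, GF g -> f g != 0 -> setprod K D g].

(* [sigma] restricted to [H] is isomorphic to the representation induced by
   [rho] from [K] to [H]. *)
Definition iso_ind (V W : vectType C) (H K : set MF) (rho : MF -> 'End(V))
    (sigma : MF -> 'End(W)) :=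
  exists j : W -> MF -> V, [/\ forall g, linear (j^~ g),
    forall w, in_ind H K rho (j w),
    forall h g w, H h -> H g -> j (sigma h w) g = j w (g * h),
    forall w, (forall g, H g -> j w g = 0) -> w = 0 &
    forall f, in_ind H K rho f -> exists w, forall g, H g -> j w g = f g].

Definition bilinear_map (V W X : vectType C) (b : V -> W -> X) :=
  (forall v, linear (b v)) /\ (forall w, linear (b^~ w)).

Definition is_tensor (V W X : vectType C) (tau : V -> W -> X) :=
  bilinear_map tau /\ forall (Y : vectType C) (b : V -> W -> Y),
    bilinear_map b -> exists! h : 'Hom(X, Y), forall v w, b v w = h (tau v w).

End Representations.

(* The subsets of C^x \ {1} containing exactly one of q and q^-1 for each q. *)
Definition half_system (C : fieldType) (S : set C) :=
  (forall q, S q -> q != 0 /\ q != 1) /\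
  forall q, q != 0 -> q != 1 -> exists! r, (r = q \/ r = q^-1) /\ S r.

Section OneGroup.
Context (R : realType) (F : nonarchLocalFieldType) (Fb : closedFieldType).
Context (iota : {rmorphism F -> Fb}) (d : nat) (C : closedFieldType).
Context (p : nat) (sqp : C).
Local Notation MF := 'M[F]_d.+1.
Local Notation MB := 'M[Fb]_d.+1.
Local Notation building := (building F Fb d R).
Local Notation Fpts := (Fpts iota).

(* [(p^n)^{1/2}] for [p^n = a] and for [p^n = a / b] respectively. *)
Definition psqrt (a : nat) : C := sqp ^+ logn p a.
Definition psqrt_ratio (a b : nat) : C :=
  sqp ^ ((logn p a)%:Z - (logn p b)%:Z).

(* The Euclidean space A_{x0} is coordinatized by the origin x0 and a Z-basis
   [aC] of X_*(aA), where [aA] is the torus A_M: the row vector [v] stands for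
   the point x0 + \sum_i v_i aC_i; [aQ] is the Gram matrix of the inner
   product, [aH] the set of hyperplanes, and [aN] the group N^heart. *)
Record apartment_data := ApartmentData {
  aA : set MB ;
  adim : nat ;
  aC : 'I_adim -> Fb -> MB ;
  aQ : 'M[R]_adim ;
  aH : set (set 'rV[R]_adim) ;
  aN : set MF }.

Section Apartment.
Context (E : apartment_data).
Local Notation pts := 'rV[R]_(adim E).
Implicit Types (x y z v : pts) (H : set pts).

Definition affine_eq H (a : 'cV[R]_(adim E)) (c : R) :=
  a != 0 /\ H = [set v | (v *m a) 0 0 = c].
Definition hyperplane H := exists a c, affine_eq H a c.
Definition opposite_sides H x y := exists a c, affine_eq H a c /\
  ((x *m a) 0 0 - c) * ((y *m a) 0 0 - c) < 0.

Definition hyperplane_system := [/\ @aH E `<=` hyperplane,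
  forall H, @aH E H -> ~ H 0 &
  forall x, exists2 O, nbhs x O &
    finite_set [set H | @aH E H /\ H `&` O !=set0]].

Definition gen : set pts := ~` \bigcup_(H in @aH E) H.
Definition sep x y : set (set pts) :=
  [set H | [/\ @aH E H, gen x, gen y & opposite_sides H x y]].
Definition dist x y : nat := #|` fset_set (sep x y)|.

Definition inner x y : R := (x *m aQ E *m y^T) 0 0.
Definition inner_product :=
  (aQ E)^T = aQ E /\ forall v, v != 0 -> 0 < inner v v.

Definition orth_reflection H (s : pts -> pts) :=
  forall v, H (2^-1 *: (v + s v)) /\
    forall h h', H h -> H h' -> inner (v - s v) (h - h') = 0.

Definition lattice_point (z : 'rV[int]_(adim E)) : pts := map_mx intr z.
Definition cochar_of (z : 'rV[int]_(adim E)) (t : Fb) : MB :=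
  \prod_i aC i t ^ z 0 i.
(* [n] sends the cocharacter with coordinates [z] to the one with [z']. *)
Definition conj_cochar (n : MF) (z z' : 'rV[int]_(adim E)) := forall t, t != 0 ->
  conj (map_mx iota n) (cochar_of z t) = cochar_of z' t.
Definition invariant_under (A : set MF) :=
  forall n (z z' w w' : 'rV[int]_(adim E)), A n ->
  conj_cochar n z z' -> conj_cochar n w w' ->
  inner (lattice_point z) (lattice_point w) = inner (lattice_point z') (lattice_point w').

(* Only used for sets of reflections, which are closed under inverses. *)
Inductive generated (S : set (pts -> pts)) : (pts -> pts) -> Prop :=
| generated_id : generated S id
| generated_comp s w : S s -> generated S w -> generated S (s \o w).

End Apartment.

(* [cKp x] is K_{x,+}; the character [cth x] is only relevant on [cKp x], and
   all the fields indexed by points only matter at points of A_gen. All the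
   representations [crho x] have the same space as [crM]. *)
Record cover_data (E : apartment_data) := CoverData {
  cG : set MB ;
  cM : set MB ;
  cBG : building ;
  cBM : building ;
  cemb : bpt cBM -> bpt cBG ;
  cx0 : bpt cBM ;
  cV : vectType C ;
  cKM : set MF ;
  crM : MF -> 'End(cV) ;
  cK : 'rV[R]_(adim E) -> set MF ;
  cKp : 'rV[R]_(adim E) -> set MF ;
  crho : 'rV[R]_(adim E) -> MF -> 'End(cV) ;
  cth : 'rV[R]_(adim E) -> MF -> C }.

Section CoverTheory.
Context (E : apartment_data) (X : cover_data E).
Local Notation pts := 'rV[R]_(adim E).
Local Notation V := (cV X).
Local Notation G := (cG X).
Local Notation M := (cM X).
Local Notation GF := (Fpts G).
Local Notation MFpts := (Fpts M).
Local Notation N := (aN E).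
Local Notation KM := (cKM X).
Local Notation K := (@cK E X).
Local Notation Kp := (@cKp E X).
Local Notation rho := (@crho E X).
Local Notation theta := (@cth E X).
Implicit Types (x y z v : pts) (H : set pts) (n : MF) (f : MF -> V).

Definition point v : bpt (cBG X) := cemb (translate (@aC E) v (cx0 X)).

(* The action of N^heart on A_{x0}. *)
Definition act n v : pts := xget 0 [set w | bact n (point v) = point w].

Definition N_point : set MF := [set n | Fpts (normalizer G M) n /\
  exists v, bact n (point 0) = point v].

Record cover_setup : Prop := CoverSetup {
  G_reductive : connected_reductive iota G ;
  M_levi : levi iota G M ;
  A_max_split : max_split iota (center M) (aA E) ;
  C_basis : cochar_basis (aA E) (@aC E) ;
  BG_building : is_building iota (@nval F) G (cBG X) ;
  BM_building : is_building iota (@nval F) M (cBM X) ;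
  emb_admissible : admissible iota M G (@cemb E X) ;
  Q_inner : inner_product E /\ invariant_under E (Fpts (normalizer G M)) ;
  H_system : hyperplane_system E ;
  KM_compact_open : compact_open MFpts KM ;
  KM_fixes : forall k, KM k -> bact k (cx0 X) = cx0 X ;
  rM_irr : irr_smooth MFpts KM (@crM E X) ;
  N_subgroup : subgroup N ;
  N_sub : N `<=` rep_normalizer GF KM (@crM E X) `&` N_point ;
  A_sub_N : Fpts (aA E) `<=` N ;
  K_compact_open : forall x, gen x -> compact_open GF (K x) ;
  Kp_open : forall x, gen x -> open_subgroup GF (Kp x) /\ normal_in (Kp x) (K x) ;
  rho_irr : forall x, gen x -> irr_smooth GF (K x) (rho x) }.

Definition quasi_cover x := forall U Ub, radical_pair iota G M U Ub ->
  [/\ K x = setprod (setprod (K x `&` Fpts U) (K x `&` MFpts)) (K x `&` Fpts Ub),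
      K x `&` MFpts = KM,
      forall k, KM k -> rho x k = @crM E X k &
      forall k, K x k -> Fpts U k \/ Fpts Ub k -> rho x k = \1%VF].

Record quasi_cover_family : Prop := QuasiCoverFamily {
  qcf_isotypic : forall x, gen x ->
    forall k, Kp x k -> rho x k = theta x k *: \1%VF ;
  qcf_hyperplanes : forall n H, N n -> @aH E H -> @aH E (act n @` H) ;
  qcf_equivariant : forall n x, N n -> gen x ->
    K (act n x) = setconj n (K x) /\ Kp (act n x) = setconj n (Kp x) ;
  qcf_cover : forall x, gen x -> quasi_cover x ;
  qcf_KMKp : forall x, gen x -> K x = setprod KM (Kp x) ;
  qcf_Kp_decomp : forall x U Ub, gen x -> radical_pair iota G M U Ub ->
    Kp x = setprod (setprod (Kp x `&` Fpts U) (Kp x `&` MFpts)) (Kp x `&` Fpts Ub) ;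
  qcf_Kp_M : forall x y, gen x -> gen y -> Kp x `&` MFpts = Kp y `&` MFpts ;
  qcf_geodesic : forall x y z, gen x -> gen y -> gen z ->
    (dist x y + dist y z = dist x z)%N ->
    exists U Ub, [/\ radical_pair iota G M U Ub,
      K x `&` Fpts U `<=` K y `&` Fpts U /\ K y `&` Fpts U `<=` K z `&` Fpts U &
      K z `&` Fpts Ub `<=` K y `&` Fpts Ub /\
      K y `&` Fpts Ub `<=` K x `&` Fpts Ub] }.

Definition double_coset_property := forall x, gen x ->
  setprod (setprod (K x) N) (K x) = rep_intertwiners GF (K x) (rho x).

Definition Ind x f := in_ind GF (K x) (rho x) f.

Definition hecke x (phi : MF -> 'End(V)) :=
  [/\ forall g, ~ GF g -> phi g = 0,
      exists D, [/\ compact D, D `<=` GF & forall g, phi g != 0 -> D g] &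
      forall k1 k2 g, K x k1 -> K x k2 -> GF g ->
        phi (k1 * g * k2) = (rho x k1 \o phi g \o rho x k2)%VF].

Definition convolution x (phi1 phi2 : MF -> 'End(V)) (g : MF) : 'End(V) :=
  \sum_(c \in lcosets GF (K x)) (phi1 (coset_rep c) \o phi2 ((coset_rep c)^-1 * g))%VF.

(* Theta_{y|x} and its normalization *)
Definition Theta y x f (g : MF) : V :=
  (coset_index (Kp y) (Kp x))%:R^-1 *:
    \sum_(c \in lcosets (Kp y) (Kp x `&` Kp y))
       theta y (coset_rep c) *: f ((coset_rep c)^-1 * g).
Definition Theta_norm y x f (g : MF) : V :=
  psqrt (coset_index (K y) (K x)) *: Theta y x f g.

Definition scalar_op x (L : (MF -> V) -> MF -> V) :=
  exists c : C, forall f g, Ind x f -> GF g -> L f g = c *: f g.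

Definition relevant : set (set pts) := [set H | @aH E H /\
  exists x y, [/\ gen x, gen y, sep x y = [set H] &
    ~ scalar_op x (fun f => Theta x y (Theta y x f))]].

Definition basic_family (T : MF -> 'End(V)) :=
  [/\ forall n, N n -> T n != 0 /\
        hom_rep KM (rep_conj n (@crM E X)) (@crM E X) (T n),
      T 1 = \1%VF &
      forall n k, N n -> KM k -> N k -> T (n * k) = (T n \o @crM E X k)%VF].

(* W^heart = N / (N \cap K_M) is handled through lifts to N: [Phi T n] is
   Phi_w for w the class of n, and similarly for [phi_w]. *)
Definition Phi (T : MF -> 'End(V)) n f (g : MF) : V :=
  T n (Theta_norm (act n^-1 0) 0 f (n^-1 * g)).

Definition fun_at (v : V) (g : MF) : V :=
  if g \in K 0 then rho 0 g v else 0.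
Definition phi_w (T : MF -> 'End(V)) n (g : MF) : 'End(V) :=
  if g \in GF then linfun (fun u : V => Phi T n (fun_at u) g) else 0.

Definition W_rel := generated
  [set s | exists2 H, relevant H & orth_reflection H s].

(* [Waff] is the preimage in N of a subgroup of W^heart. *)
Definition reflection_property (Waff : set MF) :=
  [/\ subgroup Waff /\ N `&` KM `<=` Waff, normal_in Waff N,
      forall n, Waff n -> act n = id -> KM n &
      forall w, W_rel w <-> exists2 n, Waff n & act n = w].

(* The preimage of C_rel in A_{x0}: the relevant hyperplanes, hence also the
   components of their complement, are stable under V^rel. *)
Definition C_rel : set pts :=
  connected_component (~` \bigcup_(H in relevant) H) 0.
Definition Omega : set MF := [set n | N n /\ act n @` C_rel = C_rel].

Definition wall H := relevant H /\
  exists h O, [/\ H h, nbhs h O & H `&` O `<=` closure C_rel].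

(* [n] lifts the simple reflection with wall [H]. *)
Definition simple (Waff : set MF) n H :=
  [/\ Waff n, wall H & orth_reflection H (act n)].
Definition simples Waff n := exists H, simple Waff n H.

Definition rank_one_property (Waff : set MF) (K' : pts -> pts -> set MF) :=
  forall n H x, simple Waff n H -> gen x -> sep x (act n x) = [set H] ->
    [/\ compact_open GF (K' x (act n x)), K x `<=` K' x (act n x) &
        forall m, N m -> K' x (act n x) m <-> KM m \/ KM (n^-1 * m)].

Definition word_in (S : MF -> Prop) (s : seq MF) :=
  forall i, (i < size s)%N -> S (nth 1 s i).
Definition word_prod (s : seq MF) : MF := \prod_(n <- s) n.
Definition reduced_word Waff (s : seq MF) := word_in (simples Waff) s /\
  forall s', word_in (simples Waff) s' ->
    KM ((word_prod s')^-1 * word_prod s) -> (size s <= size s')%N.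

Definition op_eq (L1 L2 : (MF -> V) -> MF -> V) :=
  forall f g, Ind 0 f -> GF g -> L1 f g = L2 f g.

Definition adapted Waff (Cgt1 : set C) (T : MF -> 'End(V)) :=
  [/\ basic_family T,
      forall n, simples Waff n -> exists2 q, Cgt1 q &
        op_eq (Phi T n \o Phi T n)
              (fun f g => (q - 1) *: Phi T n f g + q *: Phi T 1 f g),
      forall s, reduced_word Waff s ->
        op_eq (Phi T (word_prod s)) (foldr (fun n L => Phi T n \o L) id s) &
      forall t w, Omega t -> Waff w -> op_eq (Phi T t \o Phi T w) (Phi T (t * w))].

End CoverTheory.

(* [kMt] is the representation \widetilde\kappa_M, [ctau] the identification
   V_{rho_M} = V_{rho_{M^0}} (x) V_{kappa_M}; [cKx x] is K_{x,0+}, [ckap x] is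
   kappa_x, and [cK0 x y] is K^0_{x,y}. *)
Record comparison_data := ComparisonData {
  dE : apartment_data ;
  dX0 : cover_data dE ;
  dX : cover_data dE ;
  dembM : bpt (cBM dX0) -> bpt (cBM dX) ;
  dembG : bpt (cBG dX0) -> bpt (cBG dX) ;
  dVk : vectType C ;
  dkMt : MF -> 'End(dVk) ;
  dtau : cV dX0 -> dVk -> cV dX ;
  dKx : 'rV[R]_(adim dE) -> set MF ;
  dVx : 'rV[R]_(adim dE) -> vectType C ;
  dkap : forall x, MF -> 'End(dVx x) ;
  dK0 : 'rV[R]_(adim dE) -> 'rV[R]_(adim dE) -> set MF }.

Section Comparison.
Context (D : comparison_data).
Local Notation E := (dE D).
Local Notation X0 := (dX0 D).
Local Notation X := (dX D).
Local Notation G0F := (Fpts (cG X0)).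
Local Notation GF := (Fpts (cG X)).
Local Notation M0F := (Fpts (cM X0)).
Local Notation MFpts := (Fpts (cM X)).
Local Notation N := (aN E).

Record comparison_setup : Prop := ComparisonSetup {
  setup0 : cover_setup X0 ;
  setup1 : cover_setup X ;
  G0_sub : cG X0 `<=` cG X ;
  same_rank : exists r, abs_rank (cG X0) r /\ abs_rank (cG X) r ;
  M_centralizer : cM X = centralizer (cG X) (aA E) ;
  embM_admissible : admissible iota (cM X0) (cM X) (@dembM D) ;
  embG_admissible : admissible iota (cG X0) (cG X) (@dembG D) ;
  emb_commute : forall b, @dembG D (cemb b) = cemb (@dembM D b) ;
  x0_eq : @dembM D (cx0 X0) = cx0 X }.

(* Smoothness of \widetilde\kappa_M refers to the topology of M(F), which is
   open in N_G(M)(F). *)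
Definition levi_compat :=
  [/\ is_tensor (@dtau D),
      smooth_rep MFpts (setprod N (cKM X)) (@dkMt D),
      irr_smooth MFpts (cKM X) (@dkMt D) &
      exists L, [/\ compact_open MFpts L,
        normalizes (setprod N (cKM X0)) L,
        M0F `&` L `<=` rep_kernel (cKM X0) (@crM E X0),
        cKM X = setprod (cKM X0) L &
        forall k l v w, cKM X0 k -> L l ->
          @crM E X (k * l) (dtau v w) = dtau (@crM E X0 k v) (dkMt D (k * l) w)]].

Definition cover_compat := forall x : 'rV[R]_(adim E), gen x ->
  [/\ compact_open GF (dKx x) /\ dKx x `<=` cK X x,
      normalizes (cK X0 x) (dKx x),
      G0F `&` dKx x `<=` rep_kernel (cK X0 x) (crho X0 x) /\
        cK X x = setprod (cK X0 x) (dKx x),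
      irr_smooth GF (cK X x) (dkap x) /\
        (exists2 tau : cV X0 -> dVx x -> cV X, is_tensor tau &
           forall k l v w, cK X0 x k -> dKx x l ->
             crho X x (k * l) (tau v w) =
             tau (crho X0 x k v) (dkap x (k * l) w)) &
      rep_intertwiners GF (cK X x) (crho X x) =
        setprod (setprod (cK X x)
          (rep_intertwiners G0F (cK X0 x) (crho X0 x))) (cK X x)].

(* The conditions on the group [L] (= K_{x,y;0+}) and on the representation
   [kap] are symmetric in [x] and [y], so that a symmetric choice of both is
   possible as soon as they exist for each pair. *)
Definition neighbor_compat := forall x y : 'rV[R]_(adim E),
  gen x -> gen y -> dist x y = 1%N ->
  [/\ dK0 x y = dK0 y x, compact_open G0F (dK0 x y) &
   exists (L : set MF) (W : vectType C) (kap : MF -> 'End(W)),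
   [/\ compact_open GF L,
       irr_smooth GF (setprod (dK0 x y) L) kap,
       cK X0 x `<=` dK0 x y /\ cK X0 y `<=` dK0 x y,
       [/\ normalizes (dK0 x y) L,
           dKx x `<=` setprod (G0F `&` dKx x) L &
           dKx y `<=` setprod (G0F `&` dKx y) L] &
       [/\ G0F `&` L `<=` rep_kernel (cK X0 x) (crho X0 x)
                          `&` rep_kernel (cK X0 y) (crho X0 y),
           irreducible L kap,
           iso_ind (setprod (cK X0 x) L) (cK X x) (dkap x) kap &
           iso_ind (setprod (cK X0 y) L) (cK X y) (dkap y) kap]]].

Definition hecke_isomorphism (I : (MF -> 'End(cV X0)) -> MF -> 'End(cV X)) :=
  [/\ set_bij (@hecke E X0 0) (@hecke E X 0) I,
      forall (a : C) phi psi, @hecke E X0 0 phi -> @hecke E X0 0 psi ->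
        I (fun g => a *: phi g + psi g) = (fun g => a *: I phi g + I psi g) &
      forall phi psi, @hecke E X0 0 phi -> @hecke E X0 0 psi ->
        I (@convolution E X0 0 phi psi) = @convolution E X 0 (I phi) (I psi)].

(* The associated adapted family for G; Omega is the same for both groups. *)
Definition associated_adapted Waff Cgt1 (T0 : MF -> 'End(cV X0))
    (T : MF -> 'End(cV X)) :=
  adapted Waff Cgt1 T /\ forall n, Omega X0 n -> forall v w,
    T n (dtau v w) = dtau (T0 n v) (dkMt D n w).

Definition d_factor (n : MF) : C :=
  psqrt_ratio (coset_index (cK X0 0) (cK X0 (act X0 n 0)))
              (coset_index (cK X 0) (cK X (act X n 0))).

Definition supported_on (V : vectType C) (A : set MF) (phi : MF -> 'End(V)) :=
  forall g, phi g != 0 -> A g.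

(* Signs are taken in the coefficient field. *)
Definition quadratic_character (eps : MF -> C) :=
  [/\ forall n, N n -> eps n = 1 \/ eps n = -1,
      forall m n, N m -> N n -> eps (m * n) = eps m * eps n &
      forall n, N n -> cKM X0 n -> eps n = 1].

Definition describes_iso (I : (MF -> 'End(cV X0)) -> MF -> 'End(cV X))
    (eps : MF -> C) :=
  forall phi n, @hecke E X0 0 phi -> N n ->
    supported_on (setprod (setprod (cK X0 0) [set n]) (cK X0 0)) phi ->
    supported_on (setprod (setprod (cK X 0) [set n]) (cK X 0)) (I phi) /\
    forall v w, I phi n (dtau v w) =
      d_factor n *: dtau (phi n v) (eps n *: dkMt D n w).

End Comparison.
End OneGroup.

(* Main.v *)
(* Everything rests on the operators Theta^norm_{y|x}, which are multiplicative
   along geodesics. When a single irrelevant hyperplane separates x and y, both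
   composites of Theta^norm_{x|y} and Theta^norm_{y|x} are scalars, and comparing
   dimensions of induced representations shows that the scalars are 1; hence
   Theta^norm_{z|y} Theta^norm_{y|x} = Theta^norm_{z|x} as soon as no relevant
   hyperplane separates y from both x and z. Inside the compact group K_{x,y},
   the operator for G is the one for G^0 tensored with kappa_{x,y}, because
   kappa_{x,y} is irreducible on K_{x,y;0+}; so hyperplanes irrelevant for G^0 are
   irrelevant for G.

   By Schur's lemma T_n = eps(n) T^0_n (x) kappa(n) for a scalar eps(n). If no
   relevant hyperplane is crossed twice, phi_m phi_n is the same multiple of
   phi_{mn} as T_m T_n is of T_{mn}; comparing G^0 and G through I gives
   eps(mn) = eps(m) eps(n). The quadratic relation of a simple reflection s,
   evaluated at 1, gives eps(s)^2 = 1, which handles the products with s that do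
   cross a hyperplane twice; Omega and the simple reflections generate. *)
From HB Require Import structures.
From mathcomp Require Import all_boot all_order all_fingroup all_solvable all_algebra all_field.
From mathcomp Require Import finmap.
From mathcomp Require Import all_classical all_reals all_analysis.
From mathcomp Require Import ring lra zify.
Require Import Defs.
Set Implicit Arguments.
Unset Strict Implicit.
Unset Printing Implicit Defensive.
Import Order.TTheory GRing.Theory Num.Theory.
Import numFieldNormedType.Exports.
Local Open Scope classical_set_scope.
Local Open Scope ring_scope.

(** * Schur lemma and tensor products *)

(** The factor d_n has a single source: phi_n(n) is T_n divided by the square root of an index, and
    d_n is the quotient of these normalizations for the two groups. Such square roots behave well
    because each index |K_y/(K_x cap K_y)| is a power of p: it can be computed inside a unipotent
    group K_y cap U, where p-power maps contract to 1. The axioms of buildings serve to make N^heart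
    act on A_{x0} by affine maps, in the same way for G^0 and G. The hyperplane arrangement is only
    locally finite and need not come from a root system; generic segments and their first crossings
    therefore take the place of reduced words. The induced representations are infinite-dimensional.
    Operators are tested on the functions f_v and described by kernels on a compact subgroup J
    containing K_x and K_y, where every sum is finite. The constants c with T_m T_n = c T_{mn} are
    not known individually. Since I sends phi^0_n to phi_n for all n, they agree for G^0 and G
    whenever the products of the phi are controlled; this is what makes eps multiplicative. *)

Section LinearAlgebra.
Context (C : closedFieldType).

Section Eigenvector.
Import VectorInternalTheory.
Lemma eigenvector_ex (V : vectType C) (T : 'End(V)) : ({:V} != 0)%VS ->
  exists a (u : V), u != 0 /\ T u = a *: u.
Proof.
move=> V0; have nV : (0 < dim V)%N.
  rewrite lt0n; apply: contraNneq V0 => d0.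
  by rewrite -dimv_eq0 dimvf d0.
have /closed_rootP[a ra] : size (char_poly (f2mx T)) != 1%N.
  by rewrite size_char_poly eqSS -lt0n.
move: ra; rewrite -eigenvalue_root_char => /eigenvalueP[v vT v0].
exists a, (r2v v); split.
  apply/eqP => u0; case/eqP: v0; rewrite -[LHS](r2vK v) u0; exact: linear0.
by rewrite unlock /= r2vK vT linearZ.
Qed.
End Eigenvector.

(** Schur's lemma: the eigenspace of [T] for one eigenvalue is non-zero and stable under [rho],
    hence is the whole space. *)
Lemma irr_scalar (F : nonarchLocalFieldType) (d : nat) (V : vectType C)
    (K : set 'M[F]_d.+1) (rho : 'M[F]_d.+1 -> 'End(V)) (T : 'End(V)) :
  irreducible K rho -> (forall x, K x -> (T \o rho x)%VF = (rho x \o T)%VF) ->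
  exists c, T = c *: \1%VF.
Proof.
move=> [V0 irr] Tc; have [a [u [u0 Tu]]] := eigenvector_ex T V0.
exists a; pose U := lker (T - a *: \1%VF).
have UE v : (v \in U) = (T v == a *: v).
  by rewrite memv_ker add_lfunE opp_lfunE scale_lfunE id_lfunE subr_eq0.
have Ust x : K x -> (rho x @: U <= U)%VS.
  move=> Kx; apply/subvP => _ /memv_imgP[v Uv ->]; move: Uv; rewrite !UE => /eqP Tv.
  by rewrite -[T _]comp_lfunE Tc // comp_lfunE Tv linearZ.
have [|UV] := irr U Ust.
  by move=> U0; move: (UE u); rewrite Tu eqxx U0 memv0 (negPf u0).
apply/lfunP => v; have := memvf v; rewrite -UV UE => /eqP ->.
by rewrite !lfunE /= lfunE.
Qed.

(** Each [rho x] descends along [T] to some endomorphism [S], and this already makes the kernel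
    stable. The form covers T_n, which carries [rM k] to [rM (conj n k)]. *)
Lemma irr_lker0 (F : nonarchLocalFieldType) (d : nat) (V W : vectType C)
    (K : set 'M[F]_d.+1) (rho : 'M[F]_d.+1 -> 'End(V)) (T : 'Hom(V, W)) :
  irreducible K rho -> T != 0 ->
  (forall x, K x -> exists S : 'End(W), (T \o rho x)%VF = (S \o T)%VF) ->
  lker T == 0%VS.
Proof.
move=> [V0 irr] T0 Th; have [|->//|kV] := irr (lker T).
  move=> x Kx; have [S ST] := Th x Kx.
  apply/subvP => _ /memv_imgP[v Uv ->]; move: Uv; rewrite !memv_ker => /eqP Tv.
  by rewrite -[T _]comp_lfunE ST comp_lfunE Tv linear0.
case/negP: T0; apply/eqP/lfunP => v; rewrite lfunE /=; apply/eqP.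
by rewrite -memv_ker kV memvf.
Qed.

Lemma functional_ex (V : vectType C) (v : V) : v != 0 ->
  exists phi : {linear V -> C^o}, phi v != 0.
Proof.
move=> v0; have := coord_vbasis (memvf v); set n := \dim _ => vE.
have [[i ci]|c0] := pselect (exists i, coord (vbasis {:V}) i v != 0).
  by exists (coord (vbasis {:V}) i).
case/eqP: v0; rewrite vE big1 // => i _; have [->|ci] := eqVneq (coord (vbasis {:V}) i v) 0.
  by rewrite scale0r.
by case: c0; exists i.
Qed.

Lemma lfun_ex (V W : vectType C) (f : V -> W) : linear f ->
  exists h : 'Hom(V, W), h =1 f.
Proof.
move=> lf; pose fM := GRing.isLinear.Build _ _ _ _ f lf.
pose fL : {linear _ -> _} := HB.pack f fM.
by exists (linfun fL) => v; rewrite lfunE.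
Qed.

Lemma linfunE (V W : vectType C) (f : V -> W) : linear f -> linfun f =1 f.
Proof.
move=> lf; pose fM := GRing.isLinear.Build _ _ _ _ f lf.
pose fL : {linear _ -> _} := HB.pack f fM.
exact: (lfunE fL).
Qed.

Section Tensor.
Context (V W X : vectType C) (tau : V -> W -> X).
Hypothesis tT : is_tensor tau.

Lemma tensor_linl w : linear (tau^~ w). Proof. by case: tT => -[_ +] _; apply. Qed.
Lemma tensor_linr v : linear (tau v). Proof. by case: tT => -[+ _] _; apply. Qed.

Lemma tensor_Zl a v w : tau (a *: v) w = a *: tau v w.
Proof.
have [h hE] := lfun_ex (tensor_linl w).
have: h (a *: v) = a *: h v by rewrite linearZ.
by rewrite !hE.
Qed.

Lemma tensor_Zr a v w : tau v (a *: w) = a *: tau v w.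
Proof.
have [h hE] := lfun_ex (tensor_linr v).
have: h (a *: w) = a *: h w by rewrite linearZ.
by rewrite !hE.
Qed.

Lemma tensor_0l w : tau 0 w = 0. Proof. by rewrite -(scale0r 0) tensor_Zl scale0r. Qed.
Lemma tensor_0r v : tau v 0 = 0. Proof. by rewrite -(scale0r 0) tensor_Zr scale0r. Qed.

Lemma tensor_suml (J : Type) (r : seq J) (f : J -> V) w :
  tau (\sum_(j <- r) f j) w = \sum_(j <- r) tau (f j) w.
Proof.
have [h hE] := lfun_ex (tensor_linl w).
have: h (\sum_(j <- r) f j) = \sum_(j <- r) h (f j) by rewrite linear_sum.
by rewrite hE => ->; apply: eq_bigr => j _; rewrite hE.
Qed.

Lemma tensor_sumr (J : Type) (r : seq J) (f : J -> W) v :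
  tau v (\sum_(j <- r) f j) = \sum_(j <- r) tau v (f j).
Proof.
have [h hE] := lfun_ex (tensor_linr v).
have: h (\sum_(j <- r) f j) = \sum_(j <- r) h (f j) by rewrite linear_sum.
by rewrite hE => ->; apply: eq_bigr => j _; rewrite hE.
Qed.

Lemma tensor_ext (Y : vectType C) (h h' : 'Hom(X, Y)) :
  (forall v w, h (tau v w) = h' (tau v w)) -> h = h'.
Proof.
case: tT => -[l2 l1] U hh'.
have [|k [_ ku]] := U Y (fun v w => h (tau v w)).
  split=> [v a u u'|w a u u'] /=; first by rewrite (l2 v) linearP.
  by rewrite (l1 w) linearP.
by rewrite -(ku h) // -(ku h').
Qed.

(** [is_tensor] is only a universal property, so a pure tensor is detected by factoring through it a
    bilinear form f(v) g(w), with functionals f and g that are non-zero on the two vectors. *)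
Lemma tensor_neq0 v w : v != 0 -> w != 0 -> tau v w != 0.
Proof.
move=> /functional_ex[f fv] /functional_ex[g gw]; case: tT => _.
move=> /(_ C^o (fun v w => f v *: g w))[|h [hE _]].
  split=> [v' a u u'|w' a u u'] /=; first by rewrite linearP scalerDr !scalerA mulrC.
  by rewrite linearP scalerDl scalerA.
apply/eqP => t0; have := hE v w; rewrite t0 linear0 => /eqP.
by rewrite scaler_eq0 (negPf fv) (negPf gw).
Qed.
End Tensor.

Lemma tensor_map (V V' W W' X X' : vectType C) (tau : V -> W -> X)
    (tau' : V' -> W' -> X') (A : 'Hom(V, V')) (B : 'Hom(W, W')) :
  is_tensor tau -> is_tensor tau' ->
  exists h : 'Hom(X, X'), forall v w, h (tau v w) = tau' (A v) (B w).
Proof.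
move=> [_ U] [[l2 l1] _]; have [|h [hE _]] := U X' (fun v w => tau' (A v) (B w)).
  split=> [v a u u'|w a u u'] /=; first by rewrite linearP (l2 (A v)).
  by rewrite linearP (l1 (B w)).
by exists h => v w; rewrite hE.
Qed.
End LinearAlgebra.

(** * Cosets *)

Section GroupSets.
Context (T : unitRingType).
Implicit Types (A B D H : set T) (s t : seq T) (g h x y a r : T).

Lemma sgU H x : subgroup H -> H x -> x \is a GRing.unit.
Proof. by case=> HU _ _ _ /HU. Qed.
Lemma sg1 H : subgroup H -> H 1. Proof. by case. Qed.
Lemma sgM H x y : subgroup H -> H x -> H y -> H (x * y).
Proof. by case=> _ _ HM _; apply: HM. Qed.
Lemma sgV H x : subgroup H -> H x -> H x^-1.
Proof. by case=> _ _ _; apply. Qed.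

Lemma sgVM H x y : subgroup H -> H x -> H (x^-1 * y) <-> H y.
Proof.
move=> sH Hx; split=> [Hxy|Hy]; last by apply: sgM => //; apply: sgV.
by rewrite -(mulVKr (sgU sH Hx) y); apply: sgM.
Qed.
Lemma sgMl H x y : subgroup H -> H x -> H (x * y) <-> H y.
Proof.
move=> sH Hx; split=> [Hxy|Hy]; last exact: sgM.
by rewrite -(mulKr (sgU sH Hx) y); apply: sgM => //; apply: sgV.
Qed.
Lemma sgMr H x y : subgroup H -> H y -> H (x * y) <-> H x.
Proof.
move=> sH Hy; split=> [Hxy|Hx]; last exact: sgM.
by rewrite -(mulrK (sgU sH Hy) x); apply: sgM => //; apply: sgV.
Qed.

Lemma sgI A B : subgroup A -> subgroup B -> subgroup (A `&` B).
Proof.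
move=> sA sB; split=> [x [/(sgU sA)]||x y [? ?] [? ?]|x [? ?]] //.
- by split; apply: sg1.
- by split; apply: sgM.
- by split; apply: sgV.
Qed.

Lemma conjM g x y : g \is a GRing.unit -> conj g (x * y) = conj g x * conj g y.
Proof. by move=> gU; rewrite /conj !mulrA mulrVK. Qed.
Lemma conj1 g : g \is a GRing.unit -> conj g 1 = 1.
Proof. by move=> gU; rewrite /conj mulr1 divrr. Qed.
Lemma conjK g : g \is a GRing.unit -> cancel (conj g) (conj g^-1).
Proof. by move=> gU x; rewrite /conj invrK !mulrA mulVr // mul1r mulrVK. Qed.
Lemma conjVK g : g \is a GRing.unit -> cancel (conj g^-1) (conj g).
Proof. by move=> gU x; rewrite /conj invrK !mulrA mulrV // mul1r mulrK. Qed.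
Lemma conjMg g h x : g \is a GRing.unit -> h \is a GRing.unit ->
  conj (g * h) x = conj g (conj h x).
Proof. by move=> gU hU; rewrite /conj invrM // !mulrA. Qed.
Lemma conj_unit g x : g \is a GRing.unit ->
  (conj g x \is a GRing.unit) = (x \is a GRing.unit).
Proof. by move=> gU; rewrite /conj unitrMl ?unitrV // unitrMr. Qed.
Lemma conjV g x : g \is a GRing.unit -> x \is a GRing.unit ->
  conj g x^-1 = (conj g x)^-1.
Proof. by move=> gU xU; rewrite /conj invrM ?unitrV ?unitrMr // invrM // invrK mulrA. Qed.

Lemma conj_mul g x : g \is a GRing.unit -> conj g x * g = g * x.
Proof. by move=> gU; rewrite /conj mulrVK. Qed.

Lemma conj_conj g x y : g \is a GRing.unit -> x \is a GRing.unit ->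
  conj (conj g x) (conj g y) = conj g (conj x y).
Proof. by move=> gU xU; rewrite {1}/conj -conjV // -!conjM. Qed.

Lemma setconjE g A x : g \is a GRing.unit -> setconj g A x <-> A (conj g^-1 x).
Proof.
move=> gU; split=> [[a Aa <-]|Ax]; first by rewrite conjK.
by exists (conj g^-1 x) => //; rewrite conjVK.
Qed.
Lemma setconj_conj g A x : g \is a GRing.unit -> setconj g A (conj g x) <-> A x.
Proof. by move=> gU; rewrite setconjE // conjK. Qed.
Lemma setconjK g A : g \is a GRing.unit -> setconj g^-1 (setconj g A) = A.
Proof.
move=> gU; apply/seteqP; split=> x; rewrite !setconjE ?unitrV // invrK ?conjVK //.
  by rewrite conjK.
by rewrite conjK.
Qed.
Lemma setconjVK g A : g \is a GRing.unit -> setconj g (setconj g^-1 A) = A.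
Proof. by move=> gU; rewrite -{1}[g]invrK setconjK ?unitrV. Qed.
Lemma setconjI g A B : g \is a GRing.unit ->
  setconj g (A `&` B) = setconj g A `&` setconj g B.
Proof.
move=> gU; apply/seteqP; split=> x /=; rewrite !setconjE //.
Qed.
Lemma setconj_prod g A B : g \is a GRing.unit ->
  setconj g (setprod A B) = setprod (setconj g A) (setconj g B).
Proof.
move=> gU; apply/seteqP; split=> [_ [_ [a Aa [b Bb <-]] <-]|_ [_ [a Aa <-] [_ [b Bb <-] <-]]].
  exists (conj g a); first by exists a.
  by exists (conj g b); [exists b|rewrite conjM].
by exists (a * b); rewrite ?conjM //; exists a => //; exists b.
Qed.
Lemma subgroup_setconj g H : g \is a GRing.unit -> subgroup H -> subgroup (setconj g H).
Proof.
move=> gU sH; split=> [_ [x Hx <-]||_ _ [x Hx <-] [y Hy <-]|_ [x Hx <-]].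
- by rewrite /= conj_unit // (sgU sH).
- by exists 1; rewrite ?conj1 //; apply: sg1.
- by exists (x * y); rewrite ?conjM //; apply: sgM.
- by exists x^-1; [apply: sgV|rewrite conjV // (sgU sH)].
Qed.

Definition trans A D s := [/\ uniq s, forall r, r \in s -> A r,
  forall r r', r \in s -> r' \in s -> D (r^-1 * r') -> r = r' &
  forall a, A a -> exists2 r, r \in s & D (r^-1 * a)].

Definition right_inv (V : Type) A D (f : T -> V) :=
  forall a x, A a -> D x -> f (a * x) = f a.

Lemma lcosets_trans A D s : subgroup A -> subgroup D -> D `<=` A -> trans A D s ->
  lcosets A D = [set` [seq setprod [set r] D | r <- s]].
Proof.
move=> sA sD DA [us As Ds Es]; apply/seteqP; split=> [_ [a Aa <-]|c /mapP[r rs ->]].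
  have [r rs Dr] := Es a Aa; apply/mapP; exists r => //.
  have rU := sgU sA (As r rs); have aU := sgU sA Aa.
  apply/seteqP; split=> _ [_ -> [x Dx <-]].
    exists r => //; exists (r^-1 * a * x); first exact: sgM.
    by rewrite !mulrA divrr // mul1r.
  exists a => //; exists ((r^-1 * a)^-1 * x); first by apply: sgM => //; apply: sgV.
  by rewrite invrM ?unitrV // invrK !mulrA divrr // mul1r.
by exists r => //; apply: As.
Qed.

Lemma trans_coset_inj A D s : subgroup A -> subgroup D -> trans A D s ->
  {in s &, injective (fun r => setprod [set r] D)}.
Proof.
move=> sA sD [us As Ds Es] r r' rs r's E; apply: Ds => //.
have: setprod [set r'] D r' by exists r' => //; exists 1; [apply: sg1|rewrite mulr1].
rewrite -E => -[_ -> [x Dx <-]].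
by rewrite mulKr // (sgU sA) //; apply: As.
Qed.

Lemma uniq_cosets A D s : subgroup A -> subgroup D -> trans A D s ->
  uniq [seq setprod [set r] D | r <- s].
Proof.
move=> sA sD tr; rewrite map_inj_in_uniq; first by case: tr.
exact: trans_coset_inj tr.
Qed.

Lemma coset_repE D r : subgroup D -> exists2 x, D x & coset_rep (setprod [set r] D) = r * x.
Proof.
move=> sD; rewrite /coset_rep; case: xgetP => [_ -> [_ -> [x Dx <-]]|/(_ r)].
  by exists x.
by case; exists r => //; exists 1; [apply: sg1|rewrite mulr1].
Qed.

(** [coset_rep] chooses an unspecified element of each coset; right invariance makes the sum
    independent of that choice. *)
Lemma csumE (V : nmodType) A D s (f : T -> V) : subgroup A -> subgroup D ->
  D `<=` A -> trans A D s -> right_inv A D f ->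
  \sum_(c \in lcosets A D) f (coset_rep c) = \sum_(r <- s) f r.
Proof.
move=> sA sD DA tr fD; rewrite (lcosets_trans sA sD DA tr) -fsbig_seq; last exact: uniq_cosets tr.
rewrite big_map; apply: eq_big_seq => r rs.
by have [x Dx ->] := coset_repE r sD; rewrite fD //; case: tr => _ + _ _; apply.
Qed.

Lemma trans_sum (V : nmodType) A D s t (f : T -> V) : subgroup A -> subgroup D ->
  D `<=` A -> trans A D s -> trans A D t -> right_inv A D f ->
  \sum_(r <- s) f r = \sum_(r <- t) f r.
Proof. by move=> sA sD DA ts tt fi; rewrite -(csumE sA sD DA ts fi) -(csumE sA sD DA tt fi). Qed.

(** Both sizes are the sum of the constant 1 over the same set of cosets. *)
Lemma trans_size A D s t : subgroup A -> subgroup D -> D `<=` A ->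
  trans A D s -> trans A D t -> size s = size t.
Proof.
move=> sA sD DA ts tt.
have := @trans_sum int A D s t (fun=> 1) sA sD DA ts tt.
rewrite !big_const_seq !count_predT !iter_addr_0 !natz => H.
by have /(_ _)/eqP := H _; rewrite eqz_nat => E; apply/eqP/E.
Qed.

Lemma coset_indexE A B s : subgroup A -> subgroup B -> trans A (A `&` B) s ->
  coset_index A B = size s.
Proof.
move=> sA sB tr; have sAB := sgI sA sB; rewrite /coset_index (lcosets_trans sA sAB (@subIsetl _ A B) tr).
have -> : [set` [seq setprod [set r] (A `&` B) | r <- s]] =
   [set` [fset x in [seq setprod [set r] (A `&` B) | r <- s]]%fset].
  by apply/seteqP; split=> x /=; rewrite in_fset.
rewrite set_fsetK card_fseq undup_id ?size_map //.
exact: uniq_cosets tr.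
Qed.

Lemma trans_tower A B D s t : subgroup A -> subgroup B -> subgroup D -> D `<=` B -> B `<=` A ->
  trans A B s -> trans B D t -> trans A D [seq r * r' | r <- s, r' <- t].
Proof.
move=> sA sB sD DB BA [us As Ds Es] [ut Bt Dt Et].
have rU r : r \in s -> r \is a GRing.unit by move=> /As /(sgU sA).
have key r1 r2 x1 x2 : r1 \in s -> r2 \in s -> x1 \in t -> x2 \in t ->
    D ((r1 * x1)^-1 * (r2 * x2)) -> r1 = r2 /\ x1 = x2.
  move=> h1 h2 k1 k2; have x1U := sgU sB (Bt _ k1); have r1U := rU _ h1.
  rewrite invrM // -mulrA [r1^-1 * _]mulrA => Dd.
  have r12 : r1 = r2.
    apply: Ds => //; move/DB: Dd => /(sgVM _ sB (Bt _ k1)).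
    by move/(sgMr _ sB (Bt _ k2)).
  by subst r2; split=> //; apply: Dt => //; move: Dd; rewrite mulVr ?mul1r.
split.
- apply: allpairs_uniq => //; move=> [r1 x1] [r2 x2] /allpairsP[[a b] /= [h1 k1 [-> ->]]].
  move=> /allpairsP[[a' b'] /= [h2 k2 [-> ->]]] E.
  suff Dd : D ((a * b)^-1 * (a' * b')) by have [-> ->] := key _ _ _ _ h1 h2 k1 k2 Dd.
  move: E => /= ->; rewrite mulVr; first exact: sg1.
  by rewrite unitrMr ?(sgU sB (Bt _ k2)) ?rU.
- by move=> _ /allpairsP[[a b] /= [h k ->]]; apply: sgM => //; [apply: As|apply/BA/Bt].
- move=> _ _ /allpairsP[[a b] /= [h1 k1 ->]] /allpairsP[[a' b'] /= [h2 k2 ->]].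
  by move=> Dd; have [-> ->] := key _ _ _ _ h1 h2 k1 k2 Dd.
- move=> a Aa; have [r rs Br] := Es a Aa; have [x xt Dx] := Et _ Br.
  exists (r * x); first by apply/allpairsP; exists (r, x).
  have xU := sgU sB (Bt _ xt); have rU' := rU r rs.
  by rewrite invrM // -mulrA.
Qed.

Lemma trans_mul A D s a : subgroup A -> A a -> trans A D s -> trans A D [seq a * r | r <- s].
Proof.
move=> sA Aa [us As Ds Es]; have aU := sgU sA Aa.
have E r r' : r \in s -> (a * r)^-1 * (a * r') = r^-1 * r'.
  by move=> /As /(sgU sA) rU; rewrite invrM // -mulrA mulKr.
split.
- by rewrite map_inj_uniq //; apply: mulrI.
- by move=> _ /mapP[r rs ->]; apply: sgM => //; apply: As.
- by move=> _ _ /mapP[r rs ->] /mapP[r' rs' ->]; rewrite E // => /Ds ->.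
- move=> b Ab; have [|r rs Dr] := Es (a^-1 * b); first by apply/sgVM.
  exists (a * r); first exact: map_f.
  have rU := sgU sA (As r rs).
  by rewrite invrM // -mulrA.
Qed.

(** The second isomorphism theorem: when A is contained in BD, the map from B/(B cap D) to the
    cosets of D in A is a bijection. *)
Lemma trans_sub A B D s : subgroup A -> subgroup B -> B `<=` A ->
  A `<=` setprod B D -> subgroup D -> trans B (B `&` D) s -> trans A D s.
Proof.
move=> sA sB BA AB sD [us Bs Ds Es]; split=> // [r /Bs/BA//|r r' h h' Dd|a /AB[b Bb [x Dx <-]]].
  by apply: Ds => //; split=> //; apply: sgM => //; [apply: sgV => //|]; apply: Bs.
have [r rs [_ Dr]] := Es b Bb; exists r => //.
by rewrite mulrA; apply: sgM.
Qed.

Lemma trans_conj g A D s : g \is a GRing.unit -> subgroup A -> trans A D s ->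
  trans (setconj g A) (setconj g D) (map (conj g) s).
Proof.
move=> gU sA [us As Ds Es].
have E r r' : r \in s -> (conj g r)^-1 * conj g r' = conj g (r^-1 * r').
  by move=> rs; rewrite conjM // conjV // (sgU sA) //; apply: As.
split.
- by rewrite map_inj_uniq //; apply: can_inj (conjK gU).
- by move=> _ /mapP[r rs ->]; exists r => //; apply: As.
- by move=> _ _ /mapP[r rs ->] /mapP[r' rs' ->]; rewrite E // setconj_conj // => /Ds ->.
- move=> _ [a Aa <-]; have [r rs Dr] := Es a Aa.
  by exists (conj g r); rewrite ?map_f // E // setconj_conj.
Qed.

Lemma trans_refl A : subgroup A -> trans A A [:: 1].
Proof.
move=> sA; split=> // [r|r r'|a Aa].
- by rewrite inE => /eqP ->; apply: sg1.
- by rewrite !inE => /eqP -> /eqP ->.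
- by exists 1; rewrite ?inE // invr1 mul1r.
Qed.

End GroupSets.

(** * Compact open subgroups over a local field *)

Section PadicTopology.
Context (F : nonarchLocalFieldType).

(** The fractional ideal of level [N]; 0 is listed separately because [nval 0] is arbitrary. *)
Definition vge (N : int) (x : F) := x = 0 \/ N <= nval x.

Lemma vge_le N M x : M <= N -> vge N x -> vge M x.
Proof. by move=> MN [->|Nx]; [left|right; apply: le_trans Nx]. Qed.
Lemma vgeD N x y : vge N x -> vge N y -> vge N (x + y).
Proof.
move=> [->|Nx]; first by rewrite add0r.
have [->|x0] := eqVneq x 0; first by rewrite add0r.
have [->|y0] := eqVneq y 0; first by rewrite addr0; right.
move=> [/eqP|Ny]; first by rewrite (negPf y0).
have [->|xy0] := eqVneq (x + y) 0; first by left.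
right; apply: le_trans (nvalD _ _ x0 y0 xy0).
by rewrite le_min Nx.
Qed.
Lemma vgeM N M x y : vge N x -> vge M y -> vge (N + M) (x * y).
Proof.
move=> [->|Nx]; first by rewrite mul0r; left.
move=> [->|My]; first by rewrite mulr0; left.
have [->|x0] := eqVneq x 0; first by rewrite mul0r; left.
have [->|y0] := eqVneq y 0; first by rewrite mulr0; left.
by right; rewrite nvalM // lerD.
Qed.
Lemma vge_sum N (I : Type) (r : seq I) (f : I -> F) :
  (forall i, vge N (f i)) -> vge N (\sum_(i <- r) f i).
Proof. by move=> fN; elim/big_ind: _ => //; [left|apply: vgeD]. Qed.

Lemma nval1 : nval (1 : F) = 0.
Proof.
apply: (@addrI _ (nval (1 : F))).
by rewrite -nvalM ?oner_eq0 // mulr1 addr0.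
Qed.
Lemma vge_nat n : vge 0 (n%:R : F).
Proof.
elim: n => [|n IHn]; first by left.
by rewrite -addn1 natrD; apply: vgeD => //; right; rewrite nval1.
Qed.
Lemma vge_pX (p k : nat) : residue_char F p -> vge k (p%:R ^+ k : F).
Proof.
move=> [_ pv]; elim: k => [|k IHk]; first by right; rewrite expr0 nval1.
rewrite exprS (_ : k.+1%:Z = 1 + k%:Z); last by rewrite -intS.
have p1 : vge 1 (p%:R : F) by case: pv => ?; [left|right].
exact: vgeM.
Qed.
Lemma vge_dvd (p k n : nat) : residue_char F p -> (p ^ k %| n)%N -> vge k (n%:R : F).
Proof.
move=> rp /dvdnP[m ->]; rewrite natrM natrX -[k%:Z]add0r.
by apply: vgeM; [apply: vge_nat|apply: vge_pX].
Qed.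

Lemma int_lower_bound (I : finType) (f : I -> int) : exists K : int, forall i, K <= f i.
Proof.
exists (- \sum_i `|f i|) => i; rewrite (bigD1 i) //=.
have : 0 <= \sum_(j | j != i) `|f j| by apply: sumr_ge0.
by move: (\sum_(j | _) _) => S; lia.
Qed.
Lemma vge_lower_bound (I : finType) (f : I -> F) : exists K : int, forall i, vge K (f i).
Proof.
have [K Kf] := int_lower_bound (fun i => nval (f i)).
by exists K => i; right.
Qed.

Context (d : nat).
Local Notation MF := 'M[F]_d.+1.
Implicit Types (g h : MF) (A B D W : set MF).

Definition mvge (N : int) g := forall i j, vge N (g i j).

Lemma mvgeM N M g h : mvge N g -> mvge M h -> mvge (N + M) (g * h).
Proof. by move=> gN hM i j; rewrite !mxE; apply: vge_sum => k; apply: vgeM. Qed.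

Lemma mvge_lower_bound g : exists K : int, mvge K g.
Proof.
have [K Kf] := vge_lower_bound (fun ij : 'I_d.+1 * 'I_d.+1 => g ij.1 ij.2).
by exists K => i j; apply: (Kf (i, j)).
Qed.

(** Neighbourhoods in the product topology are given entry by entry; as there are finitely many
    entries, one bound [N] serves them all. *)
Lemma mx_nbhsP g A : nbhs g A <-> exists N : int, forall h, mvge N (h - g) -> A h.
Proof.
split=> [[P gP PA]|[N NA]].
  have /choice[f fP] : forall ij : 'I_d.+1 * 'I_d.+1, exists N : int,
      forall y, y = g ij.1 ij.2 \/ N <= nval (y - g ij.1 ij.2) -> P ij.1 ij.2 y.
    by move=> [i j]; have /nval_nbhs := gP i j.
  have [K Kf] := int_lower_bound (fun ij => - f ij).
  exists (- K) => h hg; apply: PA => i j; apply: (fP (i, j)) => /=.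
  move: (hg i j); rewrite !mxE => -[/eqP|hv].
    by rewrite subr_eq0 => /eqP; left.
  by right; apply: le_trans hv; rewrite lerNr; apply: (Kf (i, j)).
exists (fun i j => [set y | vge N (y - g i j)]) => [i j|h hP].
  apply/nval_nbhs; exists N => y /= [->|]; first by left; rewrite subrr.
  by right.
by apply: NA => i j; rewrite !mxE; apply: hP.
Qed.

Lemma nbhs_mull a g A : nbhs (a * g) A -> nbhs g [set h | A (a * h)].
Proof.
move=> /mx_nbhsP[N NA]; apply/mx_nbhsP; have [K aK] := mvge_lower_bound a.
exists (N - K) => h hg; apply: NA.
by rewrite -mulrBr (_ : N = K + (N - K)); [apply: mvgeM|rewrite addrC subrK].
Qed.

Lemma open_in_nbhs GF D : open_in GF D -> D 1 -> exists2 W, nbhs (1 : MF) W &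
  forall g, W g -> GF g -> D g.
Proof.
move=> [W oW ->] [W1 _]; exists W; first exact: open_nbhs_nbhs.
by move=> g Og Gg; split.
Qed.

(** A compact group has finitely many cosets modulo an open subgroup. The first half prunes a finite
    covering list to a transversal, the second finds a covering list by compactness. *)
Lemma fin_trans GF A D : subgroup A -> subgroup D -> compact A -> A `<=` GF -> D `<=` A ->
  open_in GF D -> exists s, trans A D s.
Proof.
move=> sA sD cA AG DA oD.
suff [s [As Es]] : exists s : seq MF, (forall r, r \in s -> A r) /\
    forall a, A a -> exists2 r, r \in s & D (r^-1 * a).
  pose P t := [/\ uniq t, forall r, r \in t -> A r &
    forall r r', r \in t -> r' \in t -> D (r^-1 * r') -> r = r'].
  (* [t] holds the representatives kept so far and [u] the candidates still to be examined. *)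
  suff ext n (t u : seq MF) : (size u <= n)%N -> P t -> (forall r, r \in u -> A r) ->
     (forall a, A a -> exists2 r, r \in t ++ u & D (r^-1 * a)) -> exists s, trans A D s.
    by apply: (ext _ [::] s (leqnn _)).
  elim: n t u => [|n IHn] t [|x u] //= un [ut At Dt] Au Eu.
    1,2: by exists t; split=> // a /Eu; rewrite cats0.
  have Ax : A x by apply: Au; rewrite inE eqxx.
  have [[r rt Dr]|nr] := pselect (exists2 r, r \in t & D (r^-1 * x)).
    apply: (IHn t u) => // [r' r'u|a /Eu[r']]; first by apply: Au; rewrite inE r'u orbT.
    rewrite mem_cat inE orbCA => /orP[/eqP ->|r'u] Dr'; last by exists r' => //; rewrite mem_cat.
    exists r; first by rewrite mem_cat rt.
    by have := sgM sD Dr Dr'; rewrite mulrA mulrK // (sgU sA).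
  apply: (IHn (x :: t) u) => // [|r' r'u|a /Eu[r' r'u Dr']].
  - split=> /=.
    + rewrite ut andbT; apply: contra_notN nr => xt; exists x => //.
      by rewrite mulVr ?(sgU sA) //; apply: sg1.
    + by move=> r; rewrite inE => /orP[/eqP ->//|]; apply: At.
    + move=> r r'; rewrite !inE => /orP[/eqP ->|rt] /orP[/eqP ->|r't] // Dd.
      * case: nr; exists r' => //; have := sgV sD Dd.
        by rewrite invrM ?invrK ?unitrV ?(sgU sA) //; apply: At.
      * by case: nr; exists r.
      * exact: Dt.
  - by apply: Au; rewrite inE r'u orbT.
  - by exists r' => //; move: r'u; rewrite !mem_cat !inE orbCA orbA.
have [W nO OD] := open_in_nbhs oD (sg1 sD).
apply: contrapT => nfin.
(* If no finite list covers [A], the complements of finite unions of cosets generate a proper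
   filter. At a cluster point [p] this is absurd: the coset of [p] is a neighbourhood of [p]
   disjoint from a member of the filter. *)
pose cov (s : seq MF) := [set a | A a /\ forall r, r \in s -> ~ D (r^-1 * a)].
pose FF : set_system MF := [set S | exists2 s : seq MF, (forall r, r \in s -> A r) & cov s `<=` S].
have FFF : ProperFilter FF.
  split; last split.
  - move=> [s As cs]; apply: nfin; exists s; split=> // a Aa; apply: contrapT => nr.
    by apply: (cs a); split=> // r rs Dr; apply: nr; exists r.
  - by exists [::].
  - move=> P Q [s As sP] [t At tQ]; exists (s ++ t).
      by move=> r; rewrite mem_cat => /orP[/As|/At].
    move=> a [Aa na]; split; [apply: sP|apply: tQ]; split=> // r h; apply: na;
      by rewrite mem_cat h ?orbT.
  - by move=> P Q PQ [s As sP]; exists s => // a /sP /PQ.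
have [|p [Ap clp]] := cA FF FFF; first by exists [::] => // a [].
have pU := sgU sA Ap.
have Fp : FF (cov [:: p]) by exists [:: p] => // r; rewrite inE => /eqP ->.
have nO' : nbhs p [set h | W (p^-1 * h)] by apply: nbhs_mull; rewrite mulVr.
have [a [[Aa na] Oa]] := clp _ _ Fp nO'.
apply: (na p); rewrite ?inE //; apply: OD => //; apply: AG.
by apply: sgM => //; apply: sgV.
Qed.

(** The product of i and 'C(p^k, i) is divisible by p^k, and the p-adic valuation of i is less than
    i, hence less than d. *)
Lemma dvdn_bin_pX p k i : prime p -> (0 < i <= d)%N -> (p ^ (k - d) %| 'C(p ^ k, i))%N.
Proof.
move=> pp /andP[i0 id]; have [C0|Cgt] := posnP 'C(p ^ k, i); first by rewrite C0 dvdn0.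
rewrite pfactor_dvdn // leq_subLR.
have : (p ^ k %| i * 'C(p ^ k, i))%N.
  by case: i i0 {id Cgt} => // i _; rewrite -mul_bin_diag dvdn_mulr.
rewrite pfactor_dvdn ?muln_gt0 ?i0 // lognM // => /leq_trans; apply.
by rewrite leq_add2r (leq_trans (ltnW (ltn_logl _ i0))).
Qed.

(** With g = 1 + n and n^(d+1) = 0, only the first d binomial terms of g^(p^k) - 1 survive. Their
    coefficients are divisible by p^(k-d), while the entries of the powers of n are bounded. The
    argument covers both characteristics of [F]. *)
Lemma unipotent_cvg p g (N : int) : residue_char F p -> (g - 1) ^+ d.+1 = 0 ->
  exists k : nat, mvge N (g ^+ (p ^ k) - 1).
Proof.
move=> rp; set n := g - 1 => n0; have gE : g = n + 1 by rewrite /n subrK.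
have [K KP] : exists K : int, forall i : 'I_d.+1, mvge K (n ^+ i).
  have [K Kf] := vge_lower_bound (fun x : 'I_d.+1 * ('I_d.+1 * 'I_d.+1) =>
     (n ^+ x.1) x.2.1 x.2.2).
  by exists K => i a b; apply: (Kf (i, (a, b))).
have [k kP] : exists k : nat, N <= (k%:Z - d%:Z) + K by exists (absz (N - K + d%:Z)); lia.
exists k => a b; have -> : g ^+ (p ^ k) - 1 =
    \sum_(i < p ^ k) n ^+ i.+1 *+ 'C(p ^ k, i.+1).
  by rewrite gE exprD1n big_ord_recl expr0 bin0 mulr1n addrC addKr.
rewrite summxE; apply: vge_sum => i; rewrite mulmxnE.
have [id|id] := leqP i.+1 d; last first.
  by rewrite (_ : n ^+ i.+1 = 0) ?mxE ?mul0rn; [left|rewrite -(subnK id) exprD n0 mulr0].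
rewrite -mulr_natl; apply: (@vge_le ((k - d)%N%:Z + K)).
  by apply: le_trans kP _; rewrite lerD2r; lia.
apply: vgeM; first by apply: (vge_dvd rp); apply: dvdn_bin_pX; [case: rp|rewrite id].
have id' : (i.+1 < d.+1)%N by [].
exact: (KP (Ordinal id') a b).
Qed.

Lemma unipotent_pX GF p g D : residue_char F p -> (g - 1) ^+ d.+1 = 0 ->
  open_in GF D -> D 1 -> (forall k, GF (g ^+ k)) -> exists k, D (g ^+ (p ^ k)).
Proof.
move=> rp gn oD D1 gG; have [W /mx_nbhsP[N NO] OD] := open_in_nbhs oD D1.
have [k kP] := unipotent_cvg N rp gn.
by exists k; apply: OD => //; apply: NO.
Qed.

End PadicTopology.

(** * Indices that are powers of p *)

Section PrimePowerIndex.
Context (T : unitRingType) (p : nat) (H L : set T) (s : seq T).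
Hypotheses (pp : prime p) (sH : subgroup H) (sL : subgroup L) (LH : L `<=` H).
Hypothesis tr : trans H L s.
Hypothesis Hp : forall g, H g -> exists k, L (g ^+ (p ^ k)).
Local Notation n := (size s).
Local Notation c i := (nth 1 s i).

Let Hc (i : 'I_n) : H (c i).
Proof. by case: tr => _ + _ _; apply; rewrite mem_nth. Qed.
Let cU (i : 'I_n) : c i \is a GRing.unit.
Proof. exact: sgU sH (Hc i). Qed.

Definition acts_as g (sg : {perm 'I_n}) := forall i : 'I_n, L ((c (sg i))^-1 * (g * c i)).

Lemma coset_num_inj (i j : 'I_n) : L ((c i)^-1 * c j) -> i = j.
Proof.
move=> Lij; case: tr => us _ Ds _.
have E : c i = c j by apply: Ds => //; apply: mem_nth.
by apply/val_inj/eqP; rewrite -(nth_uniq 1 (ltn_ord i) (ltn_ord j) us) E.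
Qed.

Lemma acts_as_ex g : H g -> exists sg, acts_as g sg.
Proof.
move=> Hg; have gU := sgU sH Hg.
have /choice[f fP] : forall i : 'I_n, exists j : 'I_n, L ((c j)^-1 * (g * c i)).
  move=> i; case: tr => _ _ _ /(_ (g * c i))[|r rs Dr]; first exact: sgM.
  have rn : (index r s < n)%N by rewrite index_mem.
  by exists (Ordinal rn); rewrite /= nth_index.
have finj : injective f.
  move=> i j fij; apply: coset_num_inj; have := fP j; rewrite -fij => fj.
  have := sgM sL (sgV sL (fP i)) fj.
  by rewrite !invrM ?unitrV ?unitrMl // invrK -!mulrA mulVKr // mulKr.
by exists (perm finj) => i; rewrite permE.
Qed.

(** Permutations compose from left to right, which reverses the order of the product. *)
Lemma acts_asM g h sg sh : H g -> H h -> acts_as g sg -> acts_as h sh ->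
  acts_as (h * g) (sg * sh)%g.
Proof.
move=> Hg Hh ag ah i; rewrite permM; have := sgM sL (ah (sg i)) (ag i).
by rewrite -!mulrA mulVKr ?cU // !mulrA.
Qed.

Lemma acts_asX g sg k : H g -> acts_as g sg -> acts_as (g ^+ k) (sg ^+ k)%g /\ H (g ^+ k).
Proof.
move=> Hg ag; elim: k => [|k [IHk Hk]].
  split; last exact: sg1.
  by move=> i; rewrite expg0 perm1 expr0 mul1r mulVr ?cU //; apply: sg1.
by rewrite expgSr exprS; split; [apply: acts_asM|apply: sgM].
Qed.

(** The permutations of H/L induced by H form a finite group that is transitive on [n] points, so
    [n] divides its order. By Cauchy's theorem it is a p-group as soon as no element has a prime
    order other than p. *)
Lemma pnat_trans_size : p.-nat n.
Proof.
have n0 : (0 < n)%N.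
  by case: tr => _ _ _ /(_ 1 (sg1 sH))[r]; case: (s).
pose G0 := [set sg : {perm 'I_n} | `[< exists2 g, H g & acts_as g sg >]]%SET.
have G0g : group_set G0.
  apply/group_setP; split=> [|sg sh].
    rewrite !inE; exists 1; first exact: sg1.
    by move=> i; rewrite perm1 mul1r mulVr ?cU //; apply: sg1.
  rewrite !inE => -[g Hg ag] [h Hh ah].
  by exists (h * g); [exact: sgM|exact: acts_asM].
pose G := Group G0g.
have pG : (p.-group G)%g.
  apply/pgroupP => q qp /(Cauchy qp)[sg]; rewrite !inE => -[g Hg ag] osg.
  (* [L] need not be normal, so a power of [g] fixes the coset of [c i] only if the conjugate of
     that power by the inverse of [c i] is in [L]. [Hp] is applied to each such conjugate, and [K]
     is the largest exponent. *)
  have /choice[k kP] : forall i : 'I_n, exists k, L (((c i)^-1 * g * c i) ^+ (p ^ k)).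
    by move=> i; apply: Hp; apply: sgM => //; apply: sgM => //; apply: sgV.
  pose K := (\max_i k i)%N.
  have cX (i : 'I_n) m : ((c i)^-1 * g * c i) ^+ m = (c i)^-1 * (g ^+ m * c i).
    elim: m => [|m IHm]; first by rewrite !expr0 mul1r mulVr.
    by rewrite exprSr IHm exprSr !mulrA mulrK.
  have sgK : (sg ^+ (p ^ K) = 1)%g.
    apply/permP => i; rewrite perm1; have [aX _] := acts_asX (p ^ K) Hg ag.
    apply: coset_num_inj.
    have Li : L ((c i)^-1 * (g ^+ (p ^ K) * c i)).
      rewrite -cX (_ : p ^ K = p ^ k i * p ^ (K - k i))%N; last first.
        by rewrite -expnD subnKC // leq_bigmax.
      rewrite exprM; elim: (p ^ (K - k i))%N => [|m IHm]; first by rewrite expr0; apply: sg1.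
      by rewrite exprS; apply: sgM.
    have := sgM sL (aX i) (sgV sL Li); have gU : g ^+ (p ^ K) \is a GRing.unit.
      by apply: unitrX; apply: sgU sH Hg.
    by rewrite !invrM ?unitrV ?unitrMl // invrK -!mulrA mulVKr // mulVKr.
  have : (#[sg]%g %| p ^ K)%N by rewrite order_dvdn sgK.
  by rewrite osg Euclid_dvdX // => /andP[]; rewrite dvdn_prime2 // => /eqP ->; rewrite inE.
pose i0 : 'I_n := Ordinal n0.
have orb : orbit 'P%act G i0 = [set: 'I_n]%SET.
  apply/setP => j; rewrite !inE; apply/orbitP.
  have Hg : H (c j * (c i0)^-1) by apply: sgM => //; apply: sgV.
  have [sg ag] := acts_as_ex Hg; exists sg; first by rewrite !inE; exists (c j * (c i0)^-1).
  rewrite /= apermE; apply: coset_num_inj; have := ag i0.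
  by rewrite mulrVK ?cU.
have := dvdn_orbit 'P%act G i0; rewrite orb cardsT card_ord => /pnat_dvd; apply.
exact: pG.
Qed.

End PrimePowerIndex.

(** * Parabolic subgroups and their radicals *)

Section AlgGroups.
Context (F : fieldType) (Fb : closedFieldType) (iota : {rmorphism F -> Fb}).
Context (d : nat).
Local Notation MF := 'M[F]_d.+1.
Local Notation MB := 'M[Fb]_d.+1.
Local Notation im := (map_mx iota : MF -> MB).
Implicit Types (H J P M U Z A : set MB) (g h x : MB) (S : set Fb).

Lemma im_unit (n : MF) : (im n \is a GRing.unit) = (n \is a GRing.unit).
Proof. exact: map_unitmx. Qed.
Lemma imM (m n : MF) : im (m * n) = im m * im n.
Proof. exact: map_mxM. Qed.
Lemma im1 : im 1 = 1. Proof. exact: map_mx1. Qed.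
Lemma imV (n : MF) : im n^-1 = (im n)^-1. Proof. exact: map_invmx. Qed.
Lemma im_inj : injective im. Proof. exact: map_mx_inj. Qed.
Lemma im_conj (m n : MF) : im (conj m n) = conj (im m) (im n).
Proof. by rewrite /conj !imM imV. Qed.

Lemma polyfun_sum S (I : Type) (r : seq I) (f : I -> MB -> Fb) : S 0 ->
  (forall i, polyfun S (f i)) -> polyfun S (fun g => \sum_(i <- r) f i g).
Proof.
move=> S0 fS; elim: r => [|i r IHr].
  by under eq_fun do rewrite big_nil; apply: polyfun_const.
by under eq_fun do rewrite big_cons; apply: polyfun_add.
Qed.

Lemma polyfun_prod S (I : Type) (r : seq I) (f : I -> MB -> Fb) : S 1 ->
  (forall i, polyfun S (f i)) -> polyfun S (fun g => \prod_(i <- r) f i g).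
Proof.
move=> S1 fS; elim: r => [|i r IHr].
  by under eq_fun do rewrite big_nil; apply: polyfun_const.
by under eq_fun do rewrite big_cons; apply: polyfun_mul.
Qed.

Lemma polyfun_comp S (phi : MB -> MB) f :
  (forall i j, polyfun S (fun g => phi g i j)) -> polyfun S f -> polyfun S (f \o phi).
Proof.
move=> phiS; elim=> [c Sc|i j|f1 f2 _ h1 _ h2|f1 f2 _ h1 _ h2].
- exact: polyfun_const.
- exact: phiS.
- exact: polyfun_add.
- exact: polyfun_mul.
Qed.

Lemma polyfun_mulmx S (a b : MB) i j : S 0 ->
  (forall k l, S (a k l)) -> (forall k l, S (b k l)) ->
  polyfun S (fun g => (a * g * b) i j).
Proof.
move=> S0 aS bS.
rewrite (_ : (fun g => _) = fun g => \sum_k (\sum_l a i l * g l k) * b k j); last first.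
  by apply/funext => g; rewrite !mxE; apply: eq_bigr => k _; rewrite !mxE.
apply: polyfun_sum => // k; apply: polyfun_mul; last exact: polyfun_const.
apply: polyfun_sum => // l; apply: polyfun_mul; last exact: polyfun_coord.
exact: polyfun_const.
Qed.

Lemma polyfun_conj S h f : S 0 -> (forall k l, S (h k l)) -> (forall k l, S (h^-1 k l)) ->
  polyfun S f -> polyfun S (fun g => f (conj h g)).
Proof. by move=> S0 hS h'S; apply: polyfun_comp => i j; apply: polyfun_mulmx. Qed.

Lemma polyfun_conjT h f : polyfun setT f -> polyfun setT (fun g => f (conj h g)).
Proof. exact: polyfun_conj. Qed.

Lemma polyfun_conjF (n : MF) f : polyfun (range iota) f ->
  polyfun (range iota) (fun g => f (conj (im n) g)).
Proof.
apply: polyfun_conj => [|k l|k l]; first by exists 0; rewrite ?rmorph0.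
  by exists (n k l); rewrite ?mxE.
by exists (n^-1 k l) => //; rewrite -imV mxE.
Qed.

Lemma zclosed_conj h Z : h \is a GRing.unit -> zclosed Z -> zclosed (setconj h Z).
Proof.
move=> hU [I [Ip ->]]; exists [set (fun g => f (conj h^-1 g)) | f in I]; split.
  by move=> _ [f If <-]; apply: polyfun_conjT; apply: Ip.
apply/seteqP; split=> g.
  move=> /(setconjE _ _ hU)[gU Ig]; split; first by rewrite conj_unit ?unitrV in gU.
  by move=> _ [f If <-]; apply: Ig.
move=> [gU Ig]; apply/(setconjE _ _ hU); split; first by rewrite /= conj_unit ?unitrV.
by move=> f If; apply: (Ig (fun g => f (conj h^-1 g))); exists f.
Qed.

Lemma subset_conj h A B : h \is a GRing.unit -> setconj h A `<=` B -> A `<=` setconj h^-1 B.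
Proof.
move=> hU AB x Ax; apply/setconjE; rewrite ?unitrV // invrK.
by apply: AB; exists x.
Qed.

Lemma zconnected_conj h Z : h \is a GRing.unit -> zconnected Z -> zconnected (setconj h Z).
Proof.
move=> hU Zc Z1 Z2 c1 c2 Z12 Z0; have hV : h^-1 \is a GRing.unit by rewrite unitrV.
have []:= Zc _ _ (zclosed_conj hV c1) (zclosed_conj hV c2).
- move=> x Zx; have [] := Z12 (conj h x); first by exists x.
    by move=> ?; left; apply/setconjE => //; rewrite invrK.
  by move=> ?; right; apply/setconjE => //; rewrite invrK.
- apply/seteqP; split=> // x [[Zx /(setconjE _ _ hV) x1] /(setconjE _ _ hV) x2].
  rewrite invrK in x1 x2; suff : set0 (conj h x) by [].
  by rewrite -Z0; split=> //; split=> //; exists x.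
- move=> s1; left => _ [x Zx <-]; have := s1 x Zx.
  by rewrite setconjE // invrK.
- move=> s1; right => _ [x Zx <-]; have := s1 x Zx.
  by rewrite setconjE // invrK.
Qed.

Lemma alg_group_conj h Z : h \is a GRing.unit -> alg_group Z -> alg_group (setconj h Z).
Proof. by move=> hU [cZ sZ]; split; [apply: zclosed_conj|apply: subgroup_setconj]. Qed.

Lemma defined_over_conj (n : MF) Z : n \is a GRing.unit ->
  defined_over iota Z -> defined_over iota (setconj (im n) Z).
Proof.
move=> nU dZ f fp fv; have hU : im n \is a GRing.unit by rewrite im_unit.
have [|g Zg|m [c [h [hP hE]]]] := dZ (fun g => f (conj (im n) g)).
- exact: polyfun_conjT.
- by apply: fv; exists g.
exists m, c, (fun i g => h i (conj (im n^-1) g)); split=> [i|g].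
  split; first by apply: polyfun_conjF; case: (hP i).
  by move=> _ [x Zx <-]; rewrite imV conjK //; case: (hP i) => _; apply.
by rewrite -hE imV conjVK.
Qed.

Lemma F_group_conj (n : MF) Z : n \is a GRing.unit -> F_group iota Z ->
  F_group iota (setconj (im n) Z).
Proof.
by move=> nU [aZ dZ]; split; [apply: alg_group_conj; rewrite ?im_unit|apply: defined_over_conj].
Qed.

Lemma unipotent_conj h U : h \is a GRing.unit -> unipotent U -> unipotent (setconj h U).
Proof.
move=> hU uU _ [x Ux <-]; have -> : conj h x - 1 = conj h (x - 1).
  by rewrite /conj mulrBr mulrBl mulr1 divrr.
have cX k (y : MB) : conj h y ^+ k = conj h (y ^+ k).
  by elim: k => [|k IHk]; rewrite ?expr0 ?conj1 // !exprS IHk conjM.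
by rewrite cX uU // /conj mulr0 mul0r.
Qed.

Lemma setconj_mono h A B : A `<=` B -> setconj h A `<=` setconj h B.
Proof. by move=> AB _ [x Ax <-]; exists x => //; apply: AB. Qed.

Lemma normal_in_conj h U H : h \is a GRing.unit -> subgroup H ->
  normal_in U H -> normal_in (setconj h U) (setconj h H).
Proof.
move=> hU sH [UH nU]; split; first exact: setconj_mono.
move=> _ [x Hx <-]; have xU := sgU sH Hx.
apply/seteqP; split=> [_ [_ [u Uu <-] <-]|_ [u Uu <-]].
  rewrite conj_conj //; exists (conj x u) => //.
  by rewrite -(nU _ Hx); exists u.
have := Uu; rewrite -{1}(nU _ Hx) => -[v Uv <-].
by exists (conj h v); [exists v|rewrite conj_conj].
Qed.

Lemma solvable_conj h H : h \is a GRing.unit -> solvable H -> solvable (setconj h H).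
Proof.
move=> hU [n [D [D0 Dn Ds]]]; exists n, (fun i => setconj h (D i)); split.
- by rewrite D0.
- rewrite Dn; apply/seteqP; split=> [_ [_ -> <-]|_ ->] /=; first by rewrite conj1.
  by exists 1 => //; rewrite conj1.
- move=> i /Ds[sD DD cD]; split; [exact: subgroup_setconj|exact: setconj_mono|].
  move=> _ _ [x Dx <-] [y Dy <-]; exists (x * y * x^-1 * y^-1); first exact: cD.
  by rewrite !conjM // !conjV // (sgU sD).
Qed.

Lemma setconj_fix (n : MB) H x : subgroup H -> H n -> (H (conj n x) <-> H x).
Proof.
move=> sH Hn; split=> Hx; last first.
  by apply: sgM => //; [apply: sgM|apply: sgV].
have nU := sgU sH Hn; rewrite -(conjK nU x).
by apply: sgM => //; [apply: sgM => //; apply: sgV|apply: sgV => //; apply: sgV].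
Qed.

Lemma setconj_self (n : MB) H : subgroup H -> H n -> setconj n H = H.
Proof.
move=> sH Hn; have nU := sgU sH Hn.
apply/seteqP; split=> [_ [x Hx <-]|x Hx]; first exact/setconj_fix.
by apply/setconjE => //; apply/setconj_fix => //; apply: sgV.
Qed.

Lemma borel_conj h H B : subgroup H -> H h -> borel H B -> borel H (setconj h B).
Proof.
move=> sH Hh [[aB cB sB BH] Bm]; have hU := sgU sH Hh.
have cl h' B' : H h' -> [/\ alg_group B', zconnected B', solvable B' & B' `<=` H] ->
    [/\ alg_group (setconj h' B'), zconnected (setconj h' B'),
      solvable (setconj h' B') & setconj h' B' `<=` H].
  move=> Hh' [? ? ? BH']; have hU' := sgU sH Hh'; split.
  - exact: alg_group_conj.
  - exact: zconnected_conj.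
  - exact: solvable_conj.
  - by rewrite -(setconj_self sH Hh'); apply: setconj_mono.
split; first exact: cl.
move=> B' XB' /(subset_conj hU) BB'.
by rewrite -(Bm (setconj h^-1 B')) ?setconjVK //; apply: cl => //; apply: sgV.
Qed.

Lemma parabolic_levi_conj (n : MF) (G P M U : set MB) : subgroup G -> G (im n) ->
  setconj (im n) M = M -> parabolic_levi iota G P M U ->
  parabolic_levi iota G (setconj (im n) P) M (setconj (im n) U).
Proof.
move=> sG Gn nM [[FP PG [B bB BP]] [[aU cU uU nU] Um] [FM MP] MU PE].
have hU := sgU sG Gn; have nU' : n \is a GRing.unit by rewrite -im_unit.
have sP : subgroup P by case: FP => -[].
split.
- split; first exact: F_group_conj.
    by rewrite -(setconj_self sG Gn); apply: setconj_mono.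
  by exists (setconj (im n) B); [apply: borel_conj|apply: setconj_mono].
- split.
    split; [exact: alg_group_conj|exact: zconnected_conj|exact: unipotent_conj|].
    exact: normal_in_conj.
  move=> V [aV cV uV nV]; have hV : (im n)^-1 \is a GRing.unit by rewrite unitrV.
  rewrite -(setconjVK V hU); apply: setconj_mono; apply: Um.
  split; [exact: alg_group_conj|exact: zconnected_conj|exact: unipotent_conj|].
  rewrite -(setconjK P hU); apply: normal_in_conj => //; exact: subgroup_setconj.
- by split=> //; rewrite -nM; apply: setconj_mono.
- rewrite -{1}nM -setconjI // MU; apply/seteqP; split=> [_ [_ -> <-]|_ ->] /=.
    by rewrite conj1.
  by exists 1 => //; rewrite conj1.
- by rewrite PE setconj_prod // nM.
Qed.

Lemma radical_pair_conj (n : MF) (G M U Ub : set MB) : subgroup G -> G (im n) ->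
  setconj (im n) M = M -> radical_pair iota G M U Ub ->
  radical_pair iota G M (setconj (im n) U) (setconj (im n) Ub).
Proof.
move=> sG Gn nM [P [Pb [hP hPb PPb]]].
exists (setconj (im n) P), (setconj (im n) Pb); split; try exact: parabolic_levi_conj.
by rewrite -setconjI ?PPb // (sgU sG).
Qed.

Section RadicalPair.
Context (G M U Ub : set MB).
Hypothesis rp : radical_pair iota G M U Ub.

Lemma radical_pair_sym : radical_pair iota G M Ub U.
Proof. by case: rp => P [Pb [hP hPb E]]; exists Pb, P; rewrite setIC. Qed.
Lemma rp_sgU : subgroup U. Proof. by case: rp => P [Pb [[_ [[[_ +] _ _ _] _] _ _ _] _ _]]. Qed.
Lemma rp_sgM : subgroup M. Proof. by case: rp => P [Pb [[_ _ [[[_ +] _] _] _ _] _ _]]. Qed.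
Lemma rp_UG : U `<=` G.
Proof. by case: rp => P [Pb [[[_ PG _] [[_ _ _ [UP _]] _] _ _ _] _ _]] x /UP /PG. Qed.
Lemma rp_unip : unipotent U.
Proof. by case: rp => P [Pb [[_ [[_ _ + _] _] _ _ _] _ _]]. Qed.
Lemma rp_MU x : M x -> U x -> x = 1.
Proof.
case: rp => P [Pb [[_ _ _ MU _] _ _]] Mx Ux.
by have : [set 1 : MB] x by rewrite -MU.
Qed.
Lemma rp_norm m u : M m -> U u -> U (conj m u).
Proof.
case: rp => P [Pb [[_ [[_ _ _ [_ nU]] _] [_ MP] _ _] _ _]] /MP Pm Uu.
by rewrite -(nU _ Pm); exists u.
Qed.
End RadicalPair.

(** The element b b'^-1 of Ub equals (u m)^-1 (u' m'), which lies in P, and P cap Pb = M meets Ub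
    trivially. The same argument with U and M then separates u from m. *)
Lemma rp_uniq G M U Ub u m b u' m' b' : radical_pair iota G M U Ub ->
  U u -> M m -> Ub b -> U u' -> M m' -> Ub b' -> u * m * b = u' * m' * b' ->
  [/\ u = u', m = m' & b = b'].
Proof.
move=> rp Uu Mm Bb Uu' Mm' Bb' E; have rp' := radical_pair_sym rp.
have [sU sM sB] := And3 (rp_sgU rp) (rp_sgM rp) (rp_sgU rp').
have [uU mU bU] := And3 (sgU sU Uu) (sgU sM Mm) (sgU sB Bb).
have [u'U m'U b'U] := And3 (sgU sU Uu') (sgU sM Mm') (sgU sB Bb').
have bE : b * b'^-1 = (u * m)^-1 * (u' * m').
  have {1}-> : b = (u * m)^-1 * (u' * m') * b' by rewrite -mulrA -E mulKr // unitrMl.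
  by rewrite mulrK.
have bb : b = b'.
  suff : b * b'^-1 = 1 by move/(canRL (mulrVK b'U)); rewrite mul1r.
  apply: (rp_MU rp'); last by apply: sgM => //; apply: sgV.
  case: (rp) => P [Pb [[[FP _ _] _ [_ MP] _ PE] [[_ _ _] [[_ _ _ [UPb _]] _] [_ MPb] _ PbE] <-]].
  have sP : subgroup P by case: FP => -[].
  have PUM x y : U x -> M y -> P (x * y).
    move=> Ux My; rewrite PE; exists y => //; exists (conj y^-1 x).
      by apply: (rp_norm rp) => //; apply: sgV.
    by rewrite /conj invrK !mulrA divrr ?mul1r ?mulrVK // (sgU sM).
  split; last by apply: UPb; apply: sgM => //; apply: sgV.
  by rewrite bE; apply: sgM => //; [apply: sgV => //|]; apply: PUM.
move: E; rewrite bb => /(mulIr b'U) E.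
have uE : u'^-1 * u = m' * m^-1.
  have {1}-> : u = u' * m' * m^-1 by rewrite -E mulrK.
  by rewrite -mulrA mulKr.
have uu : u = u'.
  suff : u'^-1 * u = 1 by move/(canRL (mulVKr u'U)); rewrite mulr1.
  apply: (rp_MU rp); last by apply: sgM => //; apply: sgV.
  by rewrite uE; apply: sgM => //; apply: sgV.
by split=> //; move: E; rewrite uu => /(mulrI u'U).
Qed.

(** Let n = u m b. For a in M the element a' = n a n^-1 is again in M; comparing the factorizations
    of n a and a' n shows that u and b commute with M, in particular with A, and M is the
    centralizer of A. This will show that a lift of a simple reflection is not in K_{x0}. *)
Lemma rp_normalizer G M U Ub A u m b : radical_pair iota G M U Ub ->
  A `<=` M -> M = centralizer G A -> U u -> M m -> Ub b ->
  setconj (u * m * b) M = M -> M (u * m * b).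
Proof.
move=> rp AM ME Uu Mm Bb nM; have rp' := radical_pair_sym rp.
have [sU sM sB] := And3 (rp_sgU rp) (rp_sgM rp) (rp_sgU rp').
have [uU mU bU] := And3 (sgU sU Uu) (sgU sM Mm) (sgU sB Bb).
have key a : M a -> u = conj (conj (u * m * b) a) u /\ b = conj a^-1 b.
  move=> Ma; have aU := sgU sM Ma.
  have Ma' : M (conj (u * m * b) a) by rewrite -{1}nM; exists a.
  have nU : u * m * b \is a GRing.unit by rewrite !unitrMl.
  have := conj_mul a nU; move: (conj _ a) Ma' => a' Ma' nE.
  have a'U := sgU sM Ma'.
  have E : u * (m * a) * conj a^-1 b = conj a' u * (a' * m) * b.
    have -> : u * (m * a) * conj a^-1 b = u * m * b * a.
      by rewrite /conj invrK !mulrA mulrK.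
    have -> : conj a' u * (a' * m) * b = a' * (u * m * b).
      by rewrite mulrA conj_mul // !mulrA.
    by rewrite nE.
  have [||||||<- _ ->] := rp_uniq rp _ _ _ _ _ _ E => //.
  - exact: sgM.
  - by apply: (rp_norm rp') => //; apply: sgV.
  - exact: (rp_norm rp).
  - exact: sgM.
have Mb : M b.
  rewrite ME; split; first exact: (rp_UG rp').
  move=> a /AM Ma; have aU := sgU sM Ma.
  by have [_ E] := key a Ma; rewrite {2}E /conj invrK !mulrA divrr // mul1r.
have Mu : M u.
  rewrite ME; split; first exact: (rp_UG rp).
  move=> a /AM Ma; have aU := sgU sM Ma.
  have [a0 Ma0 aE] : setconj (u * m * b) M a by rewrite nM.
  have [E _] := key a0 Ma0; rewrite aE in E.
  by rewrite {1}E conj_mul.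
by apply: sgM => //; apply: sgM.
Qed.
End AlgGroups.

(** * Split tori *)

Section Closure.
Context (F : fieldType) (Fb : closedFieldType) (iota : {rmorphism F -> Fb}).
Context (d : nat).
Local Notation MF := 'M[F]_d.+1.
Local Notation MB := 'M[Fb]_d.+1.
Implicit Types (H J P M U Z A : set MB) (g h x : MB) (S : set Fb).

(** The Zariski closure inside GL_{d+1}. *)
Definition zcl Z : set MB := [set g | g \is a GRing.unit /\
  forall f, polyfun setT f -> vanishing_on Z f -> f g = 0].

Lemma zcl_zclosed Z : zclosed (zcl Z).
Proof.
exists [set f | polyfun setT f /\ vanishing_on Z f]; split=> [f []//|].
apply/seteqP; split=> g [gU gP]; split=> // f.
  by move=> [fp fv]; apply: gP.
by move=> fp fv; apply: gP.
Qed.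

Lemma sub_zcl Z : Z `<=` [set x | x \is a GRing.unit] -> Z `<=` zcl Z.
Proof. by move=> ZU x Zx; split=> [|f _ fv]; [exact: ZU|exact: fv]. Qed.

Lemma zcl_min Z Q : zclosed Q -> Z `<=` Q -> zcl Z `<=` Q.
Proof.
move=> [I [Ip ->]] ZQ g [gU gP]; split=> // f If; apply: gP; first exact: Ip.
by move=> x /ZQ[_]; apply.
Qed.

Lemma zcl_connected Z : Z `<=` [set x | x \is a GRing.unit] -> zconnected Z -> zconnected (zcl Z).
Proof.
move=> ZU Zc Z1 Z2 c1 c2 Z12 Z0; have ZZ := sub_zcl ZU.
have [] := Zc Z1 Z2 c1 c2.
- exact: subset_trans Z12.
- by apply/seteqP; split=> // x [[/ZZ Zx ?] ?]; rewrite -Z0.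
- by move=> h; left; apply: zcl_min.
- by move=> h; right; apply: zcl_min.
Qed.

Lemma polyfun_det n (M : MB -> 'M[Fb]_n) : (forall i j, polyfun setT (fun g => M g i j)) ->
  polyfun setT (fun g => \det (M g)).
Proof.
move=> Mp; apply: polyfun_sum => // s; apply: polyfun_mul; first exact: polyfun_const.
exact: polyfun_prod.
Qed.

Lemma polyfun_adj i j : polyfun setT (fun g : MB => (\adj g) i j).
Proof.
under eq_fun do rewrite mxE /cofactor.
apply: polyfun_mul; first exact: polyfun_const.
by apply: polyfun_det => k l; under eq_fun do rewrite !mxE; apply: polyfun_coord.
Qed.

Lemma polyfun_exp f k : polyfun setT f -> polyfun setT (fun g : MB => f g ^+ k).
Proof.
move=> fp; elim: k => [|k IHk]; first by under eq_fun do rewrite expr0; apply: polyfun_const.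
by under eq_fun do rewrite exprS; apply: polyfun_mul.
Qed.

(** [polyfun] contains no inverse of the determinant, so inversion is polynomial only after
    multiplication by a power of it; the adjugate provides the entries. *)
Lemma polyfun_inv f : polyfun setT f -> exists N f', polyfun setT f' /\
  forall g : MB, g \is a GRing.unit -> f' g = \det g ^+ N * f g^-1.
Proof.
have dp : polyfun setT (fun g : MB => \det g).
  by apply: polyfun_det => i j; apply: polyfun_coord.
elim=> [c _|i j|f1 f2 _ [N1 [h1 [p1 E1]]] _ [N2 [h2 [p2 E2]]]|f1 f2 _ [N1 [h1 [p1 E1]]] _ [N2 [h2 [p2 E2]]]].
- exists 0%N, (fun=> c); split; first exact: polyfun_const.
  by move=> g _; rewrite expr0 mul1r.
- exists 1%N, (fun g => (\adj g) i j); split; first exact: polyfun_adj.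
  move=> g gU; have du : \det g \is a GRing.unit by rewrite -unitmxE.
  by rewrite expr1 /GRing.inv /= /invmx unitmxE du [in RHS]mxE mulVKr.
- exists (N1 + N2)%N, (fun g => \det g ^+ N2 * h1 g + \det g ^+ N1 * h2 g); split.
    by apply: polyfun_add; apply: polyfun_mul => //; apply: polyfun_exp.
  by move=> g gU; rewrite E1 // E2 // exprD; ring.
- exists (N1 + N2)%N, (fun g => h1 g * h2 g); split; first exact: polyfun_mul.
  by move=> g gU; rewrite E1 // E2 // exprD; ring.
Qed.

(** Products take two density steps: one factor first stays in [H], and then moves into the
    closure. *)
Lemma zcl_subgroup H : subgroup H -> subgroup (zcl H).
Proof.
move=> sH; have HU : H `<=` [set x | x \is a GRing.unit] by move=> x; apply: sgU.
have mulp (a b : MB) f : polyfun setT f -> polyfun setT (fun g => f (a * g * b)).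
  by apply: polyfun_comp => i j; apply: polyfun_mulmx.
split=> [x []//||g g' [gU gP] [g'U g'P]|g [gU gP]].
- by apply: sub_zcl => //; apply: sg1.
- split=> [|f fp fv]; first by rewrite /= unitrMl.
  have Hg' a : H a -> f (a * g') = 0.
    move=> Ha; rewrite -[a * g']mulr1; apply: (g'P (fun x => f (a * x * 1))); first exact: mulp.
    by move=> x Hx; rewrite mulr1; apply: fv; apply: sgM.
  rewrite -[g * g']mul1r mulrA; apply: (gP (fun x => f (1 * x * g'))); first exact: mulp.
  by move=> x Hx; rewrite mul1r; apply: Hg'.
- split=> [|f fp fv]; first by rewrite /= unitrV.
  have [N [f' [f'p E]]] := polyfun_inv fp.
  have /eqP : f' g = 0.
    by apply: gP => // x Hx; rewrite E ?fv ?mulr0 //; [apply: sgV|apply: sgU sH Hx].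
  rewrite E // mulf_eq0 expf_eq0.
  have -> : \det g == 0 = false by apply/negbTE; rewrite -unitfE -unitmxE.
  by rewrite andbF /= => /eqP.
Qed.

Lemma setprod_subgroup H J : subgroup H -> subgroup J ->
  (forall h x, H h -> J x -> h * x = x * h) -> subgroup (setprod H J).
Proof.
move=> sH sJ cm; split=> [_ [h Hh [x Jx <-]]||_ _ [h Hh [x Jx <-]] [h' Hh' [x' Jx' <-]]|_ [h Hh [x Jx <-]]].
- by rewrite /= unitrMl ?(sgU sJ Jx) // (sgU sH Hh).
- by exists 1; [apply: sg1|exists 1; [apply: sg1|rewrite mulr1]].
- exists (h * h'); first exact: sgM.
  by exists (x * x'); [apply: sgM|rewrite -!mulrA [x * (_ * _)]mulrA -(cm h') // !mulrA].
- have hU := sgU sH Hh; have xU := sgU sJ Jx.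
  exists h^-1; first exact: sgV.
  by exists x^-1; [apply: sgV|rewrite cm ?invrM //; apply: sgV].
Qed.

Lemma zclosed_mull h Z : h \is a GRing.unit -> zclosed Z -> zclosed [set x | Z (x * h)].
Proof.
move=> hU [I [Ip ->]]; exists [set (fun g => f (1 * g * h)) | f in I]; split.
  move=> _ [f If <-]; apply: (@polyfun_comp _ _ _ (fun g => 1 * g * h)); last exact: Ip.
  by move=> i j; apply: polyfun_mulmx.
apply/seteqP; split=> g /= [gU gP]; split.
- by rewrite unitrMl // in gU.
- by move=> _ [f If <-]; rewrite mul1r; apply: gP.
- by rewrite unitrMl.
- by move=> f If; rewrite -[g]mul1r; apply: (gP (fun g => f (1 * g * h))); exists f.
Qed.

(** By connectedness of J one of the closed pieces, say Z1, contains J. Each translate Hx with x in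
    J is connected and meets Z1 at x, so it stays in Z1. *)
Lemma setprod_connected H J : subgroup H -> subgroup J -> zconnected H -> zconnected J ->
  zconnected (setprod H J).
Proof.
move=> sH sJ Hc Jc.
have main Z1 Z2 : zclosed Z1 -> zclosed Z2 -> setprod H J `<=` Z1 `|` Z2 ->
    setprod H J `&` Z1 `&` Z2 = set0 -> J `<=` Z1 -> setprod H J `<=` Z1.
  move=> c1 c2 Z12 Z0 J1 _ [h Hh [x Jx <-]]; have xU := sgU sJ Jx.
  have dis y : setprod H J y -> Z1 y -> Z2 y -> False.
    by move=> y0 y1 y2; suff : set0 y by []; rewrite -Z0.
  have [] := Hc _ _ (zclosed_mull xU c1) (zclosed_mull xU c2).
  - by move=> h' Hh'; apply: Z12; exists h' => //; exists x.
  - apply/seteqP; split=> // h' [[Hh' /= h1] h2]; apply: dis h1 h2.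
    by exists h' => //; exists x.
  - by move=> s; apply: s.
  - move=> /(_ 1 (sg1 sH)); rewrite /= mul1r => x2.
    case: (dis x _ (J1 _ Jx) x2); exists 1; first exact: sg1.
    by exists x; rewrite ?mul1r.
move=> Z1 Z2 c1 c2 Z12 Z0.
have JHJ : J `<=` setprod H J.
  by move=> x Jx; exists 1; [apply: sg1|exists x; rewrite ?mul1r].
have [] := Jc Z1 Z2 c1 c2.
- exact: (subset_trans JHJ Z12).
- by apply/seteqP; split=> // x [[/JHJ ? ?] ?]; rewrite -Z0.
- by move=> J1; left; apply: (main Z1 Z2).
- move=> J2; right; apply: (main Z2 Z1) => //; first by rewrite setUC.
  by rewrite setIAC.
Qed.

(** The [chi i] are monomials in the matrix entries. On diagonal matrices the off-diagonal
    coordinates are zero, and so monomials are multiplicative there. *)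
Lemma polyfun_monomials f : polyfun setT f ->
  exists (I : finType) (c : I -> Fb) (chi : I -> MB -> Fb),
  (forall i, polyfun (range iota) (chi i) /\
    forall D : set MB, (forall g, D g -> is_diag_mx g) ->
    forall g h, D g -> D h -> chi i (g * h) = chi i g * chi i h) /\
  forall g, f g = \sum_i c i * chi i g.
Proof.
elim=> [c _|i j|f1 f2 _ [I1 [c1 [h1 [p1 E1]]]] _ [I2 [c2 [h2 [p2 E2]]]]|
   f1 f2 _ [I1 [c1 [h1 [p1 E1]]]] _ [I2 [c2 [h2 [p2 E2]]]]].
- exists 'I_1, (fun=> c), (fun=> fun=> 1); split=> [i|g]; last by rewrite big_ord1 mulr1.
  split=> [|*]; last by rewrite mulr1.
  by apply: polyfun_const; exists 1; rewrite ?rmorph1.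
- exists 'I_1, (fun=> 1), (fun=> fun g => g i j); split=> [_|g]; last by rewrite big_ord1 mul1r.
  split=> [|D Dd g h /Dd/is_diag_mxP gd /Dd/is_diag_mxP hd]; first exact: polyfun_coord.
  rewrite !mxE (bigD1 i) //= big1 => [|k ki]; last by rewrite gd ?mul0r // eq_sym.
  rewrite addr0; have [->//|ij] := eqVneq i j.
  by rewrite (hd i j) ?(gd i j) ?mulr0.
- exists (I1 + I2)%type, (fun i => match i with inl i => c1 i | inr i => c2 i end),
    (fun i => match i with inl i => h1 i | inr i => h2 i end); split; first by case.
  by move=> g; rewrite E1 E2 big_sumType.
- exists (I1 * I2)%type, (fun i => c1 i.1 * c2 i.2), (fun i g => h1 i.1 g * h2 i.2 g); split.
    move=> [i j] /=; have [q1 m1] := p1 i; have [q2 m2] := p2 j; split; first exact: polyfun_mul.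
    by move=> D Dd g h Dg Dh; rewrite (m1 D) // (m2 D) //; ring.
  move=> g; rewrite E1 E2 big_distrlr /= pair_big /=; apply: eq_bigr => -[i j] _ /=; ring.
Qed.

Section Dedekind.
Context (D : set MB) (I : finType) (chi : I -> MB -> Fb).
Hypothesis (DM : forall g h, D g -> D h -> D (g * h)).
Hypothesis chiM : forall i g h, D g -> D h -> chi i (g * h) = chi i g * chi i h.

Lemma chi_independent (A : {set I}) (c : I -> Fb) :
  (forall i, i \in A -> exists2 g, D g & chi i g != 0) ->
  (forall i j, i \in A -> j \in A -> i != j -> exists2 g, D g & chi i g != chi j g) ->
  (forall g, D g -> \sum_(i in A) c i * chi i g = 0) -> forall i, i \in A -> c i = 0.
Proof.
elim: {A}_.+1 {-2}A (ltnSn #|A|) c => // n IHn A An c nz ds c0 j jA.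
have [[i /andP[iA ij]]|none] := pselect (exists i, (i \in A) && (i != j)).
  have [g0 Dg0 g0P] := ds _ _ iA jA ij.
  have jA' : j \in A :\ i by rewrite !inE eq_sym ij.
  have := IHn (A :\ i) _ (fun k => c k * (chi k g0 - chi i g0)) _ _ _ j jA'.
  move=> /(_ _ _ _ _)/eqP; rewrite mulf_eq0 subr_eq0 [chi j g0 == _]eq_sym (negPf g0P) orbF => H.
  apply/eqP/H => {H}.
  - by move: An; rewrite (cardsD1 i) iA.
  - by move=> k; rewrite !inE => /andP[_]; apply: nz.
  - by move=> k l; rewrite !inE => /andP[_ ?] /andP[_ ?]; apply: ds.
  - move=> g Dg; rewrite (_ : \sum_(k in _) _ =
        \sum_(k in A) c k * chi k (g0 * g) - chi i g0 * \sum_(k in A) c k * chi k g).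
      by rewrite !c0 ?mulr0 ?subr0 //; apply: DM.
    rewrite !(big_setD1 i iA) /= mulrDr mulr_sumr.
    rewrite chiM // opprD addrACA mulrCA subrr add0r -sumrB; apply: eq_bigr => k _.
    by rewrite chiM //; ring.
have [g Dg gP] := nz _ jA.
have := c0 _ Dg; rewrite (big_setD1 j) //= big1 => [/eqP|k]; last first.
  by rewrite !inE => /andP[kj kA]; case: none; exists k; rewrite kA kj.
by rewrite addr0 mulf_eq0 (negPf gP) orbF => /eqP.
Qed.
End Dedekind.

(** By independence of characters, a linear relation between monomials on [D] is built from
    monomials that vanish on [D] and from pairs of monomials that agree on [D]. Both kinds are
    polynomials over [F], whence the rationality. *)
Lemma diag_defined_over (D : set MB) : (forall g h, D g -> D h -> D (g * h)) ->
  (forall g, D g -> is_diag_mx g) -> defined_over iota D.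
Proof.
move=> DM Dd f fp fv.
have [I [c [chi [cP E]]]] := polyfun_monomials fp.
pose span (f : MB -> Fb) := exists (n : nat) (c : 'I_n -> Fb) (h : 'I_n -> MB -> Fb),
    (forall i, polyfun (range iota) (h i) /\ vanishing_on D (h i)) /\
    forall g, f g = \sum_i c i * h i g.
have span_cons f1 f2 c1 k1 : polyfun (range iota) k1 -> vanishing_on D k1 ->
    span f2 -> (forall g, f1 g = c1 * k1 g + f2 g) -> span f1.
  move=> h1p h1v [n [c2 [h2 [h2P E2]]]] E1.
  exists n.+1, (fun i => oapp c2 c1 (unlift ord0 i)), (fun i => oapp h2 k1 (unlift ord0 i)).
  split=> [i|g]; first by case: unliftP => [j|] _ /=.
  by rewrite E1 big_ord_recl unlift_none E2; congr (_ + _); apply: eq_bigr => i _; rewrite liftK.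
suff main (A : {set I}) (c' : I -> Fb) : (forall g, D g -> \sum_(i in A) c' i * chi i g = 0) ->
    span (fun g => \sum_(i in A) c' i * chi i g).
  have [|n [c2 [h2 [h2P E2]]]] := main [set: I]%SET c.
    by move=> g Dg; rewrite -[RHS](fv g Dg) E; apply: eq_bigl => i; rewrite inE.
  exists n, c2, h2; split=> // g; rewrite -E2 E.
  by apply: eq_bigl => i; rewrite inE.
elim: {A}_.+1 {-2}A (ltnSn #|A|) c' => // n IHn A An c' c0.
have cM i g h : D g -> D h -> chi i (g * h) = chi i g * chi i h.
  by case: (cP i) => _ /(_ D Dd); apply.
have [[i [iA iv]]|nz] := pselect (exists i, i \in A /\ vanishing_on D (chi i)).
  have cE g : \sum_(k in A) c' k * chi k g = c' i * chi i g + \sum_(k in A :\ i) c' k * chi k g.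
    by rewrite (big_setD1 i).
  apply: (span_cons _ _ _ _ _ _ _ cE) => //; first by case: (cP i).
  apply: IHn; first by move: An; rewrite (cardsD1 i) iA.
  by move=> g Dg; have := c0 g Dg; rewrite cE iv // mulr0 add0r.
have [[i [j [iA jA ij eqD]]]|ds] := pselect (exists i j, [/\ i \in A, j \in A, i != j &
    forall g, D g -> chi i g = chi j g]).
  pose c2 k := if k == j then c' j + c' i else c' k.
  have cE g : \sum_(k in A) c' k * chi k g =
      c' i * (chi i g - chi j g) + \sum_(k in A :\ i) c2 k * chi k g.
    have jA' : j \in A :\ i by rewrite !inE eq_sym ij.
    rewrite (big_setD1 i) //= !(big_setD1 j jA') /= {1}/c2 eqxx.
    rewrite [X in _ = _ + (_ + X)](eq_bigr (fun k => c' k * chi k g)).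
      by ring.
    by move=> k; rewrite !inE /c2 => /andP[/negPf ->].
  apply: (span_cons _ _ _ _ _ _ _ cE).
  - rewrite (_ : (fun g => _) = fun g => chi i g + -1 * chi j g); last first.
      by apply/funext => g; rewrite mulN1r.
    apply: polyfun_add; first by case: (cP i).
    apply: polyfun_mul; last by case: (cP j).
    by apply: polyfun_const; exists (-1); rewrite ?rmorphN1.
  - by move=> g Dg /=; rewrite eqD // subrr.
  - apply: IHn; first by move: An; rewrite (cardsD1 i) iA.
    by move=> g Dg; have := c0 g Dg; rewrite cE eqD // subrr mulr0 add0r.
exists 0%N, (fun=> 0), (fun=> fun=> 0); split=> [[]//|g]; rewrite big_ord0 big1 // => i iA.
rewrite (@chi_independent D I chi DM cM A c') ?mul0r // => [k kA|k l kA lA kl].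
  apply: contrapT => nk; apply: nz; exists k; split=> // h Dh.
  by apply/eqP; apply: contrapT => /negP hk; apply: nk; exists h.
apply: contrapT => nk; apply: ds; exists k, l; split=> // h Dh.
by apply/eqP; apply: contrapT => /negP hk; apply: nk; exists h.
Qed.

End Closure.

Section SplitTori.
Context (F : fieldType) (Fb : closedFieldType) (iota : {rmorphism F -> Fb}).
Context (d : nat).
Local Notation MF := 'M[F]_d.+1.
Local Notation MB := 'M[Fb]_d.+1.
Local Notation im := (map_mx iota : MF -> MB).
Implicit Types (H J P M U Z A S : set MB) (g x : MB).

Definition F_diag (h : MF) A := h \is a GRing.unit /\ forall t, A t -> is_diag_mx (conj (im h) t).

Section Eigenidempotents.
Context (A : set MB) (h : MF).
Hypothesis hA : F_diag h A.
Local Notation chi i a := ((conj (im h) a) i i).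

Definition same_chi (i j : 'I_d.+1) := `[< forall a, A a -> chi i a = chi j a >].
(** The projector onto the weight space of [A] that contains the i-th vector of the diagonalizing
    basis. Its entries are in [F], whereas those of the elements of [A] are in [Fb]. *)
Definition eigen_idem (i : 'I_d.+1) : MF :=
  conj h^-1 (diag_mx (\row_j (same_chi i j)%:R)).

Let hU : h \is a GRing.unit. Proof. by case: hA. Qed.
Let imhU : im h \is a GRing.unit. Proof. by rewrite im_unit. Qed.

Lemma conj_eigen_idem i : conj (im h) (im (eigen_idem i)) = diag_mx (\row_j (same_chi i j)%:R).
Proof.
rewrite -im_conj /eigen_idem conjVK // map_diag_mx; congr diag_mx.
by apply/rowP => j; rewrite !mxE rmorph_nat.
Qed.

Lemma conj_im_inj : injective (conj (im h)).
Proof. exact: can_inj (conjK imhU). Qed.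

(** Commuting with [A] forces the entries of [s] between different weights to vanish, so [s]
    preserves the weight spaces. *)
Lemma eigen_idem_comm (s : MB) i : (forall a, A a -> s * a = a * s) ->
  s * im (eigen_idem i) = im (eigen_idem i) * s.
Proof.
move=> cs; apply: conj_im_inj; rewrite !conjM // conj_eigen_idem.
have [s' s'E] : {s' | s' = conj (im h) s} by exists (conj (im h) s).
rewrite -s'E; apply/matrixP => j k.
rewrite -!mulmxE mul_mx_diag mul_diag_mx !mxE; have [jk|njk] := boolP (same_chi j k).
  rewrite mulrC; congr (_%:R * _); congr nat_of_bool; apply/asboolP/asboolP => E a Aa.
    by rewrite E // (asboolW jk).
  by rewrite E // (asboolW jk).
suff -> : s' j k = 0 by rewrite mulr0 mul0r.
have [a Aa ajk] : exists2 a, A a & chi j a != chi k a.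
  apply: contrapT => na; case/negP: njk; apply/asboolP => a Aa; apply/eqP.
  by apply: contrapT => /negP ?; apply: na; exists a.
have : (s' * conj (im h) a) j k = (conj (im h) a * s') j k by rewrite s'E -!conjM // cs.
case: hA => _ /(_ a Aa)/is_diag_mxP da.
rewrite mxE (bigD1 k) //= big1 => [|l lk]; last by rewrite da ?mulr0.
rewrite [RHS]mxE [RHS](bigD1 j) //= big1 => [|l lj]; last by rewrite da ?mul0r // eq_sym.
rewrite !addr0 mulrC => /eqP; rewrite -subr_eq0 -mulrBl mulf_eq0 subr_eq0 eq_sym (negPf ajk).
by move/eqP.
Qed.

Lemma eigen_idem_diag i : exists2 P : MF, P \in unitmx & similar_diag P (eigen_idem i).
Proof.
exists h => //; rewrite /similar_to conjumx //.
have -> : h *m eigen_idem i *m invmx h = conj h (eigen_idem i) by [].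
by rewrite /eigen_idem conjVK // diag_mx_is_diag.
Qed.

Lemma eigen_idem_comm2 i j : eigen_idem i * eigen_idem j = eigen_idem j * eigen_idem i.
Proof.
rewrite /eigen_idem -!conjM ?unitrV //; congr conj; apply/matrixP => k l.
by rewrite -!mulmxE !mul_diag_mx !mxE; case: eqP => [->|] //; rewrite ?mulr1n ?mulr0n ?mulr0 // mulrC.
Qed.

Lemma eigen_decomp a : A a -> exists c : 'I_d.+1 -> Fb, a = \sum_i c i *: im (eigen_idem i).
Proof.
(* [r i] is a fixed index in the weight class of [i]. Only the indices with [r i == i] receive a
   coefficient below, so that each weight is counted once. *)
move=> Aa; pose r i := odflt i [pick j | same_chi i j].
have symE i j : same_chi i j -> same_chi i =1 same_chi j.
  move=> ij k; apply/asboolP/asboolP => E b Ab; first by rewrite -(asboolW ij) ?E.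
  by rewrite (asboolW ij) ?E.
have rE i : same_chi i (r i).
  by rewrite /r; case: pickP => [//|/= _]; apply/asboolP.
have rS i j : same_chi i j -> r i = r j.
  move=> ij; rewrite /r (eq_pick (symE _ _ ij)); case: pickP => [//|/(_ j)] /=.
  by rewrite (_ : same_chi j j) //; apply/asboolP.
exists (fun i => if r i == i then chi i a else 0); apply: conj_im_inj.
have cS (c : 'I_d.+1 -> Fb) (f : 'I_d.+1 -> MB) :
    conj (im h) (\sum_i c i *: f i) = \sum_i c i *: conj (im h) (f i).
  rewrite /conj mulr_sumr mulr_suml; apply: eq_bigr => i _.
  by rewrite -scalerAr -scalerAl.
rewrite cS; case: hA => _ /(_ a Aa)/is_diag_mxP.
have kr k : conj (im h) a k k = conj (im h) a (r k) (r k) by apply: (asboolW (rE k)).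
move: (conj (im h) a) kr => a' kr da; apply/matrixP => k l; rewrite summxE.
under eq_bigr do rewrite conj_eigen_idem !mxE.
have [kl|kl] := eqVneq k l; last first.
  by rewrite da // big1 // => i _; rewrite mulr0n mulr0.
subst l; rewrite (bigD1 (r k)) //= big1 => [|i irk].
  have -> : r (r k) = r k by rewrite -(rS _ _ (rE k)).
  rewrite eqxx -(symE _ _ (rE k)) (_ : same_chi k k); last by apply/asboolP.
  by rewrite mulr1 addr0 kr.
case: eqP => [ri|]; last by rewrite mul0r.
have [ik|] := boolP (same_chi i k); last by rewrite mulr0.
by move: irk; rewrite -(rS _ _ ik) ri eqxx.
Qed.
End Eigenidempotents.

(** Simultaneous diagonalization applies to finite families over [F]. The two sets of matrices are
    therefore replaced by their finitely many weight projectors, which have entries in [F] and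
    commute. *)
Lemma simult_diag A A' h h' : F_diag h A -> F_diag h' A' ->
  (forall a a', A a -> A' a' -> a * a' = a' * a) ->
  exists k, F_diag k A /\ F_diag k A'.
Proof.
move=> hA hA' cm.
have c1 i j : eigen_idem A h i * eigen_idem A' h' j = eigen_idem A' h' j * eigen_idem A h i.
  apply: (@im_inj _ _ iota d); rewrite imM [RHS]imM; apply: (eigen_idem_comm hA') => a' Aa'.
  by apply: esym; apply: (eigen_idem_comm hA) => a Aa; rewrite (cm a a').
pose fs := [seq eigen_idem A h i | i <- enum 'I_d.+1] ++ [seq eigen_idem A' h' i | i <- enum 'I_d.+1].
have [k kU kD] : exists2 P, P \in unitmx & all [pred A | similar_diag P A] fs.
  apply/codiagonalizableP; split=> [f g|f]; rewrite !mem_cat.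
    move=> /orP[] /mapP[i _ ->] /orP[] /mapP[j _ ->]; rewrite /comm_mx.
    - exact: (eigen_idem_comm2 hA).
    - exact: c1.
    - by symmetry; apply: c1.
    - exact: (eigen_idem_comm2 hA').
  move=> /orP[] /mapP[i _ ->]; first exact: (eigen_idem_diag hA).
  exact: (eigen_idem_diag hA').
have main B l : F_diag l B -> (forall i, similar_diag k (eigen_idem B l i)) -> F_diag k B.
  move=> lB Dk; split=> // t /(eigen_decomp lB)[c ->]; apply/is_diag_mxP => i j ij.
  rewrite /conj mulr_sumr mulr_suml summxE big1 // => m _.
  rewrite -scalerAr -scalerAl mxE -/(conj (im k) _) -im_conj mxE.
  have := Dk m; rewrite /similar_to conjumx // => /is_diag_mxP/(_ i j ij) E.
  by rewrite [X in iota X]E rmorph0 mulr0.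
exists k; split; [apply: (main _ _ hA)|apply: (main _ _ hA')] => i.
  by apply: (allP kD); rewrite mem_cat map_f ?mem_enum.
by apply: (allP kD); rewrite mem_cat orbC map_f ?mem_enum.
Qed.

(** The closure of AA' is connected, diagonal in a common basis over [F], and defined over [F]
    because diagonal multiplicative sets are. *)
Lemma split_torus_join A A' Q : subgroup A -> subgroup A' -> zconnected A -> zconnected A' ->
  (exists h, F_diag h A) -> (exists h, F_diag h A') ->
  (forall a a', A a -> A' a' -> a * a' = a' * a) ->
  zclosed Q -> subgroup Q -> A `<=` Q -> A' `<=` Q ->
  exists B, [/\ split_torus iota B, A `<=` B, A' `<=` B & B `<=` Q].
Proof.
move=> sA sA' cA cA' [h hA] [h' hA'] cm cQ sQ AQ AQ'.
have [k [[kU kA] [_ kA']]] := simult_diag hA hA' cm.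
have sP := setprod_subgroup sA sA' cm.
have PU : setprod A A' `<=` [set x | x \is a GRing.unit] by move=> x; apply: sgU.
have imkU : im k \is a GRing.unit by rewrite im_unit.
have sB := zcl_subgroup sP; exists (zcl (setprod A A')); split.
- have Bd t : zcl (setprod A A') t -> is_diag_mx (conj (im k) t).
    move=> [tU tP]; apply/is_diag_mxP => i j ij.
    apply: (tP (fun t => conj (im k) t i j)).
      by apply: (polyfun_conjT (im k) (f := fun g => g i j)); apply: polyfun_coord.
    move=> _ [a Aa [a' Aa' <-]]; rewrite conjM // mxE big1 // => l _.
    have [il|il] := eqVneq i l; last by rewrite ((is_diag_mxP (kA _ Aa)) i l) ?mul0r.
    by rewrite ((is_diag_mxP (kA' _ Aa')) l j) ?mulr0 // -il.
  split; last by exists k.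
    split; first by split; [apply: zcl_zclosed|].
    rewrite -(setconjK (zcl (setprod A A')) imkU) -imV.
    apply: defined_over_conj; first by rewrite unitrV.
    have sB' := subgroup_setconj imkU sB.
    apply: diag_defined_over => [g g' Bg Bg'|_ [g Bg <-]]; [exact: sgM|exact: Bd].
  by apply: zcl_connected => //; apply: setprod_connected.
- move=> a Aa; apply: sub_zcl => //; exists a => //; exists 1; first exact: sg1.
  by rewrite mulr1.
- move=> a Aa; apply: sub_zcl => //; exists 1; first exact: sg1.
  by exists a; rewrite ?mul1r.
- by apply: zcl_min => // _ [a Aa [a' Aa' <-]]; apply: sgM; auto.
Qed.

Lemma split_torus_diag A : split_torus iota A -> [/\ subgroup A, zconnected A & exists h, F_diag h A].
Proof. by move=> [[[_ sA] _] cA [h hU hA]]; split=> //; exists h. Qed.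

Lemma max_split_central M S A : zclosed M -> subgroup M -> max_split iota M S ->
  split_torus iota A -> A `<=` center M -> A `<=` S.
Proof.
move=> cM sM [[tS SM] Smax] tA AM.
have [sS cS dS] := split_torus_diag tS; have [sA cA dA] := split_torus_diag tA.
have AM' : A `<=` M by move=> a /AM[].
have cm s a : S s -> A a -> s * a = a * s by move=> Ss /AM[_ ca]; rewrite ca //; apply: SM.
have [B [tB SB AB BM]] := split_torus_join sS sA cS cA dS dA cm cM sM SM AM'.
by rewrite -(Smax B).
Qed.

Lemma center_subgroup M : subgroup M -> subgroup (center M).
Proof.
move=> sM; split=> [x [/(sgU sM)]//||x y [Mx xc] [My yc]|x [Mx xc]].
- by split=> [|a _]; [apply: sg1|rewrite mul1r mulr1].
- by split=> [|a Ma]; [apply: sgM|rewrite -mulrA yc // mulrA xc // mulrA].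
- split=> [|a Ma]; first exact: sgV.
  have xU := sgU sM Mx; apply: (mulrI xU); rewrite mulVKr // mulrA xc //.
  by rewrite mulrK.
Qed.

Lemma center_zclosed M : zclosed M -> zclosed (center M).
Proof.
move=> [I [Ip ME]].
exists (I `|` [set f | exists a i j, M a /\ f = fun g => (g * a * 1) i j + -1 * (a * g * 1) i j]); split.
  move=> f [/Ip//|[a [i [j [_ ->]]]]]; apply: polyfun_add.
    rewrite (_ : (fun g => _) = fun g => (1 * g * a) i j); last first.
      by apply/funext => g; rewrite mul1r mulr1.
    exact: polyfun_mulmx.
  by apply: polyfun_mul; [apply: polyfun_const|apply: polyfun_mulmx].
apply/seteqP; split=> g.
  move=> [Mg cg]; have := Mg; rewrite {1}ME => -[gU gI]; split=> // f [/gI//|[a [i [j [Ma ->]]]]].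
  by rewrite cg // mulN1r subrr.
move=> [gU gP]; have Mg : M g by rewrite ME; split=> // f If; apply: gP; left.
split=> // a Ma; apply/matrixP => i j; apply/eqP; rewrite -subr_eq0; apply/eqP.
have := gP (fun g => (g * a * 1) i j + -1 * (a * g * 1) i j).
by rewrite !mulr1 mulN1r; apply; right; exists a, i, j.
Qed.

(** The conjugate of A is diagonalizable over [F] and central in M, since n normalizes M; joined
    with A inside the centre, it is absorbed by maximality. *)
Lemma max_split_conj M A (n : MF) : zclosed M -> subgroup M -> max_split iota (center M) A ->
  n \is a GRing.unit -> setconj (im n) M = M -> setconj (im n) A `<=` A.
Proof.
move=> cM sM [[tA AM] Amax] nU nM; have imnU : im n \is a GRing.unit by rewrite im_unit.
have [sA cA [h [hU dA]]] := split_torus_diag tA.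
have nAM : setconj (im n) A `<=` center M.
  move=> _ [a /AM[Ma ac] <-]; split; first by rewrite -nM; exists a.
  by move=> b; rewrite -{1}nM => -[b' Mb' <-]; rewrite -!conjM // ac.
have dA' : exists h, F_diag h (setconj (im n) A).
  exists (h * n^-1); split; first by rewrite unitrMl ?unitrV.
  by move=> _ [a Aa <-]; rewrite imM imV conjMg ?unitrV ?im_unit // conjK //; apply: dA.
have cm a a' : A a -> setconj (im n) A a' -> a * a' = a' * a.
  by move=> /AM[_ ca] /nAM[Ma' _]; apply: ca.
have [|B [tB AB A'B BM]] := split_torus_join sA (subgroup_setconj imnU sA) cA
  (zconnected_conj imnU cA) _ dA' cm (center_zclosed cM) (center_subgroup sM) AM nAM.
  by exists h.
by rewrite (Amax B) in A'B.
Qed.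
End SplitTori.

(** * Bases of subgroups of Z^n *)

Definition has_lattice_basis n (L : set 'rV[int]_n) :=
  exists k (B : 'M[int]_(k, n)), (forall z, L (z *m B)) /\
    forall x, L x -> exists! z : 'rV[int]_k, x = z *m B.

(** The length 1 + n splits off the first coordinate. Either this coordinate vanishes on L, or an
    element of L whose first coordinate is positive and minimal completes a basis of the elements
    with first coordinate 0, by Euclidean division. *)
Lemma lattice_basis_step n (L : set 'rV[int]_(1 + n)) :
  (forall L' : set 'rV[int]_n, L' 0 -> (forall x y, L' x -> L' y -> L' (x - y)) ->
     has_lattice_basis L') ->
  L 0 -> (forall x y, L x -> L y -> L (x - y)) -> has_lattice_basis L.
Proof.
move=> IHn L0 LB.
have LN x : L x -> L (- x) by move=> Lx; rewrite -sub0r; apply: LB.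
have LD x y : L x -> L y -> L (x + y) by move=> Lx Ly; rewrite -[y]opprK; apply: LB => //; apply: LN.
have LMn x m : L x -> L (x *+ m).
  by move=> Lx; elim: m => [|m IHm]; rewrite ?mulr0n // mulrS; apply: LD.
have LZ x (m : int) : L x -> L (m *: x).
  move=> Lx; case: m => m.
    by rewrite -[Posz m]natz scaler_nat; apply: LMn.
  by rewrite NegzE scaleNr -[m.+1%:Z]natz scaler_nat; apply/LN/LMn.
pose L' := [set y : 'rV[int]_n | L (row_mx (0 : 'rV[int]_1) y : 'rV[int]_(1 + n))].
have [||k [B [BL BU]]] := IHn L'.
- by rewrite /L' /= row_mx0.
- by move=> x y Lx Ly; rewrite /L' /= (_ : row_mx _ _ = row_mx (0 : 'rV[int]_1) x - row_mx 0 y);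
    [apply: LB|rewrite opp_row_mx add_row_mx subrr].
have [nopos|[x0 [Lx0 x0pos x0min]]] : (forall x : 'rV[int]_(1 + n), L x -> x 0 0 = 0) \/
    exists x0 : 'rV[int]_(1 + n), [/\ L x0, 0 < x0 0 0 & forall x : 'rV[int]_(1 + n), L x -> 0 < x 0 0 -> x0 0 0 <= x 0 0].
  have [ex|nex] := pselect (exists m : nat, exists2 x : 'rV[int]_(1 + n), L x & x 0 0 = m.+1).
    right; have ex' : exists m : nat, `[< exists2 x : 'rV[int]_(1 + n), L x & x 0 0 = m.+1 >].
      by have [m hm] := ex; exists m; apply/asboolP.
    case: (ex_minnP ex') => m /asboolW[x Lx xm] mmin; exists x; split=> //; first by rewrite xm.
    move=> y Ly y0; have := mmin (absz (y 0 0)).-1; rewrite xm => /(_ _)H.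
    have : (m <= (absz (y 0%R 0%R)).-1)%N by apply: H; apply/asboolP; exists y => //; lia.
    by lia.
  left=> x Lx; apply: contrapT => x0; apply: nex.
  have [xp|xn] := ltP 0 (x 0 0); first by exists (absz (x 0 0)).-1, x => //; lia.
  exists (absz (x 0 0)).-1, (- x); first exact: LN.
  have x0' : x 0 0 != 0 by apply/eqP.
  by rewrite mxE; case: (x 0 0) x0' xn => c; lia.
- exists k, (row_mx (0 : 'M[int]_(k, 1)) B); split=> [z|x Lx].
    by rewrite mul_mx_row mulmx0; apply: BL.
  have xE : x = row_mx (0 : 'rV[int]_1) (rsubmx (x : 'rV[int]_(1 + n))).
    rewrite -[LHS](hsubmxK (x : 'rV[int]_(1 + n))); congr row_mx.
    apply/rowP => i; rewrite (ord1 i) !mxE.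
    by have <- := nopos x Lx; congr (x _ _); apply/val_inj.
  have [|z [zE zU]] := BU (rsubmx (x : 'rV[int]_(1 + n))); first by rewrite /L' /= -xE.
  exists z; split; first by rewrite mul_mx_row mulmx0 -zE -xE.
  move=> z'; rewrite mul_mx_row mulmx0 {1}xE => /eq_row_mx[_ zE'].
  exact: zU.
exists (1 + k)%N, (col_mx x0 (row_mx (0 : 'M[int]_(k, 1)) B)).
have zBE (z : 'rV[int]_(1 + k)) : z *m col_mx x0 (row_mx (0 : 'M[int]_(k, 1)) B) =
    z 0 0 *: x0 + row_mx 0 (rsubmx z *m B).
  rewrite -{1}[z]hsubmxK mul_row_col mul_mx_row mulmx0; congr (_ + _).
  rewrite [lsubmx z]mx11_scalar mul_scalar_mx !mxE; congr (z _ _ *: _).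
  exact/val_inj.
split=> [z|x Lx]; first by rewrite zBE; apply: LD; [apply: LZ|apply: BL].
pose q := divz (x 0 0) (x0 0 0).
pose y : 'rV[int]_(1 + n) := x - q *: x0.
have Ly : L y by apply: LB => //; apply: LZ.
have y0 : y 0 0 = 0.
  have yE : y 0 0 = modz (x 0 0) (x0 0 0) by rewrite /y !mxE /modz.
  have ylt : y 0 0 < x0 0 0 by rewrite yE ltz_pmod.
  have yge : 0 <= y 0 0 by rewrite yE modz_ge0 // gt_eqF.
  apply/eqP; rewrite eq_le yge andbT leNgt; apply/negP => /(x0min _ Ly).
  by rewrite leNgt ylt.
have yE : y = row_mx (0 : 'rV[int]_1) (rsubmx y).
  rewrite -[LHS]hsubmxK; congr row_mx; apply/rowP => i; rewrite (ord1 i) [LHS]mxE [RHS]mxE.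
  by rewrite -[RHS]y0; congr (y _ _); apply/val_inj.
have [|z [zE zU]] := BU (rsubmx y); first by rewrite /L' /= -yE.
exists (row_mx q%:M z : 'rV[int]_(1 + k)); split.
  rewrite zBE row_mxKr -zE -yE (_ : (row_mx q%:M z : 'rV[int]_(1 + k)) 0 0 = q).
    by rewrite /y addrC subrK.
  by rewrite mxE; case: splitP => [j _|j]; rewrite ?mxE ?(ord1 j) ?eqxx // add1n.
move=> z' xE; have xE' : x = z' 0 0 *: x0 + row_mx 0 (rsubmx z' *m B) by rewrite xE; exact: zBE.
have qE : q = (z' : 'rV[int]_(1 + k)) 0 0.
  rewrite /q xE' !mxE; case: splitP => [j _|j /= /esym] //; rewrite mxE addr0 mulzK //.
  by rewrite gt_eqF.
rewrite -[RHS](hsubmxK (z' : 'rV[int]_(1 + k))); congr row_mx.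
  rewrite [RHS]mx11_scalar qE; congr (_%:M); rewrite mxE; congr (z' _ _); exact/val_inj.
apply: zU; rewrite /y xE' qE addrC addKr row_mxKr; by [].
Qed.

Lemma lattice_basis n (L : set 'rV[int]_n) : L 0 -> (forall x y, L x -> L y -> L (x - y)) ->
  has_lattice_basis L.
Proof.
elim: n L => [|n IHn] L L0 LB; last exact: (@lattice_basis_step n L).
exists 0%N, 0; split=> [z|x _]; first by rewrite mulmx0.
by exists 0; split=> [|z _]; rewrite !thinmx0.
Qed.

(** * The action on the apartment *)

Section Cocharacters.
Context (F : fieldType) (Fb : closedFieldType) (iota : {rmorphism F -> Fb}).
Context (d : nat).
Local Notation MF := 'M[F]_d.+1.
Local Notation MB := 'M[Fb]_d.+1.
Local Notation im := (map_mx iota : MF -> MB).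

Lemma poly_eq0_infinite (q : {poly Fb}) : (forall t, t != 0 -> q.[t] = 0) -> q = 0.
Proof.
move=> q0; apply/eqP; apply: contrapT => /negP q_neq0.
have : q * 'X != 0 by rewrite mulf_neq0 // -size_poly_eq0 size_polyX.
move=> /closed_nonrootP[t]; rewrite /root hornerM hornerX.
by have [->|/q0 ->] := eqVneq t 0; rewrite ?mulr0 ?mul0r eqxx.
Qed.

(** As polynomials in t, q(st) and q(s) q(t) have the leading coefficients s^m lc(q) and q(s) lc(q),
    where m is the degree of q. *)
Lemma poly_multiplicative (q : {poly Fb}) : q.[1] != 0 ->
  (forall s t, s != 0 -> t != 0 -> q.[s * t] = q.[s] * q.[t]) ->
  exists m : nat, forall t, t != 0 -> q.[t] = t ^+ m.
Proof.
move=> q1 qM; have q0 : q != 0 by apply: contraNneq q1 => ->; rewrite horner0.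
exists (size q).-1 => s s0.
have E : \poly_(i < size q) (q`_i * s ^+ i) = q.[s] *: q.
  apply/eqP; rewrite -subr_eq0; apply/eqP; apply: poly_eq0_infinite => t t0.
  rewrite hornerD hornerN hornerZ -qM // horner_poly horner_coef.
  apply/eqP; rewrite subr_eq0; apply/eqP; apply: eq_bigr => i _.
  by rewrite exprMn; ring.
have /(congr1 (fun r : {poly Fb} => r`_(size q).-1)) := E.
rewrite coef_poly coefZ ltn_predL size_poly_gt0 q0 mulrC => /mulIf -> //.
by rewrite -lead_coefE lead_coef_eq0.
Qed.

Lemma exprz_eq1 (c : int) : (forall t : Fb, t != 0 -> t ^ c = 1) -> c = 0.
Proof.
move=> ct; apply: contrapT => /eqP c0.
have cp : (0 < absz c)%N by lia.
have : 'X^(absz c) - 1 = 0 :> {poly Fb}.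
  apply: poly_eq0_infinite => t t0; rewrite !(hornerE, hornerXn).
  case: c ct {c0 cp} => c ct /=; first by rewrite exprnP ct // subrr.
  have := ct t t0; rewrite NegzE -exprnN => /(congr1 GRing.inv).
  by rewrite invrK invr1 => ->; rewrite subrr.
by move/eqP; rewrite -size_poly_eq0 size_XnsubC.
Qed.

(** The cocharacter with exponents [a] of the torus of matrices diagonalized by [h]; the value at 0
    follows the normalization in [cocharacter]. *)
Definition lam (h : MF) (a : 'rV[int]_d.+1) (t : Fb) : MB :=
  if t == 0 then 1 else conj (im h)^-1 (diag_mx (\row_i t ^ a 0 i)).

Context (h : MF) (hU : h \is a GRing.unit).
Let imhU : im h \is a GRing.unit. Proof. by rewrite im_unit. Qed.
Let imhVU : (im h)^-1 \is a GRing.unit. Proof. by rewrite unitrV. Qed.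

Lemma lam0 : lam h 0 = fun=> 1.
Proof.
apply/funext => t; rewrite /lam; case: eqP => // _.
rewrite (_ : diag_mx _ = 1) ?conj1 //; apply/matrixP => i j; rewrite !mxE expr0z.
by case: eqP.
Qed.

Lemma lamD a b : lam h (a + b) = fun t => lam h a t * lam h b t.
Proof.
apply/funext => t; rewrite /lam; case: eqP => [_|/eqP t0]; first by rewrite mulr1.
rewrite -conjM //; congr conj; rewrite -mulmxE mulmx_diag; congr diag_mx.
by apply/rowP => i; rewrite !mxE expfzDr.
Qed.

Lemma lam_unit a t : lam h a t \is a GRing.unit.
Proof.
rewrite /lam; case: eqP => [_|/eqP t0]; first exact: unitr1.
rewrite conj_unit //; have : diag_mx (\row_i t ^ a 0 i) * diag_mx (\row_i t ^ (- a) 0 i) = 1.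
  rewrite -mulmxE mulmx_diag -[1]diag_const_mx; congr diag_mx.
  by apply/rowP => i; rewrite !mxE -expfzDr // subrr expr0z.
by move/mulmx1_unit => [].
Qed.

Lemma lamN a t : lam h (- a) t = (lam h a t)^-1.
Proof.
have lU := lam_unit a t; apply: (mulIr lU); rewrite mulVr //.
by have /(congr1 (fun f => f t)) := lamD (- a) a; rewrite addNr lam0.
Qed.

Lemma lamZ a t (m : int) : lam h (m *: a) t = lam h a t ^ m.
Proof.
have nat k : lam h (k%:Z *: a) t = lam h a t ^+ k.
  elim: k => [|k IHk]; first by rewrite scale0r lam0 expr0.
  by rewrite intS scalerDl scale1r lamD exprS IHk.
by case: m => k; [apply: nat|rewrite NegzE scaleNr lamN nat -exprnN].
Qed.

Lemma lam_sum k (c : 'I_k -> 'rV[int]_d.+1) (z : 'rV[int]_k) t :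
  lam h (\sum_i z 0 i *: c i) t = \prod_i lam h (c i) t ^ z 0 i.
Proof.
elim/big_rec2: _ => [|i x y _ <-]; first by rewrite lam0.
by rewrite lamD lamZ.
Qed.

Lemma lam_inj a b : (forall t, t != 0 -> lam h a t = lam h b t) -> a = b.
Proof.
move=> ab; apply/rowP => i; apply/eqP; rewrite -subr_eq0; apply/eqP.
apply: exprz_eq1 => t t0; have := ab t t0; rewrite /lam (negPf t0) => /(can_inj (conjK imhVU)).
move/matrixP/(_ i i); rewrite !mxE eqxx !mulr1n expfzDr // => ->.
by rewrite -expfzDr // subrr expr0z.
Qed.

Lemma conj_polymx (g : MB) (P : 'M[{poly Fb}]_d.+1) : exists Q : 'M[{poly Fb}]_d.+1,
  forall t, map_mx (horner_eval t) Q = conj g (map_mx (horner_eval t) P).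
Proof.
exists (map_mx polyC g * P * map_mx polyC g^-1) => t; rewrite /conj -!mulmxE !map_mxM.
have cK (M : MB) : map_mx (horner_eval t) (map_mx polyC M) = M.
  by apply/matrixP => i j; rewrite !mxE horner_evalE hornerC.
by rewrite !cK.
Qed.

Lemma cochar_conj (A : set MB) (n : MF) l : n \is a GRing.unit -> cocharacter A l ->
  setconj (im n) A `<=` A -> cocharacter A (fun t => conj (im n) (l t)).
Proof.
move=> nU [l0 lA lM [m [P lP]]] nA; have gU : im n \is a GRing.unit by rewrite im_unit.
split=> [|t t0|s t s0 t0|].
- by rewrite l0 conj1.
- by apply: nA; exists (l t) => //; apply: lA.
- by rewrite lM // conjM.
- have [Q QE] := conj_polymx (im n) P; exists m, Q => t t0.
  by rewrite lP // QE /conj -scalerAr -scalerAl.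
Qed.

Lemma cochar_sub (A A' : set MB) l : A `<=` A' -> cocharacter A l -> cocharacter A' l.
Proof. by move=> AA [l0 lA lM lP]; split=> // t t0; apply/AA/lA. Qed.

(** Each diagonal entry times t^m is a multiplicative polynomial in t, hence a monomial.
    Cocharacters of a split torus thus become integer vectors. *)
Lemma cochar_lam (A : set MB) l : subgroup A -> F_diag iota h A -> cocharacter A l -> exists a, l = lam h a.
Proof.
move=> sA [_ dA] [l0 lA lM [m [P lP]]]; have [Q QE] := conj_polymx (im h) P.
have l1 : l 1 = 1.
  have lU : l 1 \is a GRing.unit by apply: (sgU sA); apply: lA; rewrite oner_eq0.
  by apply: (mulIr lU); rewrite -lM ?oner_eq0 // !mul1r.
pose f i t := conj (im h) (l t) i i.
have dl t : t != 0 -> conj (im h) (l t) = diag_mx (\row_i f i t).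
  move=> t0; have /is_diag_mxP ld := dA _ (lA _ t0); apply/matrixP => i j; rewrite [RHS]mxE [X in X *+ _]mxE.
  by case: eqP => [->|/eqP ij]; rewrite ?mulr1n ?mulr0n // ld.
have fM i s t : s != 0 -> t != 0 -> f i (s * t) = f i s * f i t.
  move=> s0 t0; rewrite {1}/f lM // conjM // !dl // -mulmxE mulmx_diag !mxE eqxx mulr1n.
  by rewrite /f.
have fQ i t : t != 0 -> (Q i i).[t] = t ^+ m * f i t.
  move=> t0; rewrite /f lP //; have -> : conj (im h) (t ^- m *: map_mx (horner_eval t) P) =
     t ^- m *: map_mx (horner_eval t) Q by rewrite QE /conj -scalerAr -scalerAl.
  by rewrite !mxE mulVKf ?expf_neq0 // horner_evalE.
have f1 i : f i 1 != 0.
  by rewrite /f l1 conj1 // mxE eqxx oner_eq0.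
have fE i : exists a : int, forall t, t != 0 -> f i t = t ^ a.
  have [||k kE] := @poly_multiplicative (Q i i).
  - by rewrite fQ ?oner_eq0 // expr1n mul1r.
  - by move=> s t s0 t0; rewrite !fQ ?mulf_neq0 // fM // exprMn; ring.
  exists (k%:Z - m%:Z) => t t0; rewrite expfzDr // -exprnP -kE // fQ //.
  by rewrite -exprnN mulrAC divff ?mul1r // expf_neq0.
have /choice[a aE] := fE; exists (\row_i a i); apply/funext => t; rewrite /lam.
case: eqP => [->//|/eqP t0]; apply: (can_inj (conjK imhU)); rewrite conjVK // dl //.
by congr diag_mx; apply/rowP => i; rewrite !mxE aE.
Qed.

Lemma lam_cochar (A : set MB) a : (forall t, t != 0 -> A (lam h a t)) -> cocharacter A (lam h a).
Proof.
move=> aA; split=> // [|s t s0 t0|]; first by rewrite /lam eqxx.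
  rewrite /lam mulf_eq0 (negPf s0) (negPf t0) /= -conjM //; congr conj.
  rewrite -mulmxE mulmx_diag; congr diag_mx; apply/rowP => i.
  by rewrite !mxE expfzMl.
pose m := (\sum_i absz (a 0%R i))%N.
have mi i : 0 <= m%:Z + a 0 i by rewrite /m (bigD1 i) //=; lia.
have [Q QE] := conj_polymx (im h)^-1 (diag_mx (\row_i 'X^(absz (m%:Z + a 0 i)))).
exists m, Q => t t0; rewrite QE /lam (negPf t0) /conj scalerAl scalerAr; congr (_ * _ * _).
rewrite map_diag_mx; apply/matrixP => i j; rewrite !mxE /= horner_evalE hornerXn.
have [k kE] : exists k : nat, m%:Z + a 0 i = k%:Z.
  by exists (absz (m%:Z + a 0 i)); have := mi i; lia.
have aE : a 0 i = k%:Z - m%:Z by rewrite -kE addrC addKr.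
by rewrite kE aE expfzDr // -exprnN -exprnP mulrnAr mulrC.
Qed.

Lemma cochar_basis_ex (A : set MB) : subgroup A -> F_diag iota h A ->
  exists k (c : 'I_k -> 'rV[int]_d.+1), (forall i, cocharacter A (lam h (c i))) /\
    cochar_basis A (fun i => lam h (c i)).
Proof.
move=> sA dA; pose L := [set a | forall t, t != 0 -> A (lam h a t)].
have [||k [B [BL BU]]] := @lattice_basis _ L.
- by move=> t t0; rewrite lam0; apply: sg1.
- by move=> x y Lx Ly t t0; rewrite lamD lamN; apply: sgM (Lx t t0) (sgV sA (Ly t t0)).
have BE z : z *m B = \sum_i z 0 i *: row i B by apply: mulmx_sum_row.
have cB i : cocharacter A (lam h (row i B)).
  by apply: lam_cochar; have := BL (delta_mx 0 i); rewrite -rowE.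
exists k, (fun i => row i B); split=> //; split=> // l Al.
have [a aE] := cochar_lam sA dA Al.
have [|z [zE zU]] := BU a; first by move=> t t0; case: Al => _ + _ _; rewrite -aE; apply.
exists z; split=> [t t0|z' z'E]; first by rewrite aE zE BE lam_sum.
apply: zU; apply: lam_inj => t t0.
by rewrite BE lam_sum -z'E // aE.
Qed.
End Cocharacters.

(** Rank is unchanged under field extension, so the claim is one over the rationals, where
    denominators can be cleared. *)
Lemma row_free_int_real (R : realType) k n (Z : 'M[int]_(k, n)) :
  (forall z : 'rV[int]_k, z *m Z = 0 -> z = 0) -> row_free (map_mx intr Z : 'M[R]_(k, n)).
Proof.
move=> Zi; have -> : map_mx intr Z = map_mx (ratr : rat -> R) (map_mx intr Z).
  by apply/matrixP => i j; rewrite !mxE ratr_int.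
rewrite row_free_map -kermx_eq0; apply/eqP/row_matrixP => i; rewrite row0.
have : row i (kermx (map_mx intr Z : 'M[rat]_(k, n))) *m map_mx intr Z = 0.
  by rewrite -row_mul mulmx_ker row0.
move: (row i _) => u uZ.
pose D := \prod_j denq (u 0 j); have D0 : D != 0.
  by rewrite prodf_seq_neq0; apply/allP => j _; rewrite denq_neq0.
pose z : 'rV[int]_k := \row_j (numq (u 0 j) * \prod_(l | l != j) denq (u 0 l)).
have zE : map_mx intr z = D%:~R *: u.
  apply/rowP => j; have DE : D = denq (u 0 j) * \prod_(l | l != j) denq (u 0 l) by rewrite /D (bigD1 j).
  rewrite !mxE DE !rmorphM /= -[X in _ = _ * X]divq_num_den.
  by field; rewrite intr_eq0 denq_neq0.
have : z = 0.
  apply: Zi; have : map_mx (intr : int -> rat) (z *m Z) = 0.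
    by rewrite map_mxM zE -scalemxAl uZ scaler0.
  move=> /matrixP h; apply/matrixP => a b; have := h a b; rewrite [LHS]mxE [RHS]mxE => /eqP.
  by rewrite intr_eq0 => /eqP ->; rewrite mxE.
move=> z0; move/rowP: zE => zE; apply/rowP => j; have := zE j.
rewrite z0 !mxE => /esym/eqP; rewrite mulf_eq0 intr_eq0 (negPf D0) => /eqP; by [].
Qed.

(** * Translations of an apartment by cocharacters *)

Section Translations.
Context (R : realType) (F : fieldType) (Fb : closedFieldType) (iota : {rmorphism F -> Fb}).
Context (d : nat) (omega : F -> int).
Local Notation MF := 'M[F]_d.+1.
Local Notation MB := 'M[Fb]_d.+1.
Context (J S : set MB) (B : building F Fb d R) (h : MF).
Implicit Types (x y : bpt B) (r : R).
Hypotheses (hB : is_building iota omega J B) (mS : max_split iota J S) (sS : subgroup S).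
Hypothesis (hS : F_diag iota h S).
Local Notation lamh := (lam iota h).
Let hU : h \is a GRing.unit. Proof. by case: hS. Qed.

(** [translate] with an arbitrary list of indices in place of the full enumeration, for
    induction. *)
Definition trl k (e : 'I_k -> Fb -> MB) (s : seq 'I_k) (v : 'rV[R]_k) (x : bpt B) :=
  foldr (fun i y => btr (e i) (v 0 i) y) x s.

Section Family.
Context (k : nat) (e : 'I_k -> Fb -> MB).
Hypothesis eS : forall i, cocharacter S (e i).

Lemma trl_apt s v x : bapt S x -> bapt S (trl e s v x).
Proof. by move=> Sx; elim: s => [//|i s IHs] /=; apply: (btr_apt hB). Qed.

Lemma btr_trl l r s v x : cocharacter S l -> bapt S x ->
  btr l r (trl e s v x) = trl e s v (btr l r x).
Proof.
move=> Sl Sx; elim: s => [//|i s IHs] /=.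
by rewrite (btrC hB _ _ mS Sl (eS i)) ?IHs //; apply: trl_apt.
Qed.

Lemma trlD s v w x : bapt S x -> trl e s (v + w) x = trl e s v (trl e s w x).
Proof.
move=> Sx; elim: s => [//|i s IHs] /=.
have St := trl_apt s w Sx.
rewrite mxE (btrD hB _ _ mS (eS i)); last exact: trl_apt.
by rewrite IHs -(btr_trl _ s v (eS i) St).
Qed.

Lemma trl0 s x : bapt S x -> trl e s 0 x = x.
Proof.
by move=> Sx; elim: s => [//|i s IHs] /=; rewrite IHs mxE (btr0 hB mS (eS i)).
Qed.
End Family.

(** Additivity in the cocharacter makes this translation idempotent, and additivity in [r] makes it
    invertible. *)
Lemma btr_lam0 r x : bapt S x -> btr (lamh 0) r x = x.
Proof.
move=> Sx; have c0 : cocharacter S (lamh 0).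
  by apply: lam_cochar => // t t0; rewrite (lam0 iota hU); apply: sg1.
have Sy : bapt S (btr (lamh 0) r x) by apply: (btr_apt hB).
have E : btr (lamh 0) r x = btr (lamh 0) r (btr (lamh 0) r x).
  rewrite -(btrM hB _ mS c0 c0 Sx); congr (btr _ r x).
  by apply/funext => t; rewrite (lam0 iota hU) mulr1.
have inv y : bapt S y -> btr (lamh 0) (- r) (btr (lamh 0) r y) = y.
  by move=> Sy'; rewrite -(btrD hB _ _ mS c0 Sy') addNr (btr0 hB mS c0).
by rewrite -[LHS](inv _ Sy) -E inv.
Qed.

Lemma lam_closedZ a (m : int) : cocharacter S (lamh a) -> cocharacter S (lamh (m *: a)).
Proof.
move=> [_ Sa _ _]; apply: lam_cochar => // t t0; rewrite (lamZ iota hU).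
have S1 n : S (lamh a t ^+ n).
  by elim: n => [|n IHn]; rewrite ?expr0 ?exprS; [apply: sg1|apply: sgM => //; apply: Sa].
case: m => n; first exact: S1.
by rewrite NegzE -exprnN; apply: sgV.
Qed.

Lemma lam_closedD a b : cocharacter S (lamh a) -> cocharacter S (lamh b) ->
  cocharacter S (lamh (a + b)).
Proof.
move=> [_ Sa _ _] [_ Sb _ _]; apply: lam_cochar => // t t0; rewrite (lamD iota hU).
by apply: sgM; [exact: sS|apply: Sa|apply: Sb].
Qed.

Lemma btr_lamD a b r x : cocharacter S (lamh a) -> cocharacter S (lamh b) -> bapt S x ->
  btr (lamh (a + b)) r x = btr (lamh a) r (btr (lamh b) r x).
Proof. by move=> Sa Sb Sx; rewrite (lamD iota hU) (btrM hB _ mS Sa Sb Sx). Qed.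

Lemma btr_lamZ a (m : int) r x : cocharacter S (lamh a) -> bapt S x ->
  btr (lamh (m *: a)) r x = btr (lamh a) (r * m%:~R) x.
Proof.
move=> Sa Sx; have nat n y : bapt S y -> btr (lamh (n%:Z *: a)) r y = btr (lamh a) (r * n%:R) y.
  move=> Sy; elim: n => [|n IHn].
    by rewrite scale0r btr_lam0 // mulr0 (btr0 hB mS Sa Sy).
  rewrite intS scalerDl scale1r btr_lamD // ?IHn; last exact: lam_closedZ.
  by rewrite -(btrD hB _ _ mS Sa Sy) mulrS mulrDr mulr1.
case: m => n; first exact: nat.
rewrite NegzE scaleNr -scalerN.
have SN : cocharacter S (lamh (n.+1%:Z *: - a)) by rewrite scalerN -scaleNr; apply: lam_closedZ.
pose y := btr (lamh a) (r * (- n.+1%:Z)%:~R) x.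
have Sy : bapt S y by apply: (btr_apt hB).
have xE : x = btr (lamh (n.+1%:Z *: a)) r y.
  rewrite nat // /y -(btrD hB _ _ mS Sa Sx) rmorphN /= mulrN.
  by rewrite -pmulrn subrr (btr0 hB mS Sa).
rewrite [in LHS]xE -btr_lamD //; last exact: lam_closedZ.
by rewrite scalerN addNr btr_lam0.
Qed.

Lemma btr_lam_comb k (c : 'I_k -> 'rV[int]_d.+1) (z : 'rV[int]_k) r x :
  (forall i, cocharacter S (lamh (c i))) -> bapt S x ->
  btr (lamh (\sum_i z 0 i *: c i)) r x = translate (fun i => lamh (c i)) (r *: map_mx intr z) x.
Proof.
move=> Sc Sx; rewrite /translate -/(trl _ _ _ _) -big_enum /=.
elim: (enum 'I_k) => [|i s IHs] /=; first by rewrite big_nil btr_lam0.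
rewrite big_cons btr_lamD //; last first.
- elim/big_ind: _ => //; [|exact: lam_closedD|by move=> j _; apply: lam_closedZ].
  by have := lam_closedZ 0 (Sc i); rewrite scale0r.
- exact: lam_closedZ.
rewrite btr_lamZ ?IHs //; first by rewrite !mxE.
exact: trl_apt.
Qed.

Lemma translate_comb k k' (c : 'I_k -> 'rV[int]_d.+1) (l : 'I_k' -> Fb -> MB)
    (Z : 'M[int]_(k', k)) v x :
  (forall i, cocharacter S (lamh (c i))) -> (forall i, cocharacter S (l i)) ->
  (forall i, l i = lamh (\sum_j Z i j *: c j)) -> bapt S x ->
  translate l v x = translate (fun i => lamh (c i)) (v *m map_mx intr Z) x.
Proof.
move=> Sc Sl lE Sx; rewrite mulmx_sum_row -big_enum /= {1}/translate -/(trl _ _ _ _).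
elim: (enum 'I_k') => [|i s IHs] /=.
  by rewrite big_nil /translate -/(trl _ _ _ _) trl0.
rewrite big_cons /translate -/(trl _ _ _ _) trlD // IHs lE.
have -> : \sum_j Z i j *: c j = \sum_j (row i Z) 0 j *: c j.
  by apply: eq_bigr => j _; rewrite mxE.
rewrite btr_lam_comb //; last exact: trl_apt.
by rewrite /translate -/(trl _ _ _ _) map_row.
Qed.

Context (A : set MB) (k : nat) (eA : 'I_k -> Fb -> MB).
Hypotheses (sA : subgroup A) (AS : A `<=` S) (bA : cochar_basis A eA).
Let eS i : cocharacter S (eA i).
Proof. by case: bA => /(_ i) + _; apply: cochar_sub. Qed.

(** Simple transitivity concerns a basis of the cocharacters of the maximal split torus S, whereas
    [eA] is a basis for the subtorus A. Expressing [eA] in a basis for S gives an integral matrix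
    whose rows are independent, also over the reals. *)
Lemma translate_inj x : bapt S x -> injective (fun v : 'rV[R]_k => translate eA v x).
Proof.
move=> Sx; have [n [c [Sc [_ bS]]]] := cochar_basis_ex hU sS hS.
have /choice[z zP] : forall i, exists z : 'rV[int]_n, eA i = lamh (\sum_j z 0 j *: c j).
  move=> i; have [z [zE _]] := bS _ (eS i); exists z; apply/funext => t.
  have [->|t0] := eqVneq t 0; first by rewrite /lam eqxx; case: (eS i).
  by rewrite (lam_sum iota hU) zE.
pose Z : 'M[int]_(k, n) := \matrix_(i, j) z i 0 j.
have zZ i : eA i = lamh (\sum_j Z i j *: c j).
  by rewrite zP; congr lam; apply: eq_bigr => j _; rewrite mxE.
move=> v w; rewrite !(translate_comb _ Sc eS zZ Sx) => E.
have bS' : cochar_basis S (fun i => lamh (c i)) by [].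
have [u [_ uU]] := btr_simply_transitive hB mS bS' Sx
  (trl_apt Sc (enum 'I_n) (v *m map_mx intr Z) Sx).
have vwZ : v *m map_mx intr Z = w *m map_mx intr Z by rewrite -(uU _ erefl); apply: uU.
have rf : row_free (map_mx intr Z : 'M[R]_(k, n)).
  apply: row_free_int_real => y yZ.
  (* A relation between the rows of [Z] writes the trivial cocharacter in terms of [eA], where
     coordinates are unique. *)
  have l1 : cocharacter A (fun=> 1).
    split=> // [t _|*|]; [exact: sg1|by rewrite mulr1|].
    by exists 0%N, 1%:M => t _; rewrite expr0 invr1 scale1r map_mx1.
  case: bA => _ /(_ _ l1)[y0 [_ y0U]].
  rewrite -(y0U y); first by apply: y0U => t t0; rewrite big1 // => i _; rewrite mxE expr0z.
  move=> t t0; under eq_bigr do rewrite zZ.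
  rewrite -(lam_sum iota hU) (_ : \sum_i _ = 0) ?(lam0 iota hU) //.
  under eq_bigr do rewrite scaler_sumr.
  rewrite exchange_big big1 //= => j _; under eq_bigr do rewrite scalerA.
  by rewrite -scaler_suml; have /rowP/(_ j) := yZ; rewrite !mxE => ->; rewrite scale0r.
by apply: (row_free_inj rf).
Qed.

End Translations.

Lemma levi_closed (F : fieldType) (Fb : closedFieldType) (iota : {rmorphism F -> Fb}) d
    (G M : set 'M[Fb]_d.+1) : levi iota G M -> zclosed M /\ subgroup M.
Proof. by move=> [P [U [_ _ [[[cM sM] _] _] _ _]]]. Qed.

Section ApartmentAction.
Context (R : realType) (F : nonarchLocalFieldType) (Fb : closedFieldType).
Context (iota : {rmorphism F -> Fb}) (d : nat) (C : closedFieldType).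
Local Notation MF := 'M[F]_d.+1.
Local Notation im := (map_mx iota : MF -> 'M[Fb]_d.+1).

Lemma translate_admissible (J H S : set 'M[Fb]_d.+1) (B B' : building F Fb d R)
    (omega : F -> int) (f : bpt B -> bpt B') k (e : 'I_k -> Fb -> 'M[Fb]_d.+1) v x :
  is_building iota omega J B -> admissible iota J H f -> max_split iota J S ->
  bapt S x -> (forall i, cocharacter S (e i)) ->
  f (translate e v x) = translate e v (f x).
Proof.
move=> hB [_ _ fA] mS Sx eS; have [S' [_ _ _ ftr]] := fA S mS.
rewrite /translate -/(trl _ _ _ _) -/(trl _ _ _ _).
elim: (enum _) => [//|i s IHs] /=; rewrite ftr ?IHs //.
exact: (trl_apt hB mS eS).
Qed.

Context (E : apartment_data R F Fb d) (X : cover_data C E).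
Hypothesis SX : cover_setup iota X.
Local Notation pts := 'rV[R]_(adim E).
Local Notation N := (aN E).

(** A_M is a split torus in the centre of M, so it lies in each maximal split torus of M. *)
Lemma levi_apartment : exists S, [/\ max_split iota (cM X) S, aA E `<=` S & bapt S (cx0 X)].
Proof.
have [cM sM] := levi_closed (M_levi SX).
have [S mS Sx] := bapt_cover (BM_building SX) (cx0 X); exists S; split=> //.
have [[tA AM] _] := A_max_split SX.
exact: (max_split_central cM sM mS tA AM).
Qed.

Lemma group_apartment : exists S h, [/\ max_split iota (cG X) S, subgroup S, F_diag iota h S,
  aA E `<=` S & bapt S (cemb (cx0 X)) /\
    forall v, point X v = translate (@aC _ _ _ _ E) v (cemb (cx0 X))].
Proof.
have [S0 [mS0 AS0 S0x]] := levi_apartment.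
have [_ _ /(_ S0 mS0)[S [mS S0S Sapt _]]] := emb_admissible SX.
have [sS _ [h hS]] := split_torus_diag mS.1.1.
exists S, h; split=> //; first exact: subset_trans S0S.
split=> [|v]; first by apply: Sapt; exists (cx0 X).
apply: (translate_admissible _ (BM_building SX) (emb_admissible SX) mS0 S0x) => i.
by case: (C_basis SX) => /(_ i) + _; apply: cochar_sub.
Qed.

Lemma aA_subgroup : subgroup (aA E).
Proof. by case: (A_max_split SX) => -[/split_torus_diag[]]. Qed.

Lemma point_inj : injective (@point _ _ _ _ _ _ X).
Proof.
have [S [h [mS sS hS AS [Sx pE]]]] := group_apartment => v w; rewrite !pE.
exact: (translate_inj (BG_building SX) mS sS hS aA_subgroup AS (C_basis SX) Sx).
Qed.

Lemma N_normalizes n : N n -> [/\ Fpts iota (cG X) n, n \is a GRing.unit &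
  setconj (im n) (cM X) = cM X].
Proof.
move=> Nn; have nU := sgU (N_subgroup SX) Nn.
by have [_ [[Gn nM] _]] := N_sub SX Nn; split.
Qed.

(** n normalizes M, hence A_M. Its conjugation action on the cocharacters of A_M is an integral
    matrix, and [btr_conj] turns this matrix into the linear part of the action on points. *)
Lemma bact_affine n : N n -> exists (w0 : pts) (Z : 'M[R]_(adim E)),
  forall v, bact n (point X v) = point X (w0 + v *m Z).
Proof.
move=> Nn; have [S [h [mS sS hS AS [Sx pE]]]] := group_apartment.
have [Gn nU nM] := N_normalizes Nn; have hB := BG_building SX.
have hU : h \is a GRing.unit by case: hS.
have [w0 w0E] : exists v, bact n (point X 0) = point X v by case: (N_sub SX Nn) => _ [].
have [cM sM] := levi_closed (M_levi SX).
have nA := max_split_conj cM sM (A_max_split SX) nU nM.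
have [cA bA] := C_basis SX.
have cS i : cocharacter S (@aC _ _ _ _ E i) by apply: cochar_sub (cA i).
have cn i : cocharacter (aA E) (fun t => conj (im n) (@aC _ _ _ _ E i t)) by apply: cochar_conj.
have /choice[c cE] : forall i, exists c, @aC _ _ _ _ E i = lam iota h c.
  by move=> i; apply: (cochar_lam hU sS hS).
have cSl i : cocharacter S (lam iota h (c i)) by rewrite -cE.
have /choice[z zP] : forall i, exists z : 'rV[int]_(adim E),
    (fun t => conj (im n) (@aC _ _ _ _ E i t)) = lam iota h (\sum_j z 0 j *: c j).
  move=> i; have [z [zE _]] := bA _ (cn i); exists z; apply/funext => t.
  have [->|t0] := eqVneq t 0; first by rewrite /lam eqxx; case: (cn i).
  by rewrite zE // (lam_sum iota hU); apply: eq_bigr => j _; rewrite cE.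
pose Z : 'M[int]_(adim E) := \matrix_(i, j) z i 0 j.
exists w0, (map_mx intr Z) => v.
have S0 : bapt S (point X 0) by rewrite pE; apply: (trl_apt hB mS cS).
have Sw : bapt S (point X w0) by rewrite pE; apply: (trl_apt hB mS cS).
have p0 : cemb (cx0 X) = point X 0 by rewrite pE /translate -/(trl _ _ _ _) (trl0 hB mS cS).
have -> : bact n (point X v) = translate (fun i t => conj (im n) (@aC _ _ _ _ E i t)) v (point X w0).
  rewrite pE p0 -w0E /translate -/(trl _ _ _ _) -/(trl _ _ _ _).
  elim: (enum _) => [//|i s IHs] /=; rewrite -IHs (btr_conj hB _ Gn mS (cS i)) //.
  exact: (trl_apt hB mS cS).
have aCE : @aC _ _ _ _ E = fun i => lam iota h (c i) by apply/funext => i.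
have cnE i : (fun t => conj (im n) (@aC _ _ _ _ E i t)) = lam iota h (\sum_j Z i j *: c j).
  by rewrite zP; congr lam; apply: eq_bigr => j _; rewrite mxE.
have cnS i : cocharacter S (fun t => conj (im n) (@aC _ _ _ _ E i t)).
  exact: cochar_sub AS (cn i).
rewrite (translate_comb hB mS sS hS v cSl cnS cnE Sw) -aCE.
rewrite addrC [RHS]pE; have := trlD hB mS cS (enum 'I_(adim E)) (v *m map_mx intr Z) w0 Sx.
by move=> tE; rewrite [RHS]tE pE.
Qed.

Lemma bact_act n v : N n -> bact n (point X v) = point X (act X n v).
Proof.
move=> Nn; have [w0 [Z wE]] := bact_affine Nn; rewrite /act.
by case: xgetP => [w _ //|/(_ (w0 + v *m Z))]; case; apply: wE.
Qed.

Lemma act_eq n v w : N n -> bact n (point X v) = point X w -> act X n v = w.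
Proof. by move=> Nn; rewrite bact_act // => /point_inj. Qed.

Lemma act_affine n : N n -> exists Z : 'M[R]_(adim E), forall v, act X n v = act X n 0 + v *m Z.
Proof.
move=> Nn; have [w0 [Z wE]] := bact_affine Nn; exists Z => v.
by rewrite (act_eq Nn (wE v)) (act_eq Nn (wE 0)) mul0mx addr0.
Qed.

Lemma actM m n v : N m -> N n -> act X (m * n) v = act X m (act X n v).
Proof.
move=> Nm Nn; apply: act_eq; first exact: sgM (N_subgroup SX) Nm Nn.
have [[Gm _ _] [Gn _ _]] := (N_normalizes Nm, N_normalizes Nn).
by rewrite (bactM (BG_building SX)) // !bact_act.
Qed.

Lemma act1 v : act X 1 v = v.
Proof. by apply: act_eq; [exact: sg1 (N_subgroup SX)|rewrite (bact1 (BG_building SX))]. Qed.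

Lemma actK n : N n -> cancel (act X n) (act X n^-1).
Proof.
move=> Nn v; have NV := sgV (N_subgroup SX) Nn.
by rewrite -actM // mulVr ?act1 //; case: (N_normalizes Nn).
Qed.
Lemma actVK n : N n -> cancel (act X n^-1) (act X n).
Proof.
move=> Nn v; have NV := sgV (N_subgroup SX) Nn.
by rewrite -actM // mulrV ?act1 //; case: (N_normalizes Nn).
Qed.

End ApartmentAction.

Section ApartmentComparison.
Context (R : realType) (F : nonarchLocalFieldType) (Fb : closedFieldType).
Context (iota : {rmorphism F -> Fb}) (d : nat) (C : closedFieldType).
Context (D : comparison_data R F Fb d C).
Hypothesis SD : comparison_setup iota D.

(** [dembG] is equivariant and, by the commutative square, sends the point with coordinates v for
    G^0 to the one with the same coordinates for G. *)
Lemma act_comparison n : aN (dE D) n -> act (dX D) n = act (dX0 D) n.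
Proof.
move=> Nn; apply/funext => v; have S0 := setup0 SD; have S1 := setup1 SD.
have pE w : dembG (point (dX0 D) w) = point (dX D) w.
  rewrite /point (emb_commute SD); congr cemb.
  have [S [mS AS Sx]] := levi_apartment S0.
  rewrite (translate_admissible _ (BM_building S0) (embM_admissible SD) mS Sx) ?(x0_eq SD) //.
  by move=> i; case: (C_basis S0) => /(_ i) + _; apply: cochar_sub.
apply: (act_eq S1) => //; rewrite -!pE; have [Gn _ _] := N_normalizes S0 Nn.
by have [_ <- // _] := embG_admissible SD; rewrite (bact_act S0).
Qed.
End ApartmentComparison.

(** * Galleries and chambers *)

Section Hyperplanes.
Context (R : realType) (m : nat).
Local Notation pts := 'rV[R]_m.
Implicit Types (a : 'cV[R]_m) (c : R) (x y z v w : pts) (H : set pts).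

Definition aff a c v : R := (v *m a) 0 0 - c.
Definition pt x y (t : R) : pts := x + t *: (y - x).

Lemma aff_pt a c x y t : aff a c (pt x y t) = aff a c x + t * (aff a c y - aff a c x).
Proof. by rewrite /aff /pt mulmxDl -scalemxAl mulmxBl !mxE; ring. Qed.

Lemma pt0 x y : pt x y 0 = x. Proof. by rewrite /pt scale0r addr0. Qed.
Lemma pt1 x y : pt x y 1 = y. Proof. by rewrite /pt scale1r addrC subrK. Qed.

Lemma ball_row x (e : R) y : ball x e y -> 0 < e /\ forall i, `|x 0 i - y 0 i| < e.
Proof. by move=> [e0 b]; split=> // i; apply: (b 0 i). Qed.
Lemma row_ball x (e : R) y : 0 < e -> (forall i, `|x 0 i - y 0 i| < e) -> ball x e y.
Proof. by move=> e0 b; split=> // i j; rewrite (ord1 i); apply: b. Qed.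

Lemma aff_near a c x (e : R) : 0 < e ->
  exists2 r, 0 < r & forall y, ball x r y -> `|aff a c y - aff a c x| < e.
Proof.
move=> e0; pose M := 1 + \sum_i `|a i 0|.
have M0 : 0 < M by rewrite ltr_pwDl // sumr_ge0.
exists (e / M); first exact: divr_gt0.
move=> y /ball_row[_ xy].
have -> : aff a c y - aff a c x = \sum_i (y - x) 0 i * a i 0.
  by transitivity (((y - x) *m a) 0 0); [rewrite mulmxBl /aff !mxE; ring|rewrite mxE].
have h i : `|(y - x) 0 i * a i 0| <= e / M * `|a i 0|.
  by rewrite normrM ler_wpM2r // !mxE distrC ltW.
apply: le_lt_trans (ler_norm_sum _ _ _) _; apply: le_lt_trans (ler_sum _ (fun i _ => h i)) _.
rewrite -mulr_sumr mulrAC ltr_pdivrMr // ltr_pM2l // /M ltrDr //.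
Qed.

Lemma pt_near x y (e : R) : 0 < e -> exists2 r, 0 < r & forall t, 0 <= t -> t < r -> ball x e (pt x y t).
Proof.
move=> e0; pose M := 1 + \sum_i `|(y - x) 0 i|.
have M0 : 0 < M by rewrite ltr_pwDl // sumr_ge0.
exists (e / M); first exact: divr_gt0.
move=> t t0; rewrite ltr_pdivlMr // => tM; apply: row_ball => // i.
rewrite /pt !mxE opprD addNKr normrN normrM ger0_norm //.
apply: le_lt_trans tM; apply: ler_wpM2l => //; rewrite /M (bigD1 i) //= !mxE.
rewrite addrCA lerDl addr_ge0 //; exact: sumr_ge0.
Qed.

Lemma ball_convex x (e : R) y t : ball x e y -> 0 <= t -> t <= 1 -> ball x e (pt x y t).
Proof.
move=> /ball_row[e0 b] t0 t1; apply: row_ball => // i; apply: le_lt_trans (b i).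
rewrite /pt !mxE opprD addNKr normrN normrM ger0_norm // distrC.
by rewrite ler_piMl.
Qed.

Lemma pt_nbhs x y (W : set pts) : nbhs x W -> exists2 r : R, 0 < r & forall t, 0 <= t -> t < r -> W (pt x y t).
Proof.
move=> /nbhs_ballP[e e0 eW]; have [r r0 rP] := pt_near x y e0.
by exists r => // t t0 tr; apply/eW/rP.
Qed.

Lemma aff_nbhs_neq0 a c x : aff a c x != 0 -> nbhs x [set y | aff a c y != 0].
Proof.
move=> a0; have [|r r0 rP] := @aff_near a c x `|aff a c x|; first by rewrite normr_gt0.
apply/nbhs_ballP; exists r => // y /rP; rewrite /=.
by apply: contraTneq => ->; rewrite sub0r normrN ltxx.
Qed.

(** One form at a time: a point where the new form vanishes is pushed slightly towards a point where
    it does not, within the open set where the earlier forms stay non-zero. *)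
Lemma generic_point (l : seq ('cV[R]_m * R)) x (W : set pts) : nbhs x W ->
  (forall ac, ac \in l -> exists v, aff ac.1 ac.2 v != 0) ->
  exists2 y, nbhs y W & forall ac, ac \in l -> aff ac.1 ac.2 y != 0.
Proof.
move=> xW; elim: l => [|[a c] l IHl] nz; first by exists x.
have [ac acl|y yW yP] := IHl; first by apply: nz; rewrite inE acl orbT.
have [ay|ay] := eqVneq (aff a c y) 0; last first.
  by exists y => // ac; rewrite inE => /orP[/eqP ->|/yP].
have [v av] := nz (a, c) (mem_head _ _).
have nl : nbhs y [set z | forall ac, ac \in l -> aff ac.1 ac.2 z != 0].
  elim: l {IHl nz} yP => [|ac l IHl] yP; first by near=> z.
  have h1 := aff_nbhs_neq0 (yP _ (mem_head _ _)).
  have h2 : nbhs y [set z | forall ac, ac \in l -> aff ac.1 ac.2 z != 0].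
    by apply: IHl => ac' ac'l; apply: yP; rewrite inE ac'l orbT.
  apply: filterS (filterI h1 h2) => z [z1 z2] ac'; rewrite inE => /orP[/eqP -> //|]; exact: z2.
have [r r0 rP] := pt_nbhs v (filterI (nbhs_interior yW) nl).
have r20 : 0 < r / 2 by rewrite divr_gt0.
have r2r : r / 2 < r by rewrite ltr_pdivrMr // ltr_pMr // ltr1n.
have [z1 z2] := rP (r / 2) (ltW r20) r2r.
exists (pt y v (r / 2)) => // ac; rewrite inE => /orP[/eqP -> /=|]; last exact: z2.
by rewrite aff_pt ay add0r subr0 mulf_neq0 // gt_eqF.
Unshelve. all: by end_near.
Qed.
End Hyperplanes.

Lemma min_real (R : realType) (T : eqType) (s : seq T) (t : T -> R) : s != [::] ->
  exists2 x, x \in s & forall y, y \in s -> t x <= t y.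
Proof.
elim: s => [//|x s IHs] _; have [->|s0] := eqVneq s [::].
  by exists x; rewrite ?inE // => y; rewrite inE => /eqP ->.
have [y ys yP] := IHs s0; have [xy|yx] := leP (t x) (t y).
  exists x; rewrite ?inE ?eqxx // => z; rewrite inE => /orP[/eqP -> //|/yP].
  exact: le_trans.
exists y; rewrite ?inE ?ys ?orbT // => z; rewrite inE => /orP[/eqP ->|/yP //].
exact: ltW.
Qed.

Lemma finite_set_seq (T : choiceType) (A : set T) : finite_set A ->
  exists s : seq T, A = [set` s].
Proof. by move=> /finite_fsetP[B ->]; exists (enum_fset B). Qed.

(** * Sides of hyperplanes, separation and generic segments *)

Section Chambers.
Context (R : realType) (F : nonarchLocalFieldType) (Fb : closedFieldType) (d : nat).
Context (E : apartment_data R F Fb d).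
Local Notation pts := 'rV[R]_(adim E).
Implicit Types (x y z v w : pts) (H : set pts).
Hypothesis sysH : hyperplane_system E.

Lemma aH_form H : @aH _ _ _ _ E H -> exists a c, a != 0 /\ H = [set v | aff a c v = 0].
Proof.
case: sysH => hyp _ _ /hyp[a [c [a0 ->]]]; exists a, c; split=> //.
apply/seteqP; split=> v /=; rewrite /aff; first by move=> ->; rewrite subrr.
by move/eqP; rewrite subr_eq0 => /eqP.
Qed.

Lemma gen0 : gen (0 : pts).
Proof. by case: sysH => _ n0 _ [H hH]; apply: n0. Qed.

Lemma genN x H : gen x -> @aH _ _ _ _ E H -> ~ H x.
Proof. by move=> gx hH Hx; apply: gx; exists H. Qed.

Definition sameS H x y := [/\ ~ H x, ~ H y & ~ opposite_sides H x y].

Section OneHyperplane.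
Context (H : set pts) (a : 'cV[R]_(adim E)) (c : R).
Hypotheses (a0 : a != 0) (HE : H = [set v | aff a c v = 0]).
Local Notation al := (aff a c).

Lemma form_neq0 x : ~ H x <-> al x != 0.
Proof. by rewrite HE /=; split=> [/eqP|/eqP]. Qed.

(** [opposite_sides] may use any equation of H. If one of them changes sign between x and y, the
    segment meets H at the parameter p / (p - q); the fixed form vanishes at the same point, and so
    it changes sign as well. *)
Lemma oppE x y : opposite_sides H x y <-> al x * al y < 0.
Proof.
split=> [[a' [c' [[_ HE'] lt0]]]|lt0]; last first.
  exists a, c; split=> //; split=> //; rewrite HE; apply/seteqP; split=> v /=; rewrite /aff.
    by move/eqP; rewrite subr_eq0 => /eqP.
  by move=> ->; rewrite subrr.
rewrite -/(aff a' c' x) -/(aff a' c' y) in lt0.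
have Hv v : H v <-> aff a' c' v = 0.
  rewrite HE' /aff; split=> /=; first by move=> ->; rewrite subrr.
  by move/eqP; rewrite subr_eq0 => /eqP.
set p := aff a' c' x in lt0; set q := aff a' c' y in lt0.
have p0 : p != 0 by apply: contraTneq lt0 => ->; rewrite mul0r ltxx.
have pq0 : p - q != 0.
  by rewrite subr_eq0; apply: contraTneq lt0 => ->; rewrite -expr2 -leNgt sqr_ge0.
pose t := p / (p - q).
have t0 : 0 < t.
  have : 0 < p * (p - q) by rewrite mulrBr subr_gt0 (lt_le_trans lt0) // -expr2 sqr_ge0.
  have -> : t = p * (p - q) / (p - q) ^+ 2 by rewrite /t; field.
  by move=> h; rewrite divr_gt0 // exprn_even_gt0.
have t1 : 0 < 1 - t.
  have -> : 1 - t = (- q) * (p - q) / (p - q) ^+ 2 by rewrite /t; field.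
  rewrite divr_gt0 ?exprn_even_gt0 //= mulNr mulrBr opprB subr_gt0 mulrC.
  by rewrite (lt_le_trans lt0) // -expr2 sqr_ge0.
have : H (pt x y t) by apply/Hv; rewrite aff_pt -/p -/q /t; field.
rewrite HE /= aff_pt => /eqP e; have {}e : (1 - t) * al x = - (t * al y).
  by apply/eqP; rewrite -addr_eq0 -(eqP e); apply/eqP; ring.
have ax : al x != 0.
  by apply/form_neq0 => /Hv; move/eqP: p0.
have h : (1 - t) * (al x * al x) = - (t * (al x * al y)) by rewrite [LHS]mulrA e; ring.
have : 0 < - (t * (al x * al y)).
  by rewrite -h mulr_gt0 // -expr2 exprn_even_gt0.
by rewrite oppr_gt0 pmulr_rlt0.
Qed.

Lemma sameSE x y : sameS H x y <-> 0 < al x * al y.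
Proof.
split=> [[/form_neq0 x0 /form_neq0 y0 n]|p].
  by rewrite lt_neqAle eq_sym mulf_neq0 //= leNgt; apply/negP => /oppE.
split; try by apply/form_neq0; apply: contraTneq p => ->; rewrite ?mul0r ?mulr0 ltxx.
by move/oppE => /(lt_trans p); rewrite ltxx.
Qed.
End OneHyperplane.

Lemma pos_trans (u v w : R) : 0 < u * v -> 0 < v * w -> 0 < u * w.
Proof.
move=> uv vw; have : 0 < (u * w) * v ^+ 2.
  by have -> : (u * w) * v ^+ 2 = (u * v) * (v * w); [ring|rewrite mulr_gt0].
by rewrite pmulr_lgt0 // exprn_even_gt0 //=; apply: contraTneq uv => ->; rewrite mulr0 ltxx.
Qed.

Lemma sameS_sym H x y : @aH _ _ _ _ E H -> sameS H x y -> sameS H y x.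
Proof.
move=> /aH_form[a [c [a0 HE]]] /(sameSE a0 HE) h; apply/(sameSE a0 HE).
by rewrite mulrC.
Qed.
Lemma sameS_refl H x : @aH _ _ _ _ E H -> ~ H x -> sameS H x x.
Proof.
move=> /aH_form[a [c [a0 HE]]] /(form_neq0 HE) h; apply/(sameSE a0 HE).
by rewrite -expr2 exprn_even_gt0.
Qed.
Lemma sameS_trans H x y z : @aH _ _ _ _ E H -> sameS H x y -> sameS H y z -> sameS H x z.
Proof.
move=> /aH_form[a [c [a0 HE]]] /(sameSE a0 HE) h /(sameSE a0 HE) h'; apply/(sameSE a0 HE).
exact: pos_trans h h'.
Qed.
Lemma opp_sym H x y : @aH _ _ _ _ E H -> opposite_sides H x y -> opposite_sides H y x.
Proof.
by move=> /aH_form[a [c [a0 HE]]] /(oppE a0 HE) h; apply/(oppE a0 HE); rewrite mulrC.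
Qed.
Lemma opp_same H x y z : @aH _ _ _ _ E H -> opposite_sides H x y -> sameS H y z ->
  opposite_sides H x z.
Proof.
move=> /aH_form[a [c [a0 HE]]] /(oppE a0 HE) h /(sameSE a0 HE) h'; apply/(oppE a0 HE).
by rewrite -oppr_gt0 -mulNr; apply: pos_trans h'; rewrite mulNr oppr_gt0.
Qed.
Lemma opp_opp H x y z : @aH _ _ _ _ E H -> opposite_sides H x y -> opposite_sides H y z ->
  sameS H x z.
Proof.
move=> /aH_form[a [c [a0 HE]]] /(oppE a0 HE) h /(oppE a0 HE) h'; apply/(sameSE a0 HE).
by rewrite -[_ * _]mulrNN; apply: (@pos_trans _ (aff a c y)); rewrite ?mulNr ?mulrN oppr_gt0.
Qed.
Lemma opp_not H x y : @aH _ _ _ _ E H -> opposite_sides H x y -> ~ H x /\ ~ H y.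
Proof.
move=> /aH_form[a [c [a0 HE]]] /(oppE a0 HE) h; split; apply/(form_neq0 HE);
  by apply: contraTneq h => ->; rewrite ?mul0r ?mulr0 ltxx.
Qed.

Lemma sepP x y H : gen x -> gen y -> sep x y H <-> @aH _ _ _ _ E H /\ opposite_sides H x y.
Proof. by move=> gx gy; split=> [[]|[]] //; split. Qed.
Lemma nsep_same x y H : gen x -> gen y -> @aH _ _ _ _ E H -> ~ sep x y H -> sameS H x y.
Proof.
by move=> gx gy hH ns; split; [exact: genN|exact: genN|move=> o; apply/ns/sepP].
Qed.
Lemma sep_sym x y : sep x y = sep y x.
Proof.
by apply/seteqP; split=> H [hH gx gy o]; split=> //; apply: opp_sym.
Qed.
Lemma sep_xor x y z H : gen x -> gen y -> gen z ->
  sep x z H <-> ((sep x y H /\ ~ sep y z H) \/ (~ sep x y H /\ sep y z H)).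
Proof.
move=> gx gy gz; split=> [[hH _ _ o]|[[[hH _ _ o] n]|[n [hH _ _ o]]]].
- have [[_ _ _ o1]|n1] := pselect (sep x y H).
    left; split; first by split.
    by move=> [_ _ _ o2]; have [_ _] := opp_opp hH o1 o2.
  right; split=> //; split=> //.
  by apply: opp_sym => //; apply: (opp_same hH (opp_sym hH o)); apply: nsep_same.
- by split=> //; apply: (opp_same hH o); apply: nsep_same.
- split=> //; apply: opp_sym => //; apply: (opp_same hH (opp_sym hH o)).
  by apply: sameS_sym => //; apply: nsep_same.
Qed.

Lemma segment_cross H x y : @aH _ _ _ _ E H -> ~ H x -> ~ H y ->
  (sameS H x y /\ forall s, 0 <= s <= 1 -> sameS H x (pt x y s)) \/
  (opposite_sides H x y /\ exists t : R, [/\ 0 < t < 1, H (pt x y t),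
    forall s, 0 <= s -> s < t -> sameS H x (pt x y s) &
    forall s, t < s -> opposite_sides H x (pt x y s)]).
Proof.
move=> /aH_form[a [c [a0 HE]]] /(form_neq0 HE) x0 /(form_neq0 HE) y0.
have sq : 0 < aff a c x * aff a c x by rewrite -expr2 exprn_even_gt0.
have aE s : aff a c x * aff a c (pt x y s) =
    (1 - s) * (aff a c x * aff a c x) + s * (aff a c x * aff a c y) by rewrite aff_pt; ring.
set p := aff a c x in x0 sq aE *; set q := aff a c y in y0 aE *.
have [pq|pq|/eqP] := ltgtP (p * q) 0; last by rewrite mulf_eq0 (negPf x0) (negPf y0).
  right; split; first exact/(oppE a0 HE).
  have D0 : 0 < p * p - p * q by rewrite subr_gt0 (lt_trans pq).
  exists (p * p / (p * p - p * q)); split.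
  - by rewrite divr_gt0 //= ltr_pdivrMr // mul1r ltrBrDr gtrDl.
  - rewrite HE /= aff_pt -/p -/q; field.
    by rewrite -[X in X != 0]/(p * p - p * q) gt_eqF.
  - move=> s s0; rewrite ltr_pdivlMr // => st; apply/(sameSE a0 HE).
    by rewrite aE; move: st; rewrite -subr_gt0; congr (_ < _); ring.
  - move=> s; rewrite ltr_pdivrMr // => st; apply/(oppE a0 HE).
    by rewrite aE; move: st; rewrite -subr_lt0; congr (_ < _); ring.
left; split; first exact/(sameSE a0 HE).
move=> s /andP[s0 s1]; apply/(sameSE a0 HE); rewrite aE.
have [->|ns] := eqVneq s 1; first by rewrite subrr mul0r add0r mul1r.
apply: ltr_pwDl; last by rewrite mulr_ge0 // ltW.
by rewrite mulr_gt0 // subr_gt0 lt_neqAle ns.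
Qed.

(** Local finiteness leaves finitely many hyperplanes to avoid. Balls are convex, so a hyperplane
    separating h from v would meet the ball. *)
Lemma local_chamber h : exists2 e : R, 0 < e & forall v, ball h e v ->
  forall H, @aH _ _ _ _ E H -> ~ H h -> sameS H h v.
Proof.
case: sysH => _ _ /(_ h)[W /nbhs_ballP[e e0 eW]] fW.
have [s sE] := finite_set_seq fW.
have : exists2 r : R, 0 < r & forall v, ball h r v ->
    forall H, H \in s -> @aH _ _ _ _ E H -> ~ H h -> ~ H v.
  elim: s {sE} => [|H s [r r0 rP]]; first by exists 1.
  have [[hH Hh]|n] := pselect (@aH _ _ _ _ E H /\ ~ H h); last first.
    exists r => // v hv H'; rewrite inE => /orP[/eqP -> hH Hh|]; last exact: rP.
    by case: n.
  have [a [c [a0 HE]]] := aH_form hH.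
  have /nbhs_ballP[r' r'0 r'P] := aff_nbhs_neq0 (proj1 (form_neq0 HE h) Hh).
  exists (Num.min r r'); first by rewrite lt_min r0.
  move=> v hv H'; rewrite inE => /orP[/eqP -> _ _|H's].
    apply/(form_neq0 HE)/r'P; apply: le_ball hv; by rewrite ge_min lexx orbT.
  by apply: rP => //; apply: le_ball hv; rewrite ge_min lexx.
move=> [r r0 rP]; exists (Num.min e r) => [|v hv H hH Hh]; first by rewrite lt_min e0.
have hv' t : 0 <= t -> t <= 1 -> ball h (Num.min e r) (pt h v t) by exact: ball_convex.
have nH t : 0 <= t -> t <= 1 -> ~ H (pt h v t).
  move=> t0 t1 Ht; have b := hv' t t0 t1.
  have Hs : H \in s.
    have : [set` s] H.
      rewrite -sE; split=> //; exists (pt h v t); split=> //; apply: eW.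
      by apply: le_ball b; rewrite ge_min lexx.
    by [].
  apply: (rP _ _ _ Hs hH Hh Ht); apply: le_ball b; by rewrite ge_min lexx orbT.
have Hv : ~ H v by have := nH 1; rewrite pt1; apply.
have [[]//|[_ [t [/andP[t0 t1] Ht _ _]]]] := segment_cross hH Hh Hv.
by case: (nH t (ltW t0) (ltW t1) Ht).
Qed.

(** A separating hyperplane meets the segment from x to y, which is covered by finitely many of the
    balls provided by local finiteness. *)
Lemma finite_sep x y : finite_set (sep x y).
Proof.
have /choice[e eP] : forall t : R, exists e : R, 0 < e /\
    finite_set [set H | @aH _ _ _ _ E H /\ H `&` ball (pt x y t) e !=set0].
  move=> t; case: sysH => _ _ /(_ (pt x y t))[W /nbhs_ballP[e e0 eW]] fW.
  exists e; split=> //; apply: sub_finite_set fW => H [hH [v [Hv bv]]].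
  by split=> //; exists v; split=> //; apply: eW.
have /choice[r rP] : forall t : R, exists r : R, 0 < r /\
    forall s, `|t - s| < r -> ball (pt x y t) (e t) (pt x y s).
  move=> t; have [e0 _] := eP t; pose M := 1 + \sum_i `|(y - x) 0 i|.
  have M0 : 0 < M by rewrite ltr_pwDl // sumr_ge0.
  exists (e t / M); split=> [|s]; first exact: divr_gt0.
  rewrite ltr_pdivlMr // => ts; apply: row_ball => // i.
  have -> : (pt x y t) 0 i - (pt x y s) 0 i = (t - s) * (y - x) 0 i by rewrite /pt !mxE; ring.
  rewrite normrM; apply: le_lt_trans ts; apply: ler_wpM2l => //.
  by rewrite /M (bigD1 i) //= addrCA lerDl addr_ge0 // sumr_ge0.
have := @segment_compact R 0 1; rewrite compact_cover => /(_ R [set t | 0 <= t <= 1] (fun t => ball t (r t))).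
case=> [t _|t t01|D' D'P cov]; first exact: ball_open.
  exists t; first by move: t01; rewrite /= in_itv.
  by apply: ballxx; case: (rP t).
apply: (@sub_finite_set _ _ (\bigcup_(t in [set` D']) [set H | @aH _ _ _ _ E H /\ H `&` ball (pt x y t) (e t) !=set0])).
  move=> H [hH gx gy o]; have [Hx Hy] := opp_not hH o.
  have [[[_ _ n] _]|[_ [t [/andP[t0 t1] Ht _ _]]]] := segment_cross hH Hx Hy; first by [].
  have [|s D's bs] := cov t; first by rewrite /= in_itv /= !ltW.
  exists s => //; split=> //; exists (pt x y t); split=> //.
  by case: (rP s) => _; apply.
by apply: bigcup_finite => [|t _]; [exact: finite_fset|case: (eP t)].
Qed.

Lemma dist_add x y z : gen x -> gen y -> gen z ->
  (forall H, sep x y H -> ~ sep y z H) -> (dist x y + dist y z = dist x z)%N.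
Proof.
move=> gx gy gz dis; rewrite /dist.
have -> : sep x z = sep x y `|` sep y z.
  apply/seteqP; split=> H; first by move=> /(sep_xor _ gx gy gz)[[]|[]]; [left|right].
  move=> [h|h]; apply/(sep_xor _ gx gy gz); first by left; split=> //; apply: dis.
  by right; split=> // h'; apply: dis h' h.
rewrite fset_setU; [|exact: finite_sep|exact: finite_sep].
rewrite cardfsU (_ : (_ `&` _)%fset = fset0) ?cardfs0 ?subn0 //.
apply/fsetP => H; rewrite !inE; apply/negbTE/negP => /andP[].
rewrite !in_fset_set; [|exact: finite_sep|exact: finite_sep].
by rewrite !inE => /dis.
Qed.

Definition crossing_generic x y := forall H H' t, @aH _ _ _ _ E H -> @aH _ _ _ _ E H' ->
  0 <= t <= 1 -> H (pt x y t) -> H' (pt x y t) -> H = H'.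

(** Two hyperplanes cross a segment issued from x at the same time only if a certain affine form
    vanishes at its end. Moving y within its chamber avoids the zeros of finitely many such
    forms. *)
Lemma generic_end x y : gen x -> gen y -> exists y1, [/\ gen y1,
  forall H, @aH _ _ _ _ E H -> sameS H y y1 & crossing_generic x y1].
Proof.
move=> gx gy; have [s sE] := finite_set_seq (finite_sep x y).
have /choice[fm fmP] : forall H, exists ac : 'cV[R]_(adim E) * R, @aH _ _ _ _ E H ->
    ac.1 != 0 /\ H = [set v | aff ac.1 ac.2 v = 0].
  move=> H; have [/aH_form[a [c h]]|n] := pselect (@aH _ _ _ _ E H); first by exists (a, c).
  by exists (0, 0).
pose al H := aff (fm H).1 (fm H).2.
(* This form vanishes at v when H and H' cut the segment from x to v at the same parameter. It is
   identically zero only if H = H'. *)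
pose g (HH : set pts * set pts) := (al HH.1 x *: (fm HH.2).1 - al HH.2 x *: (fm HH.1).1,
  al HH.1 x * (fm HH.2).2 - al HH.2 x * (fm HH.1).2).
have gE H H' v : aff (g (H, H')).1 (g (H, H')).2 v = al H x * al H' v - al H' x * al H v.
  by rewrite /g /al /aff /= mulmxBr -!scalemxAr !mxE; ring.
have [e e0 eP] := local_chamber y.
have yW : nbhs y (ball y e) by apply/nbhs_ballP; exists e.
pose l := [seq g HH | HH <- [seq (H, H') | H <- s, H' <- s] & HH.1 != HH.2].
have sP H : H \in s -> sep x y H by move=> Hs; rewrite sE.
have [ac /mapP[[H H']]|y1 /nbhs_singleton yy1 y1P] := generic_point (l := l) yW.
  rewrite mem_filter /= => /andP[HH /allpairsP[[H1 H2] /= [/sP h1 /sP h2 [E1 E2]]]] ->.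
  subst H1 H2; have [[hH _ _ _] [hH' _ _ _]] := (h1, h2).
  have [[a0 HE] [a0' HE']] := (fmP H hH, fmP H' hH').
  apply: contrapT => nv; move/eqP: HH; apply.
  have ev v : al H x * al H' v = al H' x * al H v.
    by apply/eqP; rewrite -subr_eq0 -gE; apply/eqP; apply: contrapT => /eqP ?; apply: nv; exists v.
  have Hx := proj1 (form_neq0 HE x) (genN gx hH).
  have Hx' := proj1 (form_neq0 HE' x) (genN gx hH').
  rewrite HE HE'; apply/seteqP; split=> v /= h; have /eqP := ev v; rewrite /al h mulr0.
    by rewrite mulf_eq0 (negPf Hx) => /eqP.
  by rewrite eq_sym mulf_eq0 (negPf Hx') => /eqP.
have same H : @aH _ _ _ _ E H -> sameS H y y1 by move=> hH; apply: eP => //; apply: genN.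
have gy1 : gen y1 by move=> [H hH Hy1]; case: (same H hH) => _.
exists y1; split=> // H H' t hH hH' /andP[t0 t1] Ht Ht'.
have cr K : @aH _ _ _ _ E K -> K (pt x y1 t) -> K \in s.
  move=> hK Kt; have : [set` s] K; last by [].
  rewrite -sE; split=> //.
  have [[_ /(_ t)]|[os _]] := segment_cross hK (genN gx hK) (genN gy1 hK).
    by rewrite t0 t1 => /(_ isT)[].
  by apply: (opp_same hK os); apply: sameS_sym => //; apply: same.
apply: contrapT => HH; have := y1P (g (H, H')) _; rewrite gE => /(_ _)/negP; apply.
  apply: map_f; rewrite mem_filter /=; apply/andP; split; first exact/eqP.
  by apply/allpairsP; exists (H, H'); split=> //; apply: cr.
have [[a0 HE] [a0' HE']] := (fmP H hH, fmP H' hH').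
have z1 : al H (pt x y1 t) = 0 by move: Ht; rewrite {1}HE.
have z2 : al H' (pt x y1 t) = 0 by move: Ht'; rewrite {1}HE'.
rewrite /al !aff_pt -/(al H x) -/(al H' x) -/(al H y1) -/(al H' y1) in z1 z2.
have tn0 : t != 0.
  apply/eqP => tE; move: Ht; rewrite tE pt0; exact: genN.
apply/eqP/(mulfI tn0); rewrite mulr0.
have -> : t * (al H x * al H' y1 - al H' x * al H y1) =
   al H x * (al H' x + t * (al H' y1 - al H' x)) - al H' x * (al H x + t * (al H y1 - al H x)) by ring.
by rewrite z1 z2 !mulr0 subrr.
Qed.

End Chambers.

Lemma time_between (R : realType) (T : eqType) (l : seq T) (f : T -> R) (t0 : R) : t0 < 1 ->
  (forall x, x \in l -> t0 < f x) -> exists t, [/\ t0 < t, t < 1 & forall x, x \in l -> t < f x].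
Proof.
move=> t01; elim: l => [|x l IHl] lP.
  by exists ((t0 + 1) / 2); split=> //; [rewrite midf_lt|rewrite midf_lt].
have [y yl|t [t0t t1 tl]] := IHl; first by apply: lP; rewrite inE yl orbT.
have tx := lP x (mem_head _ _).
have [mt mx] : t0 < (t0 + f x) / 2 /\ (t0 + f x) / 2 < f x by split; rewrite midf_lt.
exists (Num.min t ((t0 + f x) / 2)); split; first by rewrite lt_min t0t.
  by rewrite gt_min t1.
move=> y; rewrite inE => /orP[/eqP ->|/tl ty]; first by rewrite gt_min mx orbT.
by rewrite gt_min ty.
Qed.

(** * Galleries, chambers and walls *)

Section Galleries.
Context (R : realType) (F : nonarchLocalFieldType) (Fb : closedFieldType) (d : nat).
Context (E : apartment_data R F Fb d).
Local Notation pts := 'rV[R]_(adim E).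
Implicit Types (x y z v w : pts) (H : set pts).
Hypothesis sysH : hyperplane_system E.

Definition cross_time x y H (t : R) := [/\ 0 < t < 1, H (pt x y t),
    forall s, 0 <= s -> s < t -> sameS H x (pt x y s) &
    forall s, t < s -> opposite_sides H x (pt x y s)].

Lemma sep_times x y : exists tm : set pts -> R, forall H, sep x y H -> cross_time x y H (tm H).
Proof.
have /choice[tm tmP] : forall H, exists t, sep x y H -> cross_time x y H t.
  move=> H; have [[hH gx gy os]|n] := pselect (sep x y H); last by exists 0.
  have [[[_ _ n] _]|[_ [t ht]]] := segment_cross sysH hH (genN gx hH) (genN gy hH).
    by [].
  by exists t.
by exists tm.
Qed.

(** The point y' is taken on a generic segment from y into the chamber of z, after the first
    crossing and before all the others. *)
Lemma gallery_step y z : gen y -> gen z -> sep y z !=set0 -> exists y' H,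
  [/\ gen y', sep y y' = [set H], sep y z H &
    forall H', sep y' z H' <-> sep y z H' /\ H' <> H].
Proof.
move=> gy gz [H1 sH1]; have [z1 [gz1 zz1 cg]] := generic_end sysH gy gz.
have nz H : ~ sep z z1 H by move=> [hH _ _ os]; case: (zz1 H hH).
have nz' H : ~ sep z1 z H by rewrite (sep_sym sysH).
have sE H : sep y z1 H <-> sep y z H.
  rewrite (sep_xor sysH H gy gz gz1); split=> [[[]//|[_ /nz]//]|h].
  by left; split=> //; apply: nz.
have [tm tmP] := sep_times y z1; have [s sS] := finite_set_seq (finite_sep sysH y z1).
have sP H : (H \in s) <-> sep y z1 H by rewrite sS.
have [|H0 H0s H0min] := @min_real R _ s tm.
  by have /sP : sep y z1 H1 by [apply/sE]; case: (s).
have /sP sH0 := H0s; have [/andP[t0 t1] Ht0 _ _] := tmP _ sH0.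
have [H|t [t0t tlt1 tP]] := @time_between R _ [seq H <- s | H != H0] tm (tm H0) t1.
  rewrite mem_filter => /andP[HH0 Hs]; rewrite lt_neqAle H0min // andbT.
  apply: contraNneq HH0 => tE; apply/eqP; have /sP sH := Hs.
  have [hH _ _ _] := sH; have [hH0 _ _ _] := sH0.
  apply: (cg _ _ (tm H)) => //; last by rewrite -tE.
    by have [/andP[a b] _ _ _] := tmP _ sH; rewrite !ltW.
  by case: (tmP _ sH).
have tp : 0 <= t by rewrite ltW // (lt_trans t0).
have sameT H : @aH _ _ _ _ E H -> H <> H0 -> sameS H y (pt y z1 t).
  move=> hH HH0; have [/[dup] sH /tmP[_ _ cs _]|n] := pselect (sep y z1 H).
    by apply: cs => //; apply: tP; rewrite mem_filter; apply/andP; split; [apply/eqP|apply/sP].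
  have [[_ cs]|[os _]] := segment_cross sysH hH (genN gy hH) (genN gz1 hH).
    by apply: cs; rewrite tp ltW.
  by case: n; split.
have oppT : opposite_sides H0 y (pt y z1 t) by case: (tmP _ sH0) => _ _ _; apply.
have [hH0 _ _ _] := sH0.
have gT : gen (pt y z1 t).
  move=> [H hH HT]; have [HE|HH0] := pselect (H = H0); last by case: (sameT H hH HH0) => _.
  by subst H; have [_] := opp_not sysH hH oppT.
have sT : sep y (pt y z1 t) = [set H0].
  apply/seteqP; split=> [H [hH _ _ os]|_ ->]; last by split.
  by apply: contrapT => HH0; have [_ _] := sameT H hH HH0.
exists (pt y z1 t), H0; split=> //; first exact/sE.
move=> H; rewrite (sep_xor sysH H gT gy gz) (sep_sym sysH _ y) sT /=; split.
  move=> [[HE n]|[HH0 h]]; last by split.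
  by subst H; case: n; apply/sE.
by move=> [h HH0]; right.
Qed.

Section Chamber.
Context (Q : set (set pts)).
Hypothesis QH : Q `<=` @aH _ _ _ _ E.
Definition chamber := connected_component (~` \bigcup_(H in Q) H) (0 : pts).

Lemma pt_continuous x y : continuous (pt x y : R -> pts).
Proof.
move=> t W /nbhs_ballP[e /= e0 eW]; pose M := 1 + \sum_i `|(y - x) 0 i|.
have M0 : 0 < M by rewrite ltr_pwDl // sumr_ge0.
apply/nbhs_ballP; exists (e / M) => [|s ts]; first exact: divr_gt0.
apply: eW; apply: row_ball => // i.
have -> : (pt x y t) 0 i - (pt x y s) 0 i = (t - s) * (y - x) 0 i by rewrite /pt !mxE; ring.
rewrite normrM; move: ts; rewrite /ball /= ltr_pdivlMr // => ts.
apply: le_lt_trans ts; apply: ler_wpM2l => //.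
by rewrite /M (bigD1 i) //= addrCA lerDl addr_ge0 // sumr_ge0.
Qed.

Lemma aff_continuous (a : 'cV[R]_(adim E)) c : continuous (aff a c).
Proof.
move=> x W /nbhs_ballP[e /= e0 eW]; have [r r0 rP] := aff_near a c x e0.
by apply/nbhs_ballP; exists r => // y /rP yW; apply: eW; rewrite /ball /= distrC.
Qed.

(** The form of H maps a connected set avoiding H to an interval without 0. Conversely the segment
    from 0 to v avoids every hyperplane of Q. *)
Lemma chamberP v : chamber v <-> forall H, Q H -> sameS H 0 v.
Proof.
split=> [[B [B0 BQ cB] Bv] H QHH|sv].
  have hH := QH QHH; have g0 := gen0 sysH.
  have nB w : B w -> ~ H w by move=> /BQ nw Hw; apply: nw; exists H.
  split; [exact: nB|exact: nB|move=> os].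
  have [a [c [a0 HE]]] := aH_form sysH hH.
  have := (connected_continuous_connected cB (continuous_subspaceT (@aff_continuous a c))).
  move=> /connected_intervalP iB; have /(oppE a0 HE) := os.
  have im w : B w -> (aff a c @` B) (aff a c w) by move=> Bw; exists w.
  have no0 : ~ (aff a c @` B) 0 by move=> [w /nB Hw w0]; apply: Hw; rewrite HE.
  have [p q] := (im _ B0, im _ Bv).
  move: (aff a c 0) (aff a c v) p q => u w p q.
  have [u0|u0|u0] := ltgtP u 0; last by rewrite u0 mul0r ltxx.
  - by rewrite nmulr_rlt0 // => w0; apply: no0; apply: (iB u w) => //; rewrite !ltW.
  - by rewrite pmulr_rlt0 // => w0; apply: no0; apply: (iB w u) => //; rewrite !ltW.
exists [set pt 0 v t | t in `[0, 1]]; last by exists 1; rewrite ?pt1 //= in_itv /= ler01 lexx.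
split.
- by exists 0; rewrite ?pt0 //= in_itv /= ler01 lexx.
- move=> w [t t01 <-] [H QHH Ht]; move: t01; rewrite /= in_itv /= => t01; have hH := QH QHH.
  have [s0 s1 s2] := sv H QHH.
  have [[_ /(_ t t01)[]]//|[]//] := segment_cross sysH hH s0 s1.
- apply: connected_continuous_connected; first exact: segment_connected.
  by apply: continuous_subspaceT; apply: pt_continuous.
Qed.

(** H is the first hyperplane of Q met by a generic segment from 0, and h is the crossing point. The
    other hyperplanes of Q are met later or not at all, so none of them separates h from 0 or
    contains h. *)
Lemma wall_ex v H1 : gen v -> Q H1 -> sep 0 v H1 ->
  exists H h, [/\ Q H, sep 0 v H, H h, exists W, nbhs h W /\ H `&` W `<=` closure chamber &
    forall H', Q H' -> H' <> H -> sameS H' 0 h].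
Proof.
move=> gv Q1 s1; have g0 := gen0 sysH; have [v1 [gv1 vv1 cg]] := generic_end sysH g0 gv.
have sE H : sep 0 v1 H <-> sep 0 v H.
  rewrite (sep_xor sysH H g0 gv gv1); split=> [[[]//|[_ [hH _ _]]]|h].
    by case: (vv1 H hH).
  by left; split=> // -[hH _ _]; case: (vv1 H hH).
have [tm tmP] := sep_times 0 v1; have [s sS] := finite_set_seq (finite_sep sysH 0 v1).
have sP H : (H \in s) <-> sep 0 v1 H by rewrite sS.
have [|H] := @min_real R _ [seq H <- s | `[< Q H >]] tm.
  have : H1 \in [seq H <- s | `[< Q H >]].
    by rewrite mem_filter; apply/andP; split; [apply/asboolP|apply/sP/sE].
  by case: [seq _ <- _ | _].
rewrite mem_filter => /andP[/asboolW QHH /sP sH] Hmin; have [hH _ _ os] := sH.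
have [/andP[t0 t1] Ht _ _] := tmP _ sH; pose h := pt 0 v1 (tm H).
have only H' : @aH _ _ _ _ E H' -> H' h -> H' = H.
  by move=> hH' H'h; apply: (cg _ _ (tm H)) => //; rewrite !ltW.
have sameh H' : Q H' -> H' <> H -> sameS H' 0 h.
  move=> QH' HH; have hH' := QH QH'.
  have [[hh /(_ (tm H))]|[os' _]] := segment_cross sysH hH' (genN g0 hH') (genN gv1 hH').
    by rewrite !ltW //; apply.
  have sH' : sep 0 v1 H' by split.
  have [_ H't cs _] := tmP _ sH'; apply: cs; first exact: ltW.
  rewrite lt_neqAle; apply/andP; split.
    by apply/eqP => tE; apply: HH; apply: only => //; rewrite /h tE.
  by apply: Hmin; rewrite mem_filter; apply/andP; split; [apply/asboolP|apply/sP].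
exists H, h; split=> //; first exact/sE.
have [e e0 eP] := local_chamber sysH h; exists (ball h e)°; split.
  by apply: nbhs_interior; apply/nbhs_ballP; exists e.
(* A point of H near h enters the chamber when it is moved slightly towards 0; hence it is in the
   closure. *)
move=> w [Hw wi] W wW; have [r r0 rP] := pt_nbhs 0 (filterI wi wW).
pose ep := Num.min (r / 2) (1 / 2).
have ep0 : 0 < ep by rewrite lt_min !divr_gt0.
have epr : ep < r by rewrite gt_min ltr_pdivrMr // ltr_pMr // ltr1n.
have [bw Ww] := rP ep (ltW ep0) epr.
exists (pt w 0 ep); split=> //; apply/chamberP => H' QH'; have hH' := QH QH'.
have [HE|HH] := pselect (H' = H).
  subst H'; have [a [c [a0 HE]]] := aH_form sysH hH.
  have n0 := genN g0 hH; apply/(sameSE a0 HE).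
  rewrite aff_pt; move: Hw; rewrite {1}HE /= => ->; rewrite add0r subr0 mulrCA mulr_gt0 //.
  by rewrite -expr2 exprn_even_gt0 //=; apply/(form_neq0 HE).
have s1' := sameh H' QH' HH; apply: (sameS_trans sysH hH' s1').
by apply: eP => //; case: s1'.
Qed.
End Chamber.

Lemma crel_chamber (iota : {rmorphism F -> Fb}) (C : closedFieldType) (X : cover_data C E) :
  C_rel iota X = chamber (relevant iota X).
Proof. by []. Qed.

Section Reflection.
Context (H : set pts) (s : pts -> pts).
Hypotheses (hH : @aH _ _ _ _ E H) (ipE : inner_product E) (sH : orth_reflection H s).

Lemma refl_aff a c v : H = [set v | aff a c v = 0] -> aff a c (s v) = - aff a c v.
Proof.
move=> HE; have [+ _] := sH v; rewrite HE /= /aff -scalemxAl mulmxDl.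
rewrite mxE [X in 2^-1 * X]mxE; move: ((v *m a) 0 0) ((s v *m a) 0 0) => p q h.
lra.
Qed.

Lemma refl_fix v : H v -> s v = v.
Proof.
move=> Hv; have [a [c [a0 HE]]] := aH_form sysH hH.
have Hsv : H (s v) by move: Hv; rewrite HE /= (refl_aff v HE) => ->; rewrite oppr0.
have [_ /(_ v (s v) Hv Hsv) i0] := sH v.
have [_ pos] := ipE; apply/eqP; apply: contrapT => /negP nv.
have : 0 < inner (v - s v) (v - s v) by apply: pos; rewrite subr_eq0 eq_sym.
by rewrite i0 ltxx.
Qed.

Lemma refl_opp v : ~ H v -> opposite_sides H v (s v).
Proof.
have [a [c [a0 HE]]] := aH_form sysH hH; move=> /(form_neq0 HE) nv.
by apply/(oppE a0 HE); rewrite (refl_aff v HE) mulrN oppr_lt0 -expr2 exprn_even_gt0.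
Qed.
End Reflection.

(** The reflection subtracts twice the component along the normal vector [u]. With respect to the
    Gram matrix Q, the vector dual to the gradient a is a^T Q^-1. *)
Lemma orth_reflection_ex H : @aH _ _ _ _ E H -> inner_product E -> exists s, orth_reflection H s.
Proof.
move=> hH [Qs pos]; have [a [c [a0 HE]]] := aH_form sysH hH.
have Qu : aQ E \in unitmx.
  rewrite -row_free_unit -kermx_eq0; apply/eqP/row_matrixP => i; rewrite row0.
  apply/eqP; apply: contrapT => /negP /pos.
  by rewrite /inner -row_mul mulmx_ker row0 mul0mx mxE ltxx.
pose u := a^T *m invmx (aQ E).
have iu v : inner u v = (v *m a) 0 0.
  by rewrite /inner /u mulmxKV // -trmx_mul mxE.
have uu : 0 < inner u u.
  apply: pos; apply: contra_neq a0 => u0; rewrite -[a]trmxK -(mulmxKV Qu a^T) -/u u0 mul0mx.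
  by rewrite trmx0.
have uu' := iu u; exists (fun v => v - (2%:R * (aff a c v / inner u u)) *: u) => v.
have aE t : aff a c (v - t *: u) = aff a c v - t * inner u u.
  by rewrite iu /aff mulmxBl -scalemxAl !mxE; ring.
split.
  rewrite HE /= (_ : 2^-1 *: _ = v - (aff a c v / inner u u) *: u).
    by rewrite aE divfK ?subrr // gt_eqF.
  by rewrite addrA -mulr2n scalerBr -[v *+ 2]scaler_nat !scalerA !mulrA mulVf ?pnatr_eq0 // mul1r scale1r.
move=> h h' Hh Hh'; rewrite opprB addrCA subrr addr0 /inner -!scalemxAl mxE.
rewrite -[X in _ * X]/(inner u (h - h')).
have -> : inner u (h - h') = (h *m a) 0 0 - (h' *m a) 0 0 by rewrite iu mulmxBl !mxE.
move: Hh Hh'; rewrite HE /= /aff.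
by move=> /eqP; rewrite subr_eq0 => /eqP -> /eqP; rewrite subr_eq0 => /eqP ->; rewrite subrr mulr0.
Qed.

End Galleries.

(** When A is contained in BD, each coset of D in A has a representative in B, so a transversal can
    be moved into B without changing its size. *)
Lemma trans_in (T : unitRingType) (A B D : set T) s : subgroup A -> subgroup B -> subgroup D ->
  B `<=` A -> D `<=` A -> A `<=` setprod B D -> trans A D s ->
  exists s', [/\ size s' = size s, trans B (B `&` D) s' & trans A D s'].
Proof.
move=> sA sB sD BA DA AB [us As Ds Es].
have /choice[f fP] : forall a, exists b, A a -> B b /\ D (b^-1 * a).
  move=> a; have [/AB[b Bb [x Dx <-]]|n] := pselect (A a); last by exists 1.
  by exists b => _; rewrite mulKr ?(sgU sB Bb).
have fU r : r \in s -> f r \is a GRing.unit by move=> /As /fP[/(sgU sB)].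
have key r r' : r \in s -> r' \in s -> D ((f r)^-1 * f r') -> r = r'.
  move=> rs r's Dd; apply: Ds => //; have [_ d1] := fP r (As r rs).
  have [_ d2] := fP r' (As r' r's); have := sgM sD (sgM sD (sgV sD d1) Dd) d2.
  rewrite invrM ?unitrV ?fU ?(sgU sA (As _ rs)) // invrK -!mulrA mulVKr ?fU //.
  by rewrite mulVKr ?fU.
have tB : trans B (B `&` D) (map f s).
  split.
  - rewrite map_inj_in_uniq // => r r' rs r's fE; apply: key => //.
    by rewrite fE mulVr ?fU //; apply: sg1.
  - by move=> _ /mapP[r rs ->]; case: (fP r (As r rs)).
  - by move=> _ _ /mapP[r rs ->] /mapP[r' r's ->] [_ Dd]; rewrite (key r r').
  - move=> b Bb; have [r rs Dr] := Es b (BA _ Bb); have [Bf Df] := fP r (As r rs).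
    exists (f r); first exact: map_f.
    split; first by apply: sgM => //; apply: sgV.
    have := sgM sD Df Dr; rewrite -mulrA mulVKr // (sgU sA) //; exact: As.
exists (map f s); split; [by rewrite size_map|by []|exact: trans_sub tB].
Qed.

Lemma mull_continuous (F : nonarchLocalFieldType) d (a : 'M[F]_d.+1) :
  continuous ( *%R a : 'M[F]_d.+1 -> 'M[F]_d.+1).
Proof. by move=> g W nW; apply: nbhs_mull. Qed.

Lemma compact_mull (F : nonarchLocalFieldType) d (a : 'M[F]_d.+1) (D : set 'M[F]_d.+1) :
  compact D -> compact [set a * x | x in D].
Proof.
move=> cD; apply: continuous_compact => //; apply: continuous_subspaceT.
exact: mull_continuous.
Qed.

Lemma compact_seq_union (F : nonarchLocalFieldType) d (s : seq 'M[F]_d.+1)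
    (D : 'M[F]_d.+1 -> set 'M[F]_d.+1) :
  (forall x, x \in s -> compact (D x)) -> compact [set g | exists2 x, x \in s & D x g].
Proof.
elim: s => [|x s IHs] cD.
  by rewrite (_ : [set _ | _] = set0); [exact: compact0|apply/seteqP; split=> // g [x]].
rewrite (_ : [set _ | _] = D x `|` [set g | exists2 x, x \in s & D x g]).
  apply: compactU; first by apply: cD; rewrite mem_head.
  by apply: IHs => y ys; apply: cD; rewrite inE ys orbT.
apply/seteqP; split=> g; last first.
  by move=> [Dg|[y ys Dg]]; [exists x; rewrite ?mem_head|exists y; rewrite // inE ys orbT].
by move=> [y]; rewrite inE => /orP[/eqP ->|ys] Dg; [left|right; exists y].
Qed.

(** * Families of quasi-covers *)

Section SupportedSum.
Context (T : unitRingType).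

(** The cosets that meet the support are those contained in AD, and they correspond to A/(A cap
    D). *)
Lemma csum_support (V : nmodType) (A J D : set T) s t (f : T -> V) :
  subgroup A -> subgroup J -> subgroup D -> D `<=` J -> A `<=` J ->
  trans J D t -> trans A (A `&` D) s -> right_inv J D f ->
  (forall r, J r -> ~ setprod A D r -> f r = 0) -> \sum_(r <- t) f r = \sum_(r <- s) f r.
Proof.
move=> sA sJ sD DJ AJ tt ts fi f0; have [us As Ds Es] := ts.
have cU : uniq [seq setprod [set r] D | r <- s].
  rewrite map_inj_in_uniq // => r r' rs r's e; apply: Ds => //.
  have Ar := As r rs; have Ar' := As r' r's.
  split; first exact: (sgM sA (sgV sA Ar) Ar').
  have : setprod [set r'] D r' by exists r' => //; exists 1; [exact: sg1|rewrite mulr1].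
  by rewrite -e => -[_ -> [x Dx <-]]; rewrite mulKr // (sgU sA Ar).
rewrite -(csumE sJ sD DJ tt fi) -(@fsbig_widen _ _ _ _ [set` [seq setprod [set r] D | r <- s]]).
- rewrite -fsbig_seq // big_map; apply: eq_big_seq => r rs.
  by have [x Dx ->] := coset_repE r sD; rewrite fi //; apply/AJ/As.
- by move=> _ /mapP[r rs ->]; exists r => //; apply/AJ/As.
- move=> _ [[b Jb <-] nb] /=; have [x Dx ->] := coset_repE b sD; rewrite fi //.
  apply: f0 => // -[a Aa [z Dz e]]; apply: nb; have [r rs [Ar Dr]] := Es a Aa.
  apply/mapP; exists r => //; have rU := sgU sA (As r rs).
  have Dw : D (r^-1 * b) by rewrite -e mulrA; apply: (sgM sD).
  have wU := sgU sD Dw.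
  have bE : b = r * (r^-1 * b) by rewrite mulVKr.
  apply/seteqP; split=> _ [_ -> [w Dw' <-]].
    by exists r => //; exists (r^-1 * b * w); [exact: (sgM sD)|rewrite mulrA -bE].
  exists b => //; exists ((r^-1 * b)^-1 * w); first exact: (sgM sD (sgV sD Dw)).
  by rewrite {1}bE -mulrA mulVKr.
Qed.

End SupportedSum.

Section InducedModel.
Context (F : nonarchLocalFieldType) (d : nat) (C : closedFieldType).
Local Notation MF := 'M[F]_d.+1.

(** [ev] is evaluation at 1, and [i v] is the function supported on [A] with value [v] at 1. The
    last identity cuts a function into its restrictions to the cosets A h^-1. *)
Lemma induced_model (V W : vectType C) (H A : set MF) (sg : MF -> 'End(V)) (kap : MF -> 'End(W)) :
  subgroup H -> subgroup A -> A `<=` H ->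
  (forall a b, A a -> A b -> sg (a * b) = (sg a \o sg b)%VF) -> sg 1 = \1%VF ->
  iso_ind H A sg kap -> exists (ev : 'Hom(W, V)) (i : 'Hom(V, W)),
  [/\ forall a w, A a -> ev (kap a w) = sg a (ev w),
      forall a v, A a -> kap a (i v) = i (sg a v),
      forall h v, H h -> ev (kap h (i v)) = if h \in A then sg h v else 0 &
      forall t w, trans H A t -> \sum_(h <- t) kap h (i (ev (kap h^-1 w))) = w].
Proof.
move=> sH sA AH sgM' sg1' [j [jl jI jE j0 jS]].
have jinj w w' : (forall g, H g -> j w g = j w' g) -> w = w'.
  move=> e; apply/eqP; rewrite -subr_eq0; apply/eqP/j0 => g Hg.
  by rewrite -scaleN1r addrC jl e // scaleN1r addNr.
pose fv v g := if g \in A then sg g v else 0.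
have fvI v : in_ind H A sg (fv v).
  split=> [k g Ak Hg|].
    rewrite /fv; have -> : (k * g \in A) = (g \in A).
      apply/idP/idP => /set_mem h; apply/mem_set; last exact: (sgM sA).
      by move/(sgMl _ sA Ak): h.
    by case: ifP => [/set_mem Ag|_]; rewrite ?linear0 // sgM' // comp_lfunE.
  exists [set 1]; split=> [|g ->|g Hg]; [exact: compact_set1|exact: sg1|].
  rewrite /fv; case: ifP => [/set_mem Ag _|_]; last by rewrite eqxx.
  by exists g => //; exists 1; rewrite ?mulr1.
have /choice[i0 i0E] := fun v => jS _ (fvI v).
have i0l : linear i0.
  move=> a u v; apply: jinj => g Hg; rewrite jl !i0E // /fv.
  by case: ifP => _; rewrite ?linearP // scaler0 addr0.
have [ev evE] := lfun_ex (jl 1); have [i iE'] := lfun_ex i0l.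
have eE w : ev w = j w 1 by exact: evE.
have iE v : i v = i0 v by exact: iE'.
exists ev, i; have H1 := sg1 sH.
have jA w a : A a -> j w a = sg a (j w 1).
  by move=> Aa; have [je _] := jI w; rewrite -je // mulr1.
split.
- by move=> a w Aa; have Ha := AH _ Aa; rewrite !eE jE // mul1r jA.
- move=> a v Aa; rewrite !iE; apply: jinj => g Hg; have Ha := AH _ Aa.
  rewrite jE // !i0E //; last exact: (sgM sH).
  rewrite /fv; have -> : (g * a \in A) = (g \in A).
    apply/idP/idP => /set_mem h; apply/mem_set; last exact: (sgM sA).
    by move/(sgMr _ sA Aa): h.
  by case: ifP => // /set_mem Ag; rewrite sgM' // comp_lfunE.
- by move=> h v Hh; rewrite iE eE jE // mul1r i0E.
- move=> t w tt; apply: jinj => g Hg; have [ut Ht Dt Et] := tt.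
  have [jg jgE'] := lfun_ex (jl g); have jgE u : jg u = j u g by exact: jgE'.
  have jsum (f : MF -> W) : j (\sum_(h <- t) f h) g = \sum_(h <- t) j (f h) g.
    by rewrite -jgE linear_sum; apply: eq_bigr => h _; exact: jgE.
  have [h0 h0t Ah0] := Et _ (sgV sH Hg); have h0U := sgU sH (Ht _ h0t); have gU := sgU sH Hg.
  have Ag : A (g * h0).
    by have := sgV sA Ah0; rewrite invrM ?unitrV // !invrK.
  have term h : h \in t -> j (kap h (i (ev (kap h^-1 w)))) g =
      if g * h \in A then sg (g * h) (j w h^-1) else 0.
    move=> ht; have Hh := Ht h ht; rewrite iE eE jE // i0E; last exact: (sgM sH).
    by rewrite jE // ?mul1r //; apply: (sgV sH).
  rewrite jsum (eq_big_seq _ term) (bigD1_seq h0) //= mem_set // big1_seq ?addr0.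
    have [je _] := jI w; rewrite -je //; last exact: (sgV sH (Ht _ h0t)).
    by rewrite mulrK.
  move=> h /andP[nh ht]; case: ifP => // /set_mem Agh; case/eqP: nh; apply: Dt => //.
  have hU := sgU sH (Ht _ ht).
  by have := sgM sA (sgV sA Agh) Ag; rewrite invrM // -mulrA mulKr.
Qed.

(* [ev' kap(l) i] is the kernel of the identity of [kap], seen as a map between
   two induced representations of [L]; as Hom_L is a line, it must be proportional
   to the map with kernel [Q] supported on the double coset of 1. *)
Lemma schur_kernel (V V' W : vectType C) (L A B : set MF) (sg : MF -> 'End(V))
    (sg' : MF -> 'End(V')) (kap : MF -> 'End(W)) (ev : 'Hom(W, V)) (i : 'Hom(V, W))
    (ev' : 'Hom(W, V')) (i' : 'Hom(V', W)) (Q : 'Hom(V, V')) t :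
  subgroup L -> subgroup A -> subgroup B -> irreducible L kap ->
  (forall a b, L a -> L b -> kap (a * b) = (kap a \o kap b)%VF) -> kap 1 = \1%VF ->
  (forall a b, A a -> A b -> sg (a * b) = (sg a \o sg b)%VF) ->
  (forall a b, B a -> B b -> sg' (a * b) = (sg' a \o sg' b)%VF) ->
  sg 1 = \1%VF -> sg' 1 = \1%VF ->
  (forall a w, A a -> L a -> ev (kap a w) = sg a (ev w)) ->
  (forall a v, B a -> L a -> kap a (i' v) = i' (sg' a v)) ->
  (forall h v, L h -> ev (kap h (i v)) = if h \in A then sg h v else 0) ->
  (forall h v, L h -> ev' (kap h (i' v)) = if h \in B then sg' h v else 0) ->
  (forall l v, L l -> A l -> B l -> Q (sg l v) = sg' l (Q v)) ->
  trans L (L `&` (A `&` B)) t ->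
  exists xi, (forall v, xi *: ev' (i v) = Q v) /\
    forall l v, L l -> ~ setprod (B `&` L) (A `&` L) l -> xi *: ev' (kap l (i v)) = 0.
Proof.
move=> sL sA sB irr kM k1 sM' sM'' s1 s1' evA iB evi evi' QE tt.
have sD := sgI sL (sgI sA sB); have [ut Lt Dt Et] := tt.
(* The conjugates by L of the operator i' Q ev on [W] depend only on the coset of [h], because Q
   intertwines on the common subgroup. Their sum commutes with L and is a scalar [xi]. *)
pose X (h : MF) := (kap h \o (i' \o (Q \o (ev \o kap (h^-1)%R))))%VF.
have XE (h : MF) w : X h w = kap h (i' (Q (ev (kap h^-1 w)))) by rewrite /X !comp_lfunE.
have kMw (a b : MF) w : L a -> L b -> kap (a * b) w = kap a (kap b w).
  by move=> La Lb; rewrite kM // comp_lfunE.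
have Xinv w : right_inv L (L `&` (A `&` B)) (fun h => X h w).
  move=> h x Lh [Lx [Ax Bx]]; have hU := sgU sL Lh; have xU := sgU sL Lx.
  rewrite !XE invrM // !kMw //; try exact: (sgV sL).
  rewrite evA; [|exact: (sgV sA)|exact: (sgV sL)].
  rewrite QE; [|exact: (sgV sL)|exact: (sgV sA)|exact: (sgV sB)].
  rewrite iB // -[sg' x _]comp_lfunE -sM'' //; last exact: (sgV sB).
  by rewrite mulrV // s1' id_lfunE.
pose Xi := \sum_(h <- t) X h.
have XiE w : Xi w = \sum_(h <- t) X h w by rewrite sum_lfunE.
have [l Ll|xi xiE] := irr_scalar irr (T := Xi).
  apply/lfunP => w; rewrite [LHS]comp_lfunE [RHS]comp_lfunE !XiE linear_sum.
  rewrite (trans_sum sL sD (@subIsetl _ _ _) tt (trans_mul sL Ll tt) (Xinv _)) big_map.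
  apply: eq_big_seq => h ht; have Lh := Lt h ht; have hU := sgU sL Lh; have lU := sgU sL Ll.
  have LV := sgV sL Lh; have LlV := sgV sL Ll; have Llh := sgM sL Ll Lh.
  rewrite !XE invrM // -!kMw //; [|exact: (sgM sL)].
  by rewrite mulrVK // kMw.
(* At l = 1 only the coset of 1 contributes, and it returns Q; for l outside the double coset no
   term survives. *)
have key l v : L l -> xi *: ev' (kap l (i v)) =
    \sum_(h <- t) ev' (kap h (i' (Q (ev (kap (h^-1 * l) (i v)))))).
  move=> Ll; have -> : xi *: ev' (kap l (i v)) = ev' (Xi (kap l (i v))).
    by rewrite xiE scale_lfunE id_lfunE linearZ.
  rewrite XiE linear_sum; apply: eq_big_seq => h ht.
  by rewrite XE kMw //; apply: (sgV sL); apply: Lt.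
exists xi; split=> [v|l v Ll nl].
  have := key 1 v (sg1 sL); rewrite k1 id_lfunE => ->.
  have [h0 h0t D0] := Et 1 (sg1 sL); rewrite mulr1 in D0.
  have [L0 [A0 B0]] := D0; have := sgV sD D0; rewrite invrK => -[L0' [A0' B0']].
  rewrite (bigD1_seq h0) //= big1_seq ?addr0 => [|h /andP[nh ht]].
    rewrite mulr1 evi // mem_set // evi' // mem_set // -QE //.
    by rewrite -[sg h0 _]comp_lfunE -sM' // mulrV ?s1 ?id_lfunE // (sgU sL L0').
  rewrite mulr1; have Lh := Lt h ht; have LV := sgV sL Lh.
  rewrite evi // evi' //; case: ifP => // /set_mem Bh; case: ifP => [/set_mem Ah|_].
    case/eqP: nh; apply: Dt => //; have Dh : (L `&` (A `&` B)) h^-1 by do !split=> //; exact: (sgV sB).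
    by apply: (sgM sD Dh); split.
  by rewrite !linear0.
rewrite key // big1_seq // => h /andP[_ ht]; have Lh := Lt h ht; have Lhl := sgM sL (sgV sL Lh) Ll.
rewrite evi // evi' //; case: ifP => // /set_mem Bh; case: ifP => [/set_mem Ah|_].
  case: nl; exists h => //; exists (h^-1 * l) => //.
  by rewrite mulVKr // (sgU sL Lh).
by rewrite !linear0.
Qed.

End InducedModel.

(** * The operators Theta^norm, their composites and their kernels *)

Section Covers.
Context (R : realType) (F : nonarchLocalFieldType) (Fb : closedFieldType).
Context (iota : {rmorphism F -> Fb}) (d : nat) (C : closedFieldType).
Context (p : nat) (sqp : C).
Hypotheses (rpF : residue_char F p) (pC : p \notin [pchar C]) (sqpE : sqp ^+ 2 = p%:R).
Local Notation MF := 'M[F]_d.+1.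
Local Notation im := (map_mx iota : MF -> 'M[Fb]_d.+1).
Local Notation Fp := (Fpts iota).
Context (E : apartment_data R F Fb d) (X : cover_data C E).
Hypotheses (SX : cover_setup iota X) (QX : quasi_cover_family iota X).
Local Notation pts := 'rV[R]_(adim E).
Local Notation V := (cV X).
Local Notation GF := (Fp (cG X)).
Local Notation MFp := (Fp (cM X)).
Local Notation N := (aN E).
Local Notation KM := (cKM X).
Local Notation K := (cK X).
Local Notation Kp := (cKp X).
Local Notation rho := (@crho _ _ _ _ _ E X).
Local Notation rM := (@crM _ _ _ _ _ E X).
Implicit Types (x y z : pts) (H : set pts) (n k g h : MF) (f : MF -> V).

Let sysH : hyperplane_system E := H_system SX.

Lemma pchar_neq0 : p%:R != 0 :> C.
Proof. by apply: contra pC => p0; rewrite inE /=; case: rpF => -> _. Qed.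
Lemma sqp_neq0 : sqp != 0.
Proof. by have := pchar_neq0; rewrite -sqpE expf_eq0. Qed.

Lemma psqrtM a b : (0 < a)%N -> (0 < b)%N -> psqrt p sqp (a * b) = psqrt p sqp a * psqrt p sqp b.
Proof. by move=> a0 b0; rewrite /psqrt lognM // exprD. Qed.
Lemma psqrt_neq0 a : psqrt p sqp a != 0.
Proof. by rewrite expf_neq0 // sqp_neq0. Qed.
Lemma psqrt_sq a : p.-nat a -> psqrt p sqp a * psqrt p sqp a = a%:R.
Proof.
move=> pa; rewrite /psqrt -exprD addnn -mul2n exprM sqpE -natrX.
by rewrite -p_part part_pnat_id.
Qed.
Lemma psqrt_div a : p.-nat a -> a%:R^-1 * psqrt p sqp a = (psqrt p sqp a)^-1.
Proof. by move=> pa; rewrite -psqrt_sq // invfM mulfVK // psqrt_neq0. Qed.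

Lemma sgGF : subgroup GF.
Proof.
have [[[_ sG] _] _ _] := G_reductive SX; split=> [g /(sgU sG)||g h Gg Gh|g Gg].
- by rewrite im_unit.
- by rewrite /Fpts /= im1; apply: sg1.
- by rewrite /Fpts /= imM; apply: sgM.
- by rewrite /Fpts /= imV; apply: sgV.
Qed.
Lemma sgG : subgroup (cG X). Proof. by have [[[_ sG] _] _ _] := G_reductive SX. Qed.

Lemma sgK x : gen x -> subgroup (K x).
Proof. by move=> /(K_compact_open SX)[[]]. Qed.
Lemma KG x g : gen x -> K x g -> GF g.
Proof. by move=> /(K_compact_open SX)[[_ [W _ ->]] _] []. Qed.
Lemma openK x : gen x -> open_in GF (K x).
Proof. by move=> /(K_compact_open SX)[[_ ]]. Qed.
Lemma compactK x : gen x -> compact (K x).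
Proof. by move=> /(K_compact_open SX)[]. Qed.
Lemma sgKM : subgroup KM. Proof. by case: (KM_compact_open SX) => -[]. Qed.
Lemma unitG g : GF g -> g \is a GRing.unit. Proof. exact: sgU sgGF. Qed.

Lemma rhoM x k k' : gen x -> K x k -> K x k' -> rho x (k * k') = (rho x k \o rho x k')%VF.
Proof. by move=> /(rho_irr SX)[[_ + _] _]; apply. Qed.
Lemma rho1 x : gen x -> rho x 1 = \1%VF.
Proof. by move=> /(rho_irr SX)[[]]. Qed.
Lemma rhoKV x k v : gen x -> K x k -> rho x k (rho x k^-1 v) = v.
Proof.
move=> gx Kk; rewrite -[LHS]comp_lfunE -rhoM //; last exact: sgV (sgK gx) Kk.
by rewrite mulrV ?rho1 ?lfunE // (sgU (sgK gx)).
Qed.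

Lemma dist_disjoint x y z : gen x -> gen y -> gen z -> (forall H, sep x y H -> ~ sep y z H) ->
  exists U Ub, [/\ radical_pair iota (cG X) (cM X) U Ub,
      K x `&` Fp U `<=` K y `&` Fp U /\ K y `&` Fp U `<=` K z `&` Fp U &
      K z `&` Fp Ub `<=` K y `&` Fp Ub /\ K y `&` Fp Ub `<=` K x `&` Fp Ub].
Proof. by move=> gx gy gz dis; apply: (qcf_geodesic QX) => //; apply: dist_add. Qed.

Lemma sep_refl x H : ~ sep x x H.
Proof.
move=> [hH gx _ os]; have [_ _] := sameS_refl sysH hH (genN gx hH); exact.
Qed.

Lemma radical_pair_ex : exists U Ub, radical_pair iota (cG X) (cM X) U Ub.
Proof.
have g0 := gen0 sysH; have [H h|U [Ub [rp _ _]]] := @dist_disjoint 0 0 0 g0 g0 g0.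
  by case: (sep_refl h).
by exists U, Ub.
Qed.

Lemma Fp_uniq U Ub u m b u' m' b' : radical_pair iota (cG X) (cM X) U Ub ->
  Fp U u -> MFp m -> Fp Ub b -> Fp U u' -> MFp m' -> Fp Ub b' ->
  u * m * b = u' * m' * b' -> [/\ u = u', m = m' & b = b'].
Proof.
move=> rp Uu Mm Bb Uu' Mm' Bb' /(congr1 im); rewrite !imM => e.
by have [/im_inj -> /im_inj -> /im_inj ->] := rp_uniq rp Uu Mm Bb Uu' Mm' Bb' e.
Qed.

Lemma KM_sub x k : gen x -> KM k -> K x k /\ MFp k.
Proof.
move=> gx KMk; have [U [Ub rp]] := radical_pair_ex.
by have [_ kE _ _] := qcf_cover QX gx rp; move: KMk; rewrite -kE => -[].
Qed.

Lemma K_decomp x U Ub k : gen x -> radical_pair iota (cG X) (cM X) U Ub -> K x k ->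
  exists u m b, [/\ K x u /\ Fp U u, KM m, K x b /\ Fp Ub b & k = u * m * b].
Proof.
move=> gx rp Kk; have [KE KMe _ _] := qcf_cover QX gx rp; move: Kk; rewrite {1}KE KMe.
by move=> [_ [u [? ?] [m ? <-]] [b [? ?] <-]]; exists u, m, b.
Qed.

Lemma rho_decomp x U Ub u m b : gen x -> radical_pair iota (cG X) (cM X) U Ub ->
  K x u -> Fp U u -> KM m -> K x b -> Fp Ub b -> rho x (u * m * b) = rM m.
Proof.
move=> gx rp Ku Uu Km Kb Bb; have [_ _ rE r1] := qcf_cover QX gx rp.
have [Km' _] := KM_sub gx Km; have Kum := sgM (sgK gx) Ku Km'.
rewrite !rhoM // (r1 u) ?(r1 b) //; [|by right|by left].
by rewrite comp_lfun1l comp_lfun1r rE.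
Qed.

Lemma rho_KM x k : gen x -> KM k -> rho x k = rM k.
Proof. by move=> gx Kk; have [U [Ub rp]] := radical_pair_ex; have [_ _ ->] := qcf_cover QX gx rp. Qed.

Lemma K_decompI x y U Ub k : gen x -> gen y -> radical_pair iota (cG X) (cM X) U Ub ->
  K x k -> K y k -> exists u m b, [/\ [/\ K x u, K y u & Fp U u], KM m,
    [/\ K x b, K y b & Fp Ub b] & k = u * m * b].
Proof.
move=> gx gy rp /(K_decomp gx rp)[u [m [b [[Ku Uu] Km [Kb Bb] ->]]]].
move=> /(K_decomp gy rp)[u' [m' [b' [[Ku' Uu'] Km' [Kb' Bb'] e]]]].
have [_ Mm] := KM_sub gx Km; have [_ Mm'] := KM_sub gx Km'.
have [eu em eb] := Fp_uniq rp Uu Mm Bb Uu' Mm' Bb' e; subst u' m' b'.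
by exists u, m, b.
Qed.

(** A common element has the same factors along U, M and Ub in K_x and in K_y, and both
    representations see only its factor in M. *)
Lemma rho_eq x y k : gen x -> gen y -> K x k -> K y k -> rho x k = rho y k.
Proof.
move=> gx gy Kx Ky; have [U [Ub rp]] := radical_pair_ex.
have [u [m [b [[? ? ?] ? [? ? ?] ->]]]] := K_decompI gx gy rp Kx Ky.
by rewrite !(rho_decomp _ rp).
Qed.

Lemma sgKp x : gen x -> subgroup (Kp x). Proof. by move=> /(Kp_open SX)[[]]. Qed.
Lemma Kp_sub x k : gen x -> Kp x k -> K x k. Proof. by move=> /(Kp_open SX)[_ [+ _]]; apply. Qed.
Lemma Kp_norm x k h : gen x -> K x h -> Kp x k -> Kp x (conj h k).
Proof. by move=> /(Kp_open SX)[_ [_ nK]] Kh Kk; rewrite -(nK _ Kh); exists k. Qed.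

(** K_x = K_M K_{x,+} and the factorization along U, M, Ub is unique, so the unipotent factors come
    from K_{x,+}. *)
Lemma Kp_unip x U Ub u : gen x -> radical_pair iota (cG X) (cM X) U Ub ->
  K x u -> Fp U u \/ Fp Ub u -> Kp x u.
Proof.
move=> gx rp; rewrite {1}(qcf_KMKp QX gx) => -[k KMk [q Kq <-]].
have [Kk Mk] := KM_sub gx KMk; have kU := unitG (KG gx Kk); have rp' := radical_pair_sym rp.
have := Kq; rewrite {1}(qcf_Kp_decomp QX gx rp) => -[_ [u' [Ku' Uu'] [m' [Km' Mm'] <-]] [b' [Kb' Bb'] qE]].
have qE' : k * q = conj k u' * (k * m') * b' by rewrite -qE /conj !mulrA mulrVK.
have U1 : Fp U 1 by rewrite /Fpts /= im1; apply: sg1 (rp_sgU rp).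
have B1 : Fp Ub 1 by rewrite /Fpts /= im1; apply: sg1 (rp_sgU rp').
have M1 : MFp 1 by rewrite /Fpts /= im1; apply: sg1 (rp_sgM rp).
have Uc : Fp U (conj k u') by rewrite /Fpts /= im_conj; apply: (rp_norm rp).
have Mc : MFp (k * m') by rewrite /Fpts /= imM; apply: sgM (rp_sgM rp) Mk Mm'.
move=> [Uq|Bq]; rewrite qE'.
  have [|_ e1 e2] := Fp_uniq rp Uq M1 B1 Uc Mc Bb'; first by rewrite !mulr1.
  by rewrite -e1 -e2 !mulr1; apply: Kp_norm.
have [|e0 e1 _] := Fp_uniq rp U1 M1 Bq Uc Mc Bb'; first by rewrite !mul1r.
by rewrite -e0 -e1 !mul1r.
Qed.

(** Factor by factor: the unipotent factors are in K_y, hence in K_{y,+}, and the part in M is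
    common to all the groups K_{x,+}. *)
Lemma Kp_cross x y k : gen x -> gen y -> Kp x k -> K y k -> Kp y k.
Proof.
move=> gx gy Kpk Kk; have [U [Ub rp]] := radical_pair_ex.
have := Kpk; rewrite {1}(qcf_Kp_decomp QX gx rp) => -[_ [u [Ku Uu] [m [Km Mm] <-]] [b [Kb Bb] kE]].
have [u' [m' [b' [[Ku' Uu'] Km' [Kb' Bb'] e]]]] := K_decomp gy rp Kk.
have [_ Mm'] := KM_sub gy Km'; rewrite -kE in e.
have [eu em eb] := Fp_uniq rp Uu Mm Bb Uu' Mm' Bb' e; subst u' m' b'.
rewrite -kE; have sKp := sgKp gy.
apply: (sgM sKp); last by apply: (Kp_unip gy rp Kb'); right.
apply: (sgM sKp); first by apply: (Kp_unip gy rp Ku'); left.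
have : (Kp x `&` MFp) m by []; by rewrite (qcf_Kp_M QX gx gy) => -[].
Qed.

Lemma transK x y : gen x -> gen y -> exists s, trans (K y) (K y `&` K x) s.
Proof.
move=> gx gy; have sI := sgI (sgK gy) (sgK gx).
apply: (fin_trans (sgK gy) sI (compactK gy) (fun g => KG gy)); first exact: subIsetl.
have [W1 o1 E1] := openK gy; have [W2 o2 E2] := openK gx.
exists (W1 `&` W2); first exact: openI.
by rewrite E1 E2; apply/seteqP; split=> g; [case=> -[? ?] [? ?]|case=> -[? ?] ?]; do !split.
Qed.

(** K_y = K_{y,+} (K_x cap K_y), because K_M lies in K_x. An average over K_{y,+} thus runs over the
    same cosets as one over K_y. *)
Lemma transK_Kp x y s : gen x -> gen y -> trans (K y) (K y `&` K x) s ->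
  exists s', [/\ size s' = size s, trans (K y) (K y `&` K x) s' & trans (Kp y) (Kp x `&` Kp y) s'].
Proof.
move=> gx gy ts; have sI := sgI (sgK gy) (sgK gx).
have [|s' [ss t1 t2]] := trans_in (sgK gy) (sgKp gy) sI (fun g => Kp_sub gy) (@subIsetl _ _ _) _ ts.
  move=> g; rewrite {1}(qcf_KMKp QX gy) => -[k KMk [q Kq <-]]; have [Kk _] := KM_sub gy KMk.
  have kU := unitG (KG gy Kk); exists (conj k q); first exact: Kp_norm.
  by exists k; [split=> //; case: (KM_sub gx KMk)|rewrite conj_mul].
exists s'; split=> //; rewrite (_ : Kp x `&` Kp y = Kp y `&` (K y `&` K x)) //.
apply/seteqP; split=> g; first by move=> [h1 h2]; do !split=> //; exact: Kp_sub.
by move=> [h1 [h2 h3]]; split=> //; apply: (Kp_cross gy gx).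
Qed.

(** [Ind] without compact support: Theta is a finite sum, so it makes sense on all equivariant
    functions. *)
Definition eqv x f := forall k g, K x k -> GF g -> f (k * g) = rho x k (f g).

Lemma eqv_right_inv x y f g : gen x -> gen y -> eqv x f -> GF g ->
  right_inv (K y) (K y `&` K x) (fun k => rho y k (f (k^-1 * g))).
Proof.
move=> gx gy fx Gg a h Ka [Kyh Kxh]; have aU := unitG (KG gy Ka); have hU := unitG (KG gy Kyh).
rewrite invrM // -mulrA fx; [|exact: sgV (sgK gx) Kxh|].
  rewrite rhoM // comp_lfunE; congr (rho y a _).
  by rewrite (rho_eq gx gy) ?rhoKV //; apply: sgV (sgK _) _.
by apply: sgM sgGF (sgV sgGF (KG gy Ka)) Gg.
Qed.

Lemma coset_indexK x y s : gen x -> gen y -> trans (K y) (K y `&` K x) s ->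
  coset_index (K y) (K x) = size s.
Proof. by move=> gx gy; apply: coset_indexE (sgK gy) (sgK gx). Qed.

(* theta_y and rho_y agree on K_{y,+}, and rho_x = rho_y on K_x \cap K_y, so the
   average may be taken over K_y instead of K_{y,+}. *)
Lemma ThetaE x y f g s : gen x -> gen y -> eqv x f -> GF g -> trans (K y) (K y `&` K x) s ->
  Theta y x f g = (size s)%:R^-1 *: \sum_(k <- s) rho y k (f (k^-1 * g)).
Proof.
move=> gx gy fx Gg ts; have [s' [<- t1 t2]] := transK_Kp gx gy ts.
have ri := eqv_right_inv gx gy fx Gg; have sI := sgI (sgK gy) (sgK gx).
rewrite (trans_sum (sgK gy) sI (@subIsetl _ _ _) ts t1 ri).
rewrite /Theta (coset_indexE (sgKp gy) (sgKp gx) (s := s')); last by rewrite setIC.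
congr (_ *: _); rewrite (csumE (V := V) (A := Kp y) (D := Kp x `&` Kp y) (s := s')
  (f := fun k => cth X y k *: f (k^-1 * g)) (sgKp gy) (sgI (sgKp gx) (sgKp gy)) (@subIsetr _ _ _) t2).
  apply: eq_big_seq => k ks; have Kk : Kp y k by case: t2 => _ + _ _; apply.
  by rewrite (qcf_isotypic QX gy Kk) !lfunE /= lfunE.
move=> a h Ka [Kxh Kyh].
have tE k v : Kp y k -> cth X y k *: v = rho y k v.
  by move=> Kk; rewrite (qcf_isotypic QX gy Kk) scale_lfunE id_lfunE.
rewrite !tE //; last exact: sgM (sgKp gy) Ka Kyh.
by apply: ri; [exact: Kp_sub|split; exact: Kp_sub].
Qed.

(* K_y is covered by (K_y \cap U) and K_y \cap K_x for a suitable U, and the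
   p-power maps of the unipotent group K_y \cap U tend to 1. *)
Lemma pnat_transK x y s : gen x -> gen y -> trans (K y) (K y `&` K x) s -> p.-nat (size s).
Proof.
move=> gx gy ts; have sI := sgI (sgK gy) (sgK gx).
(* The degenerate geodesic x, y, y provides a U for which K_y cap Ub lies in K_x. *)
have [H _ h|U [Ub [rp [xU _] [_ xB]]]] := @dist_disjoint x y y gx gy gy; first exact: sep_refl h.
have sU : subgroup (Fp U).
  have sU := rp_sgU rp; split=> [g /(sgU sU)||g h Gg Gh|g Gg]; rewrite ?im_unit //.
  - by rewrite /Fpts /= im1; apply: sg1.
  - by rewrite /Fpts /= imM; apply: sgM.
  - by rewrite /Fpts /= imV; apply: sgV.
have sKU := sgI (sgK gy) sU.
have [|s' [<- t1 _]] := trans_in (sgK gy) sKU sI (@subIsetl _ _ _) (@subIsetl _ _ _) _ ts.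
  move=> k /(K_decomp gy rp)[u [m [b [[Ku Uu] Km [Kb Bb] ->]]]].
  exists u => //; exists (m * b); last by rewrite mulrA.
  have [Km1 _] := KM_sub gx Km; have [Km2 _] := KM_sub gy Km.
  have [Kb' _] := xB b (Logic.conj Kb Bb).
  by split; apply: sgM => //; apply: sgK.
apply: (@pnat_trans_size _ p _ _ _ _ sKU (sgI sKU sI) t1); first by case: rpF.
move=> g [Kg Ug]; have Kgk (j : nat) : (K y `&` Fp U) (g ^+ j).
  by elim: j => [|j IHj]; rewrite ?expr0 ?exprS; [apply: sg1|apply: sgM].
have gn : (g - 1) ^+ d.+1 = 0.
  apply: (@im_inj _ _ iota d); have := rp_unip rp Ug.
  by rewrite -(im1 iota d) -(map_mxB iota) -[in X in X -> _](rmorphXn (map_mx iota)) raddf0.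
have [k' kP] := unipotent_pX rpF gn (openK gx) (sg1 (sgK gx)) (fun j => KG gy (Kgk j).1).
by exists k'; have [] := Kgk (p ^ k')%N; do !split.
Qed.

Local Notation Tn := (@Theta_norm _ _ _ _ _ p sqp E X).
Local Notation sq a := (psqrt p sqp a).

Let sKI x y : gen x -> gen y -> subgroup (K x `&` K y).
Proof. by move=> gx gy; apply: sgI (sgK gx) (sgK gy). Qed.
Let sq0 a : sq a != 0. Proof. exact: psqrt_neq0. Qed.
Let GM g h : GF g -> GF h -> GF (g * h). Proof. exact: sgM sgGF. Qed.
Let GV g : GF g -> GF g^-1. Proof. exact: sgV sgGF. Qed.
Let KGF x k : gen x -> K x k -> GF k. Proof. exact: KG. Qed.
Let NM n m : N n -> N m -> N (n * m). Proof. exact: sgM (N_subgroup SX). Qed.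
Let NV n : N n -> N n^-1. Proof. exact: sgV (N_subgroup SX). Qed.
Let g0 : gen (0 : pts). Proof. exact: gen0. Qed.

(** The index is a power of p, so its inverse times its square root is the inverse square root. *)
Lemma Theta_normE x y f g s : gen x -> gen y -> eqv x f -> GF g ->
  trans (K y) (K y `&` K x) s ->
  Tn y x f g = (sq (size s))^-1 *: \sum_(k <- s) rho y k (f (k^-1 * g)).
Proof.
move=> gx gy fx Gg ts; rewrite /Theta_norm (ThetaE gx gy fx Gg ts).
rewrite (coset_indexK gx gy ts) scalerA mulrC (psqrt_div) //.
exact: (pnat_transK gx gy ts).
Qed.

Lemma Theta_norm_ext x y f f' g : gen x -> gen y -> eqv x f -> eqv x f' -> GF g ->
  (forall h, GF h -> f h = f' h) -> Tn y x f g = Tn y x f' g.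
Proof.
move=> gx gy fx fx' Gg ff; have [s ts] := transK gx gy.
rewrite !(Theta_normE _ _ _ Gg ts) //; congr (_ *: _); apply: eq_big_seq => k ks.
by rewrite ff //; apply: GM => //; apply: GV; case: ts => _ /(_ k ks)/(KGF gy).
Qed.

Lemma Theta_norm_eqv x y f : gen x -> gen y -> eqv x f -> eqv y (Tn y x f).
Proof.
move=> gx gy fx k0 g Kk0 Gg; have [s ts] := transK gx gy; have k0U := unitG (KGF gy Kk0).
have Gkg := GM (KGF gy Kk0) Gg.
have ts' := trans_mul (sgK gy) Kk0 ts; have := eqv_right_inv gx gy fx Gkg => ri.
rewrite !(Theta_normE gx gy fx _ ts) // [RHS]linearZ /=; congr (_ *: _).
rewrite linear_sum (trans_sum (sgK gy) (sKI gy gx) (@subIsetl _ _ _) ts ts' ri) big_map.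
apply: eq_big_seq => k ks; have Kk : K y k by case: ts => _ + _ _; apply.
have kU := unitG (KGF gy Kk).
by rewrite (rhoM gy) // comp_lfunE invrM // -mulrA mulKr.
Qed.

Lemma Theta_normZ x y f a g : gen x -> gen y -> eqv x f -> GF g ->
  Tn y x (fun h => a *: f h) g = a *: Tn y x f g.
Proof.
move=> gx gy fx Gg; have [s ts] := transK gx gy.
have fx' : eqv x (fun h => a *: f h) by move=> k h Kk Gh; rewrite fx // linearZ.
rewrite !(Theta_normE gx gy _ Gg ts) // !scalerA [a * _]mulrC -scalerA; congr (_ *: _).
by rewrite scaler_sumr; apply: eq_big_seq => k ks; rewrite linearZ.
Qed.

(** The function f_v for any base point; at 0 it is [fun_at]. *)
Definition fun_at_pt x (v : V) g : V := if g \in K x then rho x g v else 0.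

Lemma fun_at_eqv x v : gen x -> eqv x (fun_at_pt x v).
Proof.
move=> gx k g Kk Gg; rewrite /fun_at_pt.
have -> : (k * g \in K x) = (g \in K x).
  apply/idP/idP => /set_mem h; apply/mem_set; last by apply/(sgMl _ (sgK gx) Kk).
  by move/(sgMl _ (sgK gx) Kk): h.
by case: ifP => [/set_mem Kg|_]; rewrite ?linear0 // (rhoM gx) // comp_lfunE.
Qed.

Lemma Theta_fun_at x y v k r : gen x -> gen y -> K y k -> K x r ->
  Tn y x (fun_at_pt x v) (k * r) = (sq (coset_index (K y) (K x)))^-1 *: rho y k (rho x r v).
Proof.
move=> gx gy Kk Kr; have [s ts] := transK gx gy.
have kU := unitG (KGF gy Kk).
rewrite (coset_indexK gx gy ts) (Theta_normE gx gy (fun_at_eqv _ gx) _ ts); last first.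
  by apply: GM; [exact: KGF Kk|exact: KGF Kr].
congr (_ *: _); have [us Ks Ds Es] := ts; have [k0 k0s [Kyk Kxk]] := Es k Kk.
have Kk0 := Ks _ k0s; have k0U := unitG (KGF gy Kk0).
rewrite (bigD1_seq k0) //= big1_seq ?addr0 => [|k' /andP[nk k's]].
  have Kx : K x (k0^-1 * (k * r)) by rewrite mulrA; apply: sgM (sgK gx) _ _.
  rewrite /fun_at_pt mem_set // mulrA (rhoM gx) // comp_lfunE (rho_eq gx gy) //.
  by rewrite (rhoM gy) // ?comp_lfunE ?(rhoKV) //; apply: sgV (sgK gy) _.
rewrite /fun_at_pt; case: ifP => [/set_mem Kx|_]; last by rewrite linear0.
have k'U := unitG (KGF gy (Ks _ k's)).
case/eqP: nk; apply: Ds => //; split; first by apply: (sgM (sgK gy) (sgV (sgK gy) (Ks _ k's))).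
move: Kx; rewrite mulrA => /(sgMr _ (sgK gx) Kr) Kx.
have := sgM (sgK gx) Kx (sgV (sgK gx) Kxk).
by rewrite invrM ?unitrV // invrK -!mulrA mulVKr.
Qed.

Lemma Theta_fun_at0 x y v g : gen x -> gen y -> GF g -> ~ setprod (K y) (K x) g ->
  Tn y x (fun_at_pt x v) g = 0.
Proof.
move=> gx gy Gg ng; have [s ts] := transK gx gy.
rewrite (Theta_normE gx gy (fun_at_eqv _ gx) Gg ts) big1_seq ?scaler0 // => k /= ks.
have Kk : K y k by case: ts => _ + _ _; apply.
rewrite /fun_at_pt; case: ifP => [/set_mem Kx|_]; last by rewrite linear0.
case: ng; exists k => //; exists (k^-1 * g) => //.
by rewrite mulVKr // (unitG (KGF gy Kk)).
Qed.

(** Each of the |K_x/(K_x cap K_y)| terms of the outer sum is the same multiple of v. When the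
    composite is a scalar operator, this value at 1 determines the scalar. *)
Lemma ThetaTheta_fun_at x y v : gen x -> gen y ->
  Tn x y (Tn y x (fun_at_pt x v)) 1 =
  ((sq (coset_index (K y) (K x)))^-1 * sq (coset_index (K x) (K y))) *: v.
Proof.
move=> gx gy; have [t tt] := transK gy gx.
have G1 : GF 1 by exact: sg1 (sgGF).
have ev := Theta_norm_eqv gx gy (fun_at_eqv v gx).
rewrite (Theta_normE gy gx ev G1 tt) (coset_indexK gy gx tt).
rewrite (eq_big_seq (fun=> (sq (coset_index (K y) (K x)))^-1 *: v)) => [|k ks].
  rewrite big_const_seq count_predT iter_addr_0 -scaler_nat !scalerA; congr (_ *: _).
  rewrite -(psqrt_sq (pnat_transK gy gx tt)) -mulrA mulKf //.
  by rewrite mulrC.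
have Kk : K x k by case: tt => _ + _ _; apply.
rewrite mulr1 -[k^-1]mul1r Theta_fun_at //; [|exact: sg1 (sgK gy)|exact: sgV (sgK gx) Kk].
by rewrite (rho1 gy) id_lfunE linearZ /= (rhoKV).
Qed.

Lemma unip_cover x y U Ub : gen x -> gen y -> radical_pair iota (cG X) (cM X) U Ub ->
  K y `&` Fp Ub `<=` K x `&` Fp Ub -> K y `<=` setprod (K y `&` Fp U) (K y `&` K x).
Proof.
move=> gx gy rp yB k /(K_decomp gy rp)[u [m [b [[Ku Uu] Km [Kb Bb] ->]]]].
exists u => //; exists (m * b); last by rewrite mulrA.
have [Km1 _] := KM_sub gx Km; have [Km2 _] := KM_sub gy Km.
have [Kb' _] := yB b (Logic.conj Kb Bb).
by split; [exact: (sgM (sgK gy))|exact: (sgM (sgK gx))].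
Qed.

Lemma sg_rational (U : set 'M[Fb]_d.+1) : subgroup U -> subgroup (Fp U).
Proof.
move=> sU; split=> [g /(sgU sU)||g h Gg Gh|g Gg]; rewrite ?im_unit //.
- by rewrite /Fpts /= im1; apply: sg1.
- by rewrite /Fpts /= imM; apply: sgM.
- by rewrite /Fpts /= imV; apply: sgV.
Qed.

(** Here K_y = (K_y cap U)(K_x cap K_y), and rho_y is trivial on K_y cap U, so the operator is a
    normalized sum of translates. *)
Lemma Theta_normE_unip x y f g s U Ub : gen x -> gen y ->
  radical_pair iota (cG X) (cM X) U Ub ->
  K x `&` Fp U `<=` K y `&` Fp U -> K y `&` Fp Ub `<=` K x `&` Fp Ub ->
  eqv x f -> GF g -> trans (K y `&` Fp U) (K x `&` Fp U) s ->
  Tn y x f g = (sq (size s))^-1 *: \sum_(k <- s) f (k^-1 * g).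
Proof.
move=> gx gy rp xU yB fx Gg ts; have sU := sg_rational (rp_sgU rp).
have ts' : trans (K y) (K y `&` K x) s.
  apply: (trans_sub (sgK gy) (sgI (sgK gy) sU) (@subIsetl _ _ _)
    (unip_cover gx gy rp yB) (sKI gy gx)).
  rewrite (_ : K y `&` Fp U `&` (K y `&` K x) = K x `&` Fp U) //.
  by apply/seteqP; split=> k [h1 h2]; [case: h1 h2 => ? ? []|case: (xU k (Logic.conj h1 h2))].
rewrite (Theta_normE gx gy fx Gg ts'); congr (_ *: _); apply: eq_big_seq => k ks.
have [_ Ks _ _] := ts; have [Kk Uk] := Ks k ks.
by have [_ _ _ ->] := qcf_cover QX gy rp; rewrite ?id_lfunE //; left.
Qed.

Lemma trans_unip x y U Ub : gen x -> gen y -> radical_pair iota (cG X) (cM X) U Ub ->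
  K x `&` Fp U `<=` K y `&` Fp U -> K y `&` Fp Ub `<=` K x `&` Fp Ub ->
  exists s, trans (K y `&` Fp U) (K x `&` Fp U) s.
Proof.
move=> gx gy rp xU yB; have [s ts] := transK gx gy; have sU := sg_rational (rp_sgU rp).
have [s' [_ t' _]] := trans_in (sgK gy) (sgI (sgK gy) sU) (sKI gy gx)
  (@subIsetl _ _ _) (@subIsetl _ _ _) (unip_cover gx gy rp yB) ts.
exists s'; rewrite (_ : K x `&` Fp U = K y `&` Fp U `&` (K y `&` K x)) //.
by apply/seteqP; split=> k [h1 h2]; [case: (xU k (Logic.conj h1 h2))|case: h1 h2 => ? ? []].
Qed.

(** One U serves the three points of a geodesic. Transversals multiply along the tower K_x cap U,
    K_y cap U, K_z cap U, and so do the square roots of the indices. *)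
Lemma Theta_geodesic x y z f g : gen x -> gen y -> gen z ->
  (forall H, sep x y H -> ~ sep y z H) -> eqv x f -> GF g ->
  Tn z y (Tn y x f) g = Tn z x f g.
Proof.
move=> gx gy gz dis fx Gg.
have [U [Ub [rp [xyU yzU] [zyB yxB]]]] := dist_disjoint gx gy gz dis.
have sU := sg_rational (rp_sgU rp).
have [s1 t1] := trans_unip gx gy rp xyU yxB; have [s2 t2] := trans_unip gy gz rp yzU zyB.
have t12 := trans_tower (sgI (sgK gz) sU) (sgI (sgK gy) sU) (sgI (sgK gx) sU)
  xyU yzU t2 t1.
have fy := Theta_norm_eqv gx gy fx.
rewrite (Theta_normE_unip gy gz rp yzU zyB fy Gg t2).
rewrite (Theta_normE_unip gx gz rp _ _ fx Gg t12); [|exact: subset_trans xyU yzU|exact: subset_trans zyB yxB].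
rewrite size_allpairs psqrtM; first last.
- by have [_ _ _ /(_ 1 (sg1 (sgI (sgK gy) sU)))[k]] := t1; case: (s1).
- by have [_ _ _ /(_ 1 (sg1 (sgI (sgK gz) sU)))[k]] := t2; case: (s2).
rewrite invfM -scalerA; congr (_ *: _).
rewrite big_flatten /= big_map scaler_sumr; apply: eq_big_seq => k ks; rewrite big_map.
have [_ Ks _ _] := t2; have [Kk _] := Ks k ks; have kU := unitG (KGF gz Kk).
rewrite (Theta_normE_unip gx gy rp xyU yxB fx _ t1); last exact: GM (GV (KGF gz Kk)) Gg.
congr (_ *: _); apply: eq_big_seq => k' ks'; have [_ Ks' _ _] := t1; have [Kk' _] := Ks' k' ks'.
by rewrite invrM ?mulrA // (unitG (KGF gy Kk')).
Qed.

Lemma N_KM n : N n -> setconj n KM = KM.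
Proof. by move=> Nn; have [[_ ? _] _] := N_sub SX Nn. Qed.

Lemma act_image n H : N n -> act X n^-1 @` (act X n @` H) = H.
Proof.
move=> Nn; rewrite image_comp (_ : _ \o _ = id) ?image_id //.
by apply/funext => v /=; rewrite (actK SX).
Qed.

Lemma act_imageV n H : N n -> act X n @` (act X n^-1 @` H) = H.
Proof.
move=> Nn; rewrite image_comp (_ : _ \o _ = id) ?image_id //.
by apply/funext => v /=; rewrite (actVK SX).
Qed.

Lemma gen_act n x : N n -> gen x -> gen (act X n x).
Proof.
move=> Nn gx [H hH Hx]; apply: gx; exists (act X n^-1 @` H); first exact: (qcf_hyperplanes QX (NV Nn)).
by exists (act X n x) => //; rewrite (actK SX).
Qed.

Lemma opp_act n x y H : N n -> @aH _ _ _ _ E H -> opposite_sides H x y ->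
  opposite_sides (act X n @` H) (act X n x) (act X n y).
Proof.
move=> Nn hH os; have [a [c [a0 HE]]] := aH_form sysH hH; move/(oppE a0 HE): os => os.
have [Z ZE] := act_affine SX (NV Nn).
pose c' := c - (act X n^-1 0 *m a) 0 0.
have affE v : aff (Z *m a) c' (act X n v) = aff a c v.
  rewrite /aff /c' -[in RHS](actK SX Nn v) (ZE (act X n v)) mulmxDl mulmxA [in RHS]mxE; ring.
exists (Z *m a), c'; split; last by have := os; rewrite -!affE.
split.
  apply/eqP => Za; move: os; rewrite -!affE Za /aff !mulmx0 -expr2 => /lt_geF.
  by rewrite sqr_ge0.
apply/seteqP; split=> v /=.
  move=> [w Hw <-]; have := affE w; rewrite /aff; move: Hw; rewrite HE /= /aff => -> /eqP.
  by rewrite subr_eq0 => /eqP.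
move=> e; exists (act X n^-1 v); last by rewrite (actVK SX).
by rewrite HE /= -affE (actVK SX) // /aff e subrr.
Qed.

Lemma sep_act n x y H : N n -> sep x y H -> sep (act X n x) (act X n y) (act X n @` H).
Proof.
move=> Nn [hH gx gy os]; split; [exact: (qcf_hyperplanes QX)|exact: gen_act|exact: gen_act|].
exact: opp_act.
Qed.

Lemma same_act n x y H : N n -> @aH _ _ _ _ E H -> sameS H x y ->
  sameS (act X n @` H) (act X n x) (act X n y).
Proof.
move=> Nn hH [nx ny no]; have mem v : (act X n @` H) (act X n v) -> H v.
  by move=> [w Hw /(can_inj (actK SX Nn)) <-].
split=> [/mem//|/mem//|os]; apply: no.
have := opp_act (NV Nn) (qcf_hyperplanes QX Nn hH) os.
by rewrite act_image // !(actK SX).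
Qed.

Lemma K_act n x : N n -> gen x -> K (act X n x) = setconj n (K x).
Proof. by move=> Nn gx; case: (qcf_equivariant QX Nn gx). Qed.

Lemma coset_index_act n x y : N n -> gen x -> gen y ->
  coset_index (K (act X n y)) (K (act X n x)) = coset_index (K y) (K x).
Proof.
move=> Nn gx gy; have [s ts] := transK gx gy; have [_ nU _] := N_normalizes SX Nn.
rewrite (coset_indexK gx gy ts) (coset_indexK (gen_act Nn gx) (gen_act Nn gy) (s := map (conj n) s)) ?size_map //.
by rewrite !K_act // -setconjI //; apply: trans_conj (sgK gy) ts.
Qed.

Section BasicFamily.
Context (T : MF -> 'End(V)) (bT : @basic_family _ _ _ _ _ E X T).

Lemma T_rM n k v : N n -> KM k -> T n (rM k v) = rM (conj n k) (T n v).
Proof.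
move=> Nn Kk; have [/(_ n Nn)[_ hT] _ _] := bT; have [_ nU _] := N_normalizes SX Nn.
have Kc : KM (conj n k) by rewrite -(N_KM Nn); exists k.
have := hT _ Kc; rewrite /rep_conj conjK // => /lfunP/(_ v).
by rewrite !comp_lfunE.
Qed.

(** Conjugation by n turns a factorization of k along U, M, Ub into one along the conjugate
    radicals. A quasi-cover factorizes for every choice of U, so both sides are determined by the
    factor in M. *)
Lemma T_rho n y k v : N n -> gen y -> K y k ->
  T n (rho y k v) = rho (act X n y) (conj n k) (T n v).
Proof.
move=> Nn gy Kk; have [Gn nU nM] := N_normalizes SX Nn; have gny := gen_act Nn gy.
have [U [Ub rp]] := radical_pair_ex.
have rp' := radical_pair_conj (sgG) Gn nM rp.
have Kc j : K y j -> K (act X n y) (conj n j) by move=> Kj; rewrite K_act //; exists j.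
have [u [m [b [[Ku Uu] Km [Kb Bb] ->]]]] := K_decomp gy rp Kk.
have Fc (W : set 'M[Fb]_d.+1) j : Fp W j -> Fp (setconj (im n) W) (conj n j).
  by move=> Wj; rewrite /Fpts /= im_conj; exists (im j).
rewrite (rho_decomp gy rp) // !conjM // (rho_decomp gny rp') //.
- exact: T_rM.
- exact: Kc.
- exact: Fc.
- by rewrite -(N_KM Nn); exists m.
- exact: Kc.
- exact: Fc.
Qed.

Lemma T_lker n : N n -> lker (T n) == 0%VS.
Proof.
move=> Nn; have [/(_ n Nn)[T0 hT] _ _] := bT; have [_ nU _] := N_normalizes SX Nn.
have [_ irM] := rM_irr SX; apply: irr_lker0 irM T0 _ => k Kk; exists (rM (conj n k)).
by apply/lfunP => v; rewrite !comp_lfunE T_rM.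
Qed.

Lemma T_neq0 n v : N n -> v != 0 -> T n v != 0.
Proof. by move=> Nn; apply: contraNneq => /eqP; rewrite -memv_ker (eqP (T_lker Nn)) memv0. Qed.

Definition cn n f g : V := T n (f (n^-1 * g)).

Lemma cn_eqv n y f : N n -> gen y -> eqv y f -> eqv (act X n y) (cn n f).
Proof.
move=> Nn gy fy k g; rewrite K_act // => -[k' Kk' <-] Gg; have [Gn nU _] := N_normalizes SX Nn.
rewrite /cn (_ : n^-1 * (conj n k' * g) = k' * (n^-1 * g)); last by rewrite /conj !mulrA mulVr // mul1r.
by rewrite fy ?T_rho //; apply: GM => //; apply: GV.
Qed.

(** Conjugation by n carries a transversal for (x, y) to one for (nx, ny), and [T_rho] matches the
    coefficients. *)
Lemma cn_Theta n x y f g : N n -> gen x -> gen y -> eqv x f -> GF g ->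
  Tn (act X n y) (act X n x) (cn n f) g = cn n (Tn y x f) g.
Proof.
move=> Nn gx gy fx Gg; have [s ts] := transK gx gy; have [Gn nU _] := N_normalizes SX Nn.
have Gng : GF (n^-1 * g) by exact: GM (GV Gn) Gg.
have ts' := trans_conj nU (sgK gy) ts; rewrite setconjI // -!K_act // in ts'.
rewrite (Theta_normE (gen_act Nn gx) (gen_act Nn gy) (cn_eqv Nn gx fx) Gg ts').
rewrite /cn (Theta_normE gx gy fx Gng ts) [RHS]linearZ size_map big_map /=.
congr (_ *: _); rewrite linear_sum; apply: eq_big_seq => k ks; have Kk : K y k by case: ts => _ + _ _; apply.
have kU := unitG (KGF gy Kk); rewrite /= T_rho //; congr (rho _ _ (T n (f _))).
by rewrite -conjV // /conj -!mulrA mulKr.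
Qed.

End BasicFamily.

Lemma Theta_norm_lin x y f f' a g : gen x -> gen y -> eqv x f -> eqv x f' -> GF g ->
  Tn y x (fun h => a *: f h + f' h) g = a *: Tn y x f g + Tn y x f' g.
Proof.
move=> gx gy fx fx' Gg; have [s ts] := transK gx gy.
have fx2 : eqv x (fun h => a *: f h + f' h) by move=> k h Kk Gh; rewrite fx // fx' // linearP.
rewrite !(Theta_normE gx gy _ Gg ts) // scalerA [a * _]mulrC -scalerA -scalerDr.
congr (_ *: _); rewrite scaler_sumr -big_split; apply: eq_big_seq => k ks.
by rewrite linearP.
Qed.

(** [relevant] refers to the operators without normalization; the two composites differ by a
    non-zero constant. *)
Lemma ThetaTheta x y f g : gen x -> gen y -> eqv x f -> GF g ->
  Theta x y (Theta y x f) g =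
  (sq (coset_index (K x) (K y)) * sq (coset_index (K y) (K x)))^-1 *: Tn x y (Tn y x f) g.
Proof.
move=> gx gy fx Gg; have fy := Theta_norm_eqv gx gy fx.
have -> : Theta y x f = fun h => (sq (coset_index (K y) (K x)))^-1 *: Tn y x f h.
  by apply/funext => h; rewrite /Theta_norm scalerA mulVf ?scale1r.
rewrite invfM -scalerA -(Theta_normZ) // {2}/Theta_norm scalerA mulVf //.
by rewrite scale1r.
Qed.

(* A value of Theta Theta f depends on finitely many values of [f], so that [f] can
   be cut off to have compact support. *)
Lemma scalar_eqv x y : gen x -> gen y ->
  scalar_op iota x (fun f : MF -> V => Theta x y (Theta y x f)) ->
  exists c, forall f g, eqv x f -> GF g -> Tn x y (Tn y x f) g = c *: f g.
Proof.
move=> gx gy [c cP].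
set a := sq (coset_index (K x) (K y)) * sq (coset_index (K y) (K x)); exists (a * c) => f g fx Gg.
have a0 : a != 0 by rewrite mulf_neq0.
have [s ts] := transK gx gy; have [t tt] := transK gy gx.
have sG k : k \in s -> GF k by case: ts => _ Ks _ _ /Ks/(KGF gy).
have tG k : k \in t -> GF k by case: tt => _ Ks _ _ /Ks/(KGF gx).
(* The list consists of [g] and the points at which the double sum evaluates [f]. The cut-off [f']
   keeps [f] on their K_x-cosets. *)
pose S := g :: [seq k'^-1 * (k^-1 * g) | k <- t, k' <- s].
have SG h : h \in S -> GF h.
  rewrite inE => /orP[/eqP -> //|/allpairsP[[k k'] /= [kt ks ->]]].
  by apply: GM; [apply/GV/sG|apply: GM => //; apply/GV/tG].
pose f' h := if `[< exists2 r, r \in S & K x (h * r^-1) >] then f h else 0.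
have f'S h : h \in S -> f' h = f h.
  move=> hS; rewrite /f'; case: asboolP => // -[]; exists h => //.
  by rewrite mulrV ?(unitG (SG _ hS)) //; apply: sg1 (sgK gx).
have fx' : eqv x f'.
  move=> k h Kk Gh; rewrite /f' [in LHS](_ : `[< _ >] = `[< exists2 r, r \in S & K x (h * r^-1) >]).
    by case: ifP => _; [exact: fx|rewrite linear0].
  apply/asboolP/asboolP => -[r rS]; rewrite -?mulrA => Kr; exists r => //.
    by move/(sgMl _ (sgK gx) Kk): Kr.
  by rewrite -mulrA; apply/(sgMl _ (sgK gx) Kk).
have fI : Ind iota x f'.
  split=> //; exists [set` S]; split=> [||h Gh].
  - rewrite (_ : [set` S] = [set h | exists2 r, r \in S & [set r] h]).
      by apply: compact_seq_union => r _; apply: compact_set1.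
    by apply/seteqP; split=> h /= => [hS|[r rS ->] //]; exists h.
  - by move=> h /SG.
  rewrite /f'; case: asboolP => [[r rS Kr] _|_]; last by rewrite eqxx.
  exists (h * r^-1) => //; exists r => //.
  by rewrite mulrVK // (unitG (SG _ rS)).
have := cP f' g fI Gg; rewrite ThetaTheta // -/a => e'; rewrite -f'S ?mem_head //.
have -> : (a * c) *: f' g = Tn x y (Tn y x f') g by rewrite -scalerA -e' scalerA mulfV // scale1r.
have e := Theta_normE.
rewrite !(e _ _ _ _ _ gy gx _ Gg tt); try exact: (Theta_norm_eqv).
congr (_ *: _); apply: eq_big_seq => k kt.
have Gk : GF (k^-1 * g) by apply: GM => //; apply/GV/tG.
rewrite !(e _ _ _ _ _ gx gy _ Gk ts) //; congr (rho x k (_ *: _)); apply: eq_big_seq => k' ks.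
by rewrite f'S // inE; apply/orP; right; apply/allpairsP; exists (k, k').
Qed.

Lemma scaler_inj (U : lmodType C) (a b : C) (v : U) : v != 0 -> a *: v = b *: v -> a = b.
Proof.
move=> v0 /eqP; rewrite -subr_eq0 -scalerBl scaler_eq0 (negPf v0) orbF subr_eq0.
by move/eqP.
Qed.

Lemma V_neq0 : exists v : V, v != 0.
Proof.
have [_ [V0 _]] := rM_irr SX; exists (vpick {:V}); by rewrite vpick0.
Qed.

(* Theta_{y|x} embeds the functions on [J] induced from K_x into those induced from
   K_y. *)
Lemma ind_index_le x y (J : set MF) sx sy c : gen x -> gen y -> subgroup J -> J `<=` GF ->
  K x `<=` J -> K y `<=` J -> trans J (K x) sx -> trans J (K y) sy -> c != 0 ->
  (forall f g, eqv x f -> GF g -> Tn x y (Tn y x f) g = c *: f g) ->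
  (size sx <= size sy)%N.
Proof.
move=> gx gy sJ JG KxJ KyJ tx ty c0 cP.
have rJ i : (i < size sx)%N -> J (nth 1 sx i) by move=> li; case: tx => _ + _ _; apply; rewrite mem_nth.
have rU i : (i < size sx)%N -> nth 1 sx i \is a GRing.unit by move=> /rJ/(sgU sJ).
(* [fF a] is the equivariant function supported on [J] whose values at the inverses of the
   representatives are the [a i]. *)
pose fF (a : {ffun 'I_(size sx) -> V}) g := \sum_i fun_at_pt x (a i) (g * nth 1 sx i).
have fFx a : eqv x (fF a).
  move=> k g Kk Gg; rewrite /fF linear_sum; apply: eq_bigr => i _; rewrite -mulrA.
  by rewrite (fun_at_eqv) //; apply: GM => //; apply/JG/rJ.
have fF1 a (i : 'I_(size sx)) : fF a (nth 1 sx i)^-1 = a i.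
  rewrite /fF (bigD1 i) //= mulVr ?rU // big1 ?addr0 => [|j ji].
    by rewrite /fun_at_pt mem_set ?(rho1) ?id_lfunE //; apply: sg1 (sgK gx).
  rewrite /fun_at_pt; case: ifP => // /set_mem Kij.
  case/eqP: ji; have [us _ Ds _] := tx.
  have := Ds _ _ (mem_nth 1 (ltn_ord i)) (mem_nth 1 (ltn_ord j)) Kij.
  by move/eqP; rewrite nth_uniq // => /eqP/val_inj.
have fFl a (u v : {ffun 'I_(size sx) -> V}) g : fF (a *: u + v) g = a *: fF u g + fF v g.
  rewrite /fF scaler_sumr -big_split; apply: eq_bigr => i _; rewrite !ffunE /= /fun_at_pt.
  by case: ifP => _; rewrite ?linearP // scaler0 addr0.
have yG j : j \in sy -> GF j^-1 by case: ty => _ h _ _ /h/JG/GV.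
pose L (a : {ffun 'I_(size sx) -> V}) := [ffun j : 'I_(size sy) => Tn y x (fF a) (nth 1 sy j)^-1].
have Ll : linear L.
  move=> a u v; apply/ffunP => j; rewrite !ffunE.
  have Gj := yG _ (mem_nth 1 (ltn_ord j)).
  have fE : fF (a *: u + v) = fun h => a *: fF u h + fF v h by apply/funext => g; exact: fFl.
  by rewrite fE (Theta_norm_lin _ gx gy (fFx u) (fFx v) Gj).
have L0 a : L a = 0 -> a = 0.
  move=> La; apply/ffunP => i; rewrite ffunE.
  have fy := Theta_norm_eqv gx gy (fFx a).
  have Jz g : J g -> Tn y x (fF a) g = 0.
    move=> Jg; have [us Js _ Es] := ty; have [r rs Kr] := Es _ (sgV sJ Jg).
    have rU' := sgU sJ (Js r rs); have gU := sgU sJ Jg.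
    have [j jE] : exists j : 'I_(size sy), nth 1 sy j = r.
      have ls : (index r sy < size sy)%N by rewrite index_mem.
      by exists (Ordinal ls); rewrite /= nth_index.
    have -> : g = (g * r) * r^-1 by rewrite mulrK.
    rewrite fy; last 2 first.
    - by have := sgV (sgK gy) Kr; rewrite invrM ?unitrV // !invrK.
    - exact: yG.
    by have /ffunP/(_ j) := La; rewrite !ffunE jE => ->; rewrite linear0.
  have Jr := sgV sJ (rJ i (ltn_ord i)).
  apply/eqP; rewrite -(inj_eq (scalerI c0)) scaler0 -fF1 -cP //; last exact: JG.
  have [t tt] := transK gy gx.
  rewrite (Theta_normE gy gx fy (JG _ Jr) tt) big1_seq ?scaler0 // => k /= kt.
  rewrite Jz ?linear0 //; apply: (sgM sJ _ Jr); apply: (sgV sJ); apply: KxJ.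
  by case: tt => _ + _ _; apply.
have kL : lker (linfun L) == 0%VS.
  rewrite -subv0; apply/subvP => a; rewrite memv_ker memv0 (linfunE Ll) => /eqP/L0 ->.
  by rewrite eqxx.
have := limg_ker_dim (linfun L) fullv; rewrite (eqP kL) capv0 dimv0 add0n => dE.
have := dimvS (subvf (linfun L @: fullv)); rewrite dE !dimvf.
rewrite /dim /= !card_ord leq_mul2r => /orP[/eqP V0|//].
by have [v] := V_neq0; rewrite -memv0 -(_ : fullv = 0%VS) ?memvf //; apply/eqP; rewrite -dimv_eq0 dimvf V0.
Qed.

Definition good H := forall x y f g, gen x -> gen y -> sep x y = [set H] -> eqv x f -> GF g ->
  Tn x y (Tn y x f) g = f g.

(** Irrelevance applies to both orders of x and y, so both composites are scalars, non-zero by their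
    value at 1 on f_v. [ind_index_le] in both directions gives |J/K_x| = |J/K_y|, hence equal
    indices over K_x cap K_y. The scalar is the quotient of the square roots of these indices. *)
Lemma irrelevant_good H : @aH _ _ _ _ E H -> ~ relevant iota X H ->
  (forall x y, gen x -> gen y -> sep x y = [set H] -> exists J, [/\ subgroup J, J `<=` GF,
     compact J, K x `<=` J & K y `<=` J]) -> good H.
Proof.
move=> hH irr Jex x y f g gx gy sxy fx Gg.
have syx : sep y x = [set H] by rewrite sep_sym.
have ns x' y' : gen x' -> gen y' -> sep x' y' = [set H] ->
    scalar_op iota x' (fun f : MF -> V => Theta x' y' (Theta y' x' f)).
  by move=> gx' gy' s'; apply: contrapT => n; apply: irr; split=> //; exists x', y'.
have [c cP] := scalar_eqv gx gy (ns _ _ gx gy sxy).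
have [c' cP'] := scalar_eqv gy gx (ns _ _ gy gx syx).
have [v v0] := V_neq0; have G1 : GF 1 by exact: sg1 (sgGF).
have fE z : gen z -> fun_at_pt z v 1 = v.
  by move=> gz; rewrite /fun_at_pt mem_set ?(rho1) ?id_lfunE //; apply: sg1 (sgK gz).
have TT := ThetaTheta_fun_at v.
have cE := cP _ _ (fun_at_eqv v gx) G1; rewrite TT // fE // in cE.
have cE' := cP' _ _ (fun_at_eqv v gy) G1; rewrite TT // fE // in cE'.
have {}cE : (sq (coset_index (K y) (K x)))^-1 * sq (coset_index (K x) (K y)) = c.
  exact: scaler_inj v0 cE.
have {}cE' : (sq (coset_index (K x) (K y)))^-1 * sq (coset_index (K y) (K x)) = c'.
  exact: scaler_inj v0 cE'.
have c0 : c != 0 by rewrite -cE mulf_neq0 // invr_eq0.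
have c0' : c' != 0 by rewrite -cE' mulf_neq0 // invr_eq0.
have [J [sJ JG cJ xJ yJ]] := Jex x y gx gy sxy.
have [sx tx] := fin_trans sJ (sgK gx) cJ JG xJ (openK gx).
have [sy ty] := fin_trans sJ (sgK gy) cJ JG yJ (openK gy).
have le1 := ind_index_le gx gy sJ JG xJ yJ tx ty c0 cP.
have le2 := ind_index_le gy gx sJ JG yJ xJ ty tx c0' cP'.
have [t tt] := transK gx gy; have [t' tt'] := transK gy gx.
have t1 := trans_tower sJ (sgK gy) (sKI gy gx) (@subIsetl _ _ _) yJ ty tt.
rewrite setIC in tt'.
have t2 := trans_tower sJ (sgK gx) (sKI gy gx) (@subIsetr _ _ _) xJ tx tt'.
have := trans_size sJ (sKI gy gx) (subset_trans (@subIsetl _ _ _) yJ) t1 t2.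
rewrite setIC in tt'.
rewrite !size_allpairs (_ : size sy = size sx); last by apply/eqP; rewrite eqn_leq le1 le2.
have sx0 : (0 < size sx)%N by have [_ _ _ /(_ 1 (sg1 sJ))[k]] := tx; case: (sx).
move/eqP; rewrite eqn_pmul2l // -(coset_indexK gx gy tt) -(coset_indexK gy gx tt') => /eqP iE.
by rewrite cP // -cE iE mulVf // scale1r.
Qed.

(** Induction on d(y, z), replacing y by the point y' behind the first hyperplane H on the way to z.
    If H does not separate x from y, then x, y, y' is a geodesic. If it does, then x, y', y is a
    geodesic, and the return from y to y' cancels because H is good. *)
Lemma Theta_gallery x y z f g : gen x -> gen y -> gen z ->
  (forall H, sep x y H -> sep y z H -> good H) -> eqv x f -> GF g ->
  Tn z y (Tn y x f) g = Tn z x f g.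
Proof.
have TE := Theta_norm_eqv.
have geo := Theta_geodesic.
have ext := Theta_norm_ext.
move=> + + gz; have [k] := ubnP (dist y z); elim: k y g => // k IHk y g; rewrite ltnS => dk gx gy gd fx Gg.
have [s0|/set0P sn] := eqVneq (sep y z) set0; first by apply: geo => // H _; rewrite s0.
have [y' [H [gy' syy sH sy'z]]] := gallery_step sysH gy gz sn.
have dlt : (dist y' z < dist y z)%N.
  rewrite -(dist_add sysH gy gy' gz) => [|H']; last by rewrite syy => -> /sy'z[].
  by rewrite {2}/dist syy fset_set1 cardfs1 add1n ltnSn.
have gd' : forall H', sep x y' H' -> sep y' z H' -> good H'.
  move=> H' sx /sy'z[sy nH]; apply: gd => //.
  move: sx; rewrite (sep_xor sysH H' gx gy gy') syy => -[[]//|[_ /nH[]]].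
have IH := IHk y' g (leq_trans dlt dk) gx gy' gd' fx Gg.
have zE f' : eqv y f' -> Tn z y f' g = Tn z y' (Tn y' y f') g.
  by move=> fy; rewrite geo // => H'; rewrite syy => -> /sy'z[].
have fy := TE _ _ _ gx gy fx; have fy' := TE _ _ _ gx gy' fx.
rewrite zE // -IH; apply: (ext) => // [|h Gh]; first exact: TE gy gy' fy.
have [sxH|nH] := pselect (sep x y H); last first.
  by apply: geo => // H' sx; rewrite syy => e; apply: nH; rewrite -e.
have s' H' : sep x y' H' -> ~ sep y' y H'.
  rewrite (sep_sym sysH y') syy => + e; rewrite e.
  by rewrite (sep_xor sysH H gx gy gy') syy => -[[_ []]|[]].
have fy2 := TE _ _ _ gy' gy fy'.
rewrite (ext _ _ _ (Tn y y' (Tn y' x f)) _ gy gy' fy fy2 Gh) => [|h' Gh']; last by rewrite geo.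
by apply: (gd H sxH sH) => //; rewrite sep_sym.
Qed.

(** The kernel of Theta_{y|x}, scaled to be rho_y(b) rho_x(a) at b a in K_y K_x and 0 elsewhere. No
    index remains in it, which makes the kernels for G^0 and G comparable. *)
Definition Ek y x g : 'End(V) :=
  linfun (fun u => sq (coset_index (K y) (K x)) *: Tn y x (fun_at_pt x u) g).

Let faE x u : gen x -> eqv x (fun_at_pt x u). Proof. exact: fun_at_eqv. Qed.

Lemma EkE y x g u : gen x -> gen y -> GF g ->
  Ek y x g u = sq (coset_index (K y) (K x)) *: Tn y x (fun_at_pt x u) g.
Proof.
move=> gx gy Gg; apply: (linfunE (f := fun u => _)) => a v w.
have -> : fun_at_pt x (a *: v + w) = fun h => a *: fun_at_pt x v h + fun_at_pt x w h.
  apply/funext => h; rewrite /fun_at_pt; case: ifP => _; first by rewrite linearP.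
  by rewrite scaler0 addr0.
rewrite (Theta_norm_lin _ gx gy (faE v gx) (faE w gx) Gg) scalerDr.
by congr (_ + _); rewrite [LHS]scalerA [RHS]scalerA mulrC.
Qed.

Lemma Ek_mul y x b a u : gen x -> gen y -> K y b -> K x a ->
  Ek y x (b * a) u = rho y b (rho x a u).
Proof.
move=> gx gy Kb Ka; rewrite EkE //; last by apply: GM; [exact: KGF Kb|exact: KGF Ka].
by rewrite (Theta_fun_at) // scalerA mulfV // scale1r.
Qed.

Lemma Ek_out y x g u : gen x -> gen y -> GF g -> ~ setprod (K y) (K x) g -> Ek y x g u = 0.
Proof. by move=> gx gy Gg n; rewrite EkE // (Theta_fun_at0) ?scaler0. Qed.

Lemma Ek_mulr y x g a u : gen x -> gen y -> GF g -> K x a ->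
  Ek y x (g * a) u = Ek y x g (rho x a u).
Proof.
move=> gx gy Gg Ka; have sK := sgK gx; have aU := unitG (KGF gx Ka).
have [[b Kb [c Kc <-]]|n] := pselect (setprod (K y) (K x) g).
  rewrite -mulrA !Ek_mul //; last exact: (sgM sK).
  by rewrite (rhoM) // comp_lfunE.
have Gga := GM Gg (KGF gx Ka); rewrite !Ek_out // => -[b Kb [c Kc e]]; apply: n.
exists b => //; exists (c * a^-1); first exact: (sgM sK Kc (sgV sK Ka)).
by rewrite mulrA e mulrK.
Qed.

Lemma Tn_Ek x y f g (J : set MF) t : gen x -> gen y -> subgroup J -> J `<=` GF ->
  K x `<=` J -> K y `<=` J -> trans J (K x) t -> eqv x f -> GF g ->
  Tn y x f g = (sq (coset_index (K y) (K x)))^-1 *: \sum_(r <- t) Ek y x r (f (r^-1 * g)).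
Proof.
move=> gx gy sJ JG xJ yJ tt fx Gg; have [s ts] := transK gx gy.
rewrite (Theta_normE gx gy fx Gg ts) (coset_indexK gx gy ts); congr (_ *: _).
rewrite (csum_support (sgK gy) sJ (sgK gx) xJ yJ tt ts).
- apply: eq_big_seq => k ks; have Kk : K y k by case: ts => _ + _ _; apply.
  rewrite -[X in Ek _ _ X]mulr1 Ek_mul ?(rho1) ?id_lfunE //; exact: sg1 (sgK gx).
- move=> r a Jr Ka; have rU := sgU sJ Jr; have aU := unitG (KGF gx Ka).
  rewrite Ek_mulr //; last exact: JG.
  rewrite invrM // -mulrA fx; last 2 first.
  - exact: sgV (sgK gx) Ka.
  - by apply: GM => //; apply/GV/JG.
  by rewrite (rhoKV).
- by move=> r Jr n; rewrite Ek_out //; apply: JG.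
Qed.

Lemma TT_Ek x y u g (J : set MF) t : gen x -> gen y -> subgroup J -> J `<=` GF ->
  K x `<=` J -> K y `<=` J -> trans J (K y) t -> GF g ->
  Tn x y (Tn y x (fun_at_pt x u)) g =
  (sq (coset_index (K x) (K y)) * sq (coset_index (K y) (K x)))^-1 *:
    \sum_(r <- t) Ek x y r (Ek y x (r^-1 * g) u).
Proof.
move=> gx gy sJ JG xJ yJ tt Gg; have fy := Theta_norm_eqv gx gy (faE u gx).
rewrite (Tn_Ek gy gx sJ JG yJ xJ tt fy Gg) invfM -scalerA; congr (_ *: _).
rewrite scaler_sumr; apply: eq_big_seq => r rt.
have Gr : GF (r^-1 * g) by apply: GM => //; apply/GV/JG; case: tt => _ + _ _; apply.
by rewrite [in RHS](EkE _ gx gy Gr) [in RHS]linearZ [RHS]scalerA mulVf // scale1r.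
Qed.

(** The kernel of the composite at r is, up to a constant, its value at r on f_u. Vanishing outside
    K_x leaves only the coset of 1 in the sum, where [ThetaTheta_fun_at] gives the scalar. *)
Lemma scalar_of_vanish x y (J : set MF) : gen x -> gen y -> subgroup J -> J `<=` GF ->
  compact J -> K x `<=` J -> K y `<=` J ->
  (forall u g, J g -> ~ K x g -> Tn x y (Tn y x (fun_at_pt x u)) g = 0) ->
  scalar_op iota x (fun f : MF -> V => Theta x y (Theta y x f)).
Proof.
move=> gx gy sJ JG cJ xJ yJ van; have [tx ttx] := fin_trans sJ (sgK gx) cJ JG xJ (openK gx).
have [ty tty] := fin_trans sJ (sgK gy) cJ JG yJ (openK gy).
set m1 := sq (coset_index (K x) (K y)); set m2 := sq (coset_index (K y) (K x)).
exists ((m1 * m2)^-1 * (m2^-1 * m1)) => f g [fx _] Gg; rewrite (ThetaTheta) //.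
rewrite -scalerA; congr (_ *: _).
have fy := Theta_norm_eqv gx gy fx.
have [ux Jx Dx Ex] := ttx; have [uy Jy Dy Ey] := tty.
have Gx r : r \in tx -> GF r by move=> /Jx/JG.
rewrite (Tn_Ek gy gx sJ JG yJ xJ tty fy Gg).
(* For each [q] the inner transversal is shifted by the inverse of [q], so that the argument of [f]
   no longer depends on [q]. *)
have -> : \sum_(q <- ty) Ek x y q (Tn y x f (q^-1 * g)) =
    m2^-1 *: \sum_(r <- tx) \sum_(q <- ty) Ek x y q (Ek y x (q^-1 * r) (f (r^-1 * g))).
  rewrite exchange_big scaler_sumr; apply: eq_big_seq => q qt.
  have Jq := Jy q qt; have qU := sgU sJ Jq.
  have Gq : GF (q^-1 * g) by apply: GM => //; apply/GV/JG.
  rewrite (Tn_Ek gx gy sJ JG xJ yJ (trans_mul sJ (sgV sJ Jq) ttx) fx Gq).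
  rewrite big_map -linear_sum -linearZ; congr (Ek x y q (_ *: _)); apply: eq_big_seq => r rt.
  have rU := sgU sJ (Jx r rt).
  by rewrite invrM ?unitrV // invrK -mulrA mulVKr.
have [r0 r0t Kr0] := Ex 1 (sg1 sJ); rewrite mulr1 in Kr0.
have Kr := sgV (sgK gx) Kr0; rewrite invrK in Kr; have r0U := unitG (KGF gx Kr).
rewrite (bigD1_seq r0) //= [X in _ + X]big1_seq ?addr0 => [|r /andP[nr rt]].
  have := TT_Ek (f (r0^-1 * g)) gx gy sJ JG xJ yJ tty (KGF gx Kr).
  have fe := Theta_norm_eqv gy gx
    (Theta_norm_eqv gx gy (faE (f (r0^-1 * g)) gx)).
  rewrite -[X in Tn _ _ _ X]mulr1 fe //; last exact: sg1 (sgGF).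
  rewrite (ThetaTheta_fun_at) // fx // linearZ /= (rhoKV) // -/m1 -/m2 => ->.
  by rewrite scalerA invfM.
have nK : ~ K x r.
  move=> Kr'; case/eqP: nr; apply: Dx => //.
  exact: (sgM (sgK gx) (sgV (sgK gx) Kr') Kr).
have := TT_Ek (f (r^-1 * g)) gx gy sJ JG xJ yJ tty (Gx r rt).
rewrite van // => [/esym/eqP|]; last exact: Jx.
by rewrite scaler_eq0 invr_eq0 (negPf (mulf_neq0 (sq0 _) (sq0 _))) /= => /eqP.
Qed.

(** * The Hecke algebra elements phi_n and their products *)

Section HeckeElements.
Context (T : MF -> 'End(V)) (bT : @basic_family _ _ _ _ _ E X T).
Local Notation Ph := (@Phi _ _ _ _ _ p sqp E X T).
Local Notation ph := (@phi_w _ _ _ iota _ _ p sqp E X T).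
Local Notation fat := (@fun_at _ _ _ _ _ E X).
Local Notation conv := (@convolution _ _ _ iota _ _ E X 0).
Local Notation dbl n := (setprod (setprod (K 0) [set n]) (K 0)).

Let sK0 : subgroup (K 0). Proof. exact: (sgK g0). Qed.
Let gNy n : N n -> gen (act X n^-1 0).
Proof. by move=> Nn; apply: (gen_act) => //; apply: NV. Qed.
Let GN n : N n -> GF n. Proof. by move=> /(N_normalizes SX)[]. Qed.
Let UN n : N n -> n \is a GRing.unit. Proof. by move=> /(N_normalizes SX)[]. Qed.
Let fatE v : eqv 0 (fat v). Proof. exact: fun_at_eqv. Qed.
Let TE := Theta_norm_eqv.
Let KyE n k : N n -> K (act X n^-1 0) k <-> K 0 (conj n k).
Proof.
move=> Nn; rewrite (K_act (NV Nn) g0); have nU := UN Nn.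
by rewrite setconjE ?unitrV // invrK.
Qed.

Lemma Phi_eqv n f : N n -> eqv 0 f -> eqv 0 (Ph n f).
Proof.
move=> Nn fx; have := cn_eqv bT Nn (gNy Nn) (TE g0 (gNy Nn) fx).
by rewrite (actVK SX Nn).
Qed.

Lemma Phi_fun_at n u k r : N n -> K (act X n^-1 0) k -> K 0 r ->
  Ph n (fat u) (n * k * r) =
  (sq (coset_index (K (act X n^-1 0)) (K 0)))^-1 *: T n (rho (act X n^-1 0) k (rho 0 r u)).
Proof.
move=> Nn Kk Kr; rewrite /Phi -mulrA mulKr ?UN //.
by rewrite (Theta_fun_at u g0 (gNy Nn) Kk Kr) linearZ.
Qed.

Lemma Phi_support n u g : N n -> GF g -> Ph n (fat u) g != 0 ->
  exists k r, [/\ K (act X n^-1 0) k, K 0 r & g = n * k * r].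
Proof.
move=> Nn Gg nz; apply: contrapT => ng; case/eqP: nz; rewrite /Phi.
have Gng : GF (n^-1 * g) by exact: GM (GV (GN Nn)) Gg.
rewrite (Theta_fun_at0 u g0 (gNy Nn) Gng) ?linear0 // => -[k Kk [r Kr e]].
by apply: ng; exists k, r; split=> //; rewrite -mulrA e mulVKr ?UN.
Qed.

(** K_{x0} n = n K_{n^-1 x0}, by equivariance of the family. *)
Lemma dblP n g : N n -> dbl n g <-> exists k r, [/\ K (act X n^-1 0) k, K 0 r & g = n * k * r].
Proof.
move=> Nn; split=> [[_ [k Kk [_ -> <-]] [r Kr <-]]|[k [r [/(KyE k Nn) Kk Kr ->]]]].
  exists (conj n^-1 k), r; split=> //; first by apply/KyE => //; rewrite conjVK ?UN.
  by congr (_ * r); rewrite /conj invrK !mulrA mulrV ?UN ?mul1r.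
exists (n * k); last by exists r.
by exists (conj n k) => //; exists n => //; rewrite conj_mul ?UN.
Qed.

Lemma phi_linear n g : N n -> GF g -> linear (fun u => Ph n (fat u) g).
Proof.
move=> Nn Gg a u v; have Gng : GF (n^-1 * g) by exact: GM (GV (GN Nn)) Gg.
have -> : fat (a *: u + v) = fun h => a *: fat u h + fat v h.
  apply/funext => h; rewrite /fun_at; case: ifP => _; first by rewrite linearP.
  by rewrite scaler0 addr0.
by rewrite /Phi (Theta_norm_lin _ g0 (gNy Nn) (fatE u) (fatE v) Gng) linearP.
Qed.

Lemma phiE n g u : N n -> GF g -> ph n g u = Ph n (fat u) g.
Proof. by move=> Nn Gg; rewrite /phi_w mem_set // (linfunE (phi_linear Nn Gg)). Qed.

Lemma phi_out n g : ~ GF g -> ph n g = 0.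
Proof. by move=> ng; rewrite /phi_w memNset. Qed.

Lemma phi_at n k u : N n -> K (act X n^-1 0) k ->
  ph n (n * k) u = (sq (coset_index (K (act X n^-1 0)) (K 0)))^-1 *: T n (rho (act X n^-1 0) k u).
Proof.
move=> Nn Kk; have K01 := sg1 sK0; rewrite phiE //; last exact: GM (GN Nn) (KGF (gNy Nn) Kk).
by rewrite -[n * k]mulr1 Phi_fun_at // (rho1) // id_lfunE.
Qed.

(** The inverse square root of the index is the origin of d_n. *)
Lemma phi_n n : N n -> ph n n = (sq (coset_index (K (act X n^-1 0)) (K 0)))^-1 *: T n.
Proof.
move=> Nn; have gy := gNy Nn; apply/lfunP => u; rewrite -[X in ph n X]mulr1.
by rewrite phi_at //; [rewrite (rho1) // id_lfunE scale_lfunE|exact: sg1 (sgK gy)].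
Qed.

Lemma phi_support n : N n -> supported_on (dbl n) (ph n).
Proof.
move=> Nn g nz; have [Gg|/(phi_out n) e] := pselect (GF g); last by rewrite e eqxx in nz.
apply: contrapT => ng; case/eqP: nz; apply/lfunP => u; rewrite phiE // zero_lfunE.
by apply: contrapT => /eqP/(Phi_support Nn Gg)/dblP; apply: contra_not ng => /(_ Nn).
Qed.

Lemma Theta_right x y f k g : gen x -> gen y -> eqv x f -> GF k -> GF g ->
  Tn y x f (g * k) = Tn y x (fun h => f (h * k)) g.
Proof.
move=> gx gy fx Gk Gg; have [s ts] := transK gx gy.
have fx' : eqv x (fun h => f (h * k)).
  by move=> j h Kj Gh; rewrite -mulrA fx //; apply: GM.
rewrite (Theta_normE gx gy fx (GM Gg Gk) ts).
rewrite (Theta_normE gx gy fx' Gg ts); congr (_ *: _).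
by apply: eq_big_seq => j _; rewrite mulrA.
Qed.

Lemma phi_mulr n g k : N n -> K 0 k -> ph n (g * k) = (ph n g \o rho 0 k)%VF.
Proof.
move=> Nn Kk; have Gk := KGF g0 Kk; have kU := unitG Gk.
have [Gg|ng] := pselect (GF g); last first.
  rewrite !phi_out ?comp_lfun0l // => /GM/(_ (GV Gk)).
  by rewrite mulrK.
apply/lfunP => u; rewrite comp_lfunE !phiE //; last exact: GM.
have Gng : GF (n^-1 * g) by exact: GM (GV (GN Nn)) Gg.
rewrite /Phi mulrA (Theta_right g0 (gNy Nn) (fatE u) Gk Gng); congr (T n _).
have fe : eqv 0 (fun h => fat u (h * k)).
  by move=> j h Kj Gh; rewrite -mulrA fatE //; apply: GM.
apply: (Theta_norm_ext g0 (gNy Nn) fe (fatE _) Gng) => h Gh.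
rewrite /fun_at; case: ifP => [/set_mem Kh|nk].
  have Kh' : K 0 h by move/(sgMr _ sK0 Kk): Kh.
  by rewrite mem_set // (rhoM g0) // comp_lfunE.
case: ifP => // /set_mem Kh; move: nk; rewrite mem_set //; exact: sgM.
Qed.

Lemma phi_mull n g k : N n -> K 0 k -> ph n (k * g) = (rho 0 k \o ph n g)%VF.
Proof.
move=> Nn Kk; have Gk := KGF g0 Kk; have kU := unitG Gk.
have [Gg|ng] := pselect (GF g); last first.
  rewrite !phi_out ?comp_lfun0r // => /(GM (GV Gk)).
  by rewrite mulKr.
apply/lfunP => u; rewrite comp_lfunE !phiE //; last exact: GM.
by rewrite (Phi_eqv Nn (fatE u)).
Qed.

Lemma phi_hecke n : N n -> hecke iota 0 (ph n).
Proof.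
move=> Nn; split; first exact: phi_out.
  have gy := gNy Nn; have [s ts] := transK g0 gy; have [_ Ks _ Es] := ts.
  exists [set g | exists2 a, a \in map ( *%R n) s & [set a * k | k in K 0] g]; split.
  - by apply: compact_seq_union => a _; apply: compact_mull; exact: (compactK g0).
  - move=> g [_ /mapP[k ks ->] [r Kr <-]]; apply: GM; last exact: KGF Kr.
    by apply: GM (GN Nn) _; apply: KGF gy (Ks k ks).
  - move=> g /(phi_support Nn)/(dblP _ Nn)[k [r [Kk Kr ->]]].
    have [k0 k0s [Kyk K0k]] := Es k Kk; exists (n * k0); first exact: map_f.
    exists (k0^-1 * k * r); first exact: sgM.
    by rewrite !mulrA mulrK // (unitG (KGF gy (Ks _ k0s))).
by move=> k1 k2 g K1 K2 Gg; rewrite phi_mulr // phi_mull.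
Qed.

(** Left convolution with phi_m is the operator Phi_m: only the cosets m r K_{x0} contribute, with r
    in a transversal of K_{m^-1 x0} modulo its intersection with K_{x0}, and these are the terms of
    Theta. *)
Lemma conv_phi m psi g u : N m ->
  (forall k h, K 0 k -> GF h -> psi (k * h) = (rho 0 k \o psi h)%VF) -> GF g ->
  conv (ph m) psi g u = Ph m (fun h => psi h u) g.
Proof.
move=> Nm pK Gg; have gy := gNy Nm; have [s ts] := transK g0 gy; have [us Ks Ds Es] := ts.
have Gmg : GF (m^-1 * g) by exact: GM (GV (GN Nm)) Gg.
have fe : eqv 0 (fun h => psi h u) by move=> k h Kk Gh; rewrite pK // comp_lfunE.
have Gr r : r \in s -> GF r by move=> /Ks/(KGF gy).
have Ur r : r \in s -> r \is a GRing.unit by move=> /Gr/(unitG).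
pose c r := setprod [set m * r] (K 0).
have cU : uniq [seq c r | r <- s].
  rewrite map_inj_in_uniq // => r r' rs r's e; apply: Ds => //.
  have : c r' (m * r') by exists (m * r') => //; exists 1; [exact: sg1|rewrite mulr1].
  rewrite -e => -[_ -> [x Kx]]; rewrite -mulrA => /(mulrI (UN Nm)) e'.
  split; first by apply: (sgM (sgK gy) (sgV (sgK gy) (Ks _ rs))); exact: Ks.
  by rewrite -e' mulKr ?Ur.
rewrite /convolution -(@fsbig_widen _ _ _ _ [set` [seq c r | r <- s]]); first last.
- move=> a [[b Gb <-] nb] /=; have [x Kx ->] := coset_repE b sK0.
  have Gx := KGF g0 Kx.
  rewrite (_ : ph m (b * x) = 0) ?comp_lfun0l //; apply: contrapT => /eqP nz.
  have [k [r [Kk Kr e]]] := (dblP _ Nm).1 (phi_support Nm nz).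
  have [k0 k0s [Kyk K0k]] := Es k Kk; apply: nb; apply/mapP; exists k0 => //.
  have bE : b = m * k0 * (k0^-1 * k * r * x^-1).
    by rewrite !mulrA mulrK ?Ur // -e mulrK // (unitG Gx).
  have Kz : K 0 (k0^-1 * k * r * x^-1) by apply: (sgM sK0); [exact: sgM|exact: sgV].
  move: (k0^-1 * k * r * x^-1) bE Kz => z bE Kz; have zU := unitG (KGF g0 Kz).
  apply/seteqP; split=> _ [_ -> [w Kw <-]].
    by exists (m * k0) => //; exists (z * w); [exact: sgM|rewrite mulrA bE].
  exists b => //; exists (z^-1 * w); first exact: sgM (sgV sK0 Kz) Kw.
  by rewrite bE -!mulrA mulVKr.
- move=> a /mapP[r rs ->]; exists (m * r) => //; exact: GM (GN Nm) (Gr r rs).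
rewrite -fsbig_seq // big_map sum_lfunE /Phi.
rewrite (Theta_normE g0 gy fe Gmg ts) linearZ linear_sum /= scaler_sumr.
apply: eq_big_seq => r rs; have [x Kx ->] := coset_repE (m * r) sK0.
have xU := unitG (KGF g0 Kx); have mrU : m * r \is a GRing.unit.
  exact: (unitG (GM (GN Nm) (Gr r rs))).
rewrite phi_mulr // invrM // -mulrA pK; [|exact: sgV|]; last first.
  by apply: GM Gg; apply: GV; exact: GM (GN Nm) (Gr r rs).
rewrite !comp_lfunE (rhoKV) // phi_at //; last exact: Ks.
have mU := UN Nm; have rU := Ur r rs.
by rewrite (coset_indexK g0 gy ts) invrM // mulrA.
Qed.

Lemma conv_out m psi g : ~ GF g -> (forall h, ~ GF h -> psi h = 0) -> conv (ph m) psi g = 0.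
Proof.
move=> ng p0; rewrite /convolution fsbig1 // => _ [b Gb <-].
have [x Kx ->] := coset_repE b sK0; rewrite p0 ?comp_lfun0r // => h; apply: ng.
have Gbx := GM Gb (KGF g0 Kx).
by have := GM Gbx h; rewrite mulVKr // (unitG Gbx).
Qed.

(** The operator c_n is moved to the left across the second Theta, which it transports by n. The two
    Theta are then composed along the points 0, n^-1 0, (m n)^-1 0. *)
Lemma Phi_comp m n f g : N m -> N n -> eqv 0 f -> GF g ->
  Ph m (Ph n f) g = T m (T n (Tn (act X (m * n)^-1 0) (act X n^-1 0)
    (Tn (act X n^-1 0) 0 f) ((m * n)^-1 * g))).
Proof.
move=> Nm Nn fx Gg; have Nmn := NM Nm Nn.
rewrite {1}/Phi; have fy := TE g0 (gNy Nn) fx.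
have Gmg : GF (m^-1 * g) by exact: GM (GV (GN Nm)) Gg.
have := cn_Theta bT Nn (gNy Nn) (gNy Nmn) fy Gmg.
rewrite (actVK SX Nn) invrM ?UN // (actM SX _ (NV Nn) (NV Nm)) (actVK SX Nn) => e.
by rewrite -mulrA; congr (T m _); rewrite -[RHS]e.
Qed.

Lemma conv_phi_comp m n g u : N m -> N n -> GF g ->
  conv (ph m) (ph n) g u = Ph m (Ph n (fat u)) g.
Proof.
move=> Nm Nn Gg; rewrite conv_phi //; last by move=> k h Kk _; apply: phi_mull.
rewrite /Phi; congr (T m _); apply: (Theta_norm_ext g0 (gNy Nm)).
- by move=> k h Kk Gh; rewrite phi_mull // comp_lfunE.
- exact: Phi_eqv Nn (fatE u).
- exact: GM (GV (GN Nm)) Gg.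
- by move=> h Gh; rewrite phiE.
Qed.

Lemma conv_phi_phi m n c : N m -> N n -> (forall v, T m (T n v) = c *: T (m * n) v) ->
  (forall H, sep 0 (act X n^-1 0) H -> sep (act X n^-1 0) (act X (m * n)^-1 0) H ->
     good H) ->
  conv (ph m) (ph n) = fun g => c *: ph (m * n) g.
Proof.
move=> Nm Nn Tc gd; have Nmn := NM Nm Nn; apply/funext => g.
have [Gg|ng] := pselect (GF g); last first.
  by rewrite conv_out ?phi_out ?scaler0 // => h nh; exact: phi_out.
apply/lfunP => u; rewrite conv_phi_comp // scale_lfunE phiE //.
have Gmg : GF ((m * n)^-1 * g) by exact: GM (GV (GN Nmn)) Gg.
rewrite Phi_comp // (Theta_gallery g0 (gNy Nn) (gNy Nmn) gd) //.
Qed.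

Lemma KM_act0 k : KM k -> N k -> act X k 0 = 0.
Proof.
move=> Kk Nk; have [_ Mk] := KM_sub g0 Kk.
apply: (act_eq SX Nk); have [S [h [mS sS hS AS [Sx pE]]]] := group_apartment SX.
have cS i : cocharacter S (@aC _ _ _ _ E i).
  by have [cA _] := C_basis SX; apply: cochar_sub (cA i).
have -> : point X 0 = cemb (cx0 X).
  by rewrite pE /translate -/(trl _ _ _ _) (trl0 (BG_building SX) mS cS).
have [_ eq _] := emb_admissible SX.
by rewrite -eq ?(KM_fixes SX).
Qed.

(** The path 0, s^-1 0, 0 returns to its origin, and its two indices agree because s exchanges the
    two points. Only the constant of T_s T_s remains. *)
Lemma Phi_square_at1 s c u : N s -> KM (s * s) -> (forall v, T s (T s v) = c *: rM (s * s) v) ->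
  Ph s (Ph s (fat u)) 1 = c *: u.
Proof.
move=> Ns Ks Tc; have Nss := NM Ns Ns; have KVs := sgV (sgKM) Ks.
have G1 : GF 1 by exact: sg1 (sgGF).
have a0 : act X (s * s)^-1 0 = 0 by rewrite KM_act0 //; exact: NV.
rewrite Phi_comp // a0 mulr1; set y := act X s^-1 0; have gy : gen y := gNy Ns.
have K0V : K 0 (s * s)^-1 by case: (KM_sub g0 KVs).
have fe := TE gy g0 (TE g0 gy (fatE u)).
rewrite -[(s * s)^-1]mulr1 fe // (ThetaTheta_fun_at u g0 gy).
have -> : coset_index (K 0) (K y) = coset_index (K y) (K 0).
  rewrite -(coset_index_act Ns g0 gy) (actVK SX Ns); congr (coset_index _ (K _)).
  have : act X (s * s) 0 = 0 by exact: KM_act0.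
  by rewrite (actM SX) // => e; rewrite /y -[X in act _ _ X = _]e (actK SX Ns).
rewrite mulVf // scale1r Tc (rho_KM) // -(rho_KM g0) // -(rho_KM g0) //.
by rewrite (rhoKV) //; case: (KM_sub g0 Ks).
Qed.

Lemma Phi_at1 s u : N s -> ~ K 0 s -> Ph s (fat u) 1 = 0.
Proof.
move=> Ns nK; have G1 : GF 1 by exact: sg1 (sgGF).
apply: contrapT => /eqP/(Phi_support Ns G1)/(dblP _ Ns)[_ [k Kk [_ -> <-]] [r Kr e]].
apply: nK; move: e => /(congr1 (fun a => k^-1 * a * r^-1)).
have kU := sgU sK0 Kk; have rU := sgU sK0 Kr.
by rewrite !mulrA mulVr // mul1r mulrK // mulr1 => ->; apply: sgM => //; apply: sgV.
Qed.

Lemma Phi_1 f g : eqv 0 f -> GF g -> Ph 1 f g = f g.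
Proof.
have [_ T1 _] := bT; move=> fx Gg; rewrite /Phi T1 id_lfunE invr1 mul1r (act1 SX).
rewrite (Theta_normE g0 g0 fx Gg (s := [:: 1])).
  by rewrite big_seq1 (rho1) // id_lfunE invr1 mul1r /psqrt logn1 expr0 invr1 scale1r.
by rewrite setIid; apply: trans_refl.
Qed.

(** The composite of [A] with the inverse of T_n commutes with the irreducible rho_M, so Schur's
    lemma applies. *)
Lemma T_unique n (A : 'End(V)) : N n ->
  (forall k v, KM k -> A (rM k v) = rM (conj n k) (A v)) -> exists c, A = c *: T n.
Proof.
move=> Nn hA; have kT := T_lker bT Nn; have [_ irM] := rM_irr SX.
pose S := ((T n)^-1 \o A)%VF.
have TS v : T n (S v) = A v.
  by rewrite /S -comp_lfunE comp_lfunA lker0_compfV // comp_lfun1l.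
have [k Kk|c cE] := irr_scalar irM (T := S).
  apply/lfunP => v; rewrite [LHS]comp_lfunE [RHS]comp_lfunE; apply: (lker0P kT).
  by rewrite TS hA // (T_rM bT) // TS.
exists c; apply/lfunP => v; rewrite -TS cE !scale_lfunE id_lfunE linearZ //.
Qed.

Lemma T_mul m n : N m -> N n -> exists2 c, c != 0 & forall v, T m (T n v) = c *: T (m * n) v.
Proof.
move=> Nm Nn; have [|c cE] := T_unique (NM Nm Nn) (A := (T m \o T n)%VF).
  move=> k v Kk; have Kc : KM (conj n k) by rewrite -(N_KM Nn); exists k.
  by rewrite !comp_lfunE !(T_rM bT) // conjMg ?UN.
have cP v : T m (T n v) = c *: T (m * n) v by rewrite -comp_lfunE cE scale_lfunE.
exists c => //; apply: contraTneq (isT) => c0; have [v v0] := V_neq0.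
have := T_neq0 bT Nm (T_neq0 bT Nn v0).
by rewrite cP c0 scale0r eqxx.
Qed.

Lemma hecke_phi n psi : N n -> hecke iota 0 psi -> supported_on (dbl n) psi ->
  exists a, psi = fun g => a *: ph n g.
Proof.
move=> Nn [pout _ pK] ps; have Gn := GN Nn; have K01 := sg1 sK0.
have [k v Kk|c cE] := T_unique Nn (A := psi n).
  have [K0k _] := KM_sub g0 Kk; have Kc : KM (conj n k) by rewrite -(N_KM Nn); exists k.
  have [K0c _] := KM_sub g0 Kc.
  have := pK 1 k n K01 K0k Gn; rewrite mul1r (rho1) // comp_lfun1l => /lfunP/(_ v).
  rewrite comp_lfunE (rho_KM) // => <-.
  rewrite -conj_mul ?UN // -[_ * n]mulr1 pK // (rho1) // comp_lfun1r comp_lfunE.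
  by rewrite (rho_KM).
exists (c * sq (coset_index (K (act X n^-1 0)) (K 0))); apply/funext => g.
have [|ng] := pselect (dbl n g); last first.
  have p0 : psi g = 0 by apply: contrapT => /eqP/ps.
  have q0 : ph n g = 0 by apply: contrapT => /eqP/(phi_support Nn).
  by rewrite p0 q0 scaler0.
move=> [_ [k1 K1 [_ -> <-]] [k2 K2 <-]]; rewrite pK // phi_mulr // phi_mull // phi_n // cE.
apply/lfunP => v; rewrite scale_lfunE !comp_lfunE !scale_lfunE [in RHS]linearZ /= scalerA -mulrA mulfV //.
by rewrite ?mulr1 linearZ.
Qed.

Lemma phi_nn_neq0 n : N n -> ph n n != 0.
Proof.
move=> Nn; rewrite phi_n // scaler_eq0 invr_eq0 (negPf (sq0 _)) /=.
by have [/(_ n Nn)[]] := bT.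
Qed.

Lemma fun_at_Ind u : Ind iota 0 (fat u).
Proof.
split; first exact: fatE.
exists [set 1]; split=> [|g ->|g Gg]; [exact: compact_set1|exact: sg1 (sgGF)|].
rewrite /fun_at; case: ifP => [/set_mem Kg _|_]; last by rewrite eqxx.
by exists g => //; exists 1; rewrite ?mulr1.
Qed.

Lemma hecke_scale a psi : hecke iota 0 psi -> hecke iota 0 (fun g => a *: psi g : 'End(V)).
Proof.
move=> [h1 [W [cW WG h2]] h3]; split=> [g ng||k1 k2 g K1 K2 Gg].
- by rewrite h1 // scaler0.
- by exists W; split=> // g; rewrite scaler_eq0 negb_or => /andP[_ /h2].
- by rewrite h3 // comp_lfunZl comp_lfunZr.
Qed.

Lemma T_square s : N s -> KM (s * s) -> exists2 c, c != 0 &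
  forall v, T s (T s v) = c *: rM (s * s) v.
Proof.
move=> Ns Kss; have [c c0 cP] := T_mul Ns Ns; exists c => // v; rewrite cP.
have Nss := NM Ns Ns; have [_ T1 TM] := bT.
by rewrite -[in T _](mul1r (s * s)) TM //; [rewrite T1 comp_lfun1l|exact: sg1 (N_subgroup SX)].
Qed.

(** Transport by c_n turns the composite for x, y into the one for nx, ny, and T_n is injective, so
    a scalar for the second is one for the first. *)
Lemma relevant_act n H : N n -> relevant iota X H -> relevant iota X (act X n @` H).
Proof.
move=> Nn [hH [x [y [gx gy sxy ns]]]]; split; first exact: (qcf_hyperplanes QX).
have gnx := gen_act Nn gx; have gny := gen_act Nn gy; have nU := UN Nn.
exists (act X n x), (act X n y); split=> //.
  apply/seteqP; split=> [H' sH'|_ ->]; last first.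
    by apply: (sep_act Nn); rewrite sxy.
  have := sep_act (NV Nn) sH'; rewrite !(actK SX Nn) sxy /= => <-.
  by rewrite (act_imageV).
apply: contra_not ns => /(scalar_eqv gnx gny)[c cP].
exists ((sq (coset_index (K x) (K y)) * sq (coset_index (K y) (K x)))^-1 * c) => f g [fx _] Gg.
rewrite (ThetaTheta) // -scalerA; congr (_ *: _).
have Gng := GM (GN Nn) Gg; have fy := TE gx gy fx.
have cx := cn_eqv bT Nn gx fx; have := cP _ _ cx Gng.
rewrite (_ : Tn _ _ _ _ = T n (Tn x y (Tn y x f) g)).
  rewrite /cn mulKr // -linearZ => e.
  by apply: (lker0P (T_lker bT Nn)); rewrite e.
transitivity (Tn (act X n x) (act X n y) (cn T n (Tn y x f)) (n * g)).
  apply: (Theta_norm_ext gny gnx _ _ Gng).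
  - exact: TE gnx gny cx.
  - exact: (cn_eqv bT Nn gy fy).
  - by move=> h Gh; rewrite (cn_Theta bT Nn gx gy fx Gh).
by rewrite (cn_Theta bT Nn gy gx fy Gng) /cn mulKr.
Qed.

End HeckeElements.

(** * Relevant hyperplanes crossed by Omega and by simple reflections *)

Section RelevantChambers.
Context (T : MF -> 'End(V)) (bT : @basic_family _ _ _ _ _ E X T).
Local Notation Q := (relevant iota X).

Let QH : Q `<=` @aH _ _ _ _ E. Proof. by move=> H []. Qed.
Let gN n : N n -> gen (act X n 0). Proof. by move=> Nn; apply: (gen_act). Qed.

(** [chamberP] describes C_rel by sides of relevant hyperplanes, and n permutes these hyperplanes.
    The inclusion for the inverse of n gives the equality. *)
Lemma relsep_Omega n : N n -> (forall H, Q H -> ~ sep 0 (act X n 0) H) -> Omega iota X n.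
Proof.
have sub m : N m -> (forall H, Q H -> ~ sep 0 (act X m 0) H) ->
    act X m @` C_rel iota X `<=` C_rel iota X.
  move=> Nm ns _ [v Cv <-]; rewrite crel_chamber in Cv *; apply/(chamberP sysH QH) => H QHH.
  have hH := QH QHH; have Nv := NV Nm.
  have QH' := relevant_act bT Nv QHH.
  have := (chamberP sysH QH v).1 Cv _ QH' => sv.
  have := same_act Nm (QH QH') sv.
  rewrite (act_imageV) //.
  by apply: sameS_trans => //; apply: nsep_same => //; [exact: gN|exact: ns].
move=> Nn ns; split=> //; have Nv := NV Nn.
have nsV H : Q H -> ~ sep 0 (act X n^-1 0) H.
  move=> QHH /(sep_act Nn); rewrite (actVK SX) // (sep_sym sysH).
  by apply: ns; exact: (relevant_act bT Nn QHH).
apply/seteqP; split; first exact: sub.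
move=> v Cv; exists (act X n^-1 v); last by rewrite (actVK SX).
by apply: (sub _ Nv nsV); exists v.
Qed.

Lemma Omega_relsep n H : Omega iota X n -> Q H -> ~ sep 0 (act X n^-1 0) H.
Proof.
move=> [Nn CE] QHH [hH _ _ os].
have C0 : C_rel iota X 0.
  by rewrite crel_chamber; apply/(chamberP sysH QH) => H' /QH hH'; apply: sameS_refl => //; apply: genN.
rewrite -CE in C0; have [v Cv v0] := C0.
have vE : act X n^-1 0 = v by rewrite -v0 (actK SX).
rewrite crel_chamber in Cv; have := (chamberP sysH QH v).1 Cv H QHH.
by rewrite -vE => -[].
Qed.

Section SimpleReflection.
Context (s : MF) (H : set pts) (hpt : pts).
Hypotheses (Ns : N s) (QHH : Q H) (rs : orth_reflection H (act X s)).
Hypotheses (Hh : H hpt) (hpt_same : forall H', Q H' -> H' <> H -> sameS H' 0 hpt).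

Let hH : @aH _ _ _ _ E H. Proof. exact: QH. Qed.
Let ipE : inner_product E. Proof. by case: (Q_inner SX). Qed.

Lemma refl_image : act X s @` H = H.
Proof.
apply/seteqP; split=> [_ [v Hv <-]|v Hv]; first by rewrite (refl_fix sysH hH ipE rs).
by exists v => //; rewrite (refl_fix sysH hH ipE rs).
Qed.

(** The midpoint of v and its image lies on H and is therefore fixed; as the action is affine, the
    image is sent back to v. *)
Lemma refl_involutive v : act X s (act X s v) = v.
Proof.
have [Z ZE] := act_affine SX Ns; have [m _] := rs v.
have := refl_fix sysH hH ipE rs m.
rewrite [in LHS]ZE -scalemxAl mulmxDl [act X s (act X s v)]ZE => e.
have {}e : 2 *: (act X s 0) + (v *m Z + act X s v *m Z) = v + act X s v.
  have := congr1 ( *:%R (2 : R)) e.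
  by rewrite scalerDr !scalerA mulfV ?pnatr_eq0 // !scale1r.
move: e; rewrite scaler_nat mulr2n -addrA [v + _]addrC [in RHS](ZE v).
rewrite -!addrA => /addrI; rewrite [RHS]addrC => e.
apply: (addIr (v *m Z)); rewrite -e -!addrA; congr (_ + _); exact: addrC.
Qed.

Lemma refl_act0 : act X s^-1 0 = act X s 0.
Proof. by rewrite -[in LHS](refl_involutive 0) (actK SX). Qed.

Lemma refl_sep : sep 0 (act X s 0) H.
Proof. by split=> //; [exact: gN|apply: (refl_opp sysH hH rs); exact: genN]. Qed.

(** [hpt] is a point of the wall that s fixes and that lies on the side of 0 for every other
    relevant hyperplane. For such a hyperplane both 0 and s 0 are on the side of [hpt]. *)
Lemma refl_relsep H' : Q H' -> sep 0 (act X s 0) H' -> H' = H.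
Proof.
move=> Q' [hH' _ _ os]; apply: contrapT => nH.
pose H'' := act X s^-1 @` H'; have Q'' := relevant_act bT (NV Ns) Q'.
have sE : act X s @` (act X s^-1 @` H') = H'.
  exact: (act_imageV).
have n'' : act X s^-1 @` H' <> H by move=> e; apply: nH; rewrite -sE e refl_image.
have := same_act Ns (QH Q'') (hpt_same Q'' n'').
rewrite sE (refl_fix sysH hH ipE rs Hh) => s1.
have [_ _] := sameS_trans sysH hH' (hpt_same Q' nH) (sameS_sym sysH hH' s1).
exact.
Qed.

(** The path is the translate by n^-1 of the path from 0 to s 0, since s^-1 0 = s 0. *)
Lemma refl_cross n H' : N n -> Q H' ->
  sep (act X n^-1 0) (act X (s * n)^-1 0) H' <-> H' = act X n^-1 @` H.
Proof.
move=> Nn Q'; have nU : n \is a GRing.unit by case: (N_normalizes SX Nn).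
have sU : s \is a GRing.unit by case: (N_normalizes SX Ns).
have -> : act X (s * n)^-1 0 = act X n^-1 (act X s 0).
  by rewrite invrM // (actM SX) ?refl_act0 //; exact: NV.
split=> [/(sep_act Nn)|->]; last exact: (sep_act (NV Nn) refl_sep).
rewrite !(actVK SX) // => /refl_relsep <-; first by rewrite (act_image).
exact: (relevant_act bT Nn Q').
Qed.

End SimpleReflection.
End RelevantChambers.

End Covers.

(** * Comparison of the two groups *)

Section Semidirect.
Context (T : unitRingType).
Implicit Types (H L A : set T).

Lemma norm_conj H L h l : normalizes H L -> H h -> L l -> L (conj h l).
Proof. by move=> nL Hh Ll; rewrite -(nL h Hh); exists l. Qed.

Lemma semidirect H L : subgroup H -> subgroup L -> normalizes H L -> subgroup (setprod H L).
Proof.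
move=> sH sL nL; split.
- by move=> _ [h Hh [l Ll <-]]; rewrite /= unitrMl ?(sgU sL Ll) // (sgU sH Hh).
- by exists 1; [exact: sg1|exists 1; [exact: sg1|rewrite mulr1]].
- move=> _ _ [h Hh [l Ll <-]] [h' Hh' [l' Ll' <-]]; exists (h * h'); first exact: (sgM sH).
  have h'U := sgU sH Hh'; have Lc := norm_conj nL (sgV sH Hh') Ll.
  exists (conj h'^-1 l * l'); first exact: (sgM sL).
  by rewrite /conj invrK !mulrA mulrK.
- move=> _ [h Hh [l Ll <-]]; have hU := sgU sH Hh; have lU := sgU sL Ll.
  exists h^-1; first exact: (sgV sH); exists (conj h l^-1); last by rewrite invrM // /conj !mulrA mulVr // mul1r.
  by apply: (norm_conj nL Hh); apply: (sgV sL).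
Qed.

Lemma setprod_swap H L A : subgroup H -> normalizes H L -> H `<=` A ->
  setprod H L `<=` setprod L A.
Proof.
move=> sH nL HA _ [h Hh [l Ll <-]]; exists (conj h l); first exact: norm_conj nL Hh Ll.
by exists h; [exact: HA|rewrite conj_mul // (sgU sH Hh)].
Qed.

End Semidirect.

Lemma open_inI (F : nonarchLocalFieldType) d (GF A B : set 'M[F]_d.+1) :
  open_in GF A -> open_in GF B -> open_in GF (A `&` B).
Proof.
move=> [W1 o1 ->] [W2 o2 ->]; exists (W1 `&` W2); first exact: openI.
by apply/seteqP; split=> g; [case=> -[? ?] [? ?]|case=> -[? ?] ?]; do !split.
Qed.

Lemma tensor_injl (C : closedFieldType) (U V Y : vectType C) (tau : U -> V -> Y) (a b : U) (w : V) : is_tensor tau -> w != 0 ->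
  tau a w = tau b w -> a = b.
Proof.
move=> tT w0 e; apply/eqP; rewrite -subr_eq0; apply/negP => /negP ab.
have := tensor_neq0 tT ab w0; rewrite -scaleN1r addrC (tensor_linl tT) e scaleN1r addNr.
by rewrite eqxx.
Qed.

Section KernelComparison.
Context (R : realType) (F : nonarchLocalFieldType) (Fb : closedFieldType).
Context (iota : {rmorphism F -> Fb}) (d : nat) (C : closedFieldType).
Context (p : nat) (sqp : C).
Hypotheses (rpF : residue_char F p) (pC : p \notin [pchar C]) (sqpE : sqp ^+ 2 = p%:R).
Context (D : comparison_data R F Fb d C).
Hypothesis SD : comparison_setup iota D.
Local Notation X0 := (dX0 D).
Local Notation X := (dX D).
Hypotheses (Q0 : quasi_cover_family iota X0) (Q1 : quasi_cover_family iota X).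
Hypothesis CC : cover_compat iota D.
Local Notation MF := 'M[F]_d.+1.
Local Notation pts := 'rV[R]_(adim (dE D)).
Local Notation G0F := (Fpts iota (cG X0)).
Local Notation GF := (Fpts iota (cG X)).
Let S0 := setup0 SD.
Let S1 := setup1 SD.
Implicit Types (x y : pts) (a g h k l j : MF).

Lemma G0_GF g : G0F g -> GF g. Proof. exact: (G0_sub SD). Qed.

Section Model.
Context (J0 L : set MF) (W : vectType C) (kap : MF -> 'End(W)).

(* The isomorphisms rho_x = inf(rho^0_x) (x) kappa_x and kappa ~ ind(kappa_x):
   [ev] is evaluation at 1 and [i] sends v to the function supported on K_x. *)
Record local_model x (tau : cV X0 -> dVx x -> cV X) (ev : 'Hom(W, dVx x)) (i : 'Hom(dVx x, W)) :
  Prop := LocalModel {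
  lm_tau : is_tensor tau ;
  lm_w : exists w : dVx x, w != 0 ;
  lm_J0 : cK X0 x `<=` J0 ;
  lm_sub : cK X0 x `<=` cK X x ;
  lm_dec : forall a, cK X x a -> exists a0 l, [/\ cK X0 x a0, L l, a = a0 * l &
    forall v w, crho X x a (tau v w) = tau (crho X0 x a0 v) (dkap x a w)] ;
  lm_ker : forall g, L g -> G0F g -> cK X0 x g /\ crho X0 x g = \1%VF ;
  lm_mul : forall a b, cK X x a -> cK X x b -> dkap x (a * b) = (dkap x a \o dkap x b)%VF ;
  lm_1 : dkap x 1 = \1%VF ;
  lm_ev : forall a w, cK X x a -> ev (kap a w) = dkap x a (ev w) ;
  lm_i : forall a v, cK X x a -> kap a (i v) = i (dkap x a v) ;
  lm_evi : forall l v, L l -> ev (kap l (i v)) = if l \in cK X x then dkap x l v else 0 ;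
  lm_sum : forall t w, trans L (L `&` cK X x) t ->
    \sum_(h <- t) kap h (i (ev (kap h^-1 w))) = w }.

Hypotheses (coL : compact_open GF L) (coJ : compact_open G0F J0) (nL : normalizes J0 L) (irL : irreducible L kap)
  (kM : forall a b, setprod J0 L a -> setprod J0 L b -> kap (a * b) = (kap a \o kap b)%VF)
  (k1 : kap 1 = \1%VF).

Let sL : subgroup L. Proof. by case: coL => -[]. Qed.
Let cL : compact L. Proof. by case: coL. Qed.
Let LG : L `<=` GF. Proof. by case: coL => -[_ [W1 _ ->]] _ g []. Qed.
Let sJ0 : subgroup J0. Proof. by case: coJ => -[]. Qed.
Let cJ0 : compact J0. Proof. by case: coJ. Qed.
Let J0G : J0 `<=` G0F. Proof. by case: coJ => -[_ [W1 _ ->]] _ g []. Qed.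

Lemma J0_J : J0 `<=` setprod J0 L.
Proof. by move=> j Jj; exists j => //; exists 1; [exact: sg1|rewrite mulr1]. Qed.
Lemma L_J : L `<=` setprod J0 L.
Proof. by move=> l Ll; exists 1; [exact: sg1|exists l; rewrite ?mul1r]. Qed.

Let sJ : subgroup (setprod J0 L). Proof. exact: semidirect. Qed.

(** An element of K_x is a product of elements of K^0_x and K_{x,0+}. Neighbor compatibility splits
    the second into a factor in G^0, where rho^0_x is trivial, and a factor in L; this gives
    [lm_dec]. The other fields come from the induced representation on K^0_x L, restricted to L. *)
Lemma local_model_ex x : gen x -> cK X0 x `<=` J0 ->
  dKx x `<=` setprod (G0F `&` dKx x) L -> G0F `&` L `<=` rep_kernel (cK X0 x) (crho X0 x) ->
  iso_ind (setprod (cK X0 x) L) (cK X x) (dkap x) kap ->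
  exists tau ev i, @local_model x tau ev i.
Proof.
move=> gx K0J LxL kerL iso; have s0 := sgK S0 gx; have s1 := sgK S1 gx.
have [[[[sLx _] _] LxK] nLx [kerLx KE] [[[kx1 kxM _] [Vx0 _]] [tau tT tauE]] _] := CC gx.
have dec a : cK X x a -> exists a0 l, [/\ cK X0 x a0, L l, a = a0 * l &
    forall v w, crho X x a (tau v w) = tau (crho X0 x a0 v) (dkap x a w)].
  rewrite KE => -[k Kk [lx Lx <-]]; have [z zk [l Ll zE]] := LxL _ Lx.
  have [Kz rz] := kerLx _ zk; exists (k * z), l; split=> //; first exact: (sgM s0).
    by rewrite -mulrA zE.
  by move=> v w; rewrite tauE // (rhoM S0 gx) // rz comp_lfun1r.
have sub : cK X0 x `<=` cK X x.
  by rewrite KE => k Kk; exists k => //; exists 1; [exact: sg1|rewrite mulr1].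
have nL' : normalizes (cK X0 x) L by move=> k /K0J; exact: nL.
have sH := semidirect s0 sL nL'.
have AH : cK X x `<=` setprod (cK X0 x) L.
  by move=> a /dec[a0 [l [? ? -> _]]]; exists a0 => //; exists l.
have [ev [i [p1 p2 p3 p4]]] := induced_model sH s1 AH kxM kx1 iso.
have LH : L `<=` setprod (cK X0 x) L.
  by move=> l Ll; exists 1; [exact: sg1|exists l; rewrite ?mul1r].
exists tau, ev, i; split=> //.
- by exists (vpick {:dVx x}); rewrite vpick0.
- by move=> g Lg Gg; apply: kerL.
- by move=> l v Ll; apply: p3; apply: LH.
- move=> t w tt; apply: p4; apply: (trans_sub sH sL LH _ s1 tt).
  exact: setprod_swap s0 nL' sub.
Qed.

Section Pair.
Context (x y : pts) (gx : gen x) (gy : gen y).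

Section OneModel.
Context (z : pts) (gz : gen z) (tau : cV X0 -> dVx z -> cV X) (ev : 'Hom(W, dVx z)).
Context (i : 'Hom(dVx z, W)) (lm : local_model tau ev i).

(** For an element of K_x cap L the factor in G^0 lies in L too, and rho^0_x is trivial there. *)
Lemma lm_rhoL l v w : cK X z l -> L l -> crho X z l (tau v w) = tau v (dkap z l w).
Proof.
move=> Kl Ll; have [a0 [l' [Ka Ll' e ->]]] := lm_dec lm Kl.
have l'U := sgU sL Ll'; have La : L a0.
  have -> : a0 = l * l'^-1 by rewrite e mulrK.
  by apply: (sgM sL Ll); apply: (sgV sL).
have [_ ->] := lm_ker lm La (KG S0 gz Ka).
by rewrite id_lfunE.
Qed.

Lemma lm_rho0 a v w : cK X0 z a -> crho X z a (tau v w) = tau (crho X0 z a v) (dkap z a w).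
Proof.
move=> Ka; have [a0 [l [Ka0 Ll e ->]]] := lm_dec lm (lm_sub lm Ka).
have Gl : G0F l.
  have -> : l = a0^-1 * a by rewrite e mulKr // (sgU (sgK S0 gz) Ka0).
  by apply: (sgM (sgGF S0)); [apply: (sgV (sgGF S0))|]; apply: (KG S0 gz).
have [Kl rl] := lm_ker lm Ll Gl.
by rewrite [in RHS]e (rhoM S0 gz) // rl comp_lfun1r -e.
Qed.

Lemma lm_kxVK a v : cK X z a -> dkap z a^-1 (dkap z a v) = v.
Proof.
move=> Ka; have s1 := sgK S1 gz.
rewrite -[LHS]comp_lfunE -(lm_mul lm) //; last exact: (sgV s1).
by rewrite mulVr ?(lm_1 lm) ?id_lfunE // (sgU s1).
Qed.

Lemma K_J : cK X z `<=` setprod J0 L.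
Proof. by move=> a /(lm_dec lm)[a0 [l [/(lm_J0 lm) ? ? -> _]]]; exists a0 => //; exists l. Qed.

End OneModel.

Context (taux : cV X0 -> dVx x -> cV X) (evx : 'Hom(W, dVx x)) (ix : 'Hom(dVx x, W)).
Context (tauy : cV X0 -> dVx y -> cV X) (evy : 'Hom(W, dVx y)) (iy : 'Hom(dVx y, W)).
Hypotheses (lmx : local_model taux evx ix) (lmy : local_model tauy evy iy).

Let kMw a b w : setprod J0 L a -> setprod J0 L b -> kap (a * b) w = kap a (kap b w).
Proof. by move=> Ja Jb; rewrite kM // comp_lfunE. Qed.

(** These are the components along a basis of V_{rho^0}. Through them a map into the tensor product
    becomes a family of maps into V_{kappa_y}, to which the irreducibility of kappa on L applies. *)
Lemma coordinate_maps : exists (n : nat) (e : 'I_n -> cV X0) (h : 'I_n -> 'Hom(cV X, dVx y)),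
  (forall u, u = \sum_i tauy (e i) (h i u)) /\
  forall u m i, cK X y m -> L m -> h i (crho X y m u) = dkap y m (h i u).
Proof.
pose e := vbasis {:cV X0}; have [_ U] := lm_tau lmy.
have /choice[h hP] : forall i : 'I_(\dim {:cV X0}), exists h : 'Hom(cV X, dVx y),
    forall v w, h (tauy v w) = coord e i v *: w.
  move=> i; have [|h [hE _]] := U (dVx y) (fun v w => coord e i v *: w).
    split=> [v a u u'|w a u u'] /=; first by rewrite scalerDr !scalerA mulrC.
    by rewrite linearP scalerDl scalerA.
  by exists h => v w; rewrite hE.
exists _, (fun i => e`_i), h; split=> [u|u m i Km Lm]; last first.
  have ext := tensor_ext (lm_tau lmy) (h := (h i \o crho X y m)%VF) (h' := (dkap y m \o h i)%VF).
  rewrite -[LHS]comp_lfunE -[RHS]comp_lfunE ext // => v w.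
  by rewrite !comp_lfunE (lm_rhoL gy lmy) // !hP linearZ.
have lin : linear (fun u => \sum_(i < \dim {:cV X0}) tauy e`_i (h i u)).
  move=> a u1 u2; rewrite scaler_sumr -big_split; apply: eq_bigr => i _.
  by rewrite linearP (tensor_linr (lm_tau lmy)).
have [f fE] := lfun_ex lin; have fE' u1 : f u1 = \sum_(i < \dim {:cV X0}) tauy e`_i (h i u1) by exact: fE.
have ext := tensor_ext (lm_tau lmy) (h := \1%VF) (h' := f).
rewrite -fE' -[LHS]id_lfunE ext // => v w; rewrite id_lfunE fE' {1}(coord_vbasis (memvf v)) (tensor_suml (lm_tau lmy)).
by apply: eq_bigr => i _; rewrite hP (tensor_Zl (lm_tau lmy)) (tensor_Zr (lm_tau lmy)).
Qed.

(** For fixed i and v, the i-th component of [taux v w] intertwines kappa_x and kappa_y on L cap K_x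
    cap K_y, so [schur_kernel] makes it a multiple of [evy (ix w)]. The coefficients form an
    endomorphism [psi] of V_{rho^0}; it commutes with K_{M^0} and is a scalar by Schur's lemma. *)
Lemma kernel_factor : exists c : C,
  (forall v w, taux v w = tauy (c *: v) (evy (ix w))) /\
  forall l w, L l -> ~ setprod (cK X y `&` L) (cK X x `&` L) l -> evy (kap l (ix w)) = 0.
Proof.
have [n [e [h [dec hL]]]] := coordinate_maps.
have sx := sgK S1 gx; have sy := sgK S1 gy; have sxy := sgI sL (sgI sx sy).
have [t tt] : exists t, trans L (L `&` (cK X x `&` cK X y)) t.
  apply: (fin_trans sL sxy cL LG (@subIsetl _ _ _)); have [[_ oL] _] := coL.
  by apply: open_inI oL _; apply: open_inI (openK S1 gx) (openK S1 gy).
have /choice[xi xiP] : forall iv : 'I_n * cV X0, exists xi,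
    (forall w, xi *: evy (ix w) = h iv.1 (taux iv.2 w)) /\
    forall l w, L l -> ~ setprod (cK X y `&` L) (cK X x `&` L) l -> xi *: evy (kap l (ix w)) = 0.
  move=> [i v]; have [|Q QE] := @lfun_ex _ _ _ (fun w => h i (taux v w)).
    by move=> a u u'; rewrite (tensor_linr (lm_tau lmx)) linearP.
  have QE' w : Q w = h i (taux v w) by exact: QE.
  have [|a w Ka La|a w Ka La|l w Ll Kx Ky|xi [p1 p2]] := schur_kernel (Q := Q) (ev := evx) (i := ix)
    (ev' := evy) (i' := iy) sL sx sy irL _ k1 (lm_mul lmx) (lm_mul lmy) (lm_1 lmx) (lm_1 lmy)
    _ _ (lm_evi lmx) (lm_evi lmy) _ tt.
  - by move=> a b La Lb; apply: kM; apply: L_J.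
  - exact: (lm_ev lmx).
  - exact: (lm_i lmy).
  - by rewrite !QE' -(lm_rhoL gx lmx) // (rho_eq S1 Q1 gx gy) // hL.
  - by exists xi; split=> // w; rewrite p1 QE'.
have [v0 v0n] := V_neq0 S0; have [w0 w0n] := lm_w lmx.
(* A non-zero component shows that [evy (ix w0)] is not 0, so the coefficients [xi] are determined,
   and therefore linear in v. *)
have [i0 hi0] : exists i0, h i0 (taux v0 w0) != 0.
  apply: contrapT => /forallNP hz; have := tensor_neq0 (lm_tau lmx) v0n w0n.
  rewrite [X in X != 0]dec big1 ?eqxx // => i _.
  by have /negP/negPn/eqP -> := hz i; rewrite (tensor_0r (lm_tau lmy)).
have [p1 p2] := xiP (i0, v0); rewrite -(p1 w0) /= scaler_eq0 negb_or in hi0.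
have /andP[x0 s0] := hi0.
have xil i (a : C) v v' : xi (i, a *: v + v') = a * xi (i, v) + xi (i, v').
  apply: (scaler_inj s0); have [e1 _] := xiP (i, a *: v + v').
  have [e2 _] := xiP (i, v); have [e3 _] := xiP (i, v').
  move: (e1 w0) (e2 w0) (e3 w0) => /= {}e1 {}e2 {}e3.
  by rewrite e1 (tensor_linl (lm_tau lmx)) /= linearP /= -e2 -e3 scalerDl scalerA.
have [|psi psiE'] := @lfun_ex _ _ _ (fun v => \sum_i xi (i, v) *: e i).
  move=> a v v'; rewrite scaler_sumr -big_split; apply: eq_bigr => i _.
  by rewrite xil scalerDl scalerA.
have psiE v : psi v = \sum_i xi (i, v) *: e i by exact: psiE'.
have fac v w : taux v w = tauy (psi v) (evy (ix w)).
  rewrite [LHS]dec psiE (tensor_suml (lm_tau lmy)); apply: eq_bigr => i _.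
  have [e1 _] := xiP (i, v); rewrite -e1 (tensor_Zr (lm_tau lmy)).
  by rewrite (tensor_Zl (lm_tau lmy)).
have [_ irM] := rM_irr S0; have [m Km|c cE] := irr_scalar irM (T := psi).
  apply/lfunP => v; rewrite [LHS]comp_lfunE [RHS]comp_lfunE.
  have [Kx _] := KM_sub S0 Q0 gx Km; have [Ky _] := KM_sub S0 Q0 gy Km.
  have Kx1 := lm_sub lmx Kx; have Ky1 := lm_sub lmy Ky.
  have u0 : dkap y m (evy (ix w0)) != 0.
    apply: contraNneq s0 => e0; rewrite -(lm_kxVK gy lmy (evy (ix w0)) Ky1) e0 linear0 //.
  apply: (tensor_injl (lm_tau lmy) u0).
  rewrite -{1}(lm_ev lmy) // (lm_i lmx) // -fac -(rho_KM S0 Q0 gx Km) -(lm_rho0 gx lmx) //.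
  by rewrite (rho_eq S1 Q1 gx gy Kx1 Ky1) fac (lm_rho0 gy lmy) // (rho_eq S0 Q0 gx gy Kx Ky).
exists c; split=> [v w|l w Ll nl]; first by rewrite fac cE scale_lfunE id_lfunE.
by have /eqP := p2 l w Ll nl; rewrite scaler_eq0 (negPf x0) => /eqP.
Qed.

Local Notation EkX := (Ek p sqp X).
Local Notation Ek0 := (Ek p sqp X0).

(* The kernel of Theta_{y|x} for G on J0 L is that for G^0 tensored with the
   kernel of the identity of [kap]. *)
Lemma kernel_formula : exists c : C, forall j l v w, J0 j -> L l ->
  EkX y x (j * l) (taux v w) = tauy (c *: Ek0 y x j v) (evy (kap (j * l) (ix w))).
Proof.
have [c [fac sup]] := kernel_factor; exists c => j l v w Jj Ll.
have Gj := J0G Jj; have Gl := LG Ll; have Gjl : GF (j * l) by exact: (sgM (sgGF S1) (G0_GF Gj) Gl).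
have s0x := sgK S0 gx; have s0y := sgK S0 gy.
have KxJ := K_J lmx; have KyJ := K_J lmy.
have [[b Kb [a Ka e]]|nba] := pselect (setprod (cK X y) (cK X x) (j * l)).
  rewrite -e (Ek_mul rpF pC sqpE S1 Q1 _ gx gy) //.
  have [a0 [l2 [Ka0 Ll2 aE ->]]] := lm_dec lmx Ka; have [b0 [l1 [Kb0 Ll1 bE bT]]] := lm_dec lmy Kb.
  have a0U := sgU s0x Ka0; have b0U := sgU s0y Kb0; have lU := sgU sL Ll.
  have Ja0 := lm_J0 lmx Ka0.
  (* [z] lies in G^0 as well as in L, so it belongs to the kernel of rho^0_x, and [j] is itself in
     K^0_y K^0_x. *)
  pose z := (b0 * a0)^-1 * j; have zL : L z.
    have -> : z = conj a0^-1 l1 * (l2 * l^-1).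
      have jE : j = b0 * l1 * (a0 * l2) * l^-1 by rewrite -bE -aE e mulrK.
      by rewrite /z jE invrM // /conj invrK -!mulrA mulKr.
    apply: (sgM sL); first exact: (norm_conj nL (sgV sJ0 Ja0)).
    by apply: (sgM sL Ll2); apply: (sgV sL).
  have zG : G0F z.
    apply: (sgM (sgGF S0)) => //; apply: (sgV (sgGF S0)).
    by apply: (sgM (sgGF S0)); [apply: (KG S0 gy)|apply: (KG S0 gx)].
  have [Kz rz] := lm_ker lmx zL zG.
  have -> : j = b0 * (a0 * z).
    by rewrite mulrA /z mulVKr // unitrMl.
  rewrite (Ek_mul rpF pC sqpE S0 Q0 _ gx gy) //; last exact: (sgM s0x).
  rewrite (rhoM S0 gx) // rz comp_lfun1r fac bT linearZ.
  rewrite kMw; [|exact: KyJ|exact: KxJ].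
  by rewrite (lm_ev lmy) // (lm_i lmx).
rewrite (Ek_out rpF pC sqpE S1 Q1) //.
(* If j is in K^0_y K^0_x although j l is outside K_y K_x, then a0 l a0^-1 is outside (K_y cap
   L)(K_x cap L), and the factor of kappa vanishes. *)
have [[b0 Kb0 [a0 Ka0 e]]|nba0] := pselect (setprod (cK X0 y) (cK X0 x) j); last first.
  by rewrite (Ek_out rpF pC sqpE S0 Q0) // scaler0 (tensor_0l (lm_tau lmy)).
have a0U := sgU s0x Ka0; have Ja0 := lm_J0 lmx Ka0; have Jb0 := lm_J0 lmy Kb0.
have Lc : L (conj a0 l) by exact: (norm_conj nL Ja0).
have jlE : j * l = b0 * (conj a0 l * a0) by rewrite conj_mul // mulrA e.
have Kb1 := lm_sub lmy Kb0; have Ka1 := lm_sub lmx Ka0.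
rewrite jlE kMw; [|exact: KyJ|by apply: (sgM sJ); [exact: L_J|exact: KxJ]].
rewrite kMw; [|exact: L_J|exact: KxJ].
rewrite (lm_ev lmy) // (lm_i lmx) // sup // ?linear0 ?(tensor_0r (lm_tau lmy)) //.
move=> [b1 [Kb1' _] [a1 [Ka1' _] e1]]; apply: nba.
exists (b0 * b1); first exact: (sgM (sgK S1 gy)).
exists (a1 * a0); first exact: (sgM (sgK S1 gx)).
by rewrite jlE -e1 !mulrA.
Qed.

End Pair.

Section Vanishing.
Context (x y : pts) (gx : gen x) (gy : gen y).
Context (taux : cV X0 -> dVx x -> cV X) (evx : 'Hom(W, dVx x)) (ix : 'Hom(dVx x, W)).
Context (tauy : cV X0 -> dVx y -> cV X) (evy : 'Hom(W, dVx y)) (iy : 'Hom(dVx y, W)).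
Hypotheses (lmx : local_model taux evx ix) (lmy : local_model tauy evy iy).
Local Notation EkX := (Ek p sqp X).
Local Notation Ek0 := (Ek p sqp X0).
Local Notation T0n := (@Theta_norm _ _ _ _ _ p sqp _ X0).
Local Notation T1n := (@Theta_norm _ _ _ _ _ p sqp _ X).

Lemma J_GF : setprod J0 L `<=` GF.
Proof. by move=> _ [j /J0G/G0_GF Gj [l /LG Gl <-]]; apply: (sgM (sgGF S1)). Qed.

(** Representatives of J0 L modulo K^0_y L can be taken in J0, and those of K^0_y L modulo K_y in
    L. *)
Lemma model_trans s t : trans J0 (cK X0 y) s -> trans L (L `&` cK X y) t ->
  trans (setprod J0 L) (cK X y) [seq j * l | j <- s, l <- t].
Proof.
move=> ts tt; have s0 := sgK S0 gy; have s1 := sgK S1 gy; have KJ := K_J lmy.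
have nL' : normalizes (cK X0 y) L by move=> k /(lm_J0 lmy); exact: nL.
have sH := semidirect s0 sL nL'.
have HJ : setprod (cK X0 y) L `<=` setprod J0 L.
  by move=> _ [k /(lm_J0 lmy) Jk [l Ll <-]]; exists k => //; exists l.
have LH : L `<=` setprod (cK X0 y) L.
  by move=> l Ll; exists 1; [exact: sg1|exists l; rewrite ?mul1r].
have AH : cK X y `<=` setprod (cK X0 y) L.
  by move=> a /(lm_dec lmy)[a0 [l [? ? -> _]]]; exists a0 => //; exists l.
apply: (trans_tower sJ sH s1 AH HJ).
  apply: (trans_sub sJ sJ0 J0_J _ sH).
    move=> _ [j Jj [l Ll <-]]; exists j => //; exists l => //; exact: LH.
  rewrite (_ : J0 `&` setprod (cK X0 y) L = cK X0 y) //.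
  apply/seteqP; split=> [j [Jj [k Kk [l Ll e]]]|k Kk]; last first.
    by split; [exact: (lm_J0 lmy)|exists k => //; exists 1; [exact: sg1|rewrite mulr1]].
  rewrite -e in Jj *.
  have Gl : G0F l by apply: J0G; move/(sgMl _ sJ0 (lm_J0 lmy Kk)): Jj.
  by apply: (sgM s0) => //; case: (lm_ker lmy Ll Gl).
apply: (trans_sub sH sL LH _ s1 tt); exact: (setprod_swap s0 nL' (lm_sub lmy)).
Qed.

(** The sum over J0 L of products of kernels splits: the sum over L recovers the identity of kappa
    by [lm_sum], and the sum over J0 is the composite for G^0. At g = j' l' outside K_x, either j'
    is outside K^0_x and the factor of G^0 vanishes, or l' is outside K_x and the factor of kappa
    does. *)
Lemma TT_vanish :
  (forall v g, J0 g -> ~ cK X0 x g -> T0n x y (T0n y x (fun_at_pt x v)) g = 0) ->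
  forall u g, setprod J0 L g -> ~ cK X x g -> T1n x y (T1n y x (fun_at_pt x u)) g = 0.
Proof.
move=> van u g Jg nKg; have GJ := J_GF; have KxJ := K_J lmx; have KyJ := K_J lmy.
have [s ts] := fin_trans sJ0 (sgK S0 gy) cJ0 J0G (lm_J0 lmy) (openK S0 gy).
have [t tt] : exists t, trans L (L `&` cK X y) t.
  apply: (fin_trans sL (sgI sL (sgK S1 gy)) cL LG (@subIsetl _ _ _)).
  by have [[_ oL] _] := coL; apply: open_inI oL (openK S1 gy).
have tst := model_trans ts tt; have Gg := GJ _ Jg.
rewrite (TT_Ek rpF pC sqpE S1 Q1 u gx gy sJ GJ KxJ KyJ tst Gg).
pose B r := (EkX x y r \o EkX y x (r^-1 * g)%R)%VF.
rewrite (eq_bigr (fun r => B r u)) => [|r _]; last by rewrite /B comp_lfunE.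
rewrite -sum_lfunE (_ : \sum_(r <- _) B r = 0) ?zero_lfunE ?scaler0 //.
apply: (tensor_ext (lm_tau lmx)) => v w; rewrite zero_lfunE sum_lfunE.
have [c cP] := kernel_formula gx gy lmx lmy; have [c' cP'] := kernel_formula gy gx lmy lmx.
have [j' Jj' [l' Ll' gE]] := Jg; have j'U := sgU sJ0 Jj'; have l'U := sgU sL Ll'.
have [us Js _ _] := ts; have [ut Lt _ _] := tt.
have kapM a b u1 : setprod J0 L a -> setprod J0 L b -> kap (a * b) u1 = kap a (kap b u1).
  by move=> Ja Jb; rewrite kM // comp_lfunE.
have JU a : setprod J0 L a -> a \is a GRing.unit by move/(sgU sJ).
rewrite big_flatten /= big_map.
rewrite (eq_big_seq (fun j => taux ((c' * c) *: Ek0 x y j (Ek0 y x (j^-1 * j') v))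
    (evx (kap g (ix w))))) => [|j js].
  rewrite -(tensor_suml (lm_tau lmx)) -scaler_sumr.
  have [Kj|nKj] := pselect (cK X0 x j').
    rewrite -gE kapM; [|exact: J0_J|exact: L_J].
    have Kj1 := lm_sub lmx Kj; rewrite (lm_ev lmx) // (lm_evi lmx) // memNset.
      by rewrite linear0 (tensor_0r (lm_tau lmx)).
    by move=> Kl; apply: nKg; rewrite -gE; apply: (sgM (sgK S1 gx)).
  have := TT_Ek rpF pC sqpE S0 Q0 v gx gy sJ0 J0G (lm_J0 lmx) (lm_J0 lmy) ts (J0G Jj').
  rewrite van // => /esym/eqP; rewrite scaler_eq0 invr_eq0 mulf_eq0.
  rewrite !(negPf (psqrt_neq0 rpF pC sqpE _)) /= => /eqP ->.
  by rewrite scaler0 (tensor_0l (lm_tau lmx)).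
have Jj := Js j js; have jU := sgU sJ0 Jj; have JjV := sgV sJ0 Jj.
have Jjj := sgM sJ0 JjV Jj'; have JJj := J0_J Jj; have JJjV := J0_J JjV.
have JJg := sgM sJ JJjV Jg.
rewrite big_map (eq_big_seq (fun l => taux (c' *: Ek0 x y j (c *: Ek0 y x (j^-1 * j') v))
    (evx (kap j (kap l (iy (evy (kap l^-1 (kap (j^-1 * g) (ix w)))))))))) => [|l lt].
  rewrite -(tensor_sumr (lm_tau lmx)) -!linear_sum (lm_sum lmy _ tt) linearZ scalerA /=.
  by rewrite -kapM // mulrA mulrV // mul1r.
have Ll := Lt l lt; have lU := sgU sL Ll; have LlV := sgV sL Ll; have jjU := sgU sJ0 Jjj.
have Jl := L_J Ll; have JlV := L_J LlV.
rewrite /B comp_lfunE.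
(* The argument is brought to the form required by [kernel_formula], an element of J0 times an
   element of L. *)
have e1 : (j * l)^-1 * g = j^-1 * j' * (conj (j^-1 * j')^-1 l^-1 * l').
  rewrite -gE /conj invrK !mulrA mulrV // mul1r invrM // -!mulrA; congr (_ * _).
have Lc : L (conj (j^-1 * j')^-1 l^-1 * l').
  by apply: (sgM sL) => //; apply: (norm_conj nL) => //; apply: (sgV sJ0).
rewrite e1 cP // -e1 cP' // invrM // -mulrA kapM // (kapM l^-1) //.
Qed.

End Vanishing.
End Model.

Lemma compact_setprod (J L : set MF) : compact_open G0F J -> compact_open GF L ->
  compact (setprod J L).
Proof.
move=> [[sJ [W0 o0 JE]] cJ] [[sL [W1 o1 LE]] cL].
have JG : J `<=` G0F by move=> g; rewrite JE => -[].
have [|s [us Js Ds Es]] := fin_trans sJ (sgI sJ sL) cJ JG (@subIsetl _ _ _).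
  exists (W0 `&` W1); first exact: openI.
  rewrite LE {1}JE; apply/seteqP; split=> g; first by move=> [[? ?] [? ?]].
  by move=> [[? ?] Gg]; do !split=> //; exact: G0_GF.
rewrite (_ : setprod J L = [set g | exists2 r, r \in s & [set r * l | l in L] g]).
  by apply: compact_seq_union => r _; apply: compact_mull.
apply/seteqP; split=> [_ [j Jj [l Ll <-]]|_ [r rs [l Ll <-]]]; last by exists r; [exact: Js|exists l].
have [r rs [_ Lr]] := Es j Jj; exists r => //; exists (r^-1 * j * l); first exact: (sgM sL).
by rewrite -mulrA mulVKr // (sgU sJ (Js r rs)).
Qed.

Lemma sep1_dist x y (H : set pts) : sep x y = [set H] -> dist x y = 1%N.
Proof. by move=> e; rewrite /dist e fset_set1 cardfs1. Qed.

Hypothesis NC : neighbor_compat iota D.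

Lemma neighbor_subgroup x y (H : set pts) : gen x -> gen y -> sep x y = [set H] ->
  exists J, [/\ subgroup J, J `<=` GF, compact J, cK X x `<=` J & cK X y `<=` J].
Proof.
move=> gx gy sxy; have [_ cJ0 [L [W [kap [coL [[k1 kM _] _] [Kx Ky] [nL Lx Ly] [kerL irL isox isoy]]]]]] :=
  NC gx gy (sep1_dist sxy).
have kx : G0F `&` L `<=` rep_kernel (cK X0 x) (crho X0 x) by move=> g /kerL[].
have ky : G0F `&` L `<=` rep_kernel (cK X0 y) (crho X0 y) by move=> g /kerL[].
have [tx [ex [ix lmx]]] := local_model_ex coL nL gx Kx Lx kx isox.
have [ty [ey [iy lmy]]] := local_model_ex coL nL gy Ky Ly ky isoy.
have [[sJ0 _] _] := cJ0; have [[sL _] _] := coL.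
exists (setprod (dK0 x y) L); split; [exact: semidirect|exact: (J_GF coL cJ0)| | |].
- exact: compact_setprod.
- exact: (K_J lmx).
- exact: (K_J lmy).
Qed.

(** If the composite is scalar for G^0, its value on f_v vanishes outside K^0_x. [TT_vanish]
    transfers the vanishing to G, where it implies that the composite is scalar. *)
Lemma relevant_sub : relevant iota X `<=` relevant iota X0.
Proof.
move=> H [hH [x [y [gx gy sxy ns]]]]; split=> //; exists x, y; split=> //.
apply: contra_not ns => sc; have [c cP] := scalar_eqv rpF pC sqpE S0 Q0 gx gy sc.
have [_ cJ0 [L [W [kap [coL [[k1 kM _] _] [Kx Ky] [nL Lx Ly] [kerL irL isox isoy]]]]]] :=
  NC gx gy (sep1_dist sxy).
have kx : G0F `&` L `<=` rep_kernel (cK X0 x) (crho X0 x) by move=> g /kerL[].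
have ky : G0F `&` L `<=` rep_kernel (cK X0 y) (crho X0 y) by move=> g /kerL[].
have [tx [ex [ix lmx]]] := local_model_ex coL nL gx Kx Lx kx isox.
have [ty [ey [iy lmy]]] := local_model_ex coL nL gy Ky Ly ky isoy.
have [[sJ0 [W0 _ J0E]] _] := cJ0; have [[sL _] _] := coL.
have sJ := semidirect sJ0 sL nL.
apply: (scalar_of_vanish rpF pC sqpE S1 Q1 gx gy sJ (J_GF coL cJ0) (compact_setprod cJ0 coL)
  (K_J lmx) (K_J lmy)).
have van := TT_vanish coL cJ0 nL irL kM k1 gx gy lmx lmy.
apply: van => v g Jg nK.
rewrite cP; [|exact: fun_at_eqv|by move: Jg; rewrite J0E => -[]].
by rewrite /fun_at_pt memNset ?scaler0.
Qed.

Lemma good_pair (H : set pts) : @aH _ _ _ _ (dE D) H -> ~ relevant iota X0 H ->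
  good iota p sqp X0 H /\ good iota p sqp X H.
Proof.
move=> hH ir; split.
  apply: (irrelevant_good rpF pC sqpE S0 Q0 hH ir) => x y gx gy sxy.
  have [_ [[sJ [W1 _ JE]] cJ] [L [W [kap [_ _ [Kx Ky] _ _]]]]] := NC gx gy (sep1_dist sxy).
  by exists (dK0 x y); split=> // g; rewrite JE => -[].
apply: (irrelevant_good rpF pC sqpE S1 Q1 hH) => [/relevant_sub//|x y gx gy sxy].
exact: neighbor_subgroup sxy.
Qed.

End KernelComparison.

(** * The sign character *)

Section SignCharacter.
Context (p : nat) (R : realType) (F : nonarchLocalFieldType) (Fb : closedFieldType).
Context (iota : {rmorphism F -> Fb}) (C : closedFieldType) (sqp : C) (d : nat).
Context (D : comparison_data R F Fb d C) (Waff : set 'M[F]_d.+1) (Cgt1 : set C).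
Context (T0 : 'M[F]_d.+1 -> 'End(cV (dX0 D))) (T : 'M[F]_d.+1 -> 'End(cV (dX D))).
Context (I : ('M[F]_d.+1 -> 'End(cV (dX0 D))) -> 'M[F]_d.+1 -> 'End(cV (dX D))).
Hypotheses (rpF : residue_char F p) (pC : p \notin [pchar C]) (sqpE : sqp ^+ 2 = p%:R).
Hypotheses (SD : comparison_setup iota D) (Q0 : quasi_cover_family iota (dX0 D)).
Hypotheses (Q1 : quasi_cover_family iota (dX D)).
Hypotheses (RP : reflection_property iota (dX0 D) Waff) (LC : levi_compat iota D).
Hypotheses (CC : cover_compat iota D) (NC : neighbor_compat iota D).
Hypotheses (A0 : adapted iota p sqp Waff Cgt1 T0).
Hypotheses (A1 : associated_adapted iota p sqp Waff Cgt1 T0 T).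
Hypotheses (HI : hecke_isomorphism iota I).
Hypotheses (Iphi : forall n, aN (dE D) n -> I (phi_w iota p sqp T0 n) = phi_w iota p sqp T n).
Local Notation MF := 'M[F]_d.+1.
Local Notation X0 := (dX0 D).
Local Notation X := (dX D).
Local Notation N := (aN (dE D)).
Local Notation KM0 := (cKM X0).
Local Notation KM := (cKM X).
Local Notation tau := (@dtau _ _ _ _ _ D).
Local Notation kt := (@dkMt _ _ _ _ _ D).
Local Notation ph0 := (@phi_w _ _ _ iota _ _ p sqp _ X0 T0).
Local Notation ph := (@phi_w _ _ _ iota _ _ p sqp _ X T).
Local Notation conv0 := (@convolution _ _ _ iota _ _ _ X0 0).
Local Notation conv1 := (@convolution _ _ _ iota _ _ _ X 0).
Local Notation Q := (relevant iota X0).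
Local Notation sq a := (psqrt p sqp a).
Implicit Types (n m s k : MF) (v : cV X0) (w : dVk D) (H : set 'rV[R]_(adim (dE D))).

Let S0 : cover_setup iota X0 := setup0 SD.
Let S1 : cover_setup iota X := setup1 SD.
Let bT0 : @basic_family _ _ _ _ _ _ X0 T0. Proof. by case: A0. Qed.
Let bT : @basic_family _ _ _ _ _ _ X T. Proof. by case: A1 => -[]. Qed.
Let NM n m : N n -> N m -> N (n * m). Proof. exact: sgM (N_subgroup S0). Qed.
Let NV n : N n -> N n^-1. Proof. exact: sgV (N_subgroup S0). Qed.
Let N1 : N 1. Proof. exact: sg1 (N_subgroup S0). Qed.
Let UN n : N n -> n \is a GRing.unit. Proof. by move=> /(N_normalizes S0)[]. Qed.
Let actE n : N n -> act X n = act X0 n. Proof. exact: (act_comparison SD). Qed.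
Let sysH : hyperplane_system (dE D) := H_system S0.
Let g0 : gen (0 : 'rV[R]_(adim (dE D))). Proof. exact: gen0. Qed.
Let gN n : N n -> gen (act X0 n 0). Proof. by move=> Nn; apply: (gen_act S0 Q0). Qed.
Let QH : Q `<=` @aH _ _ _ _ (dE D). Proof. by move=> H []. Qed.
Let tauT : is_tensor tau. Proof. by case: LC. Qed.

Lemma kt_mul a b w : setprod N KM a -> setprod N KM b -> kt (a * b) w = kt a (kt b w).
Proof. by move=> Na Nb; have [_ [_ kM _] _ _] := LC; rewrite kM // comp_lfunE. Qed.

Let NKM n : N n -> setprod N KM n.
Proof. by move=> Nn; exists n => //; exists 1; [exact: sg1 (sgKM S1)|rewrite mulr1]. Qed.
Let KNK k : KM k -> setprod N KM k.
Proof. by move=> Kk; exists 1 => //; exists k; rewrite ?mul1r. Qed.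

Lemma kt_neq0 n w : N n -> w != 0 -> kt n w != 0.
Proof.
move=> Nn; apply: contraNneq => k0; have [_ [k1 _ _] _ _] := LC.
have := kt_mul w (NKM (NV Nn)) (NKM Nn).
by rewrite mulVr ?UN // k1 id_lfunE k0 linear0 => ->.
Qed.

Lemma dVk_neq0 : exists w, w != 0.
Proof.
by have [_ _ [_ [W0 _]] _] := LC; exists (vpick {:dVk D}); rewrite vpick0.
Qed.

Lemma KM0_sub k : KM0 k -> KM k.
Proof.
have [_ _ _ [L [[[sL _] _] _ _ -> _]]] := LC; move=> Kk; exists k => //.
by exists 1; [exact: sg1|rewrite mulr1].
Qed.

Lemma rM_tau0 k v w : KM0 k -> @crM _ _ _ _ _ _ X k (tau v w) = tau (@crM _ _ _ _ _ _ X0 k v) (kt k w).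
Proof.
have [_ _ _ [L [[[sL _] _] _ _ _ rE]]] := LC; move=> Kk.
by have := rE k 1 v w Kk (sg1 sL); rewrite mulr1.
Qed.

(** Like T_n, the operator T^0_n (x) kappa(n) intertwines the conjugate of rho_M by n with rho_M,
    and such operators form a line. K_{M,0+} is normalized by n, so a product k0 l can be conjugated
    factor by factor. *)
Lemma sign_ex n : N n -> exists e, forall v w, T n (tau v w) = e *: tau (T0 n v) (kt n w).
Proof.
move=> Nn; have nU := UN Nn; have [h hE] := tensor_map (T0 n) (kt n) tauT tauT.
have [_ _ _ [L [[[sL _] _] nL kerL KE rE]]] := LC.
have nLn : normalizes (setprod N KM0) L by [].
have [|c cE] := T_unique S1 bT Nn (A := h).
  move=> k v Kk; have := Kk; rewrite KE => -[k0 Kk0 [l Ll kE]].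
  have Kc0 : KM0 (conj n k0) by rewrite -(N_KM S0 Nn); exists k0.
  have Lc : L (conj n l).
    apply: (norm_conj nL) => //; exists n => //; exists 1; [exact: sg1 (sgKM S0)|exact: mulr1].
  have Kc : KM (conj n k) by rewrite -(N_KM S1 Nn); exists k.
  rewrite -[LHS]comp_lfunE -[RHS]comp_lfunE; congr (_ v).
  have ext := tensor_ext tauT (h := (h \o @crM _ _ _ _ _ _ X k)%VF)
    (h' := (@crM _ _ _ _ _ _ X (conj n k) \o h)%VF).
  rewrite ext // => v1 w1; rewrite !comp_lfunE hE -kE rE // hE kE.
  rewrite -kt_mul; [|exact: NKM|exact: KNK]; rewrite -conj_mul // kt_mul; [|exact: KNK|exact: NKM].
  by rewrite (T_rM S0 bT0) // -kE conjM // rE.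
have c0 : c != 0.
  apply: contraTneq isT => c0; have [v v0] := V_neq0 S0; have [w w0] := dVk_neq0.
  have := tensor_neq0 tauT (T_neq0 S0 bT0 Nn v0) (kt_neq0 Nn w0).
  by rewrite -hE cE c0 scale0r zero_lfunE eqxx.
by exists c^-1 => v w; rewrite -hE cE scale_lfunE scalerA mulVf // scale1r.
Qed.

Lemma sign_uniq n e e' : N n -> (forall v w, e *: tau (T0 n v) (kt n w) = e' *: tau (T0 n v) (kt n w)) ->
  e = e'.
Proof.
move=> Nn ee; have [v v0] := V_neq0 S0; have [w w0] := dVk_neq0.
exact: scaler_inj (tensor_neq0 tauT (T_neq0 S0 bT0 Nn v0) (kt_neq0 Nn w0)) (ee v w).
Qed.

Lemma I_scale n a : N n -> I (fun g => a *: ph0 n g) = fun g => a *: ph n g.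
Proof.
move=> Nn; have [_ lin _] := HI; have hk := phi_hecke rpF pC sqpE S0 Q0 bT0 Nn.
have e := lin (a - 1) _ _ hk hk; rewrite Iphi // in e.
have -> : (fun g => a *: ph0 n g) = fun g => (a - 1) *: ph0 n g + ph0 n g.
  by apply/funext => g; rewrite -[X in _ + X]scale1r -scalerDl subrK.
rewrite e; apply/funext => g.
by rewrite -[X in _ + X = _]scale1r -scalerDl subrK.
Qed.

(** The constants of T_m T_n and T^0_m T^0_n are those of the products of the phi, and I identifies
    them. Comparing T_m T_n with the tensor product of T^0_m T^0_n and kappa(m n) then leaves the
    relation between the signs. *)
Lemma sign_mul_of (eps : MF -> C) m n :
  (forall n, N n -> forall v w, T n (tau v w) = eps n *: tau (T0 n v) (kt n w)) ->
  N m -> N n ->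
  (forall H, Q H -> sep 0 (act X0 n^-1 0) H -> ~ sep (act X0 n^-1 0) (act X0 (m * n)^-1 0) H) ->
  eps (m * n) = eps m * eps n.
Proof.
move=> epsE Nm Nn nr; have Nmn := NM Nm Nn.
have gd H : sep 0 (act X0 n^-1 0) H -> sep (act X0 n^-1 0) (act X0 (m * n)^-1 0) H ->
    good iota p sqp X0 H /\ good iota p sqp X H.
  move=> s1 s2; apply: (good_pair rpF pC sqpE SD Q0 Q1 CC NC); first by case: s1.
  by move=> QHH; apply: (nr H QHH s1 s2).
have [c0 c00 c0E] := T_mul S0 bT0 Nm Nn; have [c1 c10 c1E] := T_mul S1 bT Nm Nn.
have e0 := conv_phi_phi rpF pC sqpE S0 Q0 bT0 Nm Nn c0E (fun H h1 h2 => (gd H h1 h2).1).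
have e1 : conv1 (ph m) (ph n) = fun g => c1 *: ph (m * n) g.
  apply: (conv_phi_phi rpF pC sqpE S1 Q1 bT Nm Nn c1E) => H; rewrite !actE; try exact: NV.
  by move=> h1 h2; case: (gd H h1 h2).
have [_ _ mulI] := HI; have hm := phi_hecke rpF pC sqpE S0 Q0 bT0 Nm.
have := mulI _ _ hm (phi_hecke rpF pC sqpE S0 Q0 bT0 Nn).
rewrite e0 I_scale // !Iphi // e1 => /(congr1 (fun f => f (m * n))) cc.
have {}cc : c0 = c1 by exact: scaler_inj (phi_nn_neq0 rpF pC sqpE S1 Q1 bT Nmn) cc.
have e : eps m * eps n * c0 = c1 * eps (m * n).
  have [v v0] := V_neq0 S0; have [w w0] := dVk_neq0.
  apply: (scaler_inj (tensor_neq0 tauT (T_neq0 S0 bT0 Nmn v0) (kt_neq0 Nmn w0))).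
  rewrite -[RHS]scalerA -epsE // -c1E epsE // linearZ /= epsE // c0E.
  rewrite (tensor_Zl tauT) -kt_mul; [|exact: NKM|exact: NKM].
  by rewrite !scalerA [eps n * _]mulrC.
apply: (mulIf c10); rewrite mulrC -e -cc //.
Qed.

Section Character.
Context (eps : MF -> C).
Hypothesis epsE : forall n, N n -> forall v w, T n (tau v w) = eps n *: tau (T0 n v) (kt n w).

Lemma eps_Omega n : Omega iota X0 n -> eps n = 1.
Proof.
move=> On; have [Nn _] := On; apply: (sign_uniq Nn) => v w; rewrite -epsE // scale1r.
by have [_ ->] := A1.
Qed.

Lemma eps_KM k : N k -> KM0 k -> eps k = 1.
Proof.
move=> Nk Kk; apply: (sign_uniq Nk) => v w; rewrite -epsE // scale1r.
have [_ T1 TM] := bT; have [_ T01 T0M] := bT0; have KK := KM0_sub Kk.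
have := TM 1 k N1 KK Nk; have := T0M 1 k N1 Kk Nk.
by rewrite !mul1r T1 T01 !comp_lfun1l => -> ->; exact: rM_tau0.
Qed.

Definition multiplier n := forall m, N m -> eps (n * m) = eps n * eps m.

(** The path from m^-1 0 to (n m)^-1 0 is the translate by m^-1 of the path from 0 to n^-1 0, which
    crosses no relevant hyperplane. *)
Lemma Omega_multiplier n : Omega iota X0 n -> multiplier n.
Proof.
move=> On m Nm; have [Nn _] := On; have mU := UN Nm; have nU := UN Nn.
apply: sign_mul_of => // H QHH _ /(sep_act S0 Q0 Nm).
have -> : act X0 (n * m)^-1 0 = act X0 m^-1 (act X0 n^-1 0).
  by rewrite invrM // (actM S0) //; exact: NV.
rewrite !(actVK S0) //; apply: (Omega_relsep S0 On).
exact: (relevant_act rpF pC sqpE S0 Q0 bT0 Nm QHH).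
Qed.

Section Simple.
Context (s : MF) (H : set 'rV[R]_(adim (dE D))) (hpt : 'rV[R]_(adim (dE D))).
Hypotheses (ss : simple iota X0 Waff s H) (Hh : H hpt).
Hypothesis hpt_same : forall H', Q H' -> H' <> H -> sameS H' 0 hpt.

Let QHH : Q H. Proof. by case: ss => _ []. Qed.
Let rs : orth_reflection H (act X0 s). Proof. by case: ss. Qed.
Let Ns : N s. Proof. by have [Ws _ _] := ss; have [_ [+ _] _ _] := RP; exact. Qed.

(** The square of s acts trivially, and by the reflection property an element of [Waff] acting
    trivially lies in K_{M^0}. *)
Lemma simple_square : KM0 (s * s).
Proof.
have [Ws _ _] := ss; have [[sW _] _ fK _] := RP; apply: fK; first exact: (sgM sW).
by apply/funext => v; rewrite (actM S0) // (refl_involutive S0 Ns QHH rs).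
Qed.

(** An element of K_{x0} that normalizes M lies in M by [rp_normalizer], hence in K_M, and fixes x0;
    but s moves x0 across H. Consequently Phi_s contributes nothing at 1 to the quadratic
    relation. *)
Lemma simple_notin : ~ cK X 0 s.
Proof.
move=> Ks; have [Gs sU nM] := N_normalizes S1 Ns.
have [U [Ub rp]] := radical_pair_ex S1 Q1.
have [u [m [b [[Ku Uu] Km [Kb Bb] sE]]]] := K_decomp Q1 g0 rp Ks.
have [K0m Mm] := KM_sub S1 Q1 g0 Km.
have AM : aA (dE D) `<=` cM X.
  by have [[_ AZ] _] := A_max_split S1; move=> a /AZ[].
have Ms : Fpts iota (cM X) s.
  rewrite /Fpts /= sE !(imM iota); apply: (rp_normalizer rp AM (M_centralizer SD) Uu Mm Bb).
  by rewrite -!(imM iota) -sE.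
have Kms : KM s by have [_ <- _ _] := qcf_cover Q1 g0 rp.
have := KM_act0 S1 Q1 Kms Ns; rewrite actE // => s0.
have := refl_sep S0 Q0 Ns QHH rs; by rewrite s0 => /(sep_refl S0).
Qed.

(** At 1 the quadratic relation for G^0 says that T^0_s T^0_s is q times the action of s s. The
    image of the relation under I gives the same for T_s, with the same q. As T_s is eps(s) times
    T^0_s (x) kappa(s), the square of eps(s) is 1. *)
Lemma eps_square : eps s * eps s = 1.
Proof.
have K0s := simple_square; have Kss := KM0_sub K0s; have ns1 := simple_notin.
have ns0 : ~ cK X0 0 s.
  move=> K0; apply: ns1; have [[[[sL _] _] _] _ [_ ->] _ _] := CC g0.
  by exists s => //; exists 1; [exact: sg1|rewrite mulr1].
have [c0 c00 c0E] := T_square S0 bT0 Ns K0s; have [c1 c10 c1E] := T_square S1 bT Ns Kss.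
have [_ quad _ _] := A0; have [|q _ qE] := quad s; first by exists H.
have [v v0] := V_neq0 S0; have [w w0] := dVk_neq0; have [u u0] := V_neq0 S1.
have G01 : Fpts iota (cG X0) 1 := sg1 (sgGF S0); have G11 : Fpts iota (cG X) 1 := sg1 (sgGF S1).
have f1 (u1 : cV X0) : fun_at u1 1 = u1.
  by rewrite /fun_at mem_set ?(rho1 S0) ?id_lfunE //; exact: sg1 (sgK S0 g0).
have f1' (u1 : cV X) : fun_at u1 1 = u1.
  by rewrite /fun_at mem_set ?(rho1 S1) ?id_lfunE //; exact: sg1 (sgK S1 g0).
have fe : eqv iota 0 (fun_at v) := fun_at_eqv S0 v g0.
have fe' : eqv iota 0 (fun_at u) := fun_at_eqv S1 u g0.
have cq0 : c0 = q.
  apply: (scaler_inj v0); rewrite -(Phi_square_at1 rpF pC sqpE S0 Q0 bT0 v Ns K0s c0E).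
  have := qE (fun_at v) 1 (fun_at_Ind S0 v) G01 => /= ->.
  rewrite (Phi_at1 rpF pC sqpE S0 Q0 T0 v Ns ns0) scaler0 add0r.
  by rewrite (Phi_1 rpF pC sqpE S0 Q0 bT0 fe G01) f1.
have h0 := phi_hecke rpF pC sqpE S0 Q0 bT0 Ns; have h1 := phi_hecke rpF pC sqpE S0 Q0 bT0 N1.
have qf : conv0 (ph0 s) (ph0 s) = fun g => (q - 1) *: ph0 s g + q *: ph0 1 g.
  apply/funext => g; have [Gg|ng] := pselect (Fpts iota (cG X0) g); last first.
    rewrite !phi_out // !scaler0 addr0 conv_out // => h nh; exact: phi_out.
  apply/lfunP => u1; rewrite (conv_phi_comp rpF pC sqpE S0 Q0 bT0 _ Ns Ns Gg).
  have := qE (fun_at u1) g (fun_at_Ind S0 u1) Gg => /= ->.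
  by rewrite add_lfunE !scale_lfunE !(phiE rpF pC sqpE S0 Q0).
have [_ lin mulI] := HI; have := mulI _ _ h0 h0; rewrite qf lin //; last exact: hecke_scale.
rewrite I_scale // !Iphi // => /(congr1 (fun f : MF -> 'End(cV X) => f 1 u)).
rewrite (conv_phi_comp rpF pC sqpE S1 Q1 bT _ Ns Ns G11) add_lfunE !scale_lfunE.
rewrite !(phiE rpF pC sqpE S1 Q1) // (Phi_at1 rpF pC sqpE S1 Q1 T u Ns ns1) scaler0 add0r.
rewrite (Phi_1 rpF pC sqpE S1 Q1 bT fe' G11) f1'.
rewrite (Phi_square_at1 rpF pC sqpE S1 Q1 bT u Ns Kss c1E) => /(scaler_inj u0) cq1.
have Nss := NM Ns Ns; have rn : tau (@crM _ _ _ _ _ _ X0 (s * s) v) (kt (s * s) w) != 0.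
  apply: (tensor_neq0 tauT _ (kt_neq0 Nss w0)).
  have := T_neq0 S0 bT0 Ns (T_neq0 S0 bT0 Ns v0).
  by rewrite c0E scaler_eq0 negb_or => /andP[].
have : eps s * eps s * c0 = c0; last by move/(canRL (mulfK c00)); rewrite divff.
apply: (scaler_inj rn); rewrite [in RHS]cq0 cq1 -rM_tau0 // -c1E epsE // linearZ /= epsE // c0E.
rewrite (tensor_Zl tauT) -kt_mul; [|exact: NKM|exact: NKM].
by rewrite rM_tau0 // !scalerA.
Qed.

(* If H_s is crossed twice by (s, m), it is not by (s, s m). *)
Lemma simple_multiplier : multiplier s.
Proof.
move=> m Nm; have mU := UN Nm; have sU := UN Ns.
have cross n H' : N n -> Q H' -> sep (act X0 n^-1 0) (act X0 (s * n)^-1 0) H' <->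
    H' = act X0 n^-1 @` H := fun Nn QH' => refl_cross rpF pC sqpE S0 Q0 bT0 Ns QHH rs Hh hpt_same Nn QH'.
pose H1 := act X0 m^-1 @` H.
have QH1 : Q H1 := relevant_act rpF pC sqpE S0 Q0 bT0 (NV Nm) QHH.
have [sm|nsm] := pselect (sep 0 (act X0 m^-1 0) H1); last first.
  by apply: sign_mul_of => // H' Q' s1 /(cross _ _ Nm Q') e; apply: nsm; rewrite /H1 -e.
have Nsm := NM Ns Nm; have K0s := simple_square; have Nss := NM Ns Ns.
have gm := gN (NV Nm); have gsm := gN (NV Nsm).
have nH1 : ~ sep 0 (act X0 (s * m)^-1 0) H1.
  rewrite (sep_xor sysH H1 g0 gm gsm) => -[[_ n]|[n _]]; [apply: n|exact: n].
  exact/cross.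
have e1 : eps (s * (s * m)) = eps s * eps (s * m).
  apply: sign_mul_of => // H' Q' s1 /(cross _ _ Nsm Q') e; apply: nH1.
  suff -> : H1 = H' by [].
  rewrite e /H1 invrM // -[in LHS](refl_image S0 QHH rs) /H1.
  apply/seteqP; split=> [_ [_ [x Hx <-] <-]|_ [x Hx <-]].
    by exists x => //; rewrite (actM S0) //; [congr (act _ _ _); rewrite -[in LHS](refl_involutive S0 Ns QHH rs x) (actK S0)|exact: NV|exact: NV].
  rewrite (actM S0); [|exact: NV|exact: NV].
  exists (act X0 s^-1 x) => //.
  exists x => //; by rewrite -[in RHS](refl_involutive S0 Ns QHH rs x) (actK S0).
(* s s fixes 0, so it is in Omega, where eps is 1; hence eps(s (s m)) = eps(m). *)
have Oss : Omega iota X0 (s * s).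
  apply: (relsep_Omega rpF pC sqpE S0 Q0 bT0 Nss) => H' _.
  by rewrite (KM_act0 S0 Q0 K0s Nss) => /(sep_refl S0).
move: e1; rewrite mulrA (Omega_multiplier Oss Nm) (eps_Omega Oss) mul1r => ->.
by rewrite mulrA eps_square mul1r.
Qed.

End Simple.

(** Induction on the number of relevant hyperplanes between 0 and n^-1 0. With none, n is in Omega.
    Otherwise a wall H of C_rel separates 0 from n 0, and passing from n to s^-1 n, where s lifts
    the reflection in H, removes exactly the hyperplane n^-1 H. *)
Lemma multiplier_all n : N n -> multiplier n /\ eps n * eps n = 1.
Proof.
have [k] := ubnP #|` fset_set (Q `&` sep 0 (act X0 n^-1 0))|.
elim: k n => // k IHk n; rewrite ltnS => ck Nn; have nU := UN Nn.
have gn := gN (NV Nn); have fs := finite_sep sysH 0 (act X0 n^-1 0).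
have fA : finite_set (Q `&` sep 0 (act X0 n^-1 0)) by exact: finite_setIr.
have [[H1 [Q1' s1]]|none] := pselect (exists H1, Q H1 /\ sep 0 (act X0 n^-1 0) H1); last first.
  have On : Omega iota X0 n.
    apply: (relsep_Omega rpF pC sqpE S0 Q0 bT0 Nn) => H QHH.
    move=> /(sep_act S0 Q0 (NV Nn)); rewrite (actK S0) // (sep_sym sysH) => s'; apply: none.
    by exists (act X0 n^-1 @` H); split=> //; exact: (relevant_act rpF pC sqpE S0 Q0 bT0 (NV Nn) QHH).
  by split; [exact: Omega_multiplier|rewrite (eps_Omega On) mulr1].
have QnH1 := relevant_act rpF pC sqpE S0 Q0 bT0 Nn Q1'.
have := sep_act S0 Q0 Nn s1; rewrite (actVK S0) // (sep_sym sysH) => snH1.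
have [H [h [QHH sH Hh wl same]]] := wall_ex sysH QH (gN Nn) QnH1 snH1.
have [r rr] := orth_reflection_ex sysH (QH QHH) (Q_inner S0).1.
have [_ [WN _] _ gen_refl] := RP.
have [|s Ws sE] := (gen_refl r).1.
  rewrite (_ : r = r \o id) //; apply: generated_comp; last exact: generated_id.
  by exists H.
have ss : simple iota X0 Waff s H.
  split=> //; last by rewrite sE.
  by split=> //; have [W [nW HW]] := wl; exists h, W.
have Ns : N s by exact: WN.
have rs : orth_reflection H (act X0 s) by rewrite sE.
have sU := UN Ns; have Nsn := NM (NV Ns) Nn; have gsn := gN (NV Nsn).
have sV0 : act X0 s^-1^-1 0 = act X0 s^-1 0 by rewrite invrK (refl_act0 S0 Ns QHH rs).
have cross H' : Q H' -> sep (act X0 n^-1 0) (act X0 (s^-1 * n)^-1 0) H' <-> H' = act X0 n^-1 @` H.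
  move=> Q'; have := refl_cross rpF pC sqpE S0 Q0 bT0 Ns QHH rs Hh same Nn Q'.
  rewrite !invrM ?unitrV // !(actM S0); try exact: NV; try by rewrite invrK.
  by rewrite sV0.
pose Hn := act X0 n^-1 @` H.
have QHn : Q Hn := relevant_act rpF pC sqpE S0 Q0 bT0 (NV Nn) QHH.
have sHn : sep 0 (act X0 n^-1 0) Hn.
  by have := sep_act S0 Q0 (NV Nn) sH; rewrite (actK S0) // (sep_sym sysH).
have setE : Q `&` sep 0 (act X0 (s^-1 * n)^-1 0) = (Q `&` sep 0 (act X0 n^-1 0)) `\ Hn.
  apply/seteqP; split=> H' [].
    move=> Q'; rewrite (sep_xor sysH H' g0 gn gsn) => -[[h1 h2]|[h1 /cross h2]].
      by split=> //= e; apply: h2; apply/cross.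
    by case: h1; rewrite h2.
  move=> [Q' h1] /= h2; split=> //; rewrite (sep_xor sysH H' g0 gn gsn); left.
  by split=> // /cross h3; apply: h2; rewrite h3.
have card : (#|` fset_set (Q `&` sep 0 (act X0 (s^-1 * n)^-1 0))| < k)%N.
  rewrite setE fset_setD1 //; apply: leq_trans ck.
  by rewrite [X in (_ < X)%N](cardfsD1 Hn) in_fset_set // mem_set.
have [m1 e1] := IHk _ card Nsn; have m2 := simple_multiplier ss Hh same.
have e2 := eps_square ss.
have nE : n = s * (s^-1 * n) by rewrite mulrA mulrV // mul1r.
split=> [m Nm|]; last first.
  by rewrite nE m2 // mulrACA e2 e1 mulr1.
by rewrite {1}nE -mulrA m2 ?m1 ?mulrA -?m2 ?mulrA ?mulrV ?mul1r //; exact: NM.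
Qed.

End Character.

(** The definition of d_n uses the point n 0, whereas phi_n involves n^-1 0; conjugation by n
    matches the indices. *)
Lemma d_factorE n : N n -> d_factor p sqp D n =
  sq (coset_index (cK X0 (act X0 n^-1 0)) (cK X0 0)) *
  (sq (coset_index (cK X (act X n^-1 0)) (cK X 0)))^-1.
Proof.
move=> Nn; rewrite /d_factor /psqrt_ratio.
have iE0 := coset_index_act S0 Q0 Nn g0 (gN (NV Nn)); rewrite (actVK S0) // in iE0.
have gX : gen (act X n^-1 0) by rewrite actE; [exact: gN (NV Nn)|exact: NV].
have iE1 := coset_index_act S1 Q1 Nn g0 gX; rewrite (actVK S1) // in iE1.
by rewrite iE0 iE1 expfzDr ?(sqp_neq0 rpF pC sqpE) // -exprnN.
Qed.

(** A Hecke function supported on one double coset is a multiple of phi^0_n, whose image and value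
    at n are known. *)
Lemma describes_sign (eps : MF -> C) :
  (forall n, N n -> forall v w, T n (tau v w) = eps n *: tau (T0 n v) (kt n w)) ->
  describes_iso iota p sqp I eps.
Proof.
move=> epsE phi n hphi Nn supp; have [a aE] := hecke_phi rpF pC sqpE S0 Q0 bT0 Nn hphi supp.
rewrite aE I_scale //; split=> [g|v w].
  by rewrite scaler_eq0 negb_or => /andP[_ /(phi_support rpF pC sqpE S1 Q1 Nn)].
rewrite (phi_n rpF pC sqpE S1 Q1) // (phi_n rpF pC sqpE S0 Q0) // d_factorE //.
rewrite !scale_lfunE epsE // (tensor_Zr tauT) !(tensor_Zl tauT) !scalerA; congr (_ *: _).
have s0 := psqrt_neq0 rpF pC sqpE (coset_index (cK X0 (act X0 n^-1 0)) (cK X0 0)).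
rewrite [RHS](_ : _ = (sq (coset_index (cK X0 (act X0 n^-1 0)) (cK X0 0)) *
  (sq (coset_index (cK X0 (act X0 n^-1 0)) (cK X0 0)))^-1) *
  (a * (sq (coset_index (cK X (act X n^-1 0)) (cK X 0)))^-1 * eps n)); last by ring.
by rewrite mulfV // mul1r.
Qed.

(** The test function is phi^0_n, whose value at n is injective. *)
Lemma sign_unique (eps eps' : MF -> C) n : describes_iso iota p sqp I eps ->
  describes_iso iota p sqp I eps' -> N n -> eps' n = eps n.
Proof.
move=> d1 d2 Nn; have h := phi_hecke rpF pC sqpE S0 Q0 bT0 Nn.
have su := phi_support rpF pC sqpE S0 Q0 (T := T0) Nn.
have [_ e1] := d1 _ _ h Nn su; have [_ e2] := d2 _ _ h Nn su.
have [v v0] := V_neq0 S0; have [w w0] := dVk_neq0.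
have := e1 v w; rewrite e2 !(tensor_Zr tauT) => /scalerI.
have d0 : d_factor p sqp D n != 0.
  by rewrite d_factorE // mulf_neq0 ?invr_eq0 // (psqrt_neq0 rpF pC sqpE).
move=> /(_ d0); apply: scaler_inj; apply: (tensor_neq0 tauT _ (kt_neq0 Nn w0)).
rewrite (phi_n rpF pC sqpE S0 Q0) // scale_lfunE scaler_eq0 invr_eq0.
by rewrite (negPf (psqrt_neq0 rpF pC sqpE _)) (T_neq0 S0 bT0).
Qed.

Lemma sign_character : exists eps : MF -> C,
  [/\ quadratic_character D eps, forall n, Omega iota X0 n -> eps n = 1,
      describes_iso iota p sqp I eps &
      forall eps' : MF -> C, quadratic_character D eps' ->
        (forall n, Omega iota X0 n -> eps' n = 1) -> describes_iso iota p sqp I eps' ->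
        forall n, N n -> eps' n = eps n].
Proof.
(* Outside N^heart the function [eps] takes the default value 0. *)
have /choice[eps epsE'] : forall n, exists e, N n -> forall v w, T n (tau v w) = e *: tau (T0 n v) (kt n w).
  by move=> n; have [/sign_ex[e eE]|nN] := pselect (N n); [exists e|exists 0].
have epsE n : N n -> forall v w, T n (tau v w) = eps n *: tau (T0 n v) (kt n w) by exact: epsE'.
have ds := describes_sign epsE.
exists eps; split=> //.
- split=> [n Nn|m n Nm Nn|n Nn Kn].
  + have [_ e2] := multiplier_all epsE Nn.
    have /eqP := e2; rewrite -expr2 sqrf_eq1 => /orP[] /eqP ->; [by left|by right].
  + by have [m1 _] := multiplier_all epsE Nm; apply: m1.
  + exact: eps_KM.
- by move=> n On; apply: eps_Omega.
- by move=> eps' _ _ d' n Nn; apply: sign_unique ds d' Nn.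
Qed.

End SignCharacter.

Theorem theorem4p4p11 (p : nat) (R : realType) (F : nonarchLocalFieldType)
    (Fb : closedFieldType) (iota : {rmorphism F -> Fb})
    (C : closedFieldType) (sqp : C) (d : nat)
    (D : comparison_data R F Fb d C)
    (Waff : set 'M[F]_d.+1) (Cgt1 : set C)
    (T0 : 'M[F]_d.+1 -> 'End(cV (dX0 D))) (T : 'M[F]_d.+1 -> 'End(cV (dX D)))
    (I : ('M[F]_d.+1 -> 'End(cV (dX0 D))) -> 'M[F]_d.+1 -> 'End(cV (dX D))) :
  residue_char F p ->
  (forall z : Fb, algebraicOver iota z) ->
  p \notin [pchar C] ->
  sqp ^+ 2 = p%:R ->
  comparison_setup iota D ->
  quasi_cover_family iota (dX0 D) ->
  double_coset_property iota (dX0 D) ->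
  quasi_cover_family iota (dX D) ->
  reflection_property iota (dX0 D) Waff ->
  rank_one_property iota (dX0 D) Waff (@dK0 _ _ _ _ _ D) ->
  levi_compat iota D ->
  cover_compat iota D ->
  neighbor_compat iota D ->
  half_system Cgt1 ->
  adapted iota p sqp Waff Cgt1 T0 ->
  associated_adapted iota p sqp Waff Cgt1 T0 T ->
  hecke_isomorphism iota I ->
  (forall n, aN (dE D) n -> I (phi_w iota p sqp T0 n) = phi_w iota p sqp T n) ->
  exists eps : 'M[F]_d.+1 -> C,
    [/\ quadratic_character D eps,
        forall n, Omega iota (dX0 D) n -> eps n = 1,
        describes_iso iota p sqp I eps &
        forall eps' : 'M[F]_d.+1 -> C,
          quadratic_character D eps' ->
          (forall n, Omega iota (dX0 D) n -> eps' n = 1) ->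
          describes_iso iota p sqp I eps' ->
          forall n, aN (dE D) n -> eps' n = eps n].
Proof.
move=> rpF _ pC sqpE SD Q0 _ Q1 RP _ LC CC NC _ A0 A1 HI Iphi.
exact: (sign_character rpF pC sqpE SD Q0 Q1 RP LC CC NC A0 A1 HI Iphi).
Qed.
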